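(* Let $M=\widetilde M/\Gamma$ be a complete uniform visibility Riemannian manifold with no conjugate points, where $\widetilde M$ is the universal cover and $\Gamma=\pi_1(M)$ is the deck transformation group. A vector $v\in T^1M$ is a conservative point for the geodesic flow $\phi_t$ if and only if $c_{\widetilde v}(+\infty)\in L_c(\Gamma)$, i.e. is a conical limit point, for some (hence any) lift $\widetilde v\in T^1\widetilde M$ of $v$.
   Context: All geodesics have unit speed; $c_v$ is the geodesic with $c_v'(0)=v$ and $\phi_t(v)=c_v'(t)$. No conjugate points: no geodesic carries a non-trivial Jacobi field vanishing at two distinct parameters. For $p\in\widetilde M$, $\measuredangle_p(x,y)$ is the angle at $p$ between the geodesics from $p$ to $x$ and to $y$. $M$ is a uniform visibility manifold if for every $\epsilon>0$ there is $R=R(\epsilon)>0$ such that for every $p\in\widetilde M$ and every geodesic (segment) $c:[a,b]\to\widetilde M$ ($a,b$ possibly infinite) with $d(p,c)\ge R$ one has $\measuredangle_p(c(a),c(b))\le\epsilon$. Geodesics $c_1,c_2$ of $\widetilde M$ are positively asymptotic if $d(c_1(t),c_2(t))$ is bounded for $t\ge0$; the ideal boundary $\widetilde M(\infty)$ is the set of asymptote classes and $c(+\infty)$ is the class of $c$. For $p\in\widetilde M$ and $x\in\widetilde M\cup\widetilde M(\infty)$, $x\ne p$, $c_{p,x}$ is the unique geodesic with $c_{p,x}(0)=p$ going to $x$. The cone topology on $\widetilde M\cup\widetilde M(\infty)$ is generated by the open sets of $\widetilde M$ and the truncated cones $\{x:\measuredangle(c_{p,x}'(0),v)<\epsilon,\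 d(p,x)>r\}$, $v\in T^1_p\widetilde M$. A point $\xi\in\widetilde M(\infty)$ is a conical limit point if for every $p\in\widetilde M$ there are $D=D(p)>0$ and $\{\alpha_n\}\subset\Gamma$ with $\alpha_np\to\xi$ and $d(\alpha_np,c_{p,\xi})\le D$; $L_c(\Gamma)$ is the set of these points. $v\in T^1M$ is a conservative point if there are a compact set $A\subset T^1M$ and a sequence $t_n\to+\infty$ with $\phi_{t_n}(v)\in A$ for all $n$. *)

(* Defs.v *)
From HB Require Import structures.
From mathcomp Require Import all_boot all_order all_algebra.
From mathcomp Require Import all_classical all_reals all_analysis.

Set Implicit Arguments.
Unset Strict Implicit.
Unset Printing Implicit Defensive.

Import Order.TTheory GRing.Theory Num.Theory.
Import numFieldNormedType.Exports.

Local Open Scope classical_set_scope.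
Local Open Scope ring_scope.

Local Notation "f ^` ()" := (derive1 f) : ring_scope.

(* [U] is meant to be open; all the iterated directional derivatives of order
   at most [k] exist on [U], are differentiable there below order [k], and are
   continuous at order [k]. *)
Fixpoint Ck_on (R : realType) (V W : normedModType R) (k : nat)
    (U : set V) (f : V -> W) : Prop :=
  if k is k'.+1 then
    (forall x, U x -> differentiable f x) /\
    forall v : V, Ck_on k' U (fun x => 'D_v f x)
  else forall x, U x -> {for x, continuous f}.

Definition smooth_on (R : realType) (V W : normedModType R)
    (U : set V) (f : V -> W) : Prop := forall k, Ck_on k U f.

(* Smooth n-manifold (Hausdorff, second countable, with a smooth atlas) with a
   smooth Riemannian metric.  The charts [chart i] and their inverses
   [chart_inv i] are total functions, only meaningful on [chart_dom i] and on
   [chart i @` chart_dom i].  [metric i x] is the Gram matrix of the metric in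
   the chart [i] at the point of coordinates [x]. *)
Record riemannian_manifold (R : realType) (n : nat) := RiemannianManifold {
  carrier :> topologicalType;
  chart_index : Type;
  chart_dom : chart_index -> set carrier;
  chart : chart_index -> carrier -> 'rV[R]_n;
  chart_inv : chart_index -> 'rV[R]_n -> carrier;
  chart_at : carrier -> chart_index;
  metric : chart_index -> 'rV[R]_n -> 'M[R]_n;
  manifold_hausdorff : hausdorff_space carrier;
  manifold_second_countable : @second_countable carrier;
  chart_dom_open : forall i, open (chart_dom i);
  chart_img_open : forall i, open (chart i @` chart_dom i);
  chart_continuous : forall i, {within chart_dom i, continuous (chart i)};
  chart_inv_continuous : forall i,
    {within chart i @` chart_dom i, continuous (chart_inv i)};
  chartK : forall i p, chart_dom i p -> chart_inv i (chart i p) = p;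
  chart_atP : forall p, chart_dom (chart_at p) p;
  transition_smooth : forall i j,
    smooth_on (chart i @` (chart_dom i `&` chart_dom j))
              (chart j \o chart_inv i);
  metric_smooth : forall i, smooth_on (chart i @` chart_dom i) (metric i);
  metric_sym : forall i p, chart_dom i p ->
    (metric i (chart i p))^T = metric i (chart i p);
  metric_pos : forall i p, chart_dom i p -> forall v : 'rV[R]_n, v != 0 ->
    0 < (v *m metric i (chart i p) *m v^T) 0 0;
  metric_transition : forall i j p, chart_dom i p -> chart_dom j p ->
    forall v w : 'rV[R]_n,
    let d := 'd (chart j \o chart_inv i) (chart i p) in
    (d v *m metric j (chart j p) *m (d w)^T) 0 0 =
    (v *m metric i (chart i p) *m w^T) 0 0
}.

(* A tangent vector at [p] is represented by its coordinates in the preferred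
   chart [chart_at p]. *)
Record tangent_vector (R : realType) (n : nat) (M : riemannian_manifold R n) :=
  TangentVector { base : M; vec : 'rV[R]_n }.

HB.instance Definition _ (R : realType) n (M : riemannian_manifold R n) :=
  gen_eqMixin (tangent_vector M).
HB.instance Definition _ (R : realType) n (M : riemannian_manifold R n) :=
  gen_choiceMixin (tangent_vector M).

Section tangent.
Context {R : realType} {n : nat} {M : riemannian_manifold R n}.
Implicit Types (v : tangent_vector M) (c : R -> M) (p q : M).

Definition coord (i : chart_index M) v : 'rV[R]_n :=
  let j := chart_at (base v) in
  'd (chart i \o chart_inv j) (chart j (base v)) (vec v).

(* subbase of the topology of TM, pulled back through the charts of TM *)
Definition tangent_subbase : set (set (tangent_vector M)) :=
  [set S | exists i (W : set ('rV[R]_n * 'rV[R]_n)), open W /\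
    S = [set v | chart_dom i (base v) /\ W (chart i (base v), coord i v)]].

End tangent.

HB.instance Definition _ (R : realType) n (M : riemannian_manifold R n) :=
  @isSubBaseTopological.Build (tangent_vector M)
    (set (tangent_vector M)) (@tangent_subbase R n M) id.

Section riemannian_geometry.
Context {R : realType} {n : nat} (M : riemannian_manifold R n).
Implicit Types (c : R -> M) (p q : M) (i : chart_index M).

Definition inner p (u w : 'rV[R]_n) : R :=
  (u *m metric (chart_at p) (chart (chart_at p) p) *m w^T) 0 0.

Definition tnorm p (u : 'rV[R]_n) : R := Num.sqrt (inner p u u).

Definition unit_tangent : set (tangent_vector M) :=
  [set v | tnorm (base v) (vec v) = 1].

Definition vector_angle p (u w : 'rV[R]_n) : R :=
  acos (inner p u w / (tnorm p u * tnorm p w)).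

Definition Ck_curve (k : nat) c : Prop :=
  continuous c /\ forall i, Ck_on k (c @^-1` chart_dom i) (chart i \o c).

Definition velocity c (t : R) : tangent_vector M :=
  TangentVector (c t) ((chart (chart_at (c t)) \o c)^`() t).

Definition speed c (t : R) : R := tnorm (c t) (vec (velocity c t)).

(* Piecewise C^1 paths are encoded as lists of consecutive C^1 arcs
   parametrized by [0, 1], each arc being extended to a C^1 curve on R. *)
Fixpoint piecewise_path p (s : seq (R -> M)) q : Prop :=
  if s is c :: s' then
    [/\ Ck_curve 1 c, c 0 = p & piecewise_path (c 1) s' q]
  else p = q.

Definition path_length (s : seq (R -> M)) : R :=
  \sum_(c <- s) \int[lebesgue_measure]_(t in `[0, 1]) speed c t.

Definition dist p q : R := inf [set path_length s | s in piecewise_path p ^~ q].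

Definition dist_to p (A : set M) : R := inf [set dist p q | q in A].

Section coordinates.
Variables (i : chart_index M) (x : 'rV[R]_n).
Implicit Types (a b d k l m : 'I_n) (u w z : 'rV[R]_n).

Definition metric_partial a b d : R :=
  'D_(delta_mx 0 a) (fun y => metric i y b d) x.

(* Christoffel symbol Gamma^k_{ab} of the Levi-Civita connection *)
Definition christoffel k a b : R :=
  2^-1 * \sum_l invmx (metric i x) k l *
    (metric_partial a b l + metric_partial b a l - metric_partial l a b).

Definition christoffel_form u w : 'rV[R]_n :=
  \row_k \sum_a \sum_b christoffel k a b * u 0 a * w 0 b.

End coordinates.

(* l-th component of R(e_a, e_b) e_d, for the curvature tensor
   R(X, Y) Z = D_X D_Y Z - D_Y D_X Z - D_[X, Y] Z *)
Definition riemann i (x : 'rV[R]_n) (l a b d : 'I_n) : R :=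
  'D_(delta_mx 0 a) (fun y => christoffel i y l b d) x
  - 'D_(delta_mx 0 b) (fun y => christoffel i y l a d) x
  + \sum_m (christoffel i x l a m * christoffel i x m b d
            - christoffel i x l b m * christoffel i x m a d).

Definition curvature i (x u w z : 'rV[R]_n) : 'rV[R]_n :=
  \row_l \sum_a \sum_b \sum_d riemann i x l a b d * u 0 a * w 0 b * z 0 d.

(* covariant derivative along [c] of the field of coordinates [V] in chart [i] *)
Definition cov_deriv i c (V : R -> 'rV[R]_n) (t : R) : 'rV[R]_n :=
  V^`() t + christoffel_form i (chart i (c t)) ((chart i \o c)^`() t) (V t).

Definition geodesic c : Prop :=
  (forall k, Ck_curve k c) /\
  forall i t, chart_dom i (c t) -> cov_deriv i c (chart i \o c)^`() t = 0.

Definition unit_geodesic c : Prop := geodesic c /\ forall t, speed c t = 1.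

(* The field along [c] is given at time [t] by [J t] in the chart
   [chart_at (c t)]; the equation is J'' + R(J, c')c' = 0. *)
Definition jacobi_field c (J : R -> 'rV[R]_n) : Prop :=
  forall i, let Ji t := coord i (TangentVector (c t) (J t)) in
  let dx := (chart i \o c)^`() in
  smooth_on (c @^-1` chart_dom i) Ji /\
  forall t, chart_dom i (c t) ->
    cov_deriv i c (cov_deriv i c Ji) t
    + curvature i (chart i (c t)) (Ji t) (dx t) (dx t) = 0.

Definition no_conjugate_points : Prop :=
  forall c J, unit_geodesic c -> jacobi_field c J ->
  forall s t, s != t -> J s = 0 -> J t = 0 -> forall r, J r = 0.

Definition complete_manifold : Prop :=
  forall v : tangent_vector M, exists2 c, geodesic c & velocity c 0 = v.

Definition geodesic_of (v : tangent_vector M) : R -> M :=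
  xget (cst (base v)) [set c | geodesic c /\ velocity c 0 = v].

Definition geodesic_flow (t : R) (v : tangent_vector M) : tangent_vector M :=
  velocity (geodesic_of v) t.

Definition conservative_point (v : tangent_vector M) : Prop :=
  exists A : set (tangent_vector M),
    [/\ compact A, A `<=` unit_tangent &
    exists2 t : nat -> R, t @ \oo --> +oo &
      forall k, A (geodesic_flow (t k) v)].

Definition asymptotic c1 c2 : Prop :=
  exists B : R, forall t, 0 <= t -> dist (c1 t) (c2 t) <= B.

Definition asymptote_class c : set (R -> M) :=
  [set c' | unit_geodesic c' /\ asymptotic c c'].

Definition ideal_boundary : Type :=
  set_type [set asymptote_class c | c in unit_geodesic].

Inductive cone_space := Finite of M | Ideal of ideal_boundary.

(* the geodesic c_{p,x}; its value at x = p is irrelevant *)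
Definition geodesic_to p (x : cone_space) : R -> M :=
  xget (cst p) [set c | [/\ unit_geodesic c, c 0 = p &
    match x with
    | Finite q => exists2 t, 0 < t & c t = q
    | Ideal xi => val xi c
    end]].

Definition direction_to p (x : cone_space) : 'rV[R]_n :=
  vec (velocity (geodesic_to p x) 0).

Definition visual_angle p (x y : cone_space) : R :=
  vector_angle p (direction_to p x) (direction_to p y).

(* [endpoint c a x] : x = c(a), the point at infinity c(-oo) being the class of
   the reversed geodesic *)
Definition endpoint c (a : \bar R) (x : cone_space) : Prop :=
  match a, x with
  | r%:E%E, Finite q => q = c r
  | +oo%E, Ideal xi => val xi c
  | -oo%E, Ideal xi => val xi (fun t => c (- t))
  | _, _ => False
  end.

Definition uniform_visibility : Prop :=
  forall e : R, 0 < e -> exists2 r : R, 0 < r &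
    forall p c (a b : \bar R) x y, unit_geodesic c -> (a < b)%E ->
      endpoint c a x -> endpoint c b y ->
      r <= dist_to p (c @` [set t | (a <= t%:E)%E /\ (t%:E <= b)%E]) ->
      visual_angle p x y <= e.

Definition truncated_cone p (v : 'rV[R]_n) (e r : R) : set cone_space :=
  [set x | vector_angle p (direction_to p x) v < e /\
           if x is Finite q then r < dist p q else True].

Definition cone_subbase : set (set cone_space) :=
  [set S | (exists2 U : set M, open U & S = Finite @` U) \/
    exists p v e r, [/\ tnorm p v = 1, 0 < e, 0 < r &
      S = truncated_cone p v e r]].

End riemannian_geometry.

HB.instance Definition _ (R : realType) n (M : riemannian_manifold R n) :=
  gen_eqMixin (cone_space M).
HB.instance Definition _ (R : realType) n (M : riemannian_manifold R n) :=
  gen_choiceMixin (cone_space M).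
HB.instance Definition _ (R : realType) n (M : riemannian_manifold R n) :=
  @isSubBaseTopological.Build (cone_space M)
    (set (cone_space M)) (@cone_subbase R n M) id.

Definition conical_limit_set (R : realType) (n : nat)
    (M : riemannian_manifold R n) (G : set (M -> M)) : set (ideal_boundary M) :=
  [set xi | forall p : M, exists2 D : R, 0 < D &
    exists alpha : nat -> M -> M,
      [/\ forall k, G (alpha k),
          (fun k => Finite (alpha k p)) @ \oo --> Ideal xi &
          forall k, dist_to (alpha k p) (range (geodesic_to p (Ideal xi))) <= D]].

Definition simply_connected (R : realType) (T : topologicalType) : Prop :=
  (forall x y : T, exists f : R -> T,
    [/\ {within `[0, 1], continuous f}, f 0 = x & f 1 = y]) /\
  (forall f : R -> T, {within `[0, 1], continuous f} -> f 0 = f 1 ->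
    exists H : R * R -> T, [/\ {within `[0, 1] `*` `[0, 1], continuous H},
      forall t, 0 <= t <= 1 -> H (0, t) = f t /\ H (1, t) = f 0 &
      forall s, 0 <= s <= 1 -> H (s, 0) = f 0 /\ H (s, 1) = f 0]).

Definition homeomorphism (S T : topologicalType) (f : S -> T) : Prop :=
  continuous f /\
  exists g : T -> S, [/\ continuous g, cancel f g & cancel g f].

(* [F j], for [j] in [J], are the sheets of [f] over the evenly covered set [U] *)
Definition covering_map (S T : topologicalType) (f : S -> T) : Prop :=
  [/\ continuous f, (forall y, exists x, f x = y) &
  forall y : T, exists U : set T, [/\ open U, U y &
    exists (J : Type) (F : J -> set S),
      [/\ forall j, open (F j), trivIset setT F,
          \bigcup_j F j = f @^-1` U &
          forall j, exists s : T -> S,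
            [/\ {within U, continuous s},
                forall z, U z -> F j (s z) /\ f (s z) = z &
                forall x, F j x -> s (f x) = x]]]].

Section riemannian_covering.
Context {R : realType} {n : nat} {E M : riemannian_manifold R n}.
Implicit Types f : E -> M.

Definition tangent_map f (v : tangent_vector E) : tangent_vector M :=
  let p := base v in
  TangentVector (f p)
    ('d (chart (chart_at (f p)) \o f \o chart_inv (chart_at p))
        (chart (chart_at p) p) (vec v)).

Definition local_isometry f : Prop :=
  [/\ continuous f,
      forall (i : chart_index E) (j : chart_index M),
        smooth_on (chart i @` (chart_dom i `&` f @^-1` chart_dom j))
                  (chart j \o f \o chart_inv i) &
      forall (p : E) (u w : 'rV[R]_n),
        inner (f p) (vec (tangent_map f (TangentVector p u)))
                    (vec (tangent_map f (TangentVector p w))) =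
        inner p u w].

Definition universal_riemannian_covering f : Prop :=
  [/\ simply_connected R E, covering_map f & local_isometry f].

Definition deck_group f : set (E -> E) :=
  [set a | homeomorphism a /\ f \o a = f].

End riemannian_covering.

(* Main.v *)
(** The exponential map [F] of [M] at a point has invertible differential
    everywhere: the kernel of its differential at [u] is made of Jacobi fields
    vanishing at two points. By the Gauss lemma a lift through [F] of a curve of
    finite length stays in a ball, so [F] has the path-lifting property and the
    exponential map of the simply connected manifold [Mtilde] has a global
    inverse. Hence any two points of [Mtilde] are joined by exactly one geodesic,
    which is minimizing, distances and angles behave as usual, and deck
    transformations are isometries acting transitively on the fibres.

    The orbit of [v] returns to a compact subset of [T^1 M] along a sequence
    [t_n] if and only if there are deck transformations [alpha_n] such that
    [alpha_n p] stays at bounded distance from [c_w (t_n)]. By visibility, points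
    at bounded distance from a ray that tend to infinity converge to the endpoint
    of the ray in the cone topology, which shows that recurrence gives a conical
    limit point. Conversely points [alpha_n p] close to the geodesic [c_{p,xi}]
    and converging to [xi] are close to [c_{p,xi} (s_n)] with [s_n -> +oo]: by
    visibility, large negative [s_n] would give angles at [p] close to [pi]. *)

From HB Require Import structures.
From mathcomp Require Import all_boot all_order all_algebra.
From mathcomp Require Import all_classical all_reals all_analysis.
From mathcomp Require Import ring lra.
Require Import Defs.

Set Implicit Arguments.
Unset Strict Implicit.
Unset Printing Implicit Defensive.

Import Order.TTheory GRing.Theory Num.Theory.
Import numFieldNormedType.Exports.

Local Open Scope classical_set_scope.
Local Open Scope ring_scope.

(** * Calculus *)

(** The hypothesis on conjugate points concerns [M], so the exponential map to be inverted first is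
    that of [M] at [proj x]. Lifting [proj] through it gives a map [G]; undoing the differential of
    [proj] at [x] turns [G] into an inverse of the exponential map of [Mtilde] at [x]. The estimate
    that confines lifts to a ball also identifies distances to [x] with norms of initial vectors.

    The analytic obstacle is the differentiability of geodesics in their initial velocity, on which
    Jacobi fields and the Gauss lemma rest. It is proved in the strict, two-point form: that form is
    stable under composition, fits Gronwall estimates on short intervals, and yields local inverses
    by contraction.

    Compactness enters each implication locally. A cluster vector of the orbit provides one section
    of the covering, hence one deck transformation for each return and a uniform distance bound.
    Conversely the orbit is first seen to return to a compact set of base points only; returns near
    a cluster point then produce a compact set of unit vectors. *)

Section interval_induction.
Context {R : realType}.

(** Real induction. The supremum [m] of the [t] such that [P] holds on all of [[a, t]] belongs to
    that set by the third hypothesis, and the second one would move it further to the right if [m]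
    were less than [b]. *)
Lemma interval_induction (P : R -> Prop) (a b : R) :
  P a ->
  (forall t, a <= t < b -> (forall s, a <= s <= t -> P s) ->
     exists2 d : R, 0 < d & forall s, t <= s < t + d -> s <= b -> P s) ->
  (forall t, a < t <= b -> (forall s, a <= s < t -> P s) -> P t) ->
  forall t, a <= t <= b -> P t.
Proof.
move=> Pa Pr Pl t /andP[at_ tb].
pose S := [set t | a <= t <= b /\ forall s, a <= s <= t -> P s].
have Sa : S a.
  by split=> [|s]; rewrite ?lexx ?(le_trans at_ tb)// -eq_le => /eqP <-.
have hS : has_sup S.
  by split; [exists a|exists b => s [/andP[]]].
set m := sup S.
have am : a <= m by exact: sup_ubound hS.2 _ Sa.
have mb : m <= b by apply: ge_sup => [|s [/andP[]]//]; exists a.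
have Plt s : a <= s < m -> P s.
  move=> /andP[as_ sm].
  have /(sup_adherent)/(_ hS)[x [_ Px]] : 0 < m - s by rewrite subr_gt0.
  by rewrite subKr => sx; apply: Px; rewrite as_ ltW.
have Pm : P m.
  have [<-//|am'] := eqVneq a m.
  by apply: Pl => [|s /Plt//]; rewrite lt_neqAle am' am mb.
have Ple s : a <= s <= m -> P s.
  move=> /andP[as_]; rewrite le_eqVlt => /predU1P[->//|sm].
  by apply: Plt; rewrite as_.
have [mb'|] := ltP m b; last first.
  by move=> bm; apply: Ple; rewrite at_ (le_trans tb).
have [|d d0 Pd] := Pr m _ Ple; first by rewrite am.
(* Halving [d] keeps [m'] inside the half-open interval to which [P] extends. *)
pose m' := Num.min (m + d / 2) b.
have mm' : m < m' by rewrite lt_min mb' ltrDl divr_gt0.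
suff /(sup_ubound hS.2) : S m' by rewrite leNgt mm'.
split; first by rewrite (le_trans am (ltW mm'))/= ge_min lexx orbT.
move=> s /andP[as_ sm']; have [sm|ms] := leP s m; first by apply: Ple; rewrite as_.
apply: Pd; last by rewrite (le_trans sm')// ge_min lexx orbT.
rewrite (ltW ms)/= (le_lt_trans sm')// gt_min ltrD2l; apply/orP; left; lra.
Qed.

(** Connectedness of [[a, b]]. The local hypothesis is symmetric in [s1] and [s2], hence makes the
    truth value of [P] locally constant, and real induction applies to [P a <-> P t]. *)
Lemma interval_locally_constant (P : R -> Prop) (a b : R) :
  (forall t, a <= t <= b -> exists2 d : R, 0 < d &
     forall s1 s2, a <= s1 <= b -> a <= s2 <= b -> `|s1 - t| < d ->
       `|s2 - t| < d -> P s1 -> P s2) ->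
  forall s t, a <= s <= b -> a <= t <= b -> P s -> P t.
Proof.
move=> H.
suff Q t : a <= t <= b -> (P a <-> P t).
  by move=> s t /Q Qs /Q Qt Ps; apply/Qt/Qs.
apply: (@interval_induction (fun t => P a <-> P t)) => //.
- move=> {}t /andP[at_ tb] Ht.
  have [|d d0 Hd] := H t; first by rewrite at_ ltW.
  exists d => // s /andP[ts sd] sb.
  have tt : `|t - t| < d by rewrite subrr normr0.
  have st : `|s - t| < d by rewrite ger0_norm ?subr_ge0//; lra.
  have it : a <= t <= b by rewrite at_ ltW.
  have is_ : a <= s <= b by rewrite (le_trans at_ ts).
  rewrite (Ht t) ?at_ ?lexx//; split; exact: Hd.
- move=> {}t /andP[at_ tb] Ht.
  have [|d d0 Hd] := H t; first by rewrite tb ltW.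
  pose s := Num.max a (t - d / 2).
  have sa : a <= s by rewrite le_max lexx.
  have st : s < t by rewrite gt_max at_/=; lra.
  have sd : t - d / 2 <= s by rewrite le_max lexx orbT.
  rewrite (Ht s) ?sa//; split; apply: Hd; rewrite ?subrr ?normr0 ?sa ?(ltW at_)//.
  + by rewrite (le_trans (ltW st)).
  + rewrite ler0_norm; lra.
  + by rewrite (le_trans (ltW st)).
  + rewrite ler0_norm; lra.
Qed.

End interval_induction.

(** * Mean value and Gronwall inequalities for vector-valued functions *)

Section row_vectors.
Context {R : realType}.

Lemma mx_entry_le_norm m n (x : 'M[R]_(m, n)) i j : `|x i j| <= `|x|.
Proof.
rewrite [leRHS]/Num.Def.normr/= mx_normrE.
exact: (@le_bigmax _ _ _ _ (fun ij => `|x ij.1 ij.2|) (i, j)).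
Qed.

Lemma mx_norm_le m n (x : 'M[R]_(m, n)) (M : R) :
  0 <= M -> (forall i j, `|x i j| <= M) -> `|x| <= M.
Proof.
move=> M0 H; rewrite [leLHS]/Num.Def.normr/= mx_normrE.
by apply/bigmax_le => // -[i j] _; exact: H.
Qed.

Lemma is_derive_mxP m n (V : normedModType R) (z : V -> 'M[R]_(m, n)) t v dz :
  is_derive t v z dz <-> forall i j, is_derive t v (fun s => z s i j) (dz i j).
Proof.
split=> [[Dz <-] i j|H].
  apply: DeriveDef; first by move/derivable_mxP : Dz; exact.
  by rewrite derive_mx// mxE.
have Dz : derivable z t v by apply/derivable_mxP => i j; have [] := H i j.
apply: DeriveDef => //; rewrite derive_mx//; apply/matrixP => i j.
by rewrite mxE; have [] := H i j.
Qed.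

Lemma is_derive1_continuous (V : normedModType R) (z : R -> V) t dz :
  is_derive t (1 : R) z dz -> {for t, continuous z}.
Proof.
by move=> [Dz _]; apply/differentiable_continuous/derivable1_diffP.
Qed.

(** The matrix norm is the maximum of the entries, so the scalar mean value theorem can be applied
    to one entry at a time, with a different intermediate point for each. *)
Lemma mean_value_mx m n (z dz : R -> 'M[R]_(m, n)) (a b M : R) :
  (forall t, a <= t <= b -> is_derive t (1 : R) z (dz t)) ->
  (forall t, a <= t <= b -> `|dz t| <= M) ->
  forall s t, a <= s <= b -> a <= t <= b -> `|z t - z s| <= M * `|t - s|.
Proof.
move=> Dz dM s t.
wlog st : s t / s <= t.
  move=> H sab tab; have [st|/ltW ts] := leP s t; first exact: H.
  by rewrite distrC (distrC t); exact: H.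
move=> /andP[as_ sb] /andP[at_ tb].
have M0 : 0 <= M by rewrite (le_trans _ (dM s _)) ?as_.
apply: mx_norm_le => [|i j]; first by rewrite mulr_ge0.
pose f (u : R) : R := z u i j.
have D u : s <= u <= t -> is_derive u (1 : R) f (dz u i j).
  move=> /andP[su ut].
  have /Dz /is_derive_mxP : a <= u <= b by rewrite (le_trans as_ su) (le_trans ut tb).
  exact.
have D1 u : u \in `]s, t[ -> is_derive u (1 : R) f (dz u i j).
  by rewrite in_itv/= => /andP[su ut]; apply: D; rewrite !ltW.
have C1 : {within `[s, t], continuous f}.
  apply/derivable_within_continuous => x; rewrite in_itv/= => /D.
  by case.
have [c cst zc] := MVT_segment st D1 C1.
rewrite -/(f s) -/(f t) in zc *.
rewrite !mxE zc normrM ler_wpM2r//; apply: le_trans (mx_entry_le_norm _ _ _) _.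
by move: cst; rewrite in_itv/= => /andP[sc ct]; apply: dM; lra.
Qed.

(** The interval is so short that [K * (b - a) <= 2^-1]. The maximum [m] of the norm is then at most
    [|w s| + (K * m + e) * (b - a)], and half of [m] is absorbed in the left side; this is where the
    factor 2 comes from. *)
Lemma gronwall_short n (w dw : R -> 'rV[R]_n) (a b K e : R) :
  (forall t, a <= t <= b -> is_derive t (1 : R) w (dw t)) ->
  (forall t, a <= t <= b -> `|dw t| <= K * `|w t| + e) ->
  0 <= K -> 0 <= e -> K * (b - a) <= 2^-1 ->
  forall s t, a <= s <= b -> a <= t <= b ->
    `|w t| <= 2 * (`|w s| + e * (b - a)).
Proof.
move=> Dw dwK K0 e0 Kab s t sab tab.
have ab : a <= b by case/andP: sab; exact: le_trans.
have cw : {within `[a, b], continuous (fun t => `|w t|)}.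
  apply: (@continuous_in_subspaceT _ _ `[a, b]%classic (fun t => `|w t|)) => x.
  rewrite inE/= in_itv/= => /Dw /is_derive1_continuous cx.
  exact: continuous_comp cx (@norm_continuous _ _ _).
have [tau] := EVT_max ab cw; rewrite in_itv/= => tauab Hmax.
have wM u : a <= u <= b -> `|w u| <= `|w tau| by move=> ?; exact: Hmax.
have dM u : a <= u <= b -> `|dw u| <= K * `|w tau| + e.
  by move=> uab; rewrite (le_trans (dwK _ uab))// lerD2r ler_wpM2l// wM.
have := mean_value_mx Dw dM sab tauab.
have : `|tau - s| <= b - a.
  by rewrite ler_norml; move: tauab sab => /andP[? ?] /andP[? ?]; lra.
have := wM _ tab; have := ler_distD 0 (w tau) (w s).
have := lerB_dist (w tau) (w s).
have : 0 <= `|w tau| by [].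
have : 0 <= `|w s| by [].
set m := `|w tau|; set x := `|w s|; set y := `|w t|; set d := `|w tau - w s|.
move: `|tau - s| => q x0 m0 h1 _ h3 h4 h5.
have : d <= (K * m + e) * (b - a).
  by rewrite (le_trans h5)// ler_wpM2l// addr_ge0// mulr_ge0.
rewrite mulrDl mulrAC => h6.
have : K * (b - a) * m <= 2^-1 * m by rewrite ler_wpM2r.
lra.
Qed.

End row_vectors.

Section differentiability.
Context {R : realType} {V W : normedModType R}.

Lemma differentiable_near (f : V -> W) (x : V) (e : R) :
  differentiable f x -> 0 < e ->
  \forall y \near x, `|f y - f x - 'd f x (y - x)| <= e * `|y - x|.
Proof.
move=> /diff_locallyP[_] /eqaddoP /(_ _) H e0.
rewrite (near_shift 0) subr0; apply: filterS (H _ e0) => h /=.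
by rewrite !fctE /= addrK opprD addrA.
Qed.

Lemma is_diff_near (f : V -> W) (df : {linear V -> W}) (x : V) :
  continuous df ->
  (forall e : R, 0 < e ->
    \forall y \near x, `|f y - f x - df (y - x)| <= e * `|y - x|) ->
  is_diff x f df.
Proof.
move=> cdf H.
have E : f \o shift x = cst (f x) + df +o_ 0 id.
  apply/eqaddoP => e e0; have := H _ e0.
  rewrite (near_shift 0) subr0; apply: filterS => h /=.
  by rewrite !fctE /= addrK opprD addrA.
have D := diff_unique cdf E.
by apply: DiffDef => //; apply/diff_locallyP; rewrite D.
Qed.

Lemma near_eq_is_diff (f g : V -> W) (x : V) :
  {near x, f =1 g} -> differentiable f x -> is_diff x g ('d f x).
Proof.
move=> fg df; have fgx : f x = g x by exact: nbhs_singleton fg.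
apply: is_diff_near; first exact: diff_continuous.
move=> e e0; apply: filterS2 fg (differentiable_near df e0) => y ->.
by rewrite fgx.
Qed.

Lemma near_eq_differentiable (f g : V -> W) (x : V) :
  {near x, f =1 g} -> differentiable f x -> differentiable g x.
Proof. by move=> fg df; have [] := near_eq_is_diff fg df. Qed.

Lemma differentiable_mx m n (f : V -> 'M[R]_(m, n)) (x : V) :
  (forall i j, differentiable (fun y => f y i j) x) <-> differentiable f x.
Proof.
split=> [H|df i j]; last first.
  exact: differentiable_comp df (differentiable_coord _ _ _).
have -> : f = \sum_(i < m) \sum_(j < n) (fun y => f y i j *: delta_mx i j).
  apply/funext => y; rewrite {1}(matrix_sum_delta (f y)) fct_sumE.
  by apply: eq_bigr => i _; rewrite fct_sumE.
apply: differentiable_sum => i; apply: differentiable_sum => j.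
exact: differentiableZl.
Qed.

End differentiability.

(** * Calculus of [Ck_on] functions *)

Section Ck.
Context {R : realType} {V : normedModType R}.
Implicit Types (W : normedModType R) (U : set V) (k : nat).

Lemma Ck_on_sub W k U U' (f : V -> W) :
  U' `<=` U -> Ck_on k U f -> Ck_on k U' f.
Proof.
move=> UU; elim: k f => [|k IH] f /=; first by move=> H x /UU /H.
by move=> [H1 H2]; split=> [x /UU /H1//|v]; apply: IH.
Qed.

Lemma Ck_on_local W k U (f : V -> W) :
  (forall x, U x -> exists2 U', U' x & Ck_on k U' f) -> Ck_on k U f.
Proof.
elim: k f => [|k IH] f /= H; first by move=> x /H[U' U'x]; exact.
split=> [x /H[U' U'x [H' _]]|v]; first exact: H'.
by apply: IH => x /H[U' U'x [_ H']]; exists U'.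
Qed.

Lemma Ck_on_eq W k U (f g : V -> W) :
  open U -> (forall x, U x -> f x = g x) -> Ck_on k U f -> Ck_on k U g.
Proof.
move=> oU; have near_eq (h h' : V -> W) x :
    (forall y, U y -> h y = h' y) -> U x -> {near x, h =1 h'}.
  by move=> hh Ux; apply: filterS hh _; exact: open_nbhs_nbhs.
elim: k f g => [|k IH] f g fg /=.
  move=> H x Ux; move: (H x Ux); rewrite /prop_for/= /continuous_at (fg x Ux).
  by apply: cvg_trans; apply: near_eq_cvg; exact: near_eq.
move=> [H1 H2]; split=> [x Ux|v].
  by apply: near_eq_differentiable (H1 _ Ux); exact: near_eq.
apply: IH (H2 v) => x Ux; apply: near_eq_derive; exact: near_eq.
Qed.

Lemma Ck_on_cst W k U (a : W) : Ck_on k U (fun=> a).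
Proof.
elim: k a => [|k IH] a /=; first by move=> x _; exact: cst_continuous.
split=> [x _|v]; first exact: differentiable_cst.
rewrite (_ : (fun x => 'D_v (fun=> a) x) = fun=> 0); first exact: IH.
by apply/funext => x; rewrite (derive_cst a).
Qed.

Lemma Ck_on_pred W k U (f : V -> W) : Ck_on k.+1 U f -> Ck_on k U f.
Proof.
elim: k f => [|k IH] f /= [H1 H2].
  by move=> x /H1 /differentiable_continuous.
by split=> // v; apply: IH; exact: H2.
Qed.

Lemma Ck_on_differentiable W k U (f : V -> W) x :
  Ck_on k.+1 U f -> U x -> differentiable f x.
Proof. by move=> [+ _]; apply. Qed.

Lemma Ck_on_derive W k U (f : V -> W) v :
  Ck_on k.+1 U f -> Ck_on k U ('D_v f).
Proof. by move=> [_]; apply. Qed.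

Lemma Ck_onD W k U (f g : V -> W) : open U ->
  Ck_on k U f -> Ck_on k U g -> Ck_on k U (fun x => f x + g x).
Proof.
move=> oU; elim: k f g => [|k IH] f g /=.
  by move=> Hf Hg x Ux; apply: continuousD; [exact: Hf|exact: Hg].
move=> [f1 f2] [g1 g2]; split=> [x Ux|v]; first by apply: differentiableD; auto.
apply: Ck_on_eq (IH _ _ (f2 v) (g2 v)) => // x Ux.
by rewrite [RHS](@deriveD _ _ _ f g)//; apply: diff_derivable; auto.
Qed.

Lemma Ck_on_sum W k U (I : Type) (s : seq I) (F : I -> V -> W) : open U ->
  (forall j, Ck_on k U (F j)) -> Ck_on k U (fun x => \sum_(j <- s) F j x).
Proof.
move=> oU HF; elim: s => [|j s IH].
  by apply: Ck_on_eq (Ck_on_cst _ _ 0) => // x _; rewrite big_nil.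
by apply: Ck_on_eq (Ck_onD oU (HF j) IH) => // x _; rewrite big_cons.
Qed.

Lemma Ck_onM k U (f g : V -> R) : open U ->
  Ck_on k U f -> Ck_on k U g -> Ck_on k U (fun x => f x * g x).
Proof.
move=> oU; elim: k f g => [|k IH] f g.
  by move=> Hf Hg x Ux; apply: continuousM; [exact: Hf|exact: Hg].
move=> Cf Cg; have [f1 f2] := Cf; have [g1 g2] := Cg.
split=> [x Ux|v]; first by apply: differentiableM; auto.
apply: Ck_on_eq (Ck_onD oU (IH _ _ (Ck_on_pred Cf) (g2 v))
                           (IH _ _ (Ck_on_pred Cg) (f2 v))) => // x Ux.
by rewrite [RHS](@deriveM _ _ f g)//; apply: diff_derivable; auto.
Qed.

Lemma Ck_onN k U (f : V -> R) : open U ->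
  Ck_on k U f -> Ck_on k U (fun x => - f x).
Proof.
move=> oU Cf; apply: Ck_on_eq (Ck_onM oU (Ck_on_cst (W := R) k U (-1)) Cf) => // x _.
by rewrite mulN1r.
Qed.

Lemma Ck_on_prod k U (I : Type) (s : seq I) (F : I -> V -> R) : open U ->
  (forall j, Ck_on k U (F j)) -> Ck_on k U (fun x => \prod_(j <- s) F j x).
Proof.
move=> oU HF; elim: s => [|j s IH].
  by apply: Ck_on_eq (Ck_on_cst (W := R) _ _ 1) => // x _; rewrite big_nil.
by apply: Ck_on_eq (Ck_onM oU (HF j) IH) => // x _; rewrite big_cons.
Qed.

Lemma Ck_onV k U (f : V -> R) : open U -> (forall x, U x -> f x != 0) ->
  Ck_on k U f -> Ck_on k U (fun x => (f x)^-1).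
Proof.
move=> oU f0; elim: k => [|k IH].
  by move=> Hf x Ux; apply: continuousV; [exact: f0|exact: Hf].
move=> Cf; have [f1 f2] := Cf; have CV := IH (Ck_on_pred Cf).
split=> [x Ux|v]; first by apply: differentiableV; auto.
apply: Ck_on_eq (Ck_onN oU (Ck_onM oU (Ck_onM oU CV CV) (f2 v))) => // x Ux.
rewrite [RHS](@deriveV _ _ f); [|exact: f0|by apply: diff_derivable; auto].
by rewrite scaleNr -[_ *: _]/(_ * _) -exprVn expr2.
Qed.

Lemma Ck_on_mxP m n k U (f : V -> 'M[R]_(m, n)) : open U ->
  Ck_on k U f <-> forall i j, Ck_on k U (fun x => f x i j).
Proof.
move=> oU; elim: k f => [|k IH] f.
  split=> [H i j x Ux|H x Ux].
    exact: continuous_comp (H _ Ux) (@coord_continuous _ _ _ _ _ _).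
  have E : f = (fun y => \matrix_(i, j) f y i j).
    by apply/funext => y; apply/matrixP => i j; rewrite mxE.
  apply/cvgrPdist_le => e e0.
  have : \forall y \near x, forall ij : 'I_m * 'I_n, `|f x ij.1 ij.2 - f y ij.1 ij.2| <= e.
    apply: filter_forall => -[i j].
    by have /cvgrPdist_le := H i j x Ux; apply.
  apply: filterS => y Hy; apply: mx_norm_le; first exact: ltW.
  by move=> i j; rewrite !mxE; exact: (Hy (i, j)).
split=> [[H1 H2] i j|H].
  split=> [x Ux|v]; first by move: i j; apply/differentiable_mx; exact: H1.
  move: (H2 v) => /IH /(_ i j); apply: Ck_on_eq => // x Ux.
  by rewrite derive_mx ?mxE//; apply: diff_derivable; exact: H1.
have D x : U x -> differentiable f x.
  by move=> Ux; apply/differentiable_mx => i j; have [+ _] := H i j; apply.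
split=> // v; apply/IH => i j.
have [_ /(_ v)] := H i j; apply: Ck_on_eq => // x Ux.
by rewrite derive_mx ?mxE//; apply: diff_derivable; exact: D.
Qed.

Lemma Ck_on_det n k U (A : V -> 'M[R]_n) : open U ->
  (forall i j, Ck_on k U (fun x => A x i j)) -> Ck_on k U (fun x => \det (A x)).
Proof.
move=> oU HA; rewrite /determinant; apply: Ck_on_sum => // s.
by apply: Ck_onM => //; [exact: Ck_on_cst|apply: Ck_on_prod].
Qed.

(** The entries of the inverse are cofactors divided by the determinant, and both are polynomials in
    the entries of [A]. *)
Lemma Ck_on_invmx n k U (A : V -> 'M[R]_n) : open U ->
  (forall x, U x -> A x \in unitmx) ->
  (forall i j, Ck_on k U (fun x => A x i j)) ->
  forall i j, Ck_on k U (fun x => invmx (A x) i j).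
Proof.
move=> oU uA HA i j.
suff C : Ck_on k U (fun x : V => ((\det (A x))^-1 * cofactor (A x) j i)%R).
  by apply: Ck_on_eq C => // x Ux; rewrite /invmx uA// !mxE.
apply: Ck_onM => //.
  apply: Ck_onV => // [x Ux|]; last exact: Ck_on_det.
  by have := uA x Ux; rewrite unitmxE unitfE.
rewrite /cofactor; apply: Ck_onM => //; first exact: Ck_on_cst.
apply: Ck_on_det => // a b.
by apply: Ck_on_eq (HA (lift j a) (lift i b)) => // x _; rewrite !mxE.
Qed.

End Ck.

Section Ck_composition.
Context {R : realType}.

Lemma derive_sum_basis m (W : normedModType R) (g : 'rV[R]_m -> W) x v :
  differentiable g x -> 'D_v g x = \sum_j v 0 j *: 'D_(delta_mx 0 j) g x.
Proof.
move=> dg; rewrite deriveE// {1}(row_sum_delta v) linear_sum.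
by apply: eq_bigr => j _; rewrite linearZ deriveE.
Qed.

Lemma derive_comp (V V' W : normedModType R) (f : V -> V') (g : V' -> W) x v :
  differentiable f x -> differentiable g (f x) ->
  'D_v (g \o f) x = 'D_('D_v f x) g (f x).
Proof.
move=> df dg; rewrite deriveE; last exact: differentiable_comp.
by rewrite diff_comp//= -deriveE// -deriveE.
Qed.

(** Induction through the chain rule: a directional derivative of [g \o f] is a sum of products of a
    coordinate of the derivative of [f] with a partial derivative of [g] composed with [f], and the
    induction hypothesis applies to the latter. *)
Lemma Ck_on_comp (V : normedModType R) m k (U : set V) (U' : set 'rV[R]_m)
    (f : V -> 'rV[R]_m) (g : 'rV[R]_m -> R) :
  open U -> (forall x, U x -> U' (f x)) ->
  (forall j, Ck_on k U (fun x => f x 0 j)) -> Ck_on k U' g ->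
  Ck_on k U (g \o f).
Proof.
move=> oU fU; elim: k g => [|k IH] g Cf Cg.
  move=> x Ux; apply: continuous_comp; last by apply: Cg; exact: fU.
  have /Ck_on_mxP : forall i j, Ck_on 0 U (fun x => f x i j).
    by move=> i j; rewrite ord1; exact: Cf.
  by apply.
have CF : Ck_on k.+1 U f by apply/Ck_on_mxP => // i j; rewrite ord1.
have [f1 f2] := CF; have [g1 g2] := Cg.
split=> [x Ux|v].
  by apply: differentiable_comp; [exact: f1|apply: g1; exact: fU].
apply: (@Ck_on_eq _ _ _ _ _
  (fun x => \sum_j 'D_v f x 0 j * ('D_(delta_mx 0 j) g \o f) x)) => //.
  move=> x Ux; rewrite (derive_comp v (f1 _ Ux) (g1 _ (fU _ Ux))).
  by rewrite derive_sum_basis//; apply: g1; exact: fU.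
apply: Ck_on_sum => // j; apply: Ck_onM => //.
  by move: (f2 v) => /Ck_on_mxP; exact.
by apply: IH (g2 _) => j'; apply: Ck_on_pred.
Qed.

Lemma Ck_on_comp_mx (V : normedModType R) m p q k (U : set V)
    (U' : set 'rV[R]_m) (f : V -> 'rV[R]_m) (g : 'rV[R]_m -> 'M[R]_(p, q)) :
  open U -> open U' -> (forall x, U x -> U' (f x)) ->
  Ck_on k U f -> Ck_on k U' g -> Ck_on k U (g \o f).
Proof.
move=> oU oU' fU Cf Cg; apply/Ck_on_mxP => // i j.
apply: (Ck_on_comp (g := fun x => g x i j)) => //.
- exact: fU.
- by move=> l; move: Cf => /Ck_on_mxP; exact.
- by move: Cg => /Ck_on_mxP; exact.
Qed.

(** [Ck_on] asks for derivatives in all directions [v]. On the line these are multiples of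
    [derive1], so the regularity of a curve concerns a single function at each order. *)
Lemma Ck_on_curveS (W : normedModType R) k (U : set R) (f : R -> W) :
  open U ->
  Ck_on k.+1 U f <->
  (forall t, U t -> derivable f t 1) /\ Ck_on k U (derive1 f).
Proof.
move=> oU; split=> [[H1 H2]|[H1 H2]].
  split=> [t Ut|]; first by apply/derivable1_diffP; exact: H1.
  by apply: Ck_on_eq (H2 1) => // t _; rewrite derive1E.
split=> [t Ut|v]; first by apply/derivable1_diffP; exact: H1.
have Zk j (h : R -> W) : Ck_on j U h -> Ck_on j U (fun t => v *: h t).
  elim: j h => [|j IH] h /=.
    by move=> Hh t Ut; apply: continuousZr; exact: Hh.
  move=> [h1 h2]; split=> [t Ut|w]; first by apply: differentiableZ; exact: h1.
  apply: Ck_on_eq (IH _ (h2 w)) => // t Ut.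
  by rewrite [RHS](@deriveZ _ _ _ h)//; apply: diff_derivable; exact: h1.
apply: Ck_on_eq (Zk _ _ H2) => // t Ut.
rewrite derive1E' ?deriveE//; try by apply/derivable1_diffP; exact: H1.
by rewrite -linearZ/= [_ *: 1]mulr1.
Qed.

End Ck_composition.

(** * Mean values along lines and symmetry of second derivatives *)

Section second_order.
Context {R : realType}.

Lemma is_derive_line (V W : normedModType R) (f : V -> W) (x v : V) (s : R) :
  differentiable f (s *: v + x) ->
  is_derive s (1 : R) (fun s : R => f (s *: v + x)) ('D_v f (s *: v + x)).
Proof.
move=> df; pose g (s : R) := s *: v + x.
have ds : differentiable ( *:%R^~ v : R -> V) s by [].
have dg : differentiable g s by apply: differentiableD.
have Dg : 'D_1 g s = v.
  rewrite (@deriveD _ _ _ ( *:%R^~ v : R -> V) (cst x)); try exact: diff_derivable.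
  by rewrite derive_cst addr0 deriveE// diff_val scale1r.
have dfg : differentiable (f \o g) s by apply: differentiable_comp.
apply: DeriveDef; first by apply: diff_derivable.
by rewrite (derive_comp _ dg df) Dg.
Qed.

Lemma mean_value_line (V : normedModType R) (f : V -> R) (x v : V) :
  (forall s : R, 0 <= s <= 1 -> differentiable f (s *: v + x)) ->
  exists2 s : R, 0 <= s <= 1 & f (v + x) - f x = 'D_v f (s *: v + x).
Proof.
move=> df.
pose g (s : R) := f (s *: v + x).
have D (s : R) : 0 <= s <= 1 -> is_derive s (1 : R) g ('D_v f (s *: v + x)).
  by move=> /df; exact: is_derive_line.
have D1 (s : R) : s \in `]0, 1[ -> is_derive s (1 : R) g ('D_v f (s *: v + x)).
  by rewrite in_itv/= => /andP[s0 s1]; apply: D; rewrite !ltW.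
have C1 : {within `[0, 1], continuous g}.
  by apply/derivable_within_continuous => s; rewrite in_itv/= => /D; case.
have [s] := MVT_segment ler01 D1 C1.
by rewrite in_itv/= subr0 mulr1 /g scale1r scale0r add0r; exists s.
Qed.

(** The second difference over the parallelogram is the increment along [h *: v] of [g], itself a
    first difference of [f] along [h *: w]. The mean value theorem is applied to [g], then to
    ['D_v f] along [h *: w]. *)
Lemma Ck2_rectangle (V : normedModType R) (f : V -> R) (x v w : V) (U : set V)
    (h : R) : Ck_on 2 U f -> 0 < h ->
  (forall s t : R, 0 <= s <= h -> 0 <= t <= h -> U (s *: v + (t *: w + x))) ->
  exists s, exists2 t, (0 <= s <= h /\ 0 <= t <= h) &
   f (h *: v + (h *: w + x)) - f (h *: v + x) - (f (h *: w + x) - f x)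
   = h ^+ 2 * 'D_w ('D_v f) (s *: v + (t *: w + x)).
Proof.
move=> [f1 f2] h0 HU; have h01 (s : R) : 0 <= s <= 1 -> 0 <= s * h <= h.
  by move=> /andP[s0 s1]; rewrite mulr_ge0 ?ler_piMl// ltW.
have h00 : 0 <= (0 : R) <= h by rewrite lexx ltW.
have hh : 0 <= h <= h by rewrite lexx ltW.
have [f2v _] := f2 v.
pose g (y : V) := f (h *: w + y) - f y.
have dtr (y : V) : differentiable (fun y : V => h *: w + y) y.
  by apply: differentiableD.
have dfh y : U (h *: w + y) -> differentiable (fun y => f (h *: w + y)) y.
  by move=> Uy; apply: (differentiable_comp (dtr y)); exact: f1.
have dg y : U (h *: w + y) -> U y -> differentiable g y.
  by move=> U1 U2; apply: differentiableB; [exact: dfh|exact: f1].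
have U1 (s : R) : 0 <= s <= 1 -> U (h *: w + (s *: (h *: v) + x)).
  by move=> /h01 ?; rewrite scalerA addrCA; exact: HU.
have U2 (s : R) : 0 <= s <= 1 -> U (s *: (h *: v) + x).
  by move=> /h01 s01; have := HU (s * h) 0 s01 h00; rewrite scalerA scale0r add0r.
have [s s01] := @mean_value_line V g x (h *: v) (fun s s01 => dg _ (U1 s s01) (U2 s s01)).
rewrite {1 2}/g [X in X - _ = _](_ : _ = f (h *: v + (h *: w + x)) - f (h *: v + x)); last first.
  by rewrite addrCA.
move=> ->.
set y := s *: (h *: v) + x.
have -> : 'D_(h *: v) g y = h * ('D_v f (h *: w + y) - 'D_v f y).
  rewrite (@deriveB _ _ _ (fun y => f (h *: w + y)) f); first last.
  - by apply: diff_derivable; apply: f1; exact: U2.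
  - by apply: diff_derivable; apply: dfh; exact: U1.
  rewrite (derive_comp (f := fun y => h *: w + y) _ (dtr y)); last by apply: f1; exact: U1.
  rewrite (@deriveD _ _ _ (cst (h *: w)) id)// derive_cst derive_id add0r.
  rewrite !deriveE.
  - have L (k : {linear V -> R}) : k (h *: v) = h * k v by rewrite linearZ.
    by rewrite !L mulrBr.
  1-4: by apply: f1; first [exact: U2|exact: U1].
have [t|t t01 ->] := @mean_value_line V ('D_v f) y (h *: w).
  move=> t01; apply: f2v; rewrite /y !scalerA addrCA; apply: HU; exact: h01.
exists (s * h), (t * h); first by rewrite !h01.
have UU : U (t *: (h *: w) + y).
  by rewrite /y !scalerA addrCA; apply: HU; exact: h01.
rewrite deriveE; last exact: f2v.
rewrite linearZ/= -deriveE; last exact: f2v.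
by rewrite expr2 -mulrA -[_ *: _]/(_ * _) /y !scalerA [_ + (_ + x)]addrCA.
Qed.

(** Schwarz's theorem. The two orders of derivation give two mean value expressions of the same
    second difference, so the mixed derivatives take a common value at two points of any small ball
    around [x]; continuity concludes. *)
Lemma derive_symmetric (V : normedModType R) (f : V -> R) (x v w : V) (U : set V) :
  open U -> U x -> Ck_on 2 U f -> 'D_v ('D_w f) x = 'D_w ('D_v f) x.
Proof.
move=> oU Ux Cf; apply/eqP; rewrite -subr_eq0 -normr_le0.
apply/ler_addgt0Pl => e e0; rewrite addr0.
have e2 : 0 < e / 2 by rewrite divr_gt0.
have tri (A B C' : R) : `|A - C'| <= e / 2 -> `|B - C'| <= e / 2 -> `|B - A| <= e.
  by rewrite !ler_norml => /andP[? ?] /andP[? ?]; apply/andP; split; lra.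
have C a b : {for x, continuous ('D_b ('D_a f))}.
  by have [_ /(_ a) [_ /(_ b) H]] := Cf; exact: H.
pose P1 : set V := fun y => `|'D_w ('D_v f) x - 'D_w ('D_v f) y| <= e / 2.
pose P2 : set V := fun y => `|'D_v ('D_w f) x - 'D_v ('D_w f) y| <= e / 2.
have N1 : nbhs x P1 by move: (C v w) => /cvgrPdist_le /(_ _ e2).
have N2 : nbhs x P2 by move: (C w v) => /cvgrPdist_le /(_ _ e2).
have N3 : nbhs x U by exact: open_nbhs_nbhs.
have /nbhs_ballP[d /= d0 Hd] : nbhs x (U `&` (P1 `&` P2)).
  exact: (@filterI _ (nbhs x) (nbhs_filter x) _ _ N3 (@filterI _ (nbhs x) (nbhs_filter x) _ _ N1 N2)).
(* With this choice [h * (|v| + |w|) < d / 2], so the parallelogram lies in the ball of radius [d];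
   the added 1 makes the denominator positive. *)
pose h := d / (2 * (`|v| + `|w| + 1)).
have vw : 0 < `|v| + `|w| + 1 by rewrite ltr_wpDl// addr_ge0.
have h0 : 0 < h by rewrite divr_gt0// mulr_gt0.
have hb s t : 0 <= s <= h -> 0 <= t <= h -> ball x d (s *: v + (t *: w + x)).
  move=> /andP[s0 sh] /andP[t0 th]; rewrite -ball_normE/= addrA opprD addrCA subrr addr0.
  rewrite normrN (le_lt_trans (ler_normD _ _))// !normrZ !ger0_norm//.
  apply: (@le_lt_trans _ _ (h * (`|v| + `|w|))).
    by rewrite mulrDr lerD// ler_wpM2r.
  have E : h * (2 * (`|v| + `|w| + 1)) = d by rewrite divfK// gt_eqF// mulr_gt0.
  have : 0 <= h * (`|v| + `|w|) by rewrite mulr_ge0 ?addr_ge0// ltW.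
  lra.
have hbs s t : 0 <= s <= h -> 0 <= t <= h -> ball x d (s *: w + (t *: v + x)).
  by move=> ? ?; rewrite addrCA; exact: hb.
have Us s t (sh : 0 <= s <= h) (th : 0 <= t <= h) : U (s *: v + (t *: w + x)).
  by have [? _] := Hd _ (hb _ _ sh th).
have Us' s t (sh : 0 <= s <= h) (th : 0 <= t <= h) : U (s *: w + (t *: v + x)).
  by have [? _] := Hd _ (hbs _ _ sh th).
have [s [t [sh th] E1]] := Ck2_rectangle Cf h0 Us.
have [s' [t' [sh' th'] E2]] := Ck2_rectangle Cf h0 Us'.
have [_ [H1 _]] := Hd _ (hb _ _ sh th).
have [_ [_ H2]] := Hd _ (hbs _ _ sh' th').
rewrite (addrCA (h *: w) (h *: v) x) in E2.
have EE (A B C' D' : R) : A - B - (C' - D') = A - C' - (B - D') by ring.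
have h2 : h ^+ 2 != 0 by rewrite expf_eq0/= gt_eqF.
have E := mulfI h2 (etrans (esym E1) (etrans (EE _ _ _ _) E2)).
rewrite /P1 E in H1; rewrite /P2 in H2.
exact: tri H1 H2.
Qed.

Lemma near_right_ball n (x : 'rV[R]_n) (P : 'rV[R]_n -> Prop) :
  (\forall y \near x, P y) ->
  \forall d \near (0 : R)^'+, forall y, ball x d y -> P y.
Proof.
move=> /nbhs_ballP[d /= d0 Hd]; near=> e => y xy; apply: Hd.
by apply: le_ball xy; near: e; exact: nbhs_right_le.
Unshelve. all: by end_near. Qed.

Lemma ball_convex (V : normedModType R) (x y z : V) (d s : R) :
  ball x d y -> ball x d z -> 0 <= s <= 1 -> ball x d (s *: (y - z) + z).
Proof.
rewrite -ball_normE/= => xy xz /andP[s0 s1].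
have -> : x - (s *: (y - z) + z) = s *: (x - y) + (1 - s) *: (x - z).
  have -> : x - y = (x - z) - (y - z) by rewrite opprB addrA subrK.
  set b := s *: (y - z).
  by rewrite [s *: (x - z - _)]scalerBr -/b scalerBl scale1r [RHS]addrC subrKA opprD addrCA addrC.
rewrite (le_lt_trans (ler_normD _ _))// !normrZ !ger0_norm ?subr_ge0//.
have [->|sn0] := eqVneq s 0; first by rewrite mul0r add0r subr0 mul1r.
have h1 : 0 < s * (d - `|x - y|) by rewrite mulr_gt0 ?subr_gt0// lt0r sn0.
have h2 : 0 <= (1 - s) * (d - `|x - z|) by rewrite mulr_ge0 ?subr_ge0// ltW.
lra.
Qed.

Lemma norm_derive_le n (W : normedModType R) (f : 'rV[R]_n -> W) x (M : R) v :
  differentiable f x -> (forall j, `|'D_(delta_mx 0 j) f x| <= M) ->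
  `|'D_v f x| <= n%:R * M * `|v|.
Proof.
move=> df H; rewrite derive_sum_basis// (le_trans (ler_norm_sum _ _ _))//.
rewrite -[leRHS]mulrA -[n in n%:R]card_ord mulr_natl -sumr_const.
apply: ler_sum => j _; rewrite normrZ mulrC ler_pM//.
exact: mx_entry_le_norm.
Qed.

End second_order.

Section local_estimates.
Context {R : realType}.

(** Lets one small parameter [d] serve both as a radius and, through [d^-1], as a bound: shrinking
    [d] makes [d^-1] exceed any given constant, so the estimates below carry no separate
    constants. *)
Lemma near_right_inv_ge (C : R) : \forall d \near (0 : R)^'+, C <= d^-1.
Proof.
have [C0|C0] := leP C 0.
  by near=> d; rewrite (le_trans C0)// invr_ge0; near: d; exact: nbhs_right_ge.
near=> d; rewrite -[leLHS]invrK lef_pV2 ?posrE ?invr_gt0//.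
by near: d; apply: nbhs_right_le; rewrite invr_gt0.
Unshelve. all: by end_near. Qed.

Lemma Ck1_derive_bound n (f : 'rV[R]_n -> R) (U : set 'rV[R]_n) x :
  open U -> U x -> Ck_on 1 U f ->
  \forall d \near (0 : R)^'+, forall y w, ball x d y ->
    `|'D_w f y| <= d^-1 * `|w|.
Proof.
move=> oU Ux Cf; have f1 y := @Ck_on_differentiable _ _ _ _ _ _ y Cf.
pose M := \sum_j (`|'D_(delta_mx 0 j) f x| + 1).
have Mj j : `|'D_(delta_mx 0 j) f x| + 1 <= M.
  by rewrite /M (bigD1 j)//= lerDl sumr_ge0.
have near_x : \forall y \near x, U y /\ forall j, `|'D_(delta_mx 0 j) f y| <= M.
  near=> y; split; first by near: y; exact: open_nbhs_nbhs.
  move=> j; apply: le_trans (Mj j); move: j; near: y.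
  apply: filter_forall => j.
  have /cvgrPdist_le/(_ _ ltr01) := Ck_on_derive (delta_mx 0 j) Cf _ Ux.
  apply: filterS => y; rewrite distrC => H.
  by rewrite -lerBlDl (le_trans _ H)// lerB_dist.
near=> d => y w xy.
have Hd : forall y, ball x d y -> U y /\ forall j, `|'D_(delta_mx 0 j) f y| <= M.
  by near: d; exact: near_right_ball near_x.
have [Uy HM] := Hd _ xy.
apply: le_trans (norm_derive_le _ (f1 _ Uy) HM) _.
by rewrite ler_wpM2r//; near: d; exact: near_right_inv_ge.
Unshelve. all: by end_near. Qed.

Lemma Ck1_lipschitz n (f : 'rV[R]_n -> R) (U : set 'rV[R]_n) x :
  open U -> U x -> Ck_on 1 U f ->
  \forall d \near (0 : R)^'+, forall y z, ball x d y -> ball x d z ->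
    `|f y - f z| <= d^-1 * `|y - z|.
Proof.
move=> oU Ux Cf; have f1 y := @Ck_on_differentiable _ _ _ _ _ _ y Cf.
have BU := near_right_ball (open_nbhs_nbhs (conj oU Ux)).
apply: filterS2 BU (Ck1_derive_bound oU Ux Cf) => d Bd Hd y z xy xz.
have [s s01|s s01] := @mean_value_line _ _ f z (y - z).
  by apply/f1/Bd; exact: ball_convex.
by rewrite subrK => ->; apply: Hd; exact: ball_convex.
Qed.

(** The mean value theorem gives the derivative at a point [xi] of the segment; replacing [xi] by
    [r] costs a Lipschitz constant of the partial derivatives times [|xi - r|]. The point [r] is
    independent of [y] and [z] because the derivative will be taken along a reference solution while
    both other solutions vary. *)
Lemma Ck2_estimate n (f : 'rV[R]_n -> R) (U : set 'rV[R]_n) x :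
  open U -> U x -> Ck_on 2 U f ->
  \forall d \near (0 : R)^'+,
   forall r y z, ball x d r -> ball x d y -> ball x d z ->
    `|f y - f z - 'D_(y - z) f r| <= d^-1 * (`|y - r| + `|z - r|) * `|y - z|.
Proof.
move=> oU Ux Cf; have f1 y := @Ck_on_differentiable _ _ _ _ _ _ y Cf.
have L : \forall d \near (0 : R)^'+, forall j y z, ball x d y -> ball x d z ->
    `|'D_(delta_mx 0 j) f y - 'D_(delta_mx 0 j) f z| <= d^-1 * `|y - z|.
  apply: filter_forall => j.
  by apply: Ck1_lipschitz oU Ux _; exact: Ck_on_derive.
have BU := near_right_ball (open_nbhs_nbhs (conj oU Ux)).
have [e [[Le Be] e0]] := filter_ex (filterI (filterI L BU) (nbhs_right_gt 0)).
near=> d => r y z xr xy xz.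
have de : d <= e by near: d; exact: nbhs_right_le.
have dn : n%:R * e^-1 <= d^-1 by near: d; exact: near_right_inv_ge.
have sub u : ball x d u -> ball x e u by exact: le_ball.
have [s s01|s s01] := @mean_value_line _ _ f z (y - z).
  by apply/f1/Be/sub; exact: ball_convex.
rewrite subrK => ->.
have xs := ball_convex xy xz s01; set xi := s *: (y - z) + z in xs *.
have f1xi : differentiable f xi by exact/f1/Be/sub.
have f1r : differentiable f r by exact/f1/Be/sub.
rewrite !derive_sum_basis// -sumrB (le_trans (ler_norm_sum _ _ _))//.
have xir : `|xi - r| <= `|y - r| + `|z - r|.
  have -> : xi - r = s *: (y - r) + (1 - s) *: (z - r).
    by rewrite /xi; apply/rowP => k; rewrite !mxE; ring.
  case/andP: s01 => s0 s1.
  rewrite (le_trans (ler_normD _ _))// !normrZ !ger0_norm ?subr_ge0//.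
  by rewrite lerD// ler_piMl// lerBlDr lerDl.
apply: (@le_trans _ _ (\sum_(j < n) `|y - z| * (e^-1 * (`|y - r| + `|z - r|)))).
  apply: ler_sum => j _; rewrite -scalerBr normrZ ler_pM//.
    exact: mx_entry_le_norm.
  rewrite (le_trans (Le _ _ _ (sub _ xs) (sub _ xr)))// ler_wpM2l//.
  by rewrite invr_ge0 ltW.
rewrite sumr_const card_ord -mulr_natl.
set a := `|y - z|; set c := `|y - r| + `|z - r|; set ie := e^-1.
have -> : n%:R * (a * (ie * c)) = n%:R * ie * c * a by ring.
have c0 : 0 <= c by rewrite addr_ge0.
exact: (ler_wpM2r (normr_ge0 (y - z)) (ler_wpM2r c0 dn)).
Unshelve. all: by end_near. Qed.

Lemma Ck2_estimate_row n m (f : 'rV[R]_n -> 'rV[R]_m) (U : set 'rV[R]_n) x :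
  open U -> U x -> Ck_on 2 U f ->
  \forall d \near (0 : R)^'+,
   [/\ forall y, ball x d y -> U y,
    forall r y z, ball x d r -> ball x d y -> ball x d z ->
    `|f y - f z - 'D_(y - z) f r| <= d^-1 * (`|y - r| + `|z - r|) * `|y - z| &
    forall y w, ball x d y -> `|'D_w f y| <= d^-1 * `|w|].
Proof.
move=> oU Ux Cf; have f1 y := @Ck_on_differentiable _ _ _ _ _ _ y Cf.
have Cj j : Ck_on 2 U (fun y => f y 0 j) by move/Ck_on_mxP : Cf; exact.
have BU := near_right_ball (open_nbhs_nbhs (conj oU Ux)).
near=> d; have d0 : 0 < d by near: d; exact: nbhs_right_gt.
have d0' : 0 <= d^-1 by rewrite invr_ge0 ltW.
have Bd : forall y, ball x d y -> U y by near: d.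
have dE y v j : ball x d y -> 'D_v f y 0 j = 'D_v (fun y => f y 0 j) y.
  by move=> /Bd Uy; rewrite derive_mx ?mxE//; apply: diff_derivable; exact: f1.
split => //.
- move=> r y z xr xy xz; apply: mx_norm_le => [|i j].
    by rewrite !mulr_ge0// addr_ge0.
  rewrite ord1 !mxE dE//; move: r y z xr xy xz; move: j; near: d.
  by apply: filter_forall => j; exact: Ck2_estimate oU Ux (Cj j).
- move=> y w xy; apply: mx_norm_le => [|i j]; first by rewrite mulr_ge0.
  rewrite ord1 dE//; move: y w xy; move: j; near: d.
  by apply: filter_forall => j; exact: Ck1_derive_bound oU Ux (Ck_on_pred (Cj j)).
Unshelve. all: by end_near. Qed.

End local_estimates.

(** * Strict differentiability and local inverses *)

Section strict_differentiability.
Context {R : realType}.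

(** Both points of the increment vary. This makes [f] Lipschitz near [x] and a small perturbation of
    a linear map in the sense of the contraction principle, without information on derivatives at
    other points. Vectors are rows, so [L] acts on the right. *)
Definition strict_diff n m (f : 'rV[R]_n -> 'rV[R]_m) (x : 'rV[R]_n)
    (L : 'M[R]_(n, m)) : Prop :=
  forall e : R, 0 < e -> \forall d \near (0 : R)^'+, forall y z,
    ball x d y -> ball x d z -> `|f y - f z - (y - z) *m L| <= e * `|y - z|.

Lemma mulmx_norm_le m n p (A : 'M[R]_(m, n)) (B : 'M[R]_(n, p)) :
  `|A *m B| <= n%:R * `|B| * `|A|.
Proof.
apply: mx_norm_le => [|i j]; first by rewrite !mulr_ge0.
rewrite mxE (le_trans (ler_norm_sum _ _ _))//.
rewrite -[leRHS]mulrA -[n in n%:R]card_ord mulr_natl -sumr_const.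
by apply: ler_sum => k _; rewrite normrM mulrC ler_pM// mx_entry_le_norm.
Qed.

Lemma locally_lipschitz_continuous (V W : normedModType R) (f : V -> W) x k :
  (\forall y \near x, `|f x - f y| <= k * `|x - y|) -> {for x, continuous f}.
Proof.
move=> H; apply/cvgrPdist_le => e e0.
pose C := `|k| + 1; have C0 : 0 < C by rewrite ltr_wpDl.
have eC : 0 < e / C by rewrite divr_gt0.
near=> y; have Hy : `|f x - f y| <= k * `|x - y| by near: y.
have xy : `|x - y| <= e / C by near: y; apply: cvgr_dist_le eC; exact: cvg_id.
rewrite (le_trans Hy)// (@le_trans _ _ (C * `|x - y|))//.
  by rewrite ler_wpM2r// /C; have := ler_norm k; lra.
by rewrite mulrC -ler_pdivlMr.
Unshelve. all: by end_near. Qed.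

Lemma mulmxr_continuous m n p (B : 'M[R]_(n, p)) :
  continuous (mulmxr B : 'M[R]_(m, n) -> _).
Proof.
move=> A; apply: (@locally_lipschitz_continuous _ _ (mulmxr B : 'M[R]_(m, n) -> _) A (n%:R * `|B|)).
apply: (@nearW _ (nbhs A) _ (nbhs_filter A)) => A'; rewrite -[_ - _](mulmxBl A A' B).
exact: mulmx_norm_le.
Qed.

Lemma ball_self n (x : 'rV[R]_n) : \forall d \near (0 : R)^'+, ball x d x.
Proof. by near=> d; apply: ballxx; near: d; exact: nbhs_right_gt. Unshelve. all: by end_near. Qed.

Lemma strict_diff_is_diff n m (f : 'rV[R]_n -> 'rV[R]_m) x L :
  strict_diff f x L -> is_diff x f (mulmxr L).
Proof.
move=> H; apply: (@is_diff_near _ _ _ f (mulmxr L : {linear 'rV[R]_n -> 'rV[R]_m})).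
  exact: mulmxr_continuous.
move=> e e0; have [d [Hd xx]] := filter_ex (filterI (H e e0) (ball_self x)).
have d0 : 0 < d by move: xx; rewrite -ball_normE/= subrr normr0.
by near=> y; apply: Hd => //; near: y; exact: nbhsx_ballx.
Unshelve. all: by end_near. Qed.

Lemma strict_diff_eq n m (f g : 'rV[R]_n -> 'rV[R]_m) x L :
  {near x, f =1 g} -> strict_diff f x L -> strict_diff g x L.
Proof.
move=> /near_right_ball fg H e e0.
by apply: filterS2 fg (H e e0) => d fg Hd y z xy xz; rewrite -!fg//; exact: Hd.
Qed.

Lemma strict_diff_lipschitz n m (f : 'rV[R]_n -> 'rV[R]_m) x L :
  strict_diff f x L -> \forall d \near (0 : R)^'+, forall y z,
    ball x d y -> ball x d z -> `|f y - f z| <= (n%:R * `|L| + 1) * `|y - z|.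
Proof.
move=> /(_ 1 ltr01); apply: filterS => d Hd y z xy xz.
rewrite -(subrK ((y - z) *m L) (f y - f z)) (le_trans (ler_normD _ _))//.
by rewrite mulrDl addrC lerD ?mulmx_norm_le// Hd.
Qed.

Lemma strict_diff_comp n m p (f : 'rV[R]_n -> 'rV[R]_m) (g : 'rV[R]_m -> 'rV[R]_p)
    x L L' :
  strict_diff f x L -> strict_diff g (f x) L' ->
  strict_diff (g \o f) x (L *m L').
Proof.
move=> Hf Hg e e0.
pose A := n%:R * `|L| + 1; pose B := m%:R * `|L'| + 1.
have A0 : 0 < A by rewrite ltr_wpDl// mulr_ge0.
have B0 : 0 < B by rewrite ltr_wpDl// mulr_ge0.
have eA : 0 < e / 2 / A by rewrite !divr_gt0.
have eB : 0 < e / 2 / B by rewrite !divr_gt0.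
have [d' [Hd' d'0]] := filter_ex (filterI (Hg _ eA) (nbhs_right_gt 0)).
have Lf := strict_diff_lipschitz Hf.
near=> d => y z xy xz.
have d0 : 0 < d by near: d; exact: nbhs_right_gt.
have Ld : forall y z, ball x d y -> ball x d z -> `|f y - f z| <= A * `|y - z|.
  by near: d.
have Ed : forall y z, ball x d y -> ball x d z ->
   `|f y - f z - (y - z) *m L| <= e / 2 / B * `|y - z|.
  by near: d; exact: Hf.
have dA : A * d <= d'.
  rewrite mulrC -ler_pdivlMr//; near: d; apply: nbhs_right_le.
  by rewrite divr_gt0.
have fb y' : ball x d y' -> ball (f x) d' (f y').
  move=> xy'; have := Ld x y' (ballxx _ d0) xy'; rewrite -ball_normE/= => H.
  apply: le_lt_trans H _; apply: lt_le_trans dA; rewrite ltr_pM2l//.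
  by move: xy'; rewrite -ball_normE.
rewrite /= mulmxA.
rewrite -(subrK ((f y - f z) *m L') (g (f y) - g (f z))) -addrA -mulmxBl.
rewrite (le_trans (ler_normD _ _))// (splitr e) mulrDl lerD//.
  rewrite (le_trans (Hd' _ _ (fb _ xy) (fb _ xz)))//.
  rewrite (le_trans (ler_wpM2l (ltW eA) (Ld _ _ xy xz)))//.
  by rewrite mulrA divfK// gt_eqF.
rewrite (le_trans (mulmx_norm_le _ _))//.
apply: (@le_trans _ _ (B * `|f y - f z - (y - z) *m L|)).
  by rewrite ler_wpM2r// lerDl.
rewrite (le_trans (ler_wpM2l (ltW B0) (Ed _ _ xy xz)))//.
by rewrite mulrA (mulrC B) divfK ?gt_eqF.
Unshelve. all: by end_near. Qed.

Lemma Ck2_strict_diff n m (f : 'rV[R]_n -> 'rV[R]_m) U x :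
  open U -> U x -> Ck_on 2 U f -> strict_diff f x (jacobian f x).
Proof.
move=> oU Ux Cf e e0.
have [d' [[BU E _] d'0]] := filter_ex (filterI (Ck2_estimate_row oU Ux Cf) (nbhs_right_gt 0)).
near=> d => y z xy xz.
have d0 : 0 < d by near: d; exact: nbhs_right_gt.
have dd' : d <= d' by near: d; exact: nbhs_right_le.
rewrite -deriveEjacobian; last exact: Ck_on_differentiable Cf Ux.
rewrite (le_trans (E x y z _ _ _))//; try exact: le_ball dd' _ _; first exact: ballxx.
rewrite ler_wpM2r//.
have : `|y - x| + `|z - x| <= 2 * d.
  move: xy xz; rewrite -!ball_normE/= => /ltW + /ltW; rewrite !(distrC x).
  lra.
move=> H; apply: le_trans (ler_wpM2l _ H) _; first by rewrite invr_ge0 ltW.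
rewrite mulrA -ler_pdivlMl ?mulr_gt0 ?invr_gt0//; near: d.
by apply: nbhs_right_le; rewrite mulr_gt0// invr_gt0 mulr_gt0 ?invr_gt0.
Unshelve. all: by end_near. Qed.

Lemma strict_diff_affine n m (a : 'rV[R]_m) (L : 'M[R]_(n, m)) x :
  strict_diff (fun y => a + y *m L) x L.
Proof.
move=> e e0; near=> d => y z _ _.
rewrite opprD addrACA subrr add0r -mulmxBl subrr normr0 mulr_ge0//.
exact: ltW.
Unshelve. all: by end_near. Qed.

End strict_differentiability.

HB.instance Definition _ (R : realType) n := Complete.on 'rV[R]_n.

Section local_inverse.
Context {R : realType}.

(** The local inverse [g] is a total function, continuous at the points of [U] for the topology of
    the whole space, which avoids subspace topologies. The last clause makes [f] injective on
    [W]. *)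
Definition locally_invertible (X Y : topologicalType) (f : X -> Y) (x : X) : Prop :=
  exists (W : set X) (U : set Y) (g : Y -> X),
   [/\ open W /\ W x, open U,
     forall y, U y -> [/\ W (g y), f (g y) = y & {for y, continuous g}] &
     forall x', W x' -> U (f x') /\ g (f x') = x'].

(** Newton's method: [f y = t] means that [y] is fixed by [h], which subtracts from [y] the image of
    [f y - t] under the inverse of [L], and [h] is a contraction because [f] is close to [L]. The
    same closeness makes the inverse Lipschitz and gives its derivative at [f x]. *)
Lemma strict_diff_invertible n (f : 'rV[R]_n -> 'rV[R]_n) x (L : 'M[R]_n) :
  L \in unitmx -> strict_diff f x L ->
  exists W U g,
   [/\ open W /\ W x, open U,
     forall y, U y -> [/\ W (g y), f (g y) = y & {for y, continuous g}],
     forall x', W x' -> U (f x') /\ g (f x') = x' &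
     is_diff (f x) g (mulmxr (invmx L))].
Proof.
move=> uL Hf; pose c := n%:R * `|invmx L| + 1.
have c0 : 0 < c by rewrite ltr_wpDl// mulr_ge0.
have cle (y : 'rV[R]_n) : `|y *m invmx L| <= c * `|y|.
  by rewrite (le_trans (mulmx_norm_le _ _))// ler_wpM2r// lerDl.
(* [c] bounds the operator norm of the inverse of [L]; this accuracy makes the contraction factor
   [2^-1]. *)
have e0 : 0 < (2 * c)^-1 by rewrite invr_gt0 mulr_gt0.
have [d [Hd d0]] := filter_ex (filterI (Hf _ e0) (nbhs_right_gt 0)).
have H1 y z : ball x d y -> ball x d z ->
    `|(y - z) - (f y - f z) *m invmx L| <= 2^-1 * `|y - z|.
  move=> xy xz; rewrite -{1}[y - z](mulmxK uL) -mulmxBl (le_trans (cle _))//.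
  rewrite distrC (le_trans (ler_wpM2l (ltW c0) (Hd _ _ xy xz)))//.
  by rewrite mulrA invfM mulrCA divff ?mulr1// gt_eqF.
have H2 y z : ball x d y -> ball x d z -> `|y - z| <= 2 * c * `|f y - f z|.
  move=> xy xz; have := H1 _ _ xy xz; have := cle (f y - f z).
  have := lerB_dist (y - z) ((f y - f z) *m invmx L).
  lra.
have cf y : ball x d y -> {for y, continuous f}.
  move=> xy; apply: (@locally_lipschitz_continuous R _ _ f y (n%:R * `|L| + (2 * c)^-1)).
  have : nbhs y (ball x d) by apply: open_nbhs_nbhs; split => //; exact: ball_open.
  apply: filterS => z xz.
  rewrite -(subrK ((y - z) *m L) (f y - f z)) (le_trans (ler_normD _ _))//.
  by rewrite mulrDl addrC lerD ?mulmx_norm_le// Hd.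
pose r := d / 2; have r0 : 0 < r by rewrite divr_gt0.
(* For [t] in [U] the map [h] moves the centre [x] by less than [r / 2]; with the contraction factor
   [2^-1] it sends the closed ball of radius [r] into itself. *)
pose U := ball (f x) (r / (2 * c)).
have surj t : U t -> exists2 y, ball x d y & f y = t.
  rewrite /U -ball_normE/= ltr_pdivlMr ?mulr_gt0// mulrC => Ut.
  have tri (A B C : 'rV[R]_n) : A - C = (A - B) - (C - B) by rewrite opprB subrKA.
  pose h y := y - (f y - t) *m invmx L.
  have hd y z : ball x d y -> ball x d z -> `|h y - h z| <= 2^-1 * `|y - z|.
    move=> xy xz; have -> : h y - h z = (y - z) - (f y - f z) *m invmx L.
      by rewrite /h !mulmxBl; apply/rowP => k; rewrite !mxE; ring.
    exact: H1.
  have sub y : closed_ball x r y -> ball x d y.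
    rewrite closed_ballE// /closed_ball_/= -ball_normE/= => /le_lt_trans; apply.
    by rewrite /r; lra.
  have xx : ball x d x by exact: ballxx.
  have hfun : set_fun (closed_ball x r) (closed_ball x r) h.
    move=> y xy; have := hd _ _ (sub _ xy) xx.
    move: xy; rewrite closed_ballE// /closed_ball_/= => xy.
    have := cle (f x - t).
    rewrite (tri x (h x) (h y)).
    have -> : x - h x = (f x - t) *m invmx L by rewrite /h subKr.
    rewrite (distrC y x); have := ler_normB ((f x - t) *m invmx L) (h y - h x).
    move: Ut xy; lra.
  pose hF : {fun closed_ball x r >-> closed_ball x r} := [fun of mkfun hfun].
  have ctr : is_contraction hF.
    have q0 : 0 <= 2^-1 :> R by rewrite invr_ge0.
    exists (NngNum q0); split; first by rewrite /= invf_lt1// ltr1n.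
    by move=> [y z] [/= yb zb]; apply: hd; exact: sub.
  have [|y yb yh] := banach_fixed_point ctr (@closed_ball_closed _ _ _ _).
    by exists x; exact: closed_ballxx.
  exists y; first by have := sub _ yb; rewrite -ball_normE.
  apply/eqP; rewrite -subr_eq0; apply/eqP.
  rewrite -[f y - t](mulmxKV uL) -[_ *m invmx L](subKr y) -/(h y).
  by rewrite -[h y]/(hF y) -yh subrr mul0mx.
have /choice[g gP] : forall t, exists y, U t -> ball x d y /\ f y = t.
  move=> t; have [/surj[y ? ?]|nU] := pselect (U t); first by exists y.
  by exists x.
pose W := ball x d `&` f @^-1` U.
have gd t t' : U t -> U t' -> `|g t - g t'| <= 2 * c * `|t - t'|.
  move=> /gP[b1 e1] /gP[b2 e2]; rewrite -{2}e1 -{2}e2; exact: H2.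
have oU : open U by exact: ball_open.
have fxU : U (f x) by apply: ballxx; rewrite divr_gt0// mulr_gt0.
have gf x' : W x' -> g (f x') = x'.
  move=> [b /gP[b' E]]; apply/eqP; rewrite -subr_eq0 -normr_le0.
  by rewrite (le_trans (H2 _ _ b' b))// E subrr normr0 mulr0.
have gx : g (f x) = x by apply: gf; split => //; exact: ballxx.
exists W, U, g; split; [|exact: oU| | |].
- split; last by split => //; exact: ballxx.
  rewrite openE => y [by_ Uy]; apply: filterI.
    by apply: open_nbhs_nbhs; split => //; exact: ball_open.
  by apply: cf by_ _ _; exact: open_nbhs_nbhs.
- move=> y Uy; have [b E] := gP _ Uy; split => //.
    by split => //=; rewrite /preimage/= E.
  apply: (@locally_lipschitz_continuous R _ _ g y (2 * c)).
  by near=> z; apply: gd => //; near: z; exact: open_nbhs_nbhs.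
- by move=> x' Wx'; split; [case: Wx'|exact: gf].
- apply: (@is_diff_near _ _ _ g (mulmxr (invmx L) : {linear 'rV[R]_n -> 'rV[R]_n})).
    exact: mulmxr_continuous.
  (* One factor [c] comes from the inverse matrix, and [2 * c] is the Lipschitz constant of [g]. *)
  move=> e e'0; have e1 : 0 < e / (2 * c * c) by rewrite divr_gt0// !mulr_gt0.
  have [d' [Hd' d'0]] := filter_ex (filterI (Hf _ e1) (nbhs_right_gt 0)).
  near=> t; have Ut : U t by near: t; exact: open_nbhs_nbhs.
  have [b E] := gP _ Ut; rewrite gx /=.
  have b' : ball x d' (g t).
    rewrite -ball_normE/= -{1}gx (le_lt_trans (gd _ _ fxU Ut))//.
    rewrite -ltr_pdivlMl ?mulr_gt0//; near: t.
    apply: cvgr_dist_lt; first exact: cvg_id.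
    by rewrite mulr_gt0// invr_gt0 mulr_gt0.
  rewrite -{1}[g t - x](mulmxK uL) -mulmxBl (le_trans (cle _))// distrC.
  have := Hd' _ _ b' (ballxx _ d'0); rewrite E => H3.
  rewrite (le_trans (ler_wpM2l (ltW c0) H3))//.
  have := gd _ _ Ut fxU; rewrite gx => H4.
  rewrite mulrA (le_trans (ler_wpM2l _ H4))//.
    by rewrite mulr_ge0 ?ltW.
  rewrite le_eqVlt; apply/orP; left; apply/eqP.
  by field; rewrite gt_eqF.
Unshelve. all: by end_near. Qed.

End local_inverse.

(** * Differential equations *)

Section variational_equation.
Context {R : realType}.

Lemma ler_norm_add3 (V : normedModType R) (x y z : V) (p q r : R) :
  `|x| <= p -> `|y| <= q -> `|z| <= r -> `|x + y + z| <= p + q + r.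
Proof.
move=> xp yq zr; rewrite (le_trans (ler_normD _ _))// lerD//.
by rewrite (le_trans (ler_normD _ _))// lerD.
Qed.

Lemma ler_dist3 (V : normedModType R) (x y z w : V) (p q r : R) :
  `|x - y| <= p -> `|y - z| <= q -> `|z - w| <= r -> `|x - w| <= p + q + r.
Proof.
move=> xp yq zr; have -> : x - w = (x - y) + (y - z) + (z - w) by rewrite !subrKA.
exact: ler_norm_add3.
Qed.

Lemma is_derive1_near (W : normedModType R) (f : R -> W) (t : R) (v : W) :
  (forall e : R, 0 < e ->
     \forall s \near t, `|f s - f t - (s - t) *: v| <= e * `|s - t|) ->
  is_derive t (1 : R) f v.
Proof.
move=> H.
have C : h^-1 *: ((f \o shift t) (h *: (1 : R)) - f t) @[h --> 0^'] --> v.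
  apply/cvgrPdist_le => e e0; have := H e e0.
  rewrite (near_shift 0) subr0 => Hs.
  near=> h; have h0 : h != 0 by near: h; exact: nbhs_dnbhs_neq.
  have : `|f (h + t) - f t - (h + t - t) *: v| <= e * `|h + t - t|.
    by near: h; apply: cvg_within.
  rewrite addrK /= => Hh.
  rewrite distrC.
  have -> : h^-1 *: (f (h *: 1 + t) - f t) - v = h^-1 *: (f (h + t) - f t - h *: v).
    by rewrite [RHS]scalerBr scalerA mulVf// scale1r (mulr1 h : h *: 1 = h).
  by rewrite normrZ normfV ler_pdivrMl ?normr_gt0// mulrC.
by apply: DeriveDef; [apply/cvg_ex; exists v|exact: cvg_lim].
Unshelve. all: by end_near. Qed.

Variables (N n : nat) (G : 'rV[R]_N -> 'rV[R]_N) (z0 : 'rV[R]_N) (d K : R).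
Variables (S : R -> 'rV[R]_n -> 'rV[R]_N) (u0 : 'rV[R]_n) (eta a b s : R).
Variable (Ls : 'M[R]_(n, N)).
Hypotheses (d0 : 0 < d) (K0 : 0 <= K) (eta0 : 0 < eta).
Hypothesis GE : forall r y z, ball z0 d r -> ball z0 d y -> ball z0 d z ->
  `|G y - G z - 'D_(y - z) G r| <= K * (`|y - r| + `|z - r|) * `|y - z|.
Hypothesis GB : forall y w, ball z0 d y -> `|'D_w G y| <= K * `|w|.
Hypothesis GD : forall y, ball z0 d y -> differentiable G y.
Hypothesis GC : forall y w, ball z0 d y -> {for y, continuous ('D_w G)}.
Hypothesis Sb : forall u t, ball u0 eta u -> a <= t <= b -> ball z0 d (S t u).
Hypothesis SD : forall u t, ball u0 eta u -> a <= t <= b ->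
  is_derive t (1 : R) (S ^~ u) (G (S t u)).
Hypothesis Kab : K * (1 + 2 * d) * (b - a) <= 2^-1.
Hypothesis sab : a <= s <= b.
Hypothesis SLs : strict_diff (S s) u0 Ls.

Let K1 := K * (1 + 2 * d).
Let r t := S t u0.
Let ab : a <= b. Proof. by case/andP: sab; exact: le_trans. Qed.
Let u0b : ball u0 eta u0. Proof. exact: ballxx. Qed.
Let KK1 : K <= K1. Proof. by rewrite /K1 ler_peMr// lerDl mulr_ge0// ltW. Qed.
Let K10 : 0 <= K1. Proof. exact: le_trans KK1. Qed.
Let dist_ball y z : ball z0 d y -> ball z0 d z -> `|y - z| <= 2 * d.
Proof.
rewrite -!ball_normE/= => /ltW y1 /ltW z1.
rewrite -(subrKA z0) (le_trans (ler_normD _ _))// (distrC y); lra.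
Qed.

Let GL y z : ball z0 d y -> ball z0 d z -> `|G y - G z| <= K1 * `|y - z|.
Proof.
move=> yb zb; rewrite -(subrK ('D_(y - z) G z) (G y - G z)).
rewrite (le_trans (ler_normD _ _))// /K1 mulrDr mulr1 mulrDl addrC lerD ?GB//.
rewrite (le_trans (GE zb yb zb))// subrr normr0 addr0 ler_wpM2r//.
by rewrite ler_wpM2l// dist_ball.
Qed.

Let GlinZ y k w : ball z0 d y -> 'D_(k *: w) G y = k *: 'D_w G y.
Proof. by move=> /GD Dy; rewrite !deriveE// linearZ. Qed.

Let GlinB y w w' : ball z0 d y -> 'D_(w - w') G y = 'D_w G y - 'D_w' G y.
Proof. by move=> /GD Dy; rewrite !deriveE// linearB. Qed.

Let Glin_sum y m (c : 'I_m -> R) (w : 'I_m -> 'rV[R]_N) : ball z0 d y ->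
  'D_(\sum_i c i *: w i) G y = \sum_i c i *: 'D_(w i) G y.
Proof.
move=> /GD Dy; rewrite !deriveE// linear_sum; apply: eq_bigr => i _.
by rewrite linearZ -deriveE.
Qed.

Let L0 := n%:R * `|Ls| + 1.
Let L00 : 0 < L0. Proof. by rewrite ltr_wpDl// mulr_ge0. Qed.
Let Lam := 2 * L0.
Let Lam0 : 0 < Lam. Proof. by rewrite mulr_gt0. Qed.
Let C := 2 * K * Lam ^+ 2.
Let C0 : 0 <= C. Proof. by rewrite /C; apply: mulr_ge0; [apply: mulr_ge0|exact: sqr_ge0]. Qed.

(** The difference of two solutions satisfies the Gronwall hypothesis without error term, and at
    time [s] strict differentiability controls it; the factor 2 in [Lam] is that of
    [gronwall_short]. *)
Let flow_lipschitz : \forall rho \near (0 : R)^'+, forall u u' t,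
  ball u0 rho u -> ball u0 rho u' -> a <= t <= b ->
  `|S t u - S t u'| <= Lam * `|u - u'|.
Proof.
near=> rho => u u' t ub ub' tab.
have re : rho <= eta by near: rho; exact: nbhs_right_le.
have Hs : `|S s u - S s u'| <= L0 * `|u - u'|.
  by move: u u' ub ub'; near: rho; exact: strict_diff_lipschitz.
have be v : ball u0 rho v -> ball u0 eta v by exact: le_ball.
have := @gronwall_short R N (fun t => S t u - S t u') (fun t => G (S t u) - G (S t u'))
  a b K1 0.
move=> /(_ _ _ K10 (lexx _) Kab s t sab tab); rewrite mul0r addr0 => H.
apply: le_trans (H _ _) _.
- move=> x xab; apply: is_deriveB; apply: SD => //; exact: be.
- move=> x xab; rewrite addr0; apply: GL; apply: Sb => //; exact: be.
- by rewrite /Lam -mulrA ler_pM2l.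
Unshelve. all: by end_near. Qed.

Let linear_error : \forall rho \near (0 : R)^'+, forall u u' t,
  ball u0 rho u -> ball u0 rho u' -> a <= t <= b ->
  `|G (S t u) - G (S t u') - 'D_(S t u - S t u') G (r t)| <= C * rho * `|u - u'|.
Proof.
near=> rho => u u' t ub ub' tab.
have rho0 : 0 < rho by near: rho; exact: nbhs_right_gt.
have re : rho <= eta by near: rho; exact: nbhs_right_le.
have be v : ball u0 rho v -> ball u0 eta v by exact: le_ball.
have H v v' : ball u0 rho v -> ball u0 rho v' -> `|S t v - S t v'| <= Lam * `|v - v'|.
  by move=> vb vb'; move: v v' t vb vb' tab; near: rho; exact: flow_lipschitz.
rewrite (le_trans (GE _ _ _))//; try by apply: Sb => //; exact: be.
have u0r : ball u0 rho u0 by exact: ballxx.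
have Hu v : ball u0 rho v -> `|S t v - r t| <= Lam * rho.
  move=> vb; rewrite (le_trans (H _ _ vb u0r))// ler_pM2l//.
  by move: vb; rewrite -ball_normE/= distrC => /ltW.
apply: (@le_trans _ _ (K * (2 * (Lam * rho)) * (Lam * `|u - u'|))).
  apply: ler_pM => //; [by rewrite mulr_ge0 ?addr_ge0| |exact: H].
  by rewrite ler_wpM2l//; have := Hu _ ub; have := Hu _ ub'; lra.
by rewrite /C le_eqVlt; apply/orP; left; apply/eqP; ring.
Unshelve. all: by end_near. Qed.

(** The estimate behind the whole section. If the increments of the initial data cancel in a linear
    combination, the same combination of the increments of the solutions is small relative to their
    size, uniformly in time: it satisfies a linear differential inequality up to a quadratic error,
    and at time [s] the linear part [Ls] drops out. Two increments give the Cauchy property of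
    difference quotients, [n + 1] of them strict differentiability. *)
Let combination (e : R) : 0 < e -> exists2 rho : R, 0 < rho <= eta &
  forall m (c : 'I_m -> R) (u u' : 'I_m -> 'rV[R]_n) t,
    (forall i, ball u0 rho (u i)) -> (forall i, ball u0 rho (u' i)) ->
    \sum_i c i *: (u i - u' i) = 0 -> a <= t <= b ->
    `|\sum_i c i *: (S t (u i) - S t (u' i))| <= e * \sum_i `|c i| * `|u i - u' i|.
Proof.
move=> e0; have e4 : 0 < e / 4 by rewrite divr_gt0.
(* With [rho <= e / D] the accumulated error [C * rho * (b - a)] is at most [e / 4]; added to the
   [e / 4] allowed at time [s] and doubled by [gronwall_short], it gives [e]. *)
pose D := 4 * (C * (b - a) + 1).
have ba0 : 0 <= b - a by rewrite subr_ge0.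
have D0 : 0 < D by rewrite mulr_gt0// ltr_wpDl// mulr_ge0.
suff [rho [rho0 rhoe [Hs [HE HD]]]] : exists rho : R, [/\ 0 < rho, rho <= eta &
   (forall y z, ball u0 rho y -> ball u0 rho z ->
     `|S s y - S s z - (y - z) *m Ls| <= e / 4 * `|y - z|) /\
   (forall u u' t, ball u0 rho u -> ball u0 rho u' -> a <= t <= b ->
    `|G (S t u) - G (S t u') - 'D_(S t u - S t u') G (r t)| <= C * rho * `|u - u'|) /\
   rho <= e / D].
  exists rho; first by rewrite rho0.
  have be v : ball u0 rho v -> ball u0 eta v by exact: le_ball.
  move=> m c u u' t ub ub' cu tab.
  pose w t := \sum_(i < m) c i *: (S t (u i) - S t (u' i)).
  pose dw t := \sum_(i < m) c i *: (G (S t (u i)) - G (S t (u' i))).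
  pose X := \sum_(i < m) `|c i| * `|u i - u' i|.
  have X0 : 0 <= X by apply: sumr_ge0 => i _; rewrite mulr_ge0.
  have Dw x : a <= x <= b -> is_derive x (1 : R) w (dw x).
    move=> xab; have -> : w = \sum_(i < m) c i \*: (S ^~ (u i) - S ^~ (u' i)).
      by apply/funext => y; rewrite fct_sumE.
    apply: is_derive_sum => i; apply: is_deriveZ.
    by apply: is_deriveB; apply: SD => //; exact: be.
  have dwK x : a <= x <= b -> `|dw x| <= K1 * `|w x| + C * rho * X.
    move=> xab; have rx : ball z0 d (r x) by apply: Sb.
    rewrite -(subrK ('D_(w x) G (r x)) (dw x)) (le_trans (ler_normD _ _))// addrC lerD//.
      by rewrite (le_trans (GB _ rx))// ler_wpM2r.
    rewrite /w Glin_sum// /dw -sumrB (le_trans (ler_norm_sum _ _ _))// mulr_sumr.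
    apply: ler_sum => i _; rewrite -scalerBr normrZ mulrCA ler_wpM2l//.
    exact: HE.
  have CX : 0 <= C * rho * X by rewrite !mulr_ge0// ltW.
  have := gronwall_short Dw dwK K10 CX Kab sab tab.
  rewrite -/(w t) => H; apply: le_trans H _.
  have ws : `|w s| <= e / 4 * X.
    have -> : w s = \sum_(i < m) c i *: (S s (u i) - S s (u' i) - (u i - u' i) *m Ls).
      rewrite /w; under [RHS]eq_bigr do rewrite scalerBr.
      rewrite sumrB; under [X in _ = _ - X]eq_bigr do rewrite scalemxAl.
      by rewrite -mulmx_suml cu mul0mx subr0.
    rewrite (le_trans (ler_norm_sum _ _ _))// mulr_sumr; apply: ler_sum => i _.
    by rewrite normrZ mulrCA ler_wpM2l// Hs.
  have HD' : C * rho * (b - a) <= e / 4.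
    apply: (@le_trans _ _ (rho * (D / 4))).
      have -> : D / 4 = C * (b - a) + 1 by rewrite /D mulrC mulKf.
      by rewrite (mulrAC C) mulrC ler_pM2l// lerDl.
    by rewrite mulrA ler_pM2r ?invr_gt0// -ler_pdivlMr.
  have : C * rho * (b - a) * X <= e / 4 * X by rewrite ler_wpM2r.
  rewrite -/X (mulrAC (C * rho) X); lra.
have N1 : \forall rho \near (0 : R)^'+, forall y z, ball u0 rho y -> ball u0 rho z ->
    `|S s y - S s z - (y - z) *m Ls| <= e / 4 * `|y - z| by exact: SLs.
have eD : 0 < e / D by rewrite divr_gt0.
have [rho [[? [? ?]] [? ?]]] := filter_ex (filterI (filterI
  (nbhs_right_gt 0) (filterI (nbhs_right_le eta0) (nbhs_right_le eD))) (filterI N1 linear_error)).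
by exists rho.
Qed.

Let q h e t := e^-1 *: (S t (u0 + e *: h) - r t).

Let ball_shift (h : 'rV[R]_n) (rho e : R) : 0 < e -> e * `|h| < rho -> ball u0 rho (u0 + e *: h).
Proof.
by move=> e0 H; rewrite -ball_normE/= opprD addNKr normrN normrZ gtr0_norm.
Qed.

Let q_cauchy (h : 'rV[R]_n) (e : R) : 0 < e -> exists2 rho : R, 0 < rho &
  forall t e1 e2, a <= t <= b -> 0 < e1 < rho -> 0 < e2 < rho ->
    `|q h e1 t - q h e2 t| <= e.
Proof.
move=> e0; pose D := 2 * (`|h| + 1).
have h1 : 0 < `|h| + 1 by rewrite ltr_wpDl.
have D0 : 0 < D by rewrite mulr_gt0.
have [|rho /andP[rho0 rhoe] H] := combination (e := e / D); first by rewrite divr_gt0.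
have uu : ball u0 rho u0 by exact: ballxx.
exists (rho / (`|h| + 1)); first by rewrite divr_gt0.
move=> t e1 e2 tab /andP[e10 e1r] /andP[e20 e2r].
have sh e3 : 0 < e3 -> e3 < rho / (`|h| + 1) -> ball u0 rho (u0 + e3 *: h).
  move=> e30; rewrite ltr_pdivlMr// => e3r; apply: ball_shift => //.
  by apply: le_lt_trans e3r; rewrite ler_pM2l// lerDl.
(* The increments [e1 *: h] and [e2 *: h] cancel with the coefficients [e1^-1] and [- e2^-1], and
   the combination of solutions is the difference of the two quotients. *)
pose c (i : 'I_2) := if i == ord0 then e1^-1 else - e2^-1.
pose u (i : 'I_2) := if i == ord0 then u0 + e1 *: h else u0 + e2 *: h.
have := H 2%N c u (fun=> u0) t _ (fun=> uu) _ tab.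
rewrite !big_ord_recl !big_ord0 /c /u /= !addr0.
rewrite ![u0 + _]addrC !addrK !scalerA scaleNr mulNr !mulVf ?gt_eqF// scaleN1r scale1r subrr.
rewrite ![_ + u0]addrC -/(q h e1 t) -/(q h e2 t) => H'; apply: le_trans (H' _ _) _.
- by move=> i; case: ifP => _; apply: sh.
- by [].
- rewrite !normrZ normrN !normfV mulrA mulVf ?normr_eq0 ?gt_eqF// mul1r.
  rewrite mulrA mulVf ?normr_eq0 ?gt_eqF// mul1r.
  rewrite mulrAC ler_pdivrMr// ler_wpM2l ?(ltW e0)// /D; have := normr_ge0 h; lra.
Qed.

Let q_limit (h : 'rV[R]_n) : exists l : R -> 'rV[R]_N,
  forall e : R, 0 < e -> exists2 rho : R, 0 < rho &
  forall t e1, a <= t <= b -> 0 < e1 < rho -> `|q h e1 t - l t| <= e.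
Proof.
have Cv t : a <= t <= b -> cvg (q h e t @[e --> 0^'+]).
  move=> tab; apply: cauchy_cvg; apply: cauchy_exP => e e0.
  have e2 : 0 < e / 2 by rewrite divr_gt0.
  have [rho rho0 H] := q_cauchy h e2.
  exists (q h (rho / 2) t).
  suff Hn : \forall e1 \near (0 : R)^'+, ball (q h (rho / 2) t) e (q h e1 t) by exact: Hn.
  near=> e1; rewrite -ball_normE/=.
  apply: (@le_lt_trans _ _ (e / 2)); last by rewrite ltr_pdivrMr// ltr_pMr// ltr1n.
  apply: H => //; first by rewrite divr_gt0// ltr_pdivrMr// ltr_pMr// ltr1n.
  apply/andP; split; near: e1; [exact: nbhs_right_gt|exact: nbhs_right_lt].
exists (fun t => lim (q h e t @[e --> 0^'+])) => e e0.
have [rho rho0 H] := q_cauchy h e0.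
exists rho => // t e1 tab e1r; apply/ler_addgt0Pl => e' e'0.
have /cvgrPdist_le/(_ _ e'0) := Cv t tab.
set l := lim _ => Hl.
have [e2 [[e20 e2r] H2]] := filter_ex (filterI (filterI (nbhs_right_gt 0) (nbhs_right_lt rho0)) Hl).
rewrite -(subrKA (q h e2 t)) addrC (le_trans (ler_normD _ _))// lerD//.
  by rewrite distrC.
by apply: H => //; rewrite e20.
Unshelve. all: by end_near. Qed.

(** Row [j] of [L t] is the limit of difference quotients in the direction of the [j]-th basis
    vector. The convergence is uniform in [t]; the equation follows by applying the mean value
    inequality to one difference quotient and then letting its step tend to 0. *)
Lemma variational_equation : exists L : R -> 'M[R]_(n, N),
  (forall t, a <= t <= b -> strict_diff (S t) u0 (L t)) /\
  (forall t h, a < t < b ->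
     is_derive t (1 : R) (fun t => h *m L t) ('D_(h *m L t) G (S t u0))).
Proof.
have [l lP] := choice (fun j : 'I_n => q_limit (delta_mx 0 j)).
pose L t := \matrix_(j, k) l j t 0 k.
have LE h t : h *m L t = \sum_j h 0 j *: l j t.
  rewrite mulmx_sum_row; apply: eq_bigr => j _; congr (_ *: _).
  by apply/rowP => k; rewrite !mxE.
have n1 : 0 < n%:R + 1 :> R by rewrite ltr_wpDl.
have USD e : 0 < e -> exists2 rho : R, 0 < rho <= eta & forall t u u', a <= t <= b ->
    ball u0 rho u -> ball u0 rho u' ->
    `|S t u - S t u' - (u - u') *m L t| <= e * `|u - u'|.
  move=> e0; pose e' := e / (2 * (n%:R + 1)).
  have e'0 : 0 < e' by rewrite divr_gt0// mulr_gt0.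
  have [rho /andP[rho0 rhoe] Hc] := combination e'0.
  have /choice[rhoj rhojP] : forall j, exists rj : R, 0 < rj /\
      forall t e1, a <= t <= b -> 0 < e1 < rj -> `|q (delta_mx 0 j) e1 t - l j t| <= e'.
    by move=> j; have [rj rj0 H] := lP j e' e'0; exists rj.
  exists rho; first by rewrite rho0.
  move=> t u u' tab ub ub'.
  have [ep [ep0 ep1 epj]] : exists ep, [/\ 0 < ep, ep < rho & forall j, 0 < ep < rhoj j].
    have H : \forall ep \near (0 : R)^'+, forall j, 0 < ep < rhoj j.
      apply: filter_forall => j; have [rj _] := rhojP j.
      near=> ep; apply/andP; split; near: ep; [exact: nbhs_right_gt|exact: nbhs_right_lt].
    have [ep [[? ?] ?]] := filter_ex (filterI (filterI (nbhs_right_gt 0) (nbhs_right_lt rho0)) H).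
    by exists ep.
  pose h := u - u'; have hj j : `|h 0 j| <= `|h| by exact: mx_entry_le_norm.
  have dj j : `|delta_mx 0 j : 'rV[R]_n| <= 1.
    by apply: mx_norm_le => // i k; rewrite mxE; case: (_ && _); rewrite ?normr1 ?normr0.
  (* Index 0 carries the increment [u - u']; the other indices subtract its coordinates, each
     realized as a multiple of a difference quotient with the common step [ep]. *)
  pose c (i : 'I_n.+1) := if unlift ord0 i is Some j then - (h 0 j / ep) else 1.
  pose v (i : 'I_n.+1) := if unlift ord0 i is Some j then u0 + ep *: delta_mx 0 j else u.
  pose v' (i : 'I_n.+1) := if unlift ord0 i is Some j then u0 else u'.
  have uu : ball u0 rho u0 by exact: ballxx.
  have vb i : ball u0 rho (v i).
    rewrite /v; case: unliftP => [j|] _ //; apply: ball_shift => //.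
    by apply: le_lt_trans ep1; rewrite ler_piMr// ltW.
  have vb' i : ball u0 rho (v' i) by rewrite /v'; case: unliftP.
  have ep_neq : ep != 0 by rewrite gt_eqF.
  have cv : \sum_i c i *: (v i - v' i) = 0.
    rewrite big_ord_recl /c /v /v' unlift_none scale1r.
    under eq_bigr do rewrite liftK addrAC subrr add0r scalerA mulNr divfK// scaleNr.
    by rewrite sumrN -row_sum_delta subrr.
  have := Hc _ c v v' t vb vb' cv tab.
  rewrite !big_ord_recl /c /v /v' unlift_none scale1r normr1 mul1r.
  under eq_bigr do rewrite liftK scaleNr -scalerA -/(q _ _ _).
  under [X in _ <= e' * (_ + X)]eq_bigr do
    rewrite liftK [u0 + _]addrC addrK normrN normrM normfV normrZ -mulrA mulKf ?normr_eq0//.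
  rewrite sumrN => H.
  have S1 : \sum_(j < n) `|h 0 j| * `|delta_mx 0 j : 'rV[R]_n| <= n%:R * `|h|.
    rewrite -[n in n%:R]card_ord mulr_natl -sumr_const; apply: ler_sum => j _.
    by rewrite -[leRHS]mulr1 ler_pM.
  have S2 : `|\sum_j h 0 j *: q (delta_mx 0 j) ep t - h *m L t| <= n%:R * (`|h| * e').
    rewrite LE -sumrB (le_trans (ler_norm_sum _ _ _))//.
    rewrite -[n in n%:R]card_ord mulr_natl -sumr_const; apply: ler_sum => j _.
    rewrite -scalerBr normrZ ler_pM//; have [_] := rhojP j; apply=> //; exact: epj.
  rewrite -/h; set X := \sum_j _ in H S2.
  rewrite -(subrKA X) (le_trans (ler_normD _ _))//.
  have E : e = e' * (2 * (n%:R + 1)) by rewrite divfK// gt_eqF// mulr_gt0.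
  rewrite E; have := ler_wpM2l (ltW e'0) S1; move: H S2; rewrite -/h.
  move: (\sum_(j < n) _) => Y.
  have : 0 <= e' * `|h| by rewrite mulr_ge0// ltW.
  move: (`|_ - X|) (`|X - _|) (`|h|) n%:R.
  move=> p1 p2 H1 N1; lra.
exists L; split=> [t tab e e0|t0 h /andP[at0 t0b]].
  have [rho /andP[rho0 _] H] := USD e e0.
  near=> rho' => y z yb zb; apply: H => //.
    by apply: le_ball yb; near: rho'; exact: nbhs_right_le.
  by apply: le_ball zb; near: rho'; exact: nbhs_right_le.
have h1 : 0 < `|h| + 1 by rewrite ltr_wpDl.
have tab0 : a <= t0 <= b by rewrite !ltW.
have ba0 : 0 <= b - a by rewrite subr_ge0.
have hb rho e : 0 < rho -> 0 < e < rho / (`|h| + 1) -> ball u0 rho (u0 + e *: h).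
  move=> rho0 /andP[e0]; rewrite ltr_pdivlMr// => er; apply: ball_shift => //.
  by apply: le_lt_trans er; rewrite ler_pM2l// lerDl.
have near_e rho : 0 < rho -> \forall e \near (0 : R)^'+, 0 < e < rho / (`|h| + 1).
  move=> rho0; near=> e; apply/andP; split; near: e; first exact: nbhs_right_gt.
  by apply: nbhs_right_lt; rewrite divr_gt0.
have qL e : 0 < e -> \forall e1 \near (0 : R)^'+, forall t, a <= t <= b ->
    `|q h e1 t - h *m L t| <= e.
  move=> e0; have [|rho /andP[rho0 rhoe] H] := USD (e / (`|h| + 1)); first by rewrite divr_gt0.
  apply: filterS (near_e rho rho0) => e1 e1r t tab; have /andP[e10 _] := e1r.
  have := H t (u0 + e1 *: h) u0 tab (hb _ _ rho0 e1r) (ballxx _ rho0).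
  rewrite [u0 + _]addrC addrK [e1 *: h + _]addrC -scalemxAl normrZ gtr0_norm// => H'.
  have -> : q h e1 t - h *m L t = e1^-1 *: (S t (u0 + e1 *: h) - S t u0 - e1 *: (h *m L t)).
    by rewrite scalerBr scalerA mulVf ?gt_eqF// scale1r.
  rewrite normrZ gtr0_norm ?invr_gt0// ler_pdivrMl// (le_trans H')//.
  rewrite mulrCA ler_pM2l// mulrAC ler_pdivrMr// ler_pM2l// lerDl//.
have qD e : ball u0 eta (u0 + e *: h) -> forall t, a <= t <= b ->
    is_derive t (1 : R) (q h e) (e^-1 *: (G (S t (u0 + e *: h)) - G (r t))).
  move=> eb t tab; apply: (@is_deriveZ _ _ _ (S ^~ (u0 + e *: h) - S ^~ u0)).
  by apply: is_deriveB; apply: SD.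
pose K2 := K1 * Lam * `|h|.
(* The Lipschitz bound is inherited from the difference quotients. It provides the continuity at
   [t0] of the right-hand side of the equation. *)
have Llip t t' : a <= t <= b -> a <= t' <= b ->
    `|h *m L t - h *m L t'| <= K2 * `|t - t'|.
  move=> tab tab'; apply/ler_addgt0Pl => e e0.
  have [rho [rho0 [re fl]]] := filter_ex (filterI (nbhs_right_gt 0)
    (filterI (nbhs_right_le eta0) flow_lipschitz)).
  have e2 : 0 < e / 2 by rewrite divr_gt0.
  have [e1 [e1r Hq]] := filter_ex (filterI (near_e _ rho0) (qL _ e2)).
  have e1b := hb _ _ rho0 e1r; have /andP[e10 _] := e1r.
  have e1b' : ball u0 eta (u0 + e1 *: h) by exact: le_ball e1b.
  have dM x : a <= x <= b -> `|e1^-1 *: (G (S x (u0 + e1 *: h)) - G (r x))| <= K2.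
    move=> xab; rewrite normrZ gtr0_norm ?invr_gt0// ler_pdivrMl//.
    rewrite (le_trans (GL _ _))//; try by apply: Sb.
    have := fl _ _ x e1b (ballxx _ rho0) xab.
    rewrite [u0 + _]addrC addrK normrZ gtr0_norm// [_ + u0]addrC => H.
    rewrite (le_trans (ler_wpM2l K10 H))// /K2.
    by rewrite le_eqVlt; apply/orP; left; apply/eqP; ring.
  have H2 := mean_value_mx (qD _ e1b') dM tab' tab.
  have H3 := Hq t' tab'; have := Hq t tab; rewrite distrC => H1.
  apply: le_trans (ler_dist3 H1 H2 H3) _.
  by rewrite addrAC -splitr.
set v := 'D_(h *m L t0) G (S t0 u0).
have near_v e : 0 < e -> \forall x \near t0, a <= x <= b /\
    `|'D_(h *m L x) G (r x) - v| <= e.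
  move=> e0; have e2 : 0 < e / 2 by rewrite divr_gt0.
  have K20 : 0 <= K2 := mulr_ge0 (mulr_ge0 K10 (ltW Lam0)) (normr_ge0 h).
  have KK2 : 0 < K * K2 + 1 by rewrite ltr_wpDl// mulr_ge0.
  have cr : {for t0, continuous r} by apply: is_derive1_continuous (SD u0b tab0).
  have cD : {for t0, continuous ('D_(h *m L t0) G \o r)}.
    by apply: continuous_comp cr _; apply: GC; exact: Sb.
  near=> x.
  have xab : a <= x <= b.
    apply/andP; split; apply: ltW; near: x; [exact: lt_nbhsr|exact: lt_nbhsl].
  split => //.
  rewrite -(subrK ('D_(h *m L t0) G (r x)) ('D_(h *m L x) G (r x))) -addrA.
  rewrite (le_trans (ler_normD _ _))// (splitr e) lerD//.
    rewrite -GlinB; last exact: Sb.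
    rewrite (le_trans (GB _ _))//; first exact: Sb.
    rewrite (le_trans (ler_wpM2l K0 (Llip _ _ xab tab0)))// mulrA.
    apply: (@le_trans _ _ ((K * K2 + 1) * `|x - t0|)).
      by rewrite ler_wpM2r// lerDl.
    rewrite mulrC -ler_pdivlMr// distrC; near: x.
    by apply: cvgr_dist_le; [exact: cvg_id|rewrite divr_gt0].
  rewrite distrC; near: x.
  by move: cD => /cvgrPdist_le /(_ _ e2).
apply: is_derive1_near => e e0.
have /nbhs_ballP[del /= del0 Hdel] := near_v e e0.
near=> x; have xd : ball t0 del x by near: x; exact: nbhsx_ballx.
have [xab _] := Hdel _ xd.
apply/ler_addgt0Pl => e1 e10.
(* Total weight of the error [e2]: 2 for replacing [L] by a difference quotient at the two ends, and
   [(1 + K) * (b - a)] for the error in the derivative of that quotient. *)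
pose X := (1 + K) * (b - a) + 2.
have X0 : 0 < X by rewrite ltr_wpDl// mulr_ge0// addr_ge0.
pose e2 := e1 / X; have e20 : 0 < e2 by rewrite divr_gt0.
have e3 : 0 < e2 / (C * (`|h| + 1) + 1).
  by rewrite divr_gt0// ltr_wpDl// mulr_ge0// ltW.
have [rho [[rho0 rho3] [re le_]]] := filter_ex (filterI
  (filterI (nbhs_right_gt 0) (nbhs_right_le e3)) (filterI (nbhs_right_le eta0) linear_error)).
have [e4 [e4r Hq]] := filter_ex (filterI (near_e _ rho0) (qL _ e20)).
have e4b := hb _ _ rho0 e4r; have /andP[e40 _] := e4r.
have e4b' : ball u0 eta (u0 + e4 *: h) by exact: le_ball e4b.
have lin y : a <= y <= b ->
    `|e4^-1 *: (G (S y (u0 + e4 *: h)) - G (r y)) - 'D_(q h e4 y) G (r y)| <= e2.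
  move=> yab; rewrite /q GlinZ; last exact: Sb.
  rewrite -scalerBr normrZ gtr0_norm ?invr_gt0// ler_pdivrMl//.
  rewrite (le_trans (le_ _ _ _ e4b (ballxx _ rho0) yab))//.
  rewrite [u0 + _]addrC addrK normrZ gtr0_norm//.
  rewrite mulrCA ler_pM2l//.
  move: rho3; rewrite ler_pdivlMr; last by rewrite ltr_wpDl// mulr_ge0// ltW.
  apply: le_trans; rewrite mulrAC mulrC; apply: ler_wpM2l; first exact: ltW.
  have := normr_ge0 h; have := C0; nra.
have [a' [b' [a'b' at0' ax' sub]]] : exists a' b', [/\ a' <= b', a' <= t0 <= b',
    a' <= x <= b' & forall y, a' <= y <= b' -> `|y - t0| <= `|x - t0|].
  have [tx|/ltW xt] := leP t0 x.
    exists t0, x; rewrite !lexx tx; split => // y /andP[y1 y2].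
    by rewrite !ger0_norm ?subr_ge0// lerB.
  exists x, t0; rewrite !lexx xt; split => // y /andP[y1 y2].
  by rewrite !ler0_norm ?subr_le0// lerN2 lerB.
have yd y : a' <= y <= b' -> a <= y <= b /\ `|'D_(h *m L y) G (r y) - v| <= e.
  have xd' : `|t0 - x| < del by exact: xd.
  move=> /sub yx; apply: Hdel.
  suff : `|t0 - y| < del by exact.
  by rewrite distrC (le_lt_trans yx)// distrC.
pose psi (y : R) := q h e4 y - y *: v.
have Dpsi y : a' <= y <= b' -> is_derive y (1 : R) psi
    (e4^-1 *: (G (S y (u0 + e4 *: h)) - G (r y)) - v).
  move=> /yd[yab _]; apply: is_deriveB; first exact: qD.
  have D : differentiable ( *:%R^~ v : R -> 'rV[R]_N) y by [].
  apply: DeriveDef; first exact: diff_derivable.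
  by rewrite deriveE// diff_val scale1r.
have dpsi y : a' <= y <= b' ->
    `|e4^-1 *: (G (S y (u0 + e4 *: h)) - G (r y)) - v| <= e + (1 + K) * e2.
  move=> /yd[yab Hv]; have rb : ball z0 d (r y) by exact: Sb.
  have H2 : `|'D_(q h e4 y) G (r y) - 'D_(h *m L y) G (r y)| <= K * e2.
    by rewrite -GlinB// (le_trans (GB _ rb))// ler_wpM2l// Hq.
  apply: le_trans (ler_dist3 (lin _ yab) H2 Hv) _.
  by rewrite le_eqVlt; apply/orP; left; apply/eqP; ring.
have H2 := mean_value_mx Dpsi dpsi at0' ax'.
have H3 := Hq t0 tab0; have := Hq x xab; rewrite distrC => H1.
have -> : h *m L x - h *m L t0 - (x - t0) *: v =
    (h *m L x - q h e4 x) + (psi x - psi t0) + (q h e4 t0 - h *m L t0).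
  by rewrite scalerBl; apply/rowP => k; rewrite !mxE; ring.
apply: le_trans (ler_norm_add3 H1 H2 H3) _.
have xba : `|x - t0| <= b - a.
  case/andP: xab tab0 => ax xb /andP[a0 b0].
  by rewrite ler_norml opprB !lerB.
have E : e1 = e2 * X by rewrite /e2 divfK// gt_eqF.
have : (1 + K) * e2 * `|x - t0| <= (1 + K) * e2 * (b - a).
  by rewrite ler_wpM2l// mulr_ge0 ?addr_ge0// ltW.
move=> H4; apply: (@le_trans _ _ (e * `|x - t0| + (1 + K) * e2 * (b - a) + 2 * e2)).
  rewrite [leLHS](_ : _ = e * `|x - t0| + (1 + K) * e2 * `|x - t0| + 2 * e2); last by ring.
  by rewrite lerD2r lerD2l.
rewrite E /X le_eqVlt; apply/orP; left; apply/eqP; ring.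
Unshelve. all: by end_near. Qed.

End variational_equation.

(** * Path lifting *)

Section paths.
Context {R : realType}.

Lemma near_dist (P : R -> Prop) (t : R) :
  (\forall s \near t, P s) -> exists2 d : R, 0 < d & forall s, `|s - t| < d -> P s.
Proof.
move=> /nbhs_ballP[d /= d0 H]; exists d => // s st; apply: H.
suff ts : `|t - s| < d by exact: ts.
by rewrite distrC.
Qed.

Lemma glue_continuous (X : topologicalType) (f g : R -> X) (a : R) :
  continuous f -> continuous g -> f a = g a ->
  continuous (fun t => if t <= a then f t else g t).
Proof.
move=> cf cg fga t; have [ta|at_|->] := ltgtP t a.
- rewrite /continuous_at /= ltW//; apply: cvg_trans (cf t); apply: near_eq_cvg.
  near=> s; rewrite ltW//; near: s; exact: lt_nbhsl.
- rewrite /continuous_at /= leNgt at_/=; apply: cvg_trans (cg t); apply: near_eq_cvg.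
  near=> s; rewrite leNgt ifF//; apply/negbTE; rewrite negbK; near: s; exact: lt_nbhsr.
- rewrite /continuous_at lexx => N fN.
  have gN : nbhs (g a) N by rewrite -fga.
  have H1 : \forall s \near a, N (f s) := cf a _ fN.
  have H2 : \forall s \near a, N (g s) := cg a _ gN.
  suff H : \forall s \near a, N (if s <= a then f s else g s) by exact: H.
  by apply: filterS2 H1 H2 => s H1s H2s; case: ifP.
Unshelve. all: by end_near. Qed.

(** Retraction of the line onto [[a, b]]: composing with it turns a path on an interval into a
    continuous function on the whole line. *)
Definition clamp (a b t : R) := Num.max a (Num.min t b).

Lemma clamp_continuous a b : continuous (clamp a b).
Proof.
move=> t; apply: (@continuous_max _ _ (cst a) (fun t => Num.min t b)).
  exact: cst_continuous.
apply: (@continuous_min _ _ id (cst b)); [exact: cvg_id|exact: cst_continuous].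
Qed.

Lemma clamp_itv a b t : a <= b -> a <= clamp a b t <= b.
Proof. by move=> ab; rewrite le_max lexx/= ge_max ab ge_min lexx orbT. Qed.

Lemma clamp_id a b t : a <= t <= b -> clamp a b t = t.
Proof. by move=> /andP[at_ tb]; rewrite /clamp min_l// max_r. Qed.

Lemma within_continuous_comp (S T X : topologicalType) (A : set T) (f : T -> X)
    (h : S -> T) :
  {within A, continuous f} -> continuous h -> (forall s, A (h s)) ->
  continuous (f \o h).
Proof.
move=> /subspace_continuousP cf ch Ah s N /= fN.
have H1 : \forall s' \near s, A (h s') -> N (f (h s')) := ch s _ (cf _ (Ah s) _ fN).
suff H : \forall s' \near s, N (f (h s')) by exact: H.
by apply: filterS H1 => s'; apply.
Qed.

Lemma pair_continuous (S T X : topologicalType) (f : S -> T) (g : S -> X) (s : S) :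
  {for s, continuous f} -> {for s, continuous g} ->
  {for s, continuous (fun s => (f s, g s))}.
Proof. by move=> cf cg; exact: cvg_pair. Qed.

Lemma affine_continuous (k c : R) : continuous (fun t : R => k * t + c).
Proof.
move=> t; apply: (@continuousD _ _ _ (fun t => k * t) (cst c)).
  by apply: continuousM; [exact: cst_continuous|exact: cvg_id].
exact: cst_continuous.
Qed.

Lemma affine_comp_continuous (X : topologicalType) (f : R -> X) (k c : R) :
  continuous f -> continuous (fun t => f (k * t + c)).
Proof. by move=> cf t; apply: continuous_comp (@affine_continuous k c t) (cf _). Qed.

End paths.

(** * Uniqueness and existence of lifts of paths *)

Section lifting.
Context {R : realType} {X Y : topologicalType} (f : X -> Y).
Hypotheses (hX : hausdorff_space X) (cf : continuous f).
Hypothesis lf : forall x, locally_invertible f x.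

(** The set where the two lifts agree is open because [f] is locally injective, and closed because
    [X] is Hausdorff. *)
Lemma lift_unique_itv (g1 g2 : R -> X) (a b s : R) :
  (forall t, a <= t <= b -> {for t, continuous g1}) ->
  (forall t, a <= t <= b -> {for t, continuous g2}) ->
  (forall t, a <= t <= b -> f (g1 t) = f (g2 t)) ->
  a <= s <= b -> g1 s = g2 s -> forall t, a <= t <= b -> g1 t = g2 t.
Proof.
move=> c1 c2 f12 sab g12 t tab.
apply: (@interval_locally_constant R (fun t => g1 t = g2 t) a b _ s t) => // {t tab} t tab.
have [e12|ne12] := pselect (g1 t = g2 t).
  have [W [U [g [[oW Wx] _ _ gW]]]] := lf (g1 t).
  have N1 : \forall s \near t, W (g1 s).
    by apply: (c1 _ tab W); exact: open_nbhs_nbhs.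
  have N2 : \forall s \near t, W (g2 s).
    by apply: (c2 _ tab W); rewrite -e12; exact: open_nbhs_nbhs.
  have [d d0 Hd] := near_dist (filterI N1 N2).
  exists d => // s1 s2 s1ab s2ab _ /Hd[W1 W2] _.
  by rewrite -(gW _ W1).2 -(gW _ W2).2 f12.
move: hX; rewrite open_hausdorff => /(_ (g1 t) (g2 t)) [|[A B] /= [A1 B2] [oA oB AB]].
  by apply/eqP.
rewrite !inE in A1 B2.
have N1 : \forall s \near t, A (g1 s).
  by apply: (c1 _ tab A); exact: open_nbhs_nbhs.
have N2 : \forall s \near t, B (g2 s).
  by apply: (c2 _ tab B); exact: open_nbhs_nbhs.
have [d d0 Hd] := near_dist (filterI N1 N2).
exists d => // s1 s2 s1ab s2ab /Hd[A1' B1'] _ E; exfalso.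
move/eqP : AB => AB; suff : (A `&` B) (g1 s1) by rewrite AB.
by split => //; rewrite E.
Qed.

Lemma lift_unique (g1 g2 : R -> X) (s : R) : continuous g1 -> continuous g2 ->
  f \o g1 = f \o g2 -> g1 s = g2 s -> g1 = g2.
Proof.
move=> c1 c2 f12 g12; apply/funext => t.
apply: (@lift_unique_itv g1 g2 (Num.min s t) (Num.max s t) s) => //.
- by move=> u _; exact: c1.
- by move=> u _; exact: c2.
- by move=> u _; rewrite -[LHS]/((f \o g1) u) f12.
- by rewrite ge_min le_max !lexx.
- by rewrite ge_min le_max !lexx !orbT.
Qed.

Lemma dist_between (t t1 t2 u d : R) : `|t1 - t| < d -> `|t2 - t| < d ->
  Num.min t1 t2 <= u <= Num.max t1 t2 -> `|u - t| < d.
Proof.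
rewrite !ltr_norml => /andP[? ?] /andP[? ?] /andP[]; rewrite ge_min le_max.
by move=> /orP[?|?] /orP[?|?]; apply/andP; split; lra.
Qed.

(* Lifts of the members of a continuous family of paths depend continuously on
   the parameter, as soon as one of their points does. *)
Lemma lift_family (T : topologicalType) (H : T -> R -> Y) (K : T -> R -> X)
    (s0 : T) (a b : R) :
  (forall t, a <= t <= b -> {for (s0, t), continuous (fun z => H z.1 z.2)}) ->
  (\forall s \near s0, forall t, a <= t <= b ->
     {for t, continuous (K s)} /\ f (K s t) = H s t) ->
  forall t1 t2, a <= t1 <= b -> a <= t2 <= b ->
    {for s0, continuous (K ^~ t1)} -> {for s0, continuous (K ^~ t2)}.
Proof.
move=> cH KH.
apply: (@interval_locally_constant R (fun t => {for s0, continuous (K ^~ t)}) a b) => t tab.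
have K0 := nbhs_singleton KH.
have [W [U [g [[oW Wx] oU gU gW]]]] := lf (K s0 t).
have [cKt fK] := K0 _ tab.
have Ut : U (H s0 t) by rewrite -fK; exact: (gW _ Wx).1.
have : \forall z \near (s0, t), U (H z.1 z.2).
  by apply: (cH _ tab U); exact: open_nbhs_nbhs.
move=> [[A B] /= [nA /near_dist[d1 d10 Hd1]] AB].
have [d2 d20 Hd2] : exists2 d : R, 0 < d & forall s, `|s - t| < d -> W (K s0 s).
  by apply: near_dist; apply: (cKt W); exact: open_nbhs_nbhs.
pose d := Num.min d1 d2.
have dd1 x : x < d -> x < d1 by rewrite lt_min => /andP[].
have dd2 x : x < d -> x < d2 by rewrite lt_min => /andP[].
exists d; first by rewrite lt_min d10.
move=> t1 t2 t1ab t2ab t1d t2d c1.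
have between u : Num.min t1 t2 <= u <= Num.max t1 t2 -> a <= u <= b /\ `|u - t| < d.
  move=> ub; split; last exact: dist_between t1d t2d ub.
  case/andP: ub => h1 h2; rewrite (le_trans _ h1) ?(le_trans h2)//.
    by rewrite ge_max (andP t1ab).2 (andP t2ab).2.
  by rewrite le_min (andP t1ab).1 (andP t2ab).1.
have N1 : \forall s \near s0, W (K s t1).
  by apply: (c1 W); apply: open_nbhs_nbhs; split => //; apply/Hd2/dd2.
have E : \forall s \near s0, K s t2 = g (H s t2).
  apply: filterS3 nA N1 KH => s As Ws Ks.
  have UK u : a <= u <= b -> `|u - t| < d -> U (f (K s u)).
    by move=> uab ud; rewrite (Ks _ uab).2; apply: (AB (s, u)); split => //=; apply/Hd1/dd1.
  (* [g \o f \o K s] is a second lift of the same path. It agrees with [K s] at [t1], where [K s]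
     takes a value in [W], hence also at [t2]. *)
  have := @lift_unique_itv (K s) (fun u => g (f (K s u))) (Num.min t1 t2) (Num.max t1 t2) t1.
  rewrite -(Ks _ t2ab).2; apply.
  - by move=> u /between[uab _]; exact: (Ks _ uab).1.
  - move=> u /between[uab ud].
    have [_ _ cg] := gU _ (UK _ uab ud).
    apply: (@continuous_comp _ _ _ (K s) (g \o f)); first exact: (Ks _ uab).1.
    exact: continuous_comp (@cf _) cg.
  - by move=> u /between[uab ud]; have [_ -> _] := gU _ (UK _ uab ud).
  - by rewrite ge_min le_max !lexx.
  - by rewrite (gW _ Ws).2.
  - by rewrite ge_min le_max !lexx !orbT.
have U2 : U (H s0 t2).
  by apply: (AB (s0, t2)); split => /=; [exact: nbhs_singleton nA|exact/Hd1/dd1].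
have cHt : {for s0, continuous (H ^~ t2)}.
  apply: (@continuous_comp _ _ _ (fun s => (s, t2)) (fun z => H z.1 z.2)); last exact: cH.
  by apply: (@pair_continuous _ _ _ id (cst t2)); [exact: cvg_id|exact: cst_continuous].
have [_ _ cg] := gU _ U2.
rewrite /prop_for/= /continuous_at (nbhs_singleton E).
apply: cvg_trans (continuous_comp cHt cg); apply: near_eq_cvg.
by apply: filterS E => s ->.
Qed.

Definition path_lifting : Prop := forall (c : R -> Y) (t0 : R) (x : X),
  continuous c -> f x = c t0 ->
  exists g : R -> X, [/\ continuous g, g t0 = x & f \o g = c].

(** A consequence of being a covering that suffices for lifting paths and is accessible for the
    exponential map: one neighbourhood [U] of each point carries a continuous section through every
    point above it. Uniqueness of lifts comes from local invertibility. *)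
Definition evenly_sectioned : Prop := forall y, exists U : set Y, [/\ open U, U y &
  forall x, U (f x) -> exists s : Y -> X,
    s (f x) = x /\ forall z, U z -> f (s z) = z /\ {for z, continuous s}].

(** A lift that reaches a point above [U] is continued by the section through that point. As [U]
    depends only on [c t] and not on the lift, no lift can stop at [t]. *)
Lemma path_lifting_right (c : R -> Y) (x : X) (a b : R) :
  evenly_sectioned -> continuous c -> f x = c a -> a <= b ->
  exists g : R -> X, [/\ continuous g, g a = x & forall t, a <= t <= b -> f (g t) = c t].
Proof.
move=> ev cc fx ab.
apply: (@interval_locally_constant R (fun b => exists g : R -> X, [/\ continuous g, g a = x &
  forall t, a <= t <= b -> f (g t) = c t]) a b _ a b); rewrite ?lexx ?ab//; last first.
  exists (cst x); split => //; first exact: cst_continuous.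
  by move=> t; rewrite -eq_le => /eqP <-.
move=> t tab; have [U [oU Ut HU]] := ev (c t).
have [d d0 Hd] : exists2 d : R, 0 < d & forall s, `|s - t| < d -> U (c s).
  by apply: near_dist; apply: (cc t U); exact: open_nbhs_nbhs.
exists d => // s1 s2 /andP[as1 s1b] /andP[as2 s2b] s1d s2d [g [cg ga fg]].
have [s21|/ltW s12] := leP s2 s1.
  by exists g; split => // u /andP[au us2]; apply: fg; rewrite au (le_trans us2).
have fg1 : f (g s1) = c s1 by apply: fg; rewrite as1 lexx.
have [|s [sf Hs]] := HU (g s1); first by rewrite fg1; exact: Hd.
have Uc u : U (c (clamp s1 s2 u)).
  apply: Hd; have := @clamp_itv R s1 s2 u s12; move: s1d s2d; rewrite !ltr_norml.
  by move=> /andP[? ?] /andP[? ?] /andP[? ?]; apply/andP; split; lra.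
exists (fun u => if u <= s1 then g u else s (c (clamp s1 s2 u))); split.
- apply: glue_continuous => //.
    move=> u; apply: (@continuous_comp _ _ _ (c \o clamp s1 s2) s).
      by apply: continuous_comp; [exact: clamp_continuous|exact: cc].
    exact: (Hs _ (Uc u)).2.
  by rewrite clamp_id ?lexx// -fg1 sf.
- by rewrite as1.
- move=> u /andP[au us2]; case: leP => us1; first by apply: fg; rewrite au.
  by rewrite (Hs _ (Uc u)).1 clamp_id// us2 ltW.
Qed.

Lemma evenly_sectioned_path_lifting : evenly_sectioned -> path_lifting.
Proof.
move=> ev c t0 x cc fx.
have lift_itv (T : R) : 0 <= T -> exists g : R -> X, [/\ continuous g, g t0 = x &
    forall t, t0 - T <= t <= t0 + T -> f (g t) = c t].
  move=> T0; have [|g1 [c1 g10 f1]] := @path_lifting_right c x t0 (t0 + T) ev cc fx.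
    by rewrite lerDl.
  pose cm t := c (-1 * t + 2 * t0).
  have [|||g2 [c2 g20 f2]] := @path_lifting_right cm x t0 (t0 + T) ev.
  - exact: affine_comp_continuous.
  - by rewrite /cm fx; congr c; ring.
  - by rewrite lerDl.
  exists (fun t => if t <= t0 then g2 (-1 * t + 2 * t0) else g1 t); split.
  - apply: glue_continuous => //; first exact: affine_comp_continuous.
    by rewrite g10 -[RHS]g20; congr g2; ring.
  - by rewrite lexx -[RHS]g20; congr g2; ring.
  - move=> t /andP[h1 h2]; case: leP => tt0.
      rewrite f2 /cm; first by congr c; ring.
      by apply/andP; split; lra.
    by rewrite f1// ltW.
have /choice[g gP] : forall T : R, exists g : R -> X, 0 <= T -> [/\ continuous g, g t0 = x &
    forall t, t0 - T <= t <= t0 + T -> f (g t) = c t].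
  move=> T; have [/lift_itv[g Hg]|_] := leP 0 T; first by exists g.
  by exists (cst x).
have agree T T' t : 0 <= T -> 0 <= T' -> `|t - t0| <= T -> `|t - t0| <= T' ->
    g T t = g T' t.
  move=> T0 T'0; rewrite !ler_norml => /andP[h1 h2] /andP[h3 h4].
  have [c1 x1 f1] := gP _ T0; have [c2 x2 f2] := gP _ T'0.
  pose m := Num.min T T'.
  have mT : m <= T by rewrite ge_min lexx.
  have mT' : m <= T' by rewrite ge_min lexx orbT.
  have m0 : 0 <= m by rewrite le_min T0.
  have tm : t0 - m <= t <= t0 + m.
    by rewrite /m; case: (leP T T') => _; apply/andP; split; lra.
  apply: (@lift_unique_itv _ _ (t0 - m) (t0 + m) t0) tm => //.
  - by move=> u _; exact: c1.
  - by move=> u _; exact: c2.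
  - by move=> u /andP[? ?]; rewrite f1 ?f2//; apply/andP; split; lra.
  - by apply/andP; split; lra.
  - by rewrite x1.
have a1 t : 0 <= `|t - t0| + 1 by rewrite addr_ge0.
(* Each value is taken from a lift on an interval slightly larger than needed, so that near [t] all
   values come from one continuous lift. *)
exists (fun t => g (`|t - t0| + 1) t); split.
- move=> t; have [c1 _ _] := gP _ (a1 t).
  apply: cvg_trans (c1 t); apply: near_eq_cvg; near=> s.
  have st : `|s - t| < 1.
    by rewrite distrC; near: s; apply: cvgr_dist_lt => //; exact: cvg_id.
  rewrite (agree _ (`|t - t0| + 1 + 1) s) ?addr_ge0//.
  + rewrite (agree _ (`|t - t0| + 1 + 1) s) ?addr_ge0//; first by rewrite lerDl.
    have -> : s - t0 = (s - t) + (t - t0) by rewrite subrKA.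
    by rewrite (le_trans (ler_normD _ _))//; lra.
  + have -> : s - t0 = (s - t) + (t - t0) by rewrite subrKA.
    by rewrite (le_trans (ler_normD _ _))//; lra.
  + have -> : s - t0 = (s - t) + (t - t0) by rewrite subrKA.
    by rewrite (le_trans (ler_normD _ _))//; lra.
- by rewrite subrr normr0 add0r; have [_ ->] := gP _ ler01.
- apply/funext => t /=; have [_ _ H] := gP _ (a1 t); apply: H.
  by have := ler_norm (t - t0); have := ler_norm (- (t - t0)); rewrite normrN; lra.
Unshelve. all: by end_near. Qed.

End lifting.

(** * Lifting maps defined on simply connected spaces *)

Section lifting_theorem.
Context {R : realType} {E X Y : topologicalType} (f : X -> Y) (p : E -> Y).
Hypotheses (hX : hausdorff_space X) (cf : continuous f) (cp : continuous p).
Hypothesis lf : forall x, locally_invertible f x.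
Hypothesis plf : @path_lifting R X Y f.
Hypothesis scE : simply_connected R E.
Hypothesis lpcE : forall (e : E) (V : set E), nbhs e V -> exists2 V' : set E,
  nbhs e V' & forall e', V' e' -> exists c : R -> E,
    [/\ continuous c, c 0 = e, c 1 = e' & forall t, V (c t)].

Let cl (t : R) := clamp 0 1 t.

(** The loop [l] is contracted and each stage is lifted from [g 0]. The end points of these lifts
    depend continuously on the stage and lie over a single point, hence are constant; the last stage
    is a constant path, whose lift is closed. *)
Lemma loop_lift_closed (l : R -> E) (g : R -> X) :
  continuous l -> l 0 = l 1 -> continuous g -> f \o g = p \o l -> g 1 = g 0.
Proof.
move=> cl_ l01 cg fg.
have fgE t : f (g t) = p (l t) by rewrite -[LHS]/((f \o g) t) fg.
have [|H0 [cH0 H0t H0s]] := scE.2 l _ l01.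
  exact: continuous_subspaceT.
pose H (s t : R) := H0 (cl s, cl t).
have cH : continuous (fun z : R * R => H z.1 z.2).
  apply: (@within_continuous_comp (R * R)%type _ _ _ H0 (fun z : R * R => (cl z.1, cl z.2)) cH0).
    move=> z; apply: (@pair_continuous _ _ _ (fun z : R * R => cl z.1) (fun z => cl z.2)).
      by apply: (@continuous_comp _ _ _ fst cl); [exact: cvg_fst|exact: clamp_continuous].
    by apply: (@continuous_comp _ _ _ snd cl); [exact: cvg_snd|exact: clamp_continuous].
  by move=> z; split => /=; rewrite in_itv/=; exact: clamp_itv ler01.
have cHs s : continuous (H s).
  move=> t; apply: (@continuous_comp _ _ _ (fun t => (s, t)) (fun z => H z.1 z.2)); last exact: cH.
  by apply: (@pair_continuous _ _ _ (cst s) id); [exact: cst_continuous|exact: cvg_id].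
have i0 : 0 <= (0 : R) <= 1 by apply/andP; split; [exact: lexx|exact: ler01].
have i1 : 0 <= (1 : R) <= 1 by apply/andP; split; [exact: ler01|exact: lexx].
have cl0 : cl 0 = 0 by exact: clamp_id.
have cl1 : cl 1 = 1 by exact: clamp_id.
have clI t : 0 <= cl t <= 1 by exact: clamp_itv ler01.
have /choice[K KP] : forall s, exists K : R -> X,
    [/\ continuous K, K 0 = g 0 & f \o K = p \o H s].
  move=> s; apply: plf.
    by move=> t; apply: continuous_comp (@cHs s t) (@cp _).
  by rewrite fgE /= /H cl0 (H0s _ (clI s)).1.
have KE s t : f (K s t) = p (H s t).
  by have [_ _ E'] := KP s; rewrite -[LHS]/((f \o K s) t) E'.
have K1 s : {for s, continuous (K ^~ 1)}.
  apply: (@lift_family R X Y f hX cf lf _ (fun s t => p (H s t)) K s 0 1 _ _ 0 1) => //.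
  - move=> t _; apply: (@continuous_comp _ _ _ (fun z : R * R => H z.1 z.2) p); first exact: cH.
    exact: cp.
  - by apply: (@nearW _ (nbhs s) _ (nbhs_filter s)) => s' t _; split; [have [c _ _] := KP s'; exact: c|exact: KE].
  - rewrite (_ : K ^~ 0 = cst (g 0)); first exact: cst_continuous.
    by apply/funext => s'; have [_ -> _] := KP s'.
have K11 : K 1 1 = g 0.
  have [cK K0 _] := KP 1.
  apply: (@lift_unique_itv R X Y f hX lf (K 1) (cst (g 0)) 0 1 0) => //.
  - by move=> t _; exact: cK.
  - by move=> t _; exact: cst_continuous.
  - by move=> t _; rewrite KE /= fgE /H cl1 (H0t _ (clI t)).2.
have K01 : K 0 1 = g 1.
  have [cK K0 _] := KP 0.
  apply: (@lift_unique_itv R X Y f hX lf (K 0) g 0 1 0) => //.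
  - by move=> t _; exact: cK.
  - by move=> t _; exact: cg.
  - by move=> t t01; rewrite KE fgE /H cl0 (H0t _ (clI t)).1 /cl clamp_id.
rewrite -K01 -K11.
apply: (@lift_unique_itv R X Y f hX lf (K ^~ 1) (cst (K 1 1)) 0 1 1) => //.
- by move=> t _; exact: cst_continuous.
- by move=> t _; rewrite /= !KE /H cl1 (H0s _ (clI t)).2 (H0s _ i1).2.
Qed.

(** [l] runs along [a] and then back along [b]; the lift of this loop is closed, and its two halves
    are [ga] and the reverse of [gb]. *)
Lemma path_lift_endpoint (a b : R -> E) (ga gb : R -> X) :
  continuous a -> continuous b -> a 0 = b 0 -> a 1 = b 1 ->
  continuous ga -> continuous gb -> ga 0 = gb 0 ->
  f \o ga = p \o a -> f \o gb = p \o b -> ga 1 = gb 1.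
Proof.
move=> ca cb ab0 ab1 cga cgb gab0 fga fgb.
pose l t := if t <= 2^-1 then a (2 * t + 0) else b (- 2 * t + 2).
have e1 : 2 * 2^-1 + 0 = 1 :> R by field.
have e2 : - 2 * 2^-1 + 2 = 1 :> R by field.
have cl_ : continuous l.
  by apply: glue_continuous; rewrite ?e1 ?e2//; exact: affine_comp_continuous.
have h2 : 0 <= 2^-1 :> R by rewrite invr_ge0.
have h21 : 1 <= 2^-1 :> R = false by apply/negbTE; rewrite -ltNge invf_lt1// ltr1n.
have l0 : l 0 = a 0 by rewrite /l h2 mulr0 addr0.
have l1 : l 1 = b 0 by rewrite /l h21; congr b; ring.
have [||g [cg g0 fg]] := @plf (p \o l) 0 (ga 0).
- by move=> t; apply: continuous_comp (cl_ t) (@cp _).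
- by rewrite -[LHS]/((f \o ga) 0) fga /= l0.
have g10 : g 1 = g 0 by apply: loop_lift_closed cl_ _ cg fg; rewrite l0 l1.
have gE t : f (g t) = p (l t) by rewrite -[LHS]/((f \o g) t) fg.
have gaE t : f (ga t) = p (a t) by rewrite -[LHS]/((f \o ga) t) fga.
have gbE t : f (gb t) = p (b t) by rewrite -[LHS]/((f \o gb) t) fgb.
have A t : 0 <= t <= 1 -> ga t = g (2^-1 * t + 0).
  apply: (@lift_unique_itv R X Y f hX lf ga (fun t => g (2^-1 * t + 0)) 0 1 0).
  - by move=> u _; exact: cga.
  - by move=> u _; exact: affine_comp_continuous.
  - move=> u /andP[u0 u1]; rewrite gaE gE /l ifT; last by rewrite addr0 ler_piMr.
    by congr (p (a _)); field.
  - by rewrite lexx ler01.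
  - by rewrite mulr0 addr0 g0.
have B t : 0 <= t <= 1 -> gb t = g (- 2^-1 * t + 1).
  apply: (@lift_unique_itv R X Y f hX lf gb (fun t => g (- 2^-1 * t + 1)) 0 1 0).
  - by move=> u _; exact: cgb.
  - by move=> u _; exact: affine_comp_continuous.
  - move=> u /andP[u0]; rewrite le_eqVlt => /predU1P[->|u1].
      have -> : - 2^-1 * 1 + 1 = 2^-1 :> R by field.
      by rewrite gbE gE /l lexx e1 ab1.
    rewrite gbE gE /l ifF; last by apply/negbTE; rewrite -ltNge; lra.
    by congr (p (b _)); field.
  - by rewrite lexx ler01.
  - by rewrite mulr0 add0r g10 g0 gab0.
by rewrite A ?B ?lexx ?ler01//; congr g; field.
Qed.

(** [G e] is the end point of the lift of a path from [e0] to [e], which does not depend on the path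
    by [path_lift_endpoint]. *)
Theorem lifting_theorem (e0 : E) (x0 : X) : f x0 = p e0 ->
  exists G : E -> X, [/\ continuous G, f \o G = p & G e0 = x0].
Proof.
move=> fx0.
have path e : exists a : R -> E, [/\ continuous a, a 0 = e0 & a 1 = e].
  have [a [ca a0 a1]] := scE.1 e0 e; exists (a \o cl); split.
  - apply: (@within_continuous_comp R _ _ _ a cl ca); first exact: clamp_continuous.
    by move=> t; rewrite /= in_itv/=; exact: clamp_itv ler01.
  - by rewrite /= /cl clamp_id// lexx ler01.
  - by rewrite /= /cl clamp_id// lexx ler01.
have /choice[G GP] : forall e, exists x, exists a : R -> E, exists g : R -> X,
    [/\ continuous a, a 0 = e0, a 1 = e & [/\ continuous g, g 0 = x0, g 1 = x & f \o g = p \o a]].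
  move=> e; have [a [ca a0 a1]] := path e.
  have [||g [cg g0 fg]] := @plf (p \o a) 0 x0; last by exists (g 1), a, g.
    by move=> t; apply: continuous_comp (ca t) (@cp _).
  by rewrite /= a0.
have GE e (b : R -> E) (gb : R -> X) : continuous b -> b 0 = e0 -> b 1 = e ->
    continuous gb -> gb 0 = x0 -> f \o gb = p \o b -> G e = gb 1.
  move=> cb b0 b1 cgb gb0 fgb; have [a [g [ca a0 a1 [cg g0 <- fg]]]] := GP e.
  by apply: (path_lift_endpoint ca cb _ _ cg cgb) => //; rewrite ?a0 ?a1 ?g0.
have fG e : f (G e) = p e.
  by have [a [g [ca a0 <- [cg g0 <- fg]]]] := GP e; rewrite -[LHS]/((f \o g) 1) fg.
exists G; split => //; last first.
- rewrite (GE e0 (cst e0) (cst x0)) => //; try exact: cst_continuous.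
  by apply/funext => t /=.
- by apply/funext => e; exact: fG.
move=> e; have [a [g [ca a0 a1 [cg g0 g1 fg]]]] := GP e.
have [W [U [s [[oW Wx] oU sU sW]]]] := lf (G e).
have nV : nbhs e (p @^-1` U).
  by apply: cp; apply: open_nbhs_nbhs; split => //; rewrite -fG; exact: (sW _ Wx).1.
have [V' nV' HV'] := lpcE nV.
(* A path from [e] to [e'] inside the preimage of [U] is lifted by the local inverse [s], and
   appended to the path used for [e]; hence [G] is [s \o p] near [e]. *)
have E' : \forall e' \near e, G e' = s (p e').
  apply: filterS nV' => e' /HV'[c [cc c0 c1 Vc]].
  have e1 : 2 * 2^-1 + 0 = 1 :> R by field.
  have e2 : 2 * 2^-1 - 1 = 0 :> R by field.
  have h2 : 0 <= 2^-1 :> R by rewrite invr_ge0.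
  have h21 : 1 <= 2^-1 :> R = false by apply/negbTE; rewrite -ltNge invf_lt1// ltr1n.
  have e3 : 2 * 1 - 1 = 1 :> R by ring.
  rewrite (GE e' (fun t => if t <= 2^-1 then a (2 * t + 0) else c (2 * t - 1))
    (fun t => if t <= 2^-1 then g (2 * t + 0) else s (p (c (2 * t - 1))))).
  - by rewrite h21 e3 c1.
  - apply: glue_continuous; rewrite ?e1 ?e2 ?a1 ?c0//; exact: affine_comp_continuous.
  - by rewrite h2 mulr0 addr0.
  - by rewrite h21 e3.
  - apply: glue_continuous; rewrite ?e1 ?e2 ?g1 ?c0//.
    + exact: affine_comp_continuous.
    + move=> t; have [_ _ cs] := sU _ (Vc (2 * t - 1)).
      apply: (@continuous_comp _ _ _ (fun t : R => c (2 * t - 1)) (s \o p)).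
        exact: affine_comp_continuous.
      exact: continuous_comp (@cp _) cs.
    + by rewrite -fG (sW _ Wx).2.
  - by rewrite h2 mulr0 addr0.
  - apply/funext => t /=; case: ifP => _.
      by rewrite -[LHS]/((f \o g) (2 * t + 0)) fg.
    by have [_ -> _] := sU _ (Vc (2 * t - 1)).
have [_ _ cs] := sU _ (nbhs_singleton nV).
rewrite /continuous_at (nbhs_singleton E').
apply: cvg_trans (continuous_comp (@cp e) cs); apply: near_eq_cvg.
by apply: filterS E' => e' ->.
Qed.

End lifting_theorem.

(** * Riemannian geometry in charts *)

Section bilinear_forms.
Context {R : realType} {n : nat}.
Implicit Types (g : 'M[R]_n) (u v w : 'rV[R]_n).

Definition bil g u w : R := (u *m g *m w^T) 0 0.

Lemma bilDl g u v w : bil g (u + v) w = bil g u w + bil g v w.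
Proof. by rewrite /bil !mulmxDl mxE. Qed.
Lemma bilDr g u v w : bil g w (u + v) = bil g w u + bil g w v.
Proof. by rewrite /bil linearD/= mulmxDr mxE. Qed.
Lemma bilZl g k u w : bil g (k *: u) w = k * bil g u w.
Proof. by rewrite /bil -!scalemxAl mxE. Qed.
Lemma bilZr g k u w : bil g w (k *: u) = k * bil g w u.
Proof. by rewrite /bil linearZ/= -scalemxAr mxE. Qed.
Lemma bilNl g u w : bil g (- u) w = - bil g u w.
Proof. by rewrite -scaleN1r bilZl mulN1r. Qed.
Lemma bilNr g u w : bil g w (- u) = - bil g w u.
Proof. by rewrite -scaleN1r bilZr mulN1r. Qed.
Lemma bilBl g u v w : bil g (u - v) w = bil g u w - bil g v w.
Proof. by rewrite bilDl bilNl. Qed.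
Lemma bilBr g u v w : bil g w (u - v) = bil g w u - bil g w v.
Proof. by rewrite bilDr bilNr. Qed.
Lemma bil0l g w : bil g 0 w = 0.
Proof. by rewrite /bil !mul0mx mxE. Qed.
Lemma bil0r g w : bil g w 0 = 0.
Proof. by rewrite -(scale0r 0) bilZr mul0r. Qed.

Lemma bilE g u w : bil g u w = \sum_a \sum_b u 0 a * g a b * w 0 b.
Proof.
rewrite /bil mxE exchange_big /=; apply: eq_bigr => b _; rewrite !mxE.
by rewrite mulr_suml.
Qed.

Lemma bil_sym g u w : g^T = g -> bil g u w = bil g w u.
Proof.
move=> gs; have E : (u *m g *m w^T)^T = w *m g *m u^T by rewrite !trmx_mul trmxK gs mulmxA.
by rewrite /bil -E [RHS]mxE.
Qed.

Definition bnorm g u : R := Num.sqrt (bil g u u).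

Definition posdef g := g^T = g /\ forall u, u != 0 -> 0 < bil g u u.

Lemma posdef_ge0 g u : posdef g -> 0 <= bil g u u.
Proof.
by move=> [_ gp]; have [->|/gp/ltW//] := eqVneq u 0; rewrite bil0l.
Qed.

Lemma posdef_eq0 g u : posdef g -> bil g u u = 0 -> u = 0.
Proof. by move=> [_ gp] u0; apply: contrapT => /eqP/gp; rewrite u0 ltxx. Qed.

Lemma posdef_unit g : posdef g -> g \in unitmx.
Proof.
move=> gp; rewrite -row_free_unit -kermx_eq0; apply/eqP/row_matrixP => i.
rewrite row0; apply: (posdef_eq0 gp); rewrite /bil.
have /sub_kermxP -> : (row i (kermx g) <= kermx g)%MS by exact: row_sub.
by rewrite mul0mx mxE.
Qed.

Lemma bil_nondegenerate g u : posdef g -> (forall w, bil g u w = 0) -> u = 0.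
Proof. by move=> gp /(_ u); exact: posdef_eq0. Qed.

Lemma bnorm_ge0 g u : 0 <= bnorm g u. Proof. exact: sqrtr_ge0. Qed.

Lemma bnorm_sqr g u : posdef g -> bnorm g u ^+ 2 = bil g u u.
Proof. by move=> gp; rewrite sqr_sqrtr// posdef_ge0. Qed.

Lemma bnorm_eq0 g u : posdef g -> bnorm g u = 0 -> u = 0.
Proof. by move=> gp u0; apply: (posdef_eq0 gp); rewrite -bnorm_sqr// u0 expr0n. Qed.

Lemma bnormZ g k u : bnorm g (k *: u) = `|k| * bnorm g u.
Proof.
by rewrite /bnorm bilZl bilZr mulrA -expr2 sqrtrM ?sqr_ge0// sqrtr_sqr.
Qed.

Lemma cauchy_schwarz_bil g u w : posdef g -> `|bil g u w| <= bnorm g u * bnorm g w.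
Proof.
move=> gp; have [u0|u0] := eqVneq (bnorm g u) 0.
  by rewrite (bnorm_eq0 gp u0) bil0l normr0 mulr_ge0// bnorm_ge0.
rewrite -(ler_pXn2r (ltn0Sn 1)) ?nnegrE ?mulr_ge0 ?bnorm_ge0// exprMn !bnorm_sqr//.
rewrite real_normK ?num_real//.
have Q0 : 0 < bil g u u by rewrite -bnorm_sqr// exprn_gt0// lt0r u0 bnorm_ge0.
have := posdef_ge0 (bil g u u *: w - bil g u w *: u) gp.
rewrite bilBl !bilBr !bilZl !bilZr (bil_sym w u gp.1).
rewrite (_ : _ - _ = bil g u u * (bil g u u * bil g w w - bil g u w ^+ 2)); last by ring.
by rewrite pmulr_rge0// subr_ge0.
Qed.

Lemma bnorm_upper g u : bnorm g u ^+ 2 <= n%:R * n%:R * `|g| * `|u| ^+ 2 \/ ~ posdef g.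
Proof.
have [gp|] := pselect (posdef g); [left|by right].
rewrite bnorm_sqr// bilE.
apply: (@le_trans _ _ (\sum_(a < n) \sum_(b < n) `|u| * `|g| * `|u|)).
  apply: ler_sum => a _; apply: ler_sum => b _; rewrite (le_trans (ler_norm _))//.
  by rewrite !normrM ler_pM ?mulr_ge0// ?ler_pM// mx_entry_le_norm.
have dsum (x : R) : \sum_(a < n) \sum_(b < n) x = n%:R * n%:R * x.
  by rewrite sumr_const card_ord sumr_const card_ord -mulrnA -[x *+ _]mulr_natl natrM.
rewrite dsum.
by rewrite le_eqVlt; apply/orP; left; apply/eqP; ring.
Qed.

Lemma bil_continuous g : continuous (fun u => bil g u u).
Proof.
move=> u; rewrite (_ : (fun u => bil g u u) =
    fun u => \sum_a \sum_b u 0 a * g a b * u 0 b :> R); last first.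
  by apply/funext => w; rewrite bilE.
suff : Ck_on 0 setT (fun u => \sum_a \sum_b u 0 a * g a b * u 0 b :> R) by apply.
have cj k : Ck_on 0 setT (fun u : 'rV[R]_n => u 0 k) by move=> w _; exact: coord_continuous.
apply: Ck_on_sum => [|a]; first exact: openT.
apply: Ck_on_sum => [|b]; first exact: openT.
apply: Ck_onM; [exact: openT| |exact: cj].
apply: Ck_onM; [exact: openT|exact: cj|exact: Ck_on_cst].
Qed.

(** The unit sphere of the sup norm is compact and the form has a positive minimum on it; when the
    sphere is empty the only vector is 0. *)
Lemma bnorm_lower g : posdef g -> exists2 c : R, 0 < c & forall u, c * `|u| <= bnorm g u.
Proof.
move=> gp; pose S := [set u : 'rV[R]_n | `|u| = 1].
have [[u0 Su0]|S0] := pselect (exists u, S u); last first.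
  exists 1 => // u; rewrite mul1r; have [->|u0] := eqVneq u 0.
    by rewrite normr0 bnorm_ge0.
  exfalso; apply: S0; exists (`|u|^-1 *: u); rewrite /S/= normrZ normfV normr_id.
  by rewrite mulVf// normr_eq0.
have cS : compact S.
  apply: bounded_closed_compact.
    by exists 1; split => // x x1 u; rewrite /S/= => ->; rewrite ltW.
  have -> : S = (fun u : 'rV[R]_n => `|u|) @^-1` [set 1] by [].
  by apply: closed_comp; [move=> u _; exact: norm_continuous|exact: closed_eq].
have [m] := EVT_min_rV (f := fun u => bil g u u) (ex_intro _ _ Su0) cS
  (continuous_subspaceT (@bil_continuous g)).
rewrite inE => Sm Hm.
have m0 : m != 0 by apply/eqP => m0; move: Sm; rewrite /S/= m0 normr0 => /esym/eqP; rewrite oner_eq0.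
have bm : 0 < bil g m m := gp.2 _ m0.
exists (bnorm g m) => [|u]; first by rewrite sqrtr_gt0.
have [->|u0'] := eqVneq u 0; first by rewrite normr0 mulr0 bnorm_ge0.
have nu : 0 < `|u| by rewrite normr_gt0.
rewrite -ler_pdivlMr// mulrC -[`|u|^-1]ger0_norm ?invr_ge0// -bnormZ ler_sqrt.
  by apply: Hm; rewrite inE /S/= normrZ normfV normr_id mulVf ?gt_eqF.
exact: posdef_ge0.
Qed.

End bilinear_forms.

Lemma diff_comp_near (R : realType) (U V W : normedModType R) (f : U -> V) (g : V -> W)
    (h : U -> W) x y :
  differentiable f x -> differentiable g y -> f x = y -> {near x, g \o f =1 h} ->
  forall w, 'd g y ('d f x w) = 'd h x w.
Proof.
move=> df dg fxy E w; rewrite -fxy in dg *.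
have [_ ->] := near_eq_is_diff E (differentiable_comp df dg).
by rewrite (diff_comp df dg).
Qed.

Section charts.
Context {R : realType} {n : nat} {M : riemannian_manifold R n}.
Implicit Types (i j : chart_index M) (p : M) (c : R -> M) (u w : 'rV[R]_n).

Lemma within_open_continuous (S T : topologicalType) (A : set S) (f : S -> T) :
  open A -> {within A, continuous f} -> forall x, A x -> {for x, continuous f}.
Proof.
move=> oA /subspace_continuousP cf x Ax N fN.
have H : \forall y \near x, A y -> N (f y) := cf x Ax _ fN.
suff H' : \forall y \near x, N (f y) by exact: H'.
have HA : \forall y \near x, A y by exact: open_nbhs_nbhs.
by apply: filterS2 H HA => y; apply.
Qed.

Lemma chart_continuous_at i p : chart_dom i p -> {for p, continuous (chart i)}.
Proof. apply: within_open_continuous; [exact: chart_dom_open|exact: chart_continuous]. Qed.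

Definition chart_img i := chart i @` chart_dom i.

Lemma chart_inv_continuous_at i x : chart_img i x -> {for x, continuous (chart_inv i)}.
Proof. apply: within_open_continuous; [exact: chart_img_open|exact: chart_inv_continuous]. Qed.

Lemma chart_imgP i p : chart_dom i p -> chart_img i (chart i p).
Proof. by exists p. Qed.

Lemma chart_invK i x : chart_img i x -> chart i (chart_inv i x) = x.
Proof. by move=> [p ip <-]; rewrite chartK. Qed.

Lemma chart_inv_dom i x : chart_img i x -> chart_dom i (chart_inv i x).
Proof. by move=> [p ip <-]; rewrite chartK. Qed.

Lemma chart_image_open i (V : set M) : open V -> open (chart i @` (chart_dom i `&` V)).
Proof.
move=> oV; rewrite openE => _ [p [ip Vp] <-].
have H1 : nbhs (chart i p) (chart_img i).
  by apply: open_nbhs_nbhs; split; [exact: chart_img_open|exact: chart_imgP].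
have H2 : nbhs (chart i p) (chart_inv i @^-1` V).
  apply: (chart_inv_continuous_at (chart_imgP ip) (t := V)).
  by rewrite chartK//; exact: open_nbhs_nbhs.
apply: filterS2 H1 H2 => x ix Vx; exists (chart_inv i x); last exact: chart_invK.
by split => //; exact: chart_inv_dom.
Qed.

Lemma near_chart_dom i p : chart_dom i p -> \forall q \near p, chart_dom i q.
Proof. by move=> ip; apply: open_nbhs_nbhs; split => //; exact: chart_dom_open. Qed.

Lemma near_curve_chart i c t : {for t, continuous c} -> chart_dom i (c t) ->
  \forall s \near t, chart_dom i (c s).
Proof. by move=> cc it; apply: (cc (chart_dom i)); exact: near_chart_dom. Qed.

Definition trans i j : 'rV[R]_n -> 'rV[R]_n := chart j \o chart_inv i.

Lemma trans_domain i j p : chart_dom i p -> chart_dom j p ->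
  (chart i @` (chart_dom i `&` chart_dom j)) (chart i p).
Proof. by move=> ip jp; exists p. Qed.

Lemma trans_domain_open i j : open (chart i @` (chart_dom i `&` chart_dom j)).
Proof. by apply: chart_image_open; exact: chart_dom_open. Qed.

Lemma trans_chart i j p : chart_dom i p -> trans i j (chart i p) = chart j p.
Proof. by move=> ip; rewrite /trans/= chartK. Qed.

Lemma trans_differentiable i j p : chart_dom i p -> chart_dom j p ->
  differentiable (trans i j) (chart i p).
Proof.
move=> ip jp; have [+ _] := @transition_smooth _ _ M i j 1%N.
by apply; exact: trans_domain.
Qed.

Lemma trans_diffK i j p w : chart_dom i p -> chart_dom j p ->
  'd (trans j i) (chart j p) ('d (trans i j) (chart i p) w) = w.
Proof.
move=> ip jp.
have E : {near chart i p, trans j i \o trans i j =1 id}.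
  have : nbhs (chart i p) (chart i @` (chart_dom i `&` chart_dom j)).
    by apply: open_nbhs_nbhs; split; [exact: trans_domain_open|exact: trans_domain].
  by apply: filterS => _ [q [iq jq] <-] /=; rewrite trans_chart// trans_chart.
rewrite (diff_comp_near (trans_differentiable ip jp) (trans_differentiable jp ip) (trans_chart _ ip) E).
by rewrite diff_val.
Qed.

Lemma trans_diff_comp i j k p w : chart_dom i p -> chart_dom j p -> chart_dom k p ->
  'd (trans j k) (chart j p) ('d (trans i j) (chart i p) w) = 'd (trans i k) (chart i p) w.
Proof.
move=> ip jp kp.
have E : {near chart i p, trans j k \o trans i j =1 trans i k}.
  have : nbhs (chart i p) (chart i @` (chart_dom i `&` chart_dom j)).
    by apply: open_nbhs_nbhs; split; [exact: trans_domain_open|exact: trans_domain].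
  by apply: filterS => _ [q [iq jq] <-] /=; rewrite !trans_chart.
exact: (diff_comp_near (trans_differentiable ip jp) (trans_differentiable jp kp) (trans_chart _ ip) E).
Qed.

Lemma trans_diff_id i p w : chart_dom i p -> 'd (trans i i) (chart i p) w = w.
Proof. by move=> ip; rewrite -{1}(trans_diff_comp w ip ip ip) trans_diffK. Qed.

Lemma coordE i p u : coord i (TangentVector p u) =
  'd (trans (chart_at p) i) (chart (chart_at p) p) u.
Proof. by []. Qed.

Lemma coord_chart_at p u : coord (chart_at p) (TangentVector p u) = u.
Proof. by rewrite coordE trans_diff_id//; exact: chart_atP. Qed.

Lemma coord_trans i j (v : tangent_vector M) : chart_dom i (base v) -> chart_dom j (base v) ->
  'd (trans i j) (chart i (base v)) (coord i v) = coord j v.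
Proof. by case: v => p u /= ip jp; rewrite !coordE; apply: trans_diff_comp => //; exact: chart_atP. Qed.

Definition of_coord i p w : tangent_vector M :=
  TangentVector p ('d (trans i (chart_at p)) (chart i p) w).

Lemma of_coordK i p w : chart_dom i p -> coord i (of_coord i p w) = w.
Proof. by move=> ip; rewrite coordE trans_diffK//; exact: chart_atP. Qed.

Lemma coordK i (v : tangent_vector M) : chart_dom i (base v) ->
  of_coord i (base v) (coord i v) = v.
Proof.
by case: v => p u /= ip; congr TangentVector; rewrite coordE trans_diffK//; exact: chart_atP.
Qed.

Lemma coord_inj i p u w : chart_dom i p ->
  coord i (TangentVector p u) = coord i (TangentVector p w) -> u = w.
Proof.
move=> ip E; have := coordK (v := TangentVector p u) ip; rewrite E.
by rewrite (coordK (v := TangentVector p w) ip) => -[].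
Qed.

Definition met i x : 'rV[R]_n -> 'rV[R]_n -> R := bil (metric i x).

Lemma metric_posdef i p : chart_dom i p -> posdef (metric i (chart i p)).
Proof. by move=> ip; split; [exact: metric_sym|exact: metric_pos]. Qed.

Lemma inner_coord i p u w : chart_dom i p ->
  met i (chart i p) (coord i (TangentVector p u)) (coord i (TangentVector p w)) = inner p u w.
Proof.
move=> ip; rewrite !coordE.
by have /= := metric_transition (chart_atP p) ip u w.
Qed.

Lemma tnormE p u : tnorm p u = bnorm (metric (chart_at p) (chart (chart_at p) p)) u.
Proof. by []. Qed.

Lemma metric_at_posdef p : posdef (metric (chart_at p) (chart (chart_at p) p)).
Proof. exact/metric_posdef/chart_atP. Qed.

Lemma curve_trans i j c t u : {for t, continuous c} ->
  chart_dom i (c t) -> chart_dom j (c t) ->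
  is_derive t (1 : R) (chart i \o c) u ->
  is_derive t (1 : R) (chart j \o c) ('d (trans i j) (chart i (c t)) u).
Proof.
move=> cc it jt [Dc <-].
have dc : differentiable (chart i \o c) t by exact/derivable1_diffP.
have di := trans_differentiable it jt.
have E : \forall s \near t, (trans i j \o (chart i \o c)) s = (chart j \o c) s.
  by apply: filterS (near_curve_chart cc it) => s si /=; rewrite trans_chart.
apply: near_eq_is_derive E _.
apply: DeriveDef; first by apply: diff_derivable; apply: differentiable_comp.
by rewrite (derive_comp (g := trans i j) _ dc di) deriveE.
Qed.

Lemma coord_velocity i c t : {for t, continuous c} -> chart_dom i (c t) ->
  derivable (chart i \o c) t 1 -> coord i (velocity c t) = derive1 (chart i \o c) t.
Proof.
move=> cc it Dc; have Di := derivableP Dc.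
have [_ E] := curve_trans cc it (chart_atP (c t)) Di.
by rewrite /velocity coordE !derive1E E trans_diffK//; exact: chart_atP.
Qed.

Lemma velocity_of_coord i c t u : {for t, continuous c} -> chart_dom i (c t) ->
  is_derive t (1 : R) (chart i \o c) u -> velocity c t = of_coord i (c t) u.
Proof.
move=> cc it Dc; have [_ E] := curve_trans cc it (chart_atP (c t)) Dc.
by rewrite /velocity derive1E E.
Qed.

Lemma speed_chart i c t u : {for t, continuous c} -> chart_dom i (c t) ->
  is_derive t (1 : R) (chart i \o c) u ->
  speed c t = bnorm (metric i (chart i (c t))) u.
Proof.
move=> cc it Dc; rewrite /speed (velocity_of_coord cc it Dc) /tnorm /bnorm.
by congr Num.sqrt; rewrite /= -(inner_coord _ _ it) !of_coordK.
Qed.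

Lemma tnorm_coord i p u : chart_dom i p ->
  tnorm p u = bnorm (metric i (chart i p)) (coord i (TangentVector p u)).
Proof. by move=> ip; rewrite /tnorm /bnorm -(inner_coord _ _ ip). Qed.

End charts.

Section derivatives_along_curves.
Context {R : realType}.

Lemma is_derive_sum_fun (V W : normedModType R) m (h : 'I_m -> V -> W) x v (dh : 'I_m -> W) :
  (forall i, is_derive x v (h i) (dh i)) ->
  is_derive x v (fun y => \sum_i h i y) (\sum_i dh i).
Proof.
move=> H; have -> : (fun y => \sum_i h i y) = \sum_i h i by apply/funext => y; rewrite fct_sumE.
exact: is_derive_sum.
Qed.

Lemma is_derive_mul (V : normedModType R) (f g : V -> R) x v df dg :
  is_derive x v f df -> is_derive x v g dg ->
  is_derive x v (fun y => f y * g y) (df * g x + f x * dg).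
Proof.
move=> Df Dg; apply: is_derive_eq (is_deriveM Df Dg) _.
by rewrite addrC (mulrC df).
Qed.

Lemma is_derive_entry (V : normedModType R) m n (f : V -> 'M[R]_(m, n)) x v df i j :
  is_derive x v f df -> is_derive x v (fun y => f y i j) (df i j).
Proof. by move=> /is_derive_mxP; exact. Qed.

Lemma is_derive_comp_curve (V W : normedModType R) (x : R -> V) (f : V -> W) t xd :
  is_derive t (1 : R) x xd -> differentiable f (x t) ->
  is_derive t (1 : R) (f \o x) ('D_xd f (x t)).
Proof.
move=> [Dx <-] df; have dx : differentiable x t by exact/derivable1_diffP.
apply: DeriveDef; first by apply: diff_derivable; exact: differentiable_comp.
exact: derive_comp.
Qed.

Lemma is_derive_bil n (g : R -> 'M[R]_n) (u w : R -> 'rV[R]_n) t gd ud wd :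
  is_derive t (1 : R) g gd -> is_derive t (1 : R) u ud -> is_derive t (1 : R) w wd ->
  is_derive t (1 : R) (fun s => bil (g s) (u s) (w s))
    (bil gd (u t) (w t) + bil (g t) ud (w t) + bil (g t) (u t) wd).
Proof.
move=> Dg Du Dw.
have -> : (fun s => bil (g s) (u s) (w s)) =
    fun s => \sum_a \sum_b u s 0 a * g s a b * w s 0 b.
  by apply/funext => s; rewrite bilE.
apply: is_derive_eq.
  apply: is_derive_sum_fun => a; apply: is_derive_sum_fun => b.
  by apply: is_derive_mul; [apply: is_derive_mul|]; exact: is_derive_entry.
rewrite !bilE -!big_split; apply: eq_bigr => a _.
by rewrite -!big_split; apply: eq_bigr => b _ /=; ring.
Qed.

Lemma is_derive_row_mx m n (x : R -> 'rV[R]_m) (y : R -> 'rV[R]_n) t xd yd :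
  is_derive t (1 : R) x xd -> is_derive t (1 : R) y yd ->
  is_derive t (1 : R) (fun s => row_mx (x s) (y s)) (row_mx xd yd).
Proof.
move=> Dx Dy; apply/is_derive_mxP => i j; rewrite ord1.
rewrite -(splitK j); case: (fintype.split j) => k /=.
  by under eq_fun do rewrite row_mxEl; rewrite row_mxEl; exact: is_derive_entry.
by under eq_fun do rewrite row_mxEr; rewrite row_mxEr; exact: is_derive_entry.
Qed.

Lemma is_derive_lsubmx m n (z : R -> 'rV[R]_(m + n)) t zd :
  is_derive t (1 : R) z zd -> is_derive t (1 : R) (fun s => lsubmx (z s)) (lsubmx zd).
Proof.
move=> Dz; apply/is_derive_mxP => i j.
by under eq_fun do rewrite mxE; rewrite mxE; exact: is_derive_entry.
Qed.

Lemma is_derive_rsubmx m n (z : R -> 'rV[R]_(m + n)) t zd :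
  is_derive t (1 : R) z zd -> is_derive t (1 : R) (fun s => rsubmx (z s)) (rsubmx zd).
Proof.
move=> Dz; apply/is_derive_mxP => i j.
by under eq_fun do rewrite mxE; rewrite mxE; exact: is_derive_entry.
Qed.

Lemma is_derive0_cst (f : R -> R) : (forall t, is_derive t (1 : R) f 0) ->
  forall s t, f s = f t.
Proof.
move=> D s t; wlog st : s t / s <= t.
  by move=> H; have [/H//|/ltW/H ->] := leP s t.
have [] := @MVT_segment R f (fun=> 0) s t st.
  by apply: derivable_within_continuous => x _; have [] := D x.
by move=> c _ /eqP; rewrite mul0r subr_eq0 => /eqP.
Qed.

Lemma Ck_on_coord m n k U i j : Ck_on k U (fun x : 'M[R]_(m, n) => x i j).
Proof.
case: k => [x _|k]; first exact: coord_continuous.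
split=> [x _|v]; first exact: differentiable_coord.
rewrite (_ : (fun x => 'D_v (fun x : 'M[R]_(m, n) => x i j) x) = fun=> v i j).
  exact: Ck_on_cst.
apply/funext => x; rewrite deriveE; last exact: differentiable_coord.
have @f : {linear 'M[R]_(m, n) -> R}.
  by exists (fun N : 'M[R]_(_, _) => N i j); do 2![eexists]; do ?[constructor];
     rewrite ?mxE// => ? *; rewrite ?mxE//; move=> ?; rewrite !mxE.
by rewrite (_ : (fun _ => _) = f)// diff_lin//; exact: coord_continuous.
Qed.

Lemma Ck_on_affine (W : normedModType R) k (U : set R) (f : R -> W) (a b : R) :
  open U -> Ck_on k U f -> Ck_on k [set t | U (a * t + b)] (fun t => f (a * t + b)).
Proof.
move=> oU.
have oV : open [set t | U (a * t + b)].
  apply: (@open_comp _ _ (fun t : R => a * t + b) U) => // t _; exact: affine_continuous.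
elim: k f => [|k IH] f Cf.
  move=> t Ut; apply: (@continuous_comp _ _ _ (fun t => a * t + b) f); last exact: Cf.
  exact: affine_continuous.
have Da t : is_derive t (1 : R) (fun t => a * t + b) a.
  have -> : (fun t => a * t + b) = (a \*: id) + cst b by [].
  by apply: is_derive_eq; rewrite addr0 [LHS]mulr1.
have da t : differentiable (fun t => a * t + b) t.
  by apply/derivable1_diffP; case: (Da t).
split=> [t Ut|v].
  by apply: differentiable_comp (da t) _; exact: Ck_on_differentiable Cf Ut.
apply: Ck_on_eq (IH _ (Ck_on_derive (a * v) Cf)) => // t Ut.
have df := Ck_on_differentiable Cf Ut.
rewrite (@derive_comp _ _ _ _ (fun t => a * t + b) f t v (da t) df).
congr ('D_ _ f _); rewrite deriveE//.
have -> : v = v *: (1 : R) by rewrite [RHS]mulr1.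
rewrite linearZ/= -deriveE//; have [_ ->] := Da t.
by rewrite [_%:A]mulr1 [RHS]mulrC.
Qed.

End derivatives_along_curves.

Section geodesics.
Context {R : realType} {n : nat} {M : riemannian_manifold R n}.
Implicit Types (i j : chart_index M) (p : M) (c : R -> M) (x u v w : 'rV[R]_n).

Lemma metric_differentiable i x : chart_img i x -> differentiable (metric i) x.
Proof. by move=> ix; have [+ _] := @metric_smooth _ _ M i 1%N; exact. Qed.

Definition dmet i x v u w : R := bil ('D_v (metric i) x) u w.

Lemma metric_entry_Ck i k a b : Ck_on k (chart_img i) (fun y => metric i y a b).
Proof.
by move: a b; apply/Ck_on_mxP; [exact: chart_img_open|exact: metric_smooth].
Qed.

Lemma dmetE i x v u w : chart_img i x ->
  dmet i x v u w = \sum_a \sum_b \sum_d metric_partial i x a b d * v 0 a * u 0 b * w 0 d.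
Proof.
move=> ix; rewrite /dmet bilE.
have dg := metric_differentiable ix.
under eq_bigr do under eq_bigr do rewrite derive_sum_basis// summxE mulr_sumr mulr_suml.
under eq_bigr do rewrite exchange_big/=.
rewrite exchange_big; apply: eq_bigr => a _; apply: eq_bigr => b _; apply: eq_bigr => d _.
rewrite mxE derive_mx; last exact: diff_derivable.
by rewrite mxE -/(metric_partial i x a b d); ring.
Qed.

Lemma sum3_rot (F : 'I_n -> 'I_n -> 'I_n -> R) :
  \sum_a \sum_b \sum_d F a b d = \sum_a \sum_b \sum_d F d a b.
Proof.
rewrite exchange_big; under eq_bigr do rewrite exchange_big.
rewrite exchange_big; under eq_bigr do rewrite exchange_big.
rewrite exchange_big; under eq_bigr do rewrite exchange_big.
by rewrite exchange_big; apply: eq_bigr => a _; rewrite exchange_big.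
Qed.

(** Koszul's formula in a chart: pairing with the metric cancels the inverse matrix in the
    Christoffel symbols. Later computations with the metric handle the symbols through this
    identity. *)
Lemma koszul i x u v w : chart_img i x ->
  met i x (christoffel_form i x u v) w =
  2^-1 * (dmet i x u v w + dmet i x v u w - dmet i x w u v).
Proof.
move=> ix; have gp : posdef (metric i x) by case: ix => p ip <-; exact: metric_posdef.
pose X a b l := metric_partial i x a b l + metric_partial i x b a l - metric_partial i x l a b.
pose T := \row_l \sum_a \sum_b (2^-1 * X a b l * u 0 a * v 0 b).
have -> : christoffel_form i x u v = T *m (invmx (metric i x))^T.
  apply/rowP => k; rewrite !mxE /christoffel.
  under [RHS]eq_bigr do rewrite !mxE mulr_suml.
  under [RHS]eq_bigr do under eq_bigr do rewrite mulr_suml.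
  under [LHS]eq_bigr do under eq_bigr do rewrite mulr_sumr !mulr_suml.
  rewrite [RHS]sum3_rot; apply: eq_bigr => a _; apply: eq_bigr => b _; apply: eq_bigr => l _.
  by rewrite /X; ring.
rewrite /met /bil trmx_inv gp.1 mulmxKV; last exact: posdef_unit.
rewrite !dmetE// mxE.
under eq_bigr do rewrite !mxE mulr_suml.
under eq_bigr do under eq_bigr do rewrite mulr_suml.
rewrite sum3_rot [X in _ + X - _]exchange_big [X in _ - X]sum3_rot -!big_split -sumrB mulr_sumr /=.
apply: eq_bigr => a _; rewrite -!big_split -sumrB mulr_sumr; apply: eq_bigr => b _.
rewrite -!big_split -sumrB mulr_sumr; apply: eq_bigr => d _.
by rewrite /X /=; ring.
Qed.

Lemma near_open (T : topologicalType) (U : set T) (p : T) : open U -> U p -> \forall q \near p, U q.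
Proof. by move=> oU Ux; exact: open_nbhs_nbhs (conj oU Ux). Qed.

Lemma metric_partial_sym i x a b d : chart_img i x ->
  metric_partial i x a b d = metric_partial i x a d b.
Proof.
move=> ix; apply: near_eq_derive.
  near=> y; have [p ip <-] : chart_img i y.
    by near: y; apply: near_open ix; exact: chart_img_open.
  by have [/matrixP/(_ d b) <- _] := metric_posdef ip; rewrite mxE.
Unshelve. all: by end_near.
Qed.

Lemma christoffel_sym i x k a b : chart_img i x ->
  christoffel i x k a b = christoffel i x k b a.
Proof.
move=> ix; rewrite /christoffel; congr (_ * _); apply: eq_bigr => l _.
by rewrite (metric_partial_sym l a b ix); congr (_ * _); ring.
Qed.

Lemma christoffel_formC i x u w : chart_img i x ->
  christoffel_form i x u w = christoffel_form i x w u.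
Proof.
move=> ix; apply/rowP => k; rewrite !mxE exchange_big; apply: eq_bigr => a _.
by apply: eq_bigr => b _; rewrite (christoffel_sym _ _ _ ix); ring.
Qed.

Lemma christoffel_Ck i m k a b :
  Ck_on m (chart_img i) (fun x => christoffel i x k a b).
Proof.
have oi : open (chart_img i) by exact: chart_img_open.
have mC l a' b' : Ck_on m (chart_img i) (fun x => metric_partial i x l a' b').
  exact: Ck_on_derive (@metric_entry_Ck i m.+1 a' b').
apply: Ck_onM => //; first exact: Ck_on_cst.
apply: Ck_on_sum => // l; apply: Ck_onM => //.
  apply: Ck_on_invmx => // [x [p ip <-]|c d]; last exact: metric_entry_Ck.
  by apply: posdef_unit; exact: metric_posdef.
apply: Ck_onD => //; last by apply: Ck_onN.
exact: Ck_onD.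
Qed.

(** The geodesic equation as a first order system in position and velocity. *)
Definition spray i (z : 'rV[R]_(n + n)) : 'rV[R]_(n + n) :=
  row_mx (rsubmx z) (- christoffel_form i (lsubmx z) (rsubmx z) (rsubmx z)).

Definition state_dom i : set 'rV[R]_(n + n) := [set z | chart_img i (lsubmx z)].

Lemma lsubmx_Ck k (U : set 'rV[R]_(n + n)) :
  open U -> Ck_on k U (fun z => lsubmx z : 'rV_n).
Proof.
by move=> oU; apply/Ck_on_mxP => // a b; under eq_fun do rewrite mxE; exact: Ck_on_coord.
Qed.

Lemma rsubmx_Ck k (U : set 'rV[R]_(n + n)) :
  open U -> Ck_on k U (fun z => rsubmx z : 'rV_n).
Proof.
by move=> oU; apply/Ck_on_mxP => // a b; under eq_fun do rewrite mxE; exact: Ck_on_coord.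
Qed.

Lemma state_dom_open i : open (state_dom i).
Proof.
apply: (@open_comp _ _ (fun z : 'rV[R]_(n + n) => lsubmx z) (chart_img i)); last first.
  exact: chart_img_open.
by move=> z _; exact: (@lsubmx_Ck 0 setT openT).
Qed.

Lemma spray_Ck i k : Ck_on k (state_dom i) (spray i).
Proof.
have oi : open (state_dom i) by exact: state_dom_open.
apply/Ck_on_mxP => // r j; rewrite ord1 -(splitK j).
case: (fintype.split j) => l /=.
  by under eq_fun do rewrite row_mxEl mxE; exact: Ck_on_coord.
under eq_fun do rewrite row_mxEr mxE mxE.
apply: Ck_onN => //; apply: Ck_on_sum => // a; apply: Ck_on_sum => // b.
do 2?apply: Ck_onM => //; last 2 first.
- by under eq_fun do rewrite mxE; exact: Ck_on_coord.
- by under eq_fun do rewrite mxE; exact: Ck_on_coord.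
apply: (Ck_on_comp (f := fun z => lsubmx z : 'rV_n) (U' := chart_img i)
  (g := fun x => christoffel i x l a b)) => //.
  by move=> c; under eq_fun do rewrite mxE; exact: Ck_on_coord.
exact: christoffel_Ck.
Qed.

Definition tstate i (v : tangent_vector M) := row_mx (chart i (base v)) (coord i v).

Lemma tstate_inj i (v w : tangent_vector M) : chart_dom i (base v) ->
  chart_dom i (base w) -> tstate i v = tstate i w -> v = w.
Proof.
move=> iv iw /eq_row_mx[E1 E2].
have E : base v = base w by rewrite -(chartK iv) -(chartK iw) E1.
by rewrite -(coordK iv) -(coordK iw) E E2.
Qed.

Lemma tstate_dom i (v : tangent_vector M) : chart_dom i (base v) -> state_dom i (tstate i v).
Proof. by move=> iv; rewrite /state_dom/= row_mxKl; exact: chart_imgP. Qed.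

Lemma chart_curve_Ck k c i : Ck_curve k.+1 c ->
  (forall t, chart_dom i (c t) -> derivable (chart i \o c) t 1) /\
  Ck_on k (c @^-1` chart_dom i) (derive1 (chart i \o c)).
Proof.
move=> [cc /(_ i)/Ck_on_curveS]; apply.
by apply: open_comp => [x _|]; [exact: cc|exact: chart_dom_open].
Qed.

Lemma curve_dom_open c i : continuous c -> open (c @^-1` chart_dom i).
Proof. by move=> cc; apply: open_comp => [x _|]; [exact: cc|exact: chart_dom_open]. Qed.

Lemma smooth_curve_derivable2 c i t : Ck_curve 2 c -> chart_dom i (c t) ->
  is_derive t (1 : R) (derive1 (chart i \o c)) (derive1 (derive1 (chart i \o c)) t).
Proof.
move=> C2 it; have [_ /Ck_on_curveS] := @chart_curve_Ck 1 c i C2.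
case=> [|/(_ t it) D _]; first by apply: curve_dom_open; exact: C2.1.
by rewrite derive1E; exact/derivableP.
Qed.

Lemma curve_is_derive c i t : Ck_curve 1 c -> chart_dom i (c t) ->
  is_derive t (1 : R) (chart i \o c) (derive1 (chart i \o c) t).
Proof.
move=> C1 it; have [/(_ t it) D _] := @chart_curve_Ck 0 c i C1.
by rewrite derive1E; exact/derivableP.
Qed.

Lemma tstate_velocity c i t : Ck_curve 1 c -> chart_dom i (c t) ->
  tstate i (velocity c t) = row_mx (chart i (c t)) (derive1 (chart i \o c) t).
Proof.
move=> C1 it; rewrite /tstate coord_velocity//; first exact: C1.1.
by have [/(_ t it) D _] := @chart_curve_Ck 0 c i C1.
Qed.

Lemma geodesic_ode c i t : geodesic c -> chart_dom i (c t) ->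
  is_derive t (1 : R) (fun s => tstate i (velocity c s)) (spray i (tstate i (velocity c t))).
Proof.
move=> [Ck eqn] it.
have E : {near t, (fun s => row_mx (chart i (c s)) (derive1 (chart i \o c) s)) =1
    (fun s => tstate i (velocity c s))}.
  near=> s; rewrite tstate_velocity//; near: s.
  by apply: (@near_open _ (c @^-1` chart_dom i)) => //; apply: curve_dom_open; exact: (Ck 0%N).1.
apply: (near_eq_is_derive E).
rewrite tstate_velocity// /spray row_mxKl row_mxKr.
apply: is_derive_row_mx; first exact: curve_is_derive.
apply: is_derive_eq; first exact: smooth_curve_derivable2.
by apply/eqP; rewrite -addr_eq0; apply/eqP; exact: eqn.
Unshelve. all: by end_near.
Qed.

Lemma spray_lipschitz i z : state_dom i z -> exists2 d : R, 0 < d & exists2 K : R, 0 <= K &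
  forall y y', ball z d y -> ball z d y' -> `|spray i y - spray i y'| <= K * `|y - y'|.
Proof.
move=> iz; have H := Ck2_estimate_row (@state_dom_open i) iz (@spray_Ck i 2).
have [d [d0 [_ H1 H2]]] := filter_ex (filterI (nbhs_right_gt (0 : R)) H).
exists d => //; exists (d^-1 + d^-1 * (2 * d)).
  by rewrite addr_ge0 ?mulr_ge0 ?invr_ge0 ?(ltW d0).
move=> y y' By By'; rewrite -[spray i y - _](subrK ('D_(y - y') (spray i) y')).
rewrite (le_trans (ler_normD _ _))// addrC mulrDl lerD ?H2//.
apply: le_trans (H1 _ _ _ By' By By') _; rewrite subrr normr0 addr0.
rewrite ler_wpM2r// ler_wpM2l ?invr_ge0 ?(ltW d0)//.
move: By By'; rewrite -!ball_normE/= => By By'.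
rewrite -[y - y'](subrKA z) (le_trans (ler_normD _ _))// mulrDl mul1r lerD ?(ltW By')//.
by rewrite distrC ltW.
Qed.

Lemma short_time (e K : R) : 0 < e -> 0 <= K ->
  exists r : R, [/\ 0 < r, r < e & K * (2 * r) <= 2^-1].
Proof.
move=> e0 K0; have K1 : 0 < K + 1 by rewrite ltr_wpDl.
exists (Num.min (e / 2) (4 * (K + 1))^-1); split.
- by rewrite lt_min divr_gt0// invr_gt0 mulr_gt0.
- by rewrite gt_min ltr_pdivrMr// ltr_pMr// ltr1n.
- apply: (@le_trans _ _ (K * (2 * (4 * (K + 1))^-1))).
    by rewrite ler_wpM2l// ler_wpM2l// ge_min lexx orbT.
  rewrite invfM mulrCA mulrA mulrA ler_pdivrMr//.
  lra.
Qed.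

(** Gronwall with no error term and initial difference 0, on an interval so short that
    [K * (2 * r) <= 2^-1]. *)
Lemma ode_unique_near N (G : 'rV[R]_N -> 'rV[R]_N) (z1 z2 : R -> 'rV[R]_N) (t0 d K : R) :
  0 < d -> 0 <= K ->
  (forall y y', ball (z1 t0) d y -> ball (z1 t0) d y' -> `|G y - G y'| <= K * `|y - y'|) ->
  (\forall t \near t0, is_derive t (1 : R) z1 (G (z1 t))) ->
  (\forall t \near t0, is_derive t (1 : R) z2 (G (z2 t))) ->
  z1 t0 = z2 t0 -> \forall t \near t0, z1 t = z2 t.
Proof.
move=> d0 K0 HK D1 D2 E.
have B (z : R -> 'rV[R]_N) : (\forall t \near t0, is_derive t (1 : R) z (G (z t))) ->
    z t0 = z1 t0 -> \forall t \near t0, ball (z1 t0) d (z t).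
  move=> /nbhs_singleton/is_derive1_continuous zc Ez.
  by apply: zc; rewrite Ez; exact: nbhsx_ballx.
have B1 := B _ D1 erefl; have B2 := B _ D2 (esym E).
have [e e0 He] := near_dist (filterI (filterI D1 D2) (filterI B1 B2)).
have [r [r0 re rK]] := short_time e0 K0.
near=> s.
have sr : `|s - t0| < r.
  near: s; apply/nbhs_ballP; exists r; first exact: r0.
  by move=> x; rewrite -ball_normE/= distrC.
have itv t : t0 - r <= t <= t0 + r -> `|t - t0| < e.
  by rewrite -ler_distl => H; exact: le_lt_trans H re.
pose w t := z1 t - z2 t.
have Dw t : t0 - r <= t <= t0 + r -> is_derive t (1 : R) w (G (z1 t) - G (z2 t)).
  by move=> /itv/He[[k1 k2] _]; apply: is_deriveB.
have Bw t : t0 - r <= t <= t0 + r -> `|G (z1 t) - G (z2 t)| <= K * `|w t| + 0.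
  by move=> /itv/He[_ [k1 k2]]; rewrite addr0; exact: HK k1 k2.
have := gronwall_short Dw Bw K0 (lexx 0) _ (s := t0) (t := s).
have -> : t0 + r - (t0 - r) = 2 * r by ring.
have ht0 : t0 - r <= t0 <= t0 + r by rewrite lerBlDr !lerDl (ltW r0).
have hs : t0 - r <= s <= t0 + r by rewrite -ler_distl (ltW sr).
move=> /(_ rK ht0 hs); rewrite mul0r addr0 /w E subrr normr0 mulr0 normr_le0 subr_eq0.
exact: eqP.
Unshelve. all: by end_near.
Qed.

Lemma velocity_eq_near c1 c2 t0 : geodesic c1 -> geodesic c2 ->
  velocity c1 t0 = velocity c2 t0 -> \forall s \near t0, velocity c1 s = velocity c2 s.
Proof.
move=> g1 g2 E; have E0 : c1 t0 = c2 t0 by exact: (congr1 (fun v : tangent_vector M => base v) E).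
set i := chart_at (c1 t0).
have i1 : chart_dom i (c1 t0) by exact: chart_atP.
have i2 : chart_dom i (c2 t0) by rewrite -E0.
pose z c s := tstate i (velocity c s).
have zE : z c1 t0 = z c2 t0 by rewrite /z E.
have [d d0 [K K0 HK]] := spray_lipschitz (tstate_dom (v := velocity c1 t0) i1).
have dom c : geodesic c -> chart_dom i (c t0) -> \forall s \near t0, chart_dom i (c s).
  by move=> gc ic; apply: near_curve_chart ic; exact: (gc.1 0%N).1.
have D c : geodesic c -> chart_dom i (c t0) ->
    \forall s \near t0, is_derive s (1 : R) (z c) (spray i (z c s)).
  move=> gc ic; have ds := dom c gc ic; near=> s; apply: geodesic_ode gc _.
  by near: s.
have zz := ode_unique_near d0 K0 HK (D _ g1 i1) (D _ g2 i2) zE.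
have ds1 := dom _ g1 i1; have ds2 := dom _ g2 i2.
move: ds1 ds2 zz; apply: filterS3 => s j1 j2 e.
exact: (@tstate_inj i (velocity c1 s) (velocity c2 s) j1 j2 e).
Unshelve. all: by end_near.
Qed.

(** Closedness of the agreement set in the uniqueness of geodesics. Distinct base points are
    separated in the Hausdorff manifold; with equal base points, the two states are distinct vectors
    in one chart. *)
Lemma velocity_neq_near c1 c2 t0 : geodesic c1 -> geodesic c2 ->
  velocity c1 t0 <> velocity c2 t0 -> \forall s \near t0, velocity c1 s <> velocity c2 s.
Proof.
move=> g1 g2 E; have [E0|E0] := pselect (c1 t0 = c2 t0); last first.
  have := @manifold_hausdorff _ _ M; rewrite open_hausdorff => /(_ (c1 t0) (c2 t0)).
  case=> [|[A B]/=]; first exact/eqP.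
  rewrite !inE => [[A1 B2]] [oA oB AB].
  have := near_open oA A1; have := near_open oB B2.
  move=> /((g2.1 0%N).1 t0) nB /((g1.1 0%N).1 t0) nA.
  have {}nA : \forall s \near t0, A (c1 s) by exact: nA.
  have {}nB : \forall s \near t0, B (c2 s) by exact: nB.
  near=> s; move=> Es; have Es1 := congr1 (fun v : tangent_vector M => base v) Es.
  have : (A `&` B) (c1 s) by split; [near: s|rewrite [c1 s]Es1; near: s].
  by rewrite AB.
set i := chart_at (c1 t0).
have i1 : chart_dom i (c1 t0) by exact: chart_atP.
have i2 : chart_dom i (c2 t0) by rewrite -E0.
pose w s := tstate i (velocity c1 s) - tstate i (velocity c2 s).
have wc : {for t0, continuous w}.
  apply: is_derive1_continuous; apply: is_deriveB; exact: geodesic_ode.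
have w0 : w t0 != 0.
  by rewrite subr_eq0; apply/eqP => H; apply: E; exact: tstate_inj H.
have : \forall s \near t0, w s != 0.
  have : nbhs (w t0) (~` [set 0]).
    by apply: open_nbhs_nbhs; split; [rewrite openC; apply: accessible_closed_set1; apply: hausdorff_accessible; exact: norm_hausdorff|exact/eqP].
  move=> /wc nw; near=> s; have /eqP : (~` [set 0]) (w s) by near: s; exact: nw.
  by [].
move=> nw; near=> s; have : w s != 0 by near: s; exact: nw.
by apply: contra_neq_not => H; rewrite /w H subrr.
Unshelve. all: by end_near.
Qed.

Lemma geodesic_unique c1 c2 t0 : geodesic c1 -> geodesic c2 ->
  velocity c1 t0 = velocity c2 t0 -> c1 = c2.
Proof.
move=> g1 g2 E; apply/funext => t.
suff E' : velocity c1 t = velocity c2 t.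
  exact: (congr1 (fun v : tangent_vector M => base v) E').
pose a := Num.min t0 t; pose b := Num.max t0 t.
have ha : a <= t0 <= b by rewrite ge_min le_max lexx.
have hb : a <= t <= b by rewrite ge_min le_max lexx !orbT.
apply: (interval_locally_constant (P := fun t => velocity c1 t = velocity c2 t) _ ha hb E) => s _.
have [H|H] := pselect (velocity c1 s = velocity c2 s).
  have [d d0 Hd] := near_dist (velocity_eq_near g1 g2 H).
  exists d; first exact: d0.
  by move=> s1 s2 _ _ _ h2 _; exact: Hd.
have [d d0 Hd] := near_dist (velocity_neq_near g1 g2 H).
exists d; first exact: d0.
by move=> s1 s2 _ _ h1 _ E1; case: (Hd _ h1).
Qed.

Lemma affine_Ck_curve k c (a b : R) : Ck_curve k c -> Ck_curve k (fun t => c (a * t + b)).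
Proof.
move=> [cc Ck]; split=> [|i]; first exact: affine_comp_continuous.
by apply: Ck_on_affine (Ck i); exact: curve_dom_open.
Qed.

Lemma derive1_affine (W : normedModType R) (f : R -> W) (a b t : R) :
  derivable f (a * t + b) 1 ->
  is_derive t (1 : R) (fun t => f (a * t + b)) (a *: derive1 f (a * t + b)).
Proof.
move=> df; have Da : is_derive t (1 : R) (fun t => a * t + b) a.
  have -> : (fun t => a * t + b) = (a \*: id) + cst b by [].
  by apply: is_derive_eq; rewrite addr0 [LHS]mulr1.
apply: is_derive_eq (is_derive_comp_curve (f := f) Da _) _.
  exact/derivable1_diffP.
rewrite derive1E !deriveE; try exact/derivable1_diffP.
by rewrite -linearZ; congr ('d f _ _); rewrite [RHS]mulr1.
Qed.

Lemma velocity_affine c (a b t : R) : Ck_curve 1 c ->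
  velocity (fun t => c (a * t + b)) t =
  TangentVector (c (a * t + b)) (a *: vec (velocity c (a * t + b))).
Proof.
move=> C1; rewrite /velocity/=; congr TangentVector.
set j := chart_at _; have [D _] := curve_is_derive C1 (chart_atP (c (a * t + b))).
by rewrite derive1E; have [_ ->] := @derive1_affine _ (chart j \o c) a b t D.
Qed.

Lemma tnormZ p (k : R) u : tnorm p (k *: u) = `|k| * tnorm p u.
Proof. by rewrite !tnormE bnormZ. Qed.

Lemma speed_affine c (a b t : R) : Ck_curve 1 c ->
  speed (fun t => c (a * t + b)) t = `|a| * speed c (a * t + b).
Proof. by move=> C1; rewrite /speed velocity_affine// tnormZ. Qed.

Lemma christoffel_formZ i x (a : R) u w :
  christoffel_form i x (a *: u) (a *: w) = a ^+ 2 *: christoffel_form i x u w.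
Proof.
apply/rowP => k; rewrite !mxE mulr_sumr; apply: eq_bigr => b _; rewrite mulr_sumr.
by apply: eq_bigr => d _; rewrite !mxE; ring.
Qed.

Lemma geodesic_affine c (a b : R) : geodesic c -> geodesic (fun t => c (a * t + b)).
Proof.
move=> [Ck eqn]; split=> [k|i t it]; first exact: affine_Ck_curve.
have D s : chart_dom i (c (a * s + b)) ->
    is_derive s (1 : R) (chart i \o (fun t => c (a * t + b)))
      (a *: derive1 (chart i \o c) (a * s + b)).
  by move=> /(curve_is_derive (Ck 1%N))[Ds _]; exact: (@derive1_affine _ (chart i \o c)).
have [D2 _] := smooth_curve_derivable2 (Ck 2) it.
have E : derive1 (derive1 (chart i \o (fun t => c (a * t + b)))) t =
    a ^+ 2 *: derive1 (derive1 (chart i \o c)) (a * t + b).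
  rewrite derive1E; apply: derive_val.
  apply: (@near_eq_is_derive _ _ _ (fun s => a *: derive1 (chart i \o c) (a * s + b))).
    near=> s; rewrite [in RHS]derive1E; have [//|_ ->//] := D s.
    near: s; apply: (near_curve_chart (c := fun t => c (a * t + b))) => //.
    exact: (affine_Ck_curve a b (Ck 0%N)).1.
  rewrite expr2 -scalerA; apply: is_deriveZ.
  exact: (@derive1_affine _ (derive1 (chart i \o c))).
rewrite /cov_deriv E; have [_] := D _ it; rewrite -derive1E => ->.
by rewrite christoffel_formZ -scalerDr [X in _ *: X]eqn// scaler0.
Unshelve. all: by end_near.
Qed.

Lemma derive_metric_curve i (x u w : R -> 'rV[R]_n) t xd ud wd :
  chart_img i (x t) -> is_derive t (1 : R) x xd ->
  is_derive t (1 : R) u ud -> is_derive t (1 : R) w wd ->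
  is_derive t (1 : R) (fun s => met i (x s) (u s) (w s))
    (dmet i (x t) xd (u t) (w t) + met i (x t) ud (w t) + met i (x t) (u t) wd).
Proof.
move=> ix Dx Du Dw; have dg := metric_differentiable ix.
exact: (is_derive_bil (is_derive_comp_curve Dx dg) Du Dw).
Qed.

Lemma met_sym i x u w : chart_img i x -> met i x u w = met i x w u.
Proof. by case=> p ip <-; apply: bil_sym; case: (metric_posdef ip). Qed.

(** The derivative of the squared speed consists of a metric term and two acceleration terms, which
    cancel by the geodesic equation and Koszul's formula. *)
Lemma geodesic_speed_cst c s t : geodesic c -> speed c s = speed c t.
Proof.
move=> gc; pose f s := inner (c s) (vec (velocity c s)) (vec (velocity c s)).
suff Ef : forall s t, f s = f t by rewrite /speed /tnorm -/(f s) -/(f t) (Ef s t).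
apply: is_derive0_cst => r; set i := chart_at (c r).
have ir : chart_dom i (c r) by exact: chart_atP.
have [cc _] := gc.1 0%N.
set x := chart i \o c.
apply: (@near_eq_is_derive _ _ _ (fun s => met i (x s) (derive1 x s) (derive1 x s))).
  near=> z; have iz : chart_dom i (c z).
    by near: z; apply: near_curve_chart => //; exact: cc.
  rewrite /f -(inner_coord _ _ iz) -/(velocity c z) coord_velocity//.
    exact: cc.
  by have [+ _] := curve_is_derive (gc.1 1%N) iz.
have ix : chart_img i (x r) by exact: chart_imgP.
apply: is_derive_eq.
  apply: derive_metric_curve => //; first exact: curve_is_derive (gc.1 1%N) ir.
    exact: smooth_curve_derivable2 (gc.1 2) ir.
  exact: smooth_curve_derivable2 (gc.1 2) ir.
have /eqP := gc.2 i r ir; rewrite /cov_deriv -/x addr_eq0 => /eqP ->.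
rewrite (met_sym _ (- _) ix) /met bilNl -/(met i _ _ _) koszul//.
by field.
Unshelve. all: by end_near.
Qed.

Lemma geodesic_of_spec (cM : complete_manifold M) (v : tangent_vector M) :
  geodesic (geodesic_of v) /\ velocity (geodesic_of v) 0 = v.
Proof.
have [c gc vc] := cM v.
exact: (@xgetPex _ (cst (base v)) [set c | geodesic c /\ velocity c 0 = v] (ex_intro _ c (conj gc vc))).
Qed.

Lemma geodesic_ofE c (v : tangent_vector M) : geodesic c -> velocity c 0 = v -> geodesic_of v = c.
Proof.
move=> gc vc.
have [g1 v1] : geodesic (geodesic_of v) /\ velocity (geodesic_of v) 0 = v.
  exact: (@xgetPex _ (cst (base v)) [set c | geodesic c /\ velocity c 0 = v] (ex_intro _ c (conj gc vc))).
by apply: (geodesic_unique (t0 := 0) g1 gc); rewrite v1 vc.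
Qed.

Lemma geodesic_of_scale (cM : complete_manifold M) p u (k t : R) :
  geodesic_of (TangentVector p (k *: u)) t = geodesic_of (TangentVector p u) (k * t).
Proof.
have [g v] := geodesic_of_spec cM (TangentVector p u).
rewrite (@geodesic_ofE (fun t => geodesic_of (TangentVector p u) (k * t + 0))) ?addr0//.
  exact: geodesic_affine.
by rewrite velocity_affine ?mulr0 ?addr0 ?v//; [case: v => ->|exact: (g.1 1%N)].
Qed.

End geodesics.

(** * Jacobi fields and the exponential map *)

Section geodesic_variation.
Context {R : realType} {n : nat} {M : riemannian_manifold R n}.
Implicit Types (i j : chart_index M) (p : M) (c : R -> M).

Lemma dist_continuous (V : normedModType R) (x : V) : continuous (fun y => `|y - x|).
Proof.
move=> y; apply: (@continuous_comp _ _ _ (fun y => y - x) (fun y => `|y|)).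
  by apply: continuousB; [exact: cvg_id|exact: cvg_cst].
exact: norm_continuous.
Qed.

Lemma left_point (a e : R) : 0 < a -> 0 < e -> exists2 b : R, 0 <= b < a & `|b - a| < e.
Proof.
move=> a0 e0; exists (Num.max 0 (a - e / 2)).
  by rewrite le_max lexx gt_max a0 ltrBlDr ltrDl divr_gt0.
have h : 0 < e / 2 by rewrite divr_gt0.
rewrite distrC ger0_norm; last by rewrite subr_ge0 ge_max ltW//= lerBlDr lerDl ltW.
by rewrite ltrBlDr -ltrBlDl lt_max; apply/orP; right; rewrite ltrD2l ltrN2; lra.
Qed.

(** The set is compact, hence closed in the whole Hausdorff manifold. A curve confined to it
    therefore cannot leave the chart at a limit time. *)
Lemma chart_ball_closed i x (r : R) : (forall y, `|y - x| <= r -> chart_img i y) ->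
  closed (chart_inv i @` [set y | `|y - x| <= r]).
Proof.
move=> H; apply: compact_closed; first exact: manifold_hausdorff.
apply: continuous_compact.
  apply: continuous_in_subspaceT => y; rewrite inE/= => /H.
  exact: chart_inv_continuous_at.
apply: bounded_closed_compact.
  exists (`|x| + r); split=> [|M' HM y /= hy]; first exact: num_real.
  apply: le_trans (ltW HM); rewrite -[y](subrK x) addrC.
  by apply: le_trans (ler_normD _ _) _; rewrite lerD2l.
have -> : [set y | `|y - x| <= r] = (fun y => `|y - x|) @^-1` [set t | t <= r] by [].
apply: closed_comp => [y _|]; [exact: dist_continuous|exact: closed_le].
Qed.

(* A geodesic stays in a coordinate ball for a time controlled by the size of
   the spray there. *)
Lemma geodesic_confined c i (z0 : 'rV[R]_(n + n)) (d B s r : R) :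
  geodesic c -> 0 < d -> 0 < B ->
  (forall y, ball z0 d y -> state_dom i y) ->
  (forall y, ball z0 d y -> `|spray i y| <= B) ->
  chart_dom i (c s) -> ball z0 (d / 2) (tstate i (velocity c s)) ->
  B * r <= d / 4 ->
  forall t, `|t - s| <= r -> chart_dom i (c t) /\ ball z0 d (tstate i (velocity c t)).
Proof.
move=> gc d0 B0 Hd HB is0 bs Br t tr.
(* With the sign [e], the time [e * a + s] runs from [s] towards [t] as [a] increases from 0, which
   treats both directions at once. *)
pose e : R := Num.sg (t - s).
have Et : t = e * `|t - s| + s by rewrite -numEsg subrK.
have e1 : `|e| <= 1 by rewrite normr_sg; case: (_ == _) => //=; rewrite ler01.
pose z (a : R) := tstate i (velocity c (e * a + s)).
pose P (a : R) := chart_dom i (c (e * a + s)) /\ `|z a - z0| <= d / 2 + B * a.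
have cc := (gc.1 0%N).1.
have ce : continuous (fun a => c (e * a + s)) by exact: affine_comp_continuous.
have Pball a : 0 <= a <= r -> P a -> ball z0 d (z a).
  move=> /andP[a0 ar] [_ H]; rewrite -ball_normE/= distrC (le_lt_trans H)//.
  have : B * a <= d / 4 by apply: le_trans Br; rewrite ler_wpM2l// ltW.
  by move: (B * a) => q hq; lra.
have Dz a : chart_dom i (c (e * a + s)) -> is_derive a (1 : R) z (e *: spray i (z a)).
  move=> ia; have [D E] := geodesic_ode gc ia.
  apply: is_derive_eq; first exact: (@derive1_affine _ _ (fun s => tstate i (velocity c s))).
  by rewrite derive1E E.
have zc a : chart_dom i (c (e * a + s)) -> {for a, continuous z}.
  by move=> /Dz/is_derive1_continuous.
have near_dom a : chart_dom i (c (e * a + s)) -> \forall b \near a, chart_dom i (c (e * b + s)).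
  by move=> ia; apply: (near_curve_chart (c := fun a => c (e * a + s))) => //; exact: ce.
suff HP a : 0 <= a <= r -> P a.
  have ar : 0 <= `|t - s| <= r by rewrite normr_ge0.
  by split; rewrite {1}Et; [have [] := HP _ ar|exact: Pball ar (HP _ ar)].
apply: interval_induction => {a}.
- split; first by rewrite mulr0 add0r.
  by rewrite /z !mulr0 add0r addr0; move: bs; rewrite -ball_normE/= distrC => /ltW.
- move=> a /andP[a0 ar] HP.
  have ia : P a by apply: HP; rewrite a0 lexx.
  have ba : ball z0 d (z a) by apply: Pball ia; rewrite a0 ltW.
  have nb : \forall b \near a, ball z0 d (z b).
    by apply: (zc _ ia.1); apply: open_nbhs_nbhs; split => //; exact: ball_open.
  have [dl dl0 Hdl] := near_dist (filterI (near_dom _ ia.1) nb).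
  have Hb b : 0 <= b < a + dl -> b <= r -> chart_dom i (c (e * b + s)) /\ ball z0 d (z b).
    move=> /andP[b0 bd] br; have [ba'|ab] := leP b a.
      have Pb : P b by apply: HP; rewrite b0.
      by split; [case: Pb|apply: Pball Pb; rewrite b0].
    by have [] := Hdl b; rewrite // ger0_norm ?subr_ge0 ?ltW// ltrBlDl.
  exists dl => // b /andP[ab bd] br.
  have b0 : 0 <= b by exact: le_trans ab.
  split; first by apply: (Hb b _ br).1; rewrite b0.
  have Hb' x : 0 <= x <= b -> chart_dom i (c (e * x + s)) /\ ball z0 d (z x).
    move=> /andP[x0 xb]; apply: Hb; last exact: le_trans br.
    by rewrite x0 (le_lt_trans xb).
  have := @mean_value_mx _ _ _ z (fun x => e *: spray i (z x)) 0 b B.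
  have h0 : 0 <= (0 : R) <= b by rewrite lexx b0.
  have hb : 0 <= b <= b by rewrite b0 lexx.
  move=> /(_ _ _ 0 b h0 hb); rewrite subr0 ger0_norm// => H.
  have {}H : `|z b - z 0| <= B * b.
    apply: H => x xb; first by have [/Dz] := Hb' x xb.
    have [_ /HB H] := Hb' x xb; rewrite normrZ (le_trans _ H)// ler_piMl//.
  rewrite -[z b](subrK (z 0)) -addrA addrC.
  apply: le_trans (ler_normD _ _) _; apply: lerD H.
  by rewrite /z mulr0 add0r; move: bs; rewrite -ball_normE/= distrC => /ltW.
move=> a /andP[a0 ar] HP.
(* Since [B * a <= d / 4] throughout, the states before time [a] stay in the closed ball of radius
   [rho], strictly inside the ball of radius [d]. *)
pose rho := d / 2 + d / 4.
have lsub_ball y : `|y - z0| <= rho -> ball z0 d y.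
  by move=> H; rewrite -ball_normE/= distrC (le_lt_trans H)// /rho; lra.
have Hrho b : 0 <= b < a -> `|z b - z0| <= rho.
  move=> /andP[b0 ba]; apply: le_trans (HP b _).2 _; first by rewrite b0.
  by rewrite lerD2l (le_trans _ Br)// ler_wpM2l ?(ltW B0)// (le_trans (ltW ba)).
have clo : closed (chart_inv i @` [set y | `|y - lsubmx z0| <= rho]).
  apply: chart_ball_closed => y hy.
  have := Hd (row_mx y (rsubmx z0)); rewrite /state_dom/= row_mxKl; apply.
  apply: lsub_ball; rewrite -[z0 in _ - z0]hsubmxK opp_row_mx add_row_mx subrr.
  apply: mx_norm_le => [|k l]; first exact: le_trans hy.
  rewrite -(splitK l); case: (fintype.split l) => q /=.
    by rewrite row_mxEl (le_trans (mx_entry_le_norm _ _ _)).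
  by rewrite row_mxEr mxE normr0 (le_trans _ hy).
have ia : chart_dom i (c (e * a + s)).
  have : (chart_inv i @` [set y | `|y - lsubmx z0| <= rho]) (c (e * a + s)).
    apply: clo => V /(ce a) nV.
    have /near_dist[dl dl0 Hdl] : \forall b \near a, V (c (e * b + s)) by exact: nV.
    have [b bab /Hdl bd] := left_point a0 dl0.
    exists (c (e * b + s)); split.
      exists (lsubmx (z b)); last first.
        by rewrite /z row_mxKl chartK//; case: (HP b bab).
      rewrite /= -linearB; apply: le_trans (Hrho b bab).
      apply: mx_norm_le => // k l; rewrite mxE; exact: mx_entry_le_norm.
    exact: bd.
  case=> y hy <-; apply: chart_inv_dom.
  have := Hd (row_mx y (rsubmx z0)); rewrite /state_dom/= row_mxKl; apply.
  apply: lsub_ball; rewrite -[z0 in _ - z0]hsubmxK opp_row_mx add_row_mx subrr.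
  apply: mx_norm_le => [|k l]; first exact: le_trans hy.
  rewrite -(splitK l); case: (fintype.split l) => q /=.
    by rewrite row_mxEl (le_trans (mx_entry_le_norm _ _ _)).
  by rewrite row_mxEr mxE normr0 (le_trans _ hy).
split=> //; rewrite leNgt; apply/negP => H.
have : \forall b \near a, d / 2 + B * a < `|z b - z0|.
  have cn : {for a, continuous (fun b => `|z b - z0|)}.
    apply: (@continuous_comp _ _ _ z (fun y => `|y - z0|)); first exact: zc.
    exact: dist_continuous.
  exact: (cn [set t | d / 2 + B * a < t] (near_open (@open_gt _ _) H)).
move=> /near_dist[dl dl0 Hdl].
have [b bab /Hdl bd] := left_point a0 dl0.
have := lt_le_trans bd (HP b bab).2; have /andP[_ ba] := bab.
by rewrite ltrD2l ltr_pM2l// ltNge (ltW ba).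
Qed.

End geodesic_variation.

(** * Differentiability of geodesics in their initial velocity *)

Section geodesic_flow_derivative.
Context {R : realType} {n : nat} {M : riemannian_manifold R n}.
Implicit Types (i j : chart_index M) (p : M) (c : R -> M).

(** Change of coordinates of the tangent bundle: the transition map on positions, its differential
    on velocities. *)
Definition tau i j (z : 'rV[R]_(n + n)) : 'rV[R]_(n + n) :=
  row_mx (trans i j (lsubmx z)) ('d (trans i j) (lsubmx z) (rsubmx z)).

Lemma tau_tstate i j (v : tangent_vector M) : chart_dom i (base v) -> chart_dom j (base v) ->
  tau i j (tstate i v) = tstate j v.
Proof. by move=> iv jv; rewrite /tau row_mxKl row_mxKr trans_chart// coord_trans. Qed.

Definition tau_dom i j : set 'rV[R]_(n + n) :=
  [set z | (chart i @` (chart_dom i `&` chart_dom j)) (lsubmx z)].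

Lemma tau_dom_open i j : open (tau_dom i j).
Proof.
apply: (@open_comp _ _ (fun z : 'rV[R]_(n + n) => lsubmx z)); last first.
  exact: trans_domain_open.
by move=> z _; exact: (@lsubmx_Ck _ _ 0 setT openT).
Qed.

Lemma tau_Ck k i j : Ck_on k (tau_dom i j) (tau i j).
Proof.
have oi : open (tau_dom i j) by exact: tau_dom_open.
have oT : open (chart i @` (chart_dom i `&` chart_dom j)) by exact: trans_domain_open.
have sT m : Ck_on m (chart i @` (chart_dom i `&` chart_dom j)) (trans i j).
  exact: transition_smooth.
have comp (f : 'rV[R]_n -> 'rV[R]_n) : Ck_on k (chart i @` (chart_dom i `&` chart_dom j)) f ->
    Ck_on k (tau_dom i j) (fun z => f (lsubmx z)).
  move=> Cf; apply: (Ck_on_comp_mx (f := fun z => lsubmx z : 'rV_n) oi oT) Cf => //.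
  exact: lsubmx_Ck.
apply/Ck_on_mxP => // r l; rewrite ord1 -(splitK l).
case: (fintype.split l) => q /=.
  under eq_fun do rewrite row_mxEl.
  by have /Ck_on_mxP := comp _ (sT k); exact.
under eq_fun do rewrite row_mxEr.
apply: (@Ck_on_eq _ _ _ _ _ (fun z => \sum_a rsubmx z 0 a * 'D_(delta_mx 0 a) (trans i j) (lsubmx z) 0 q)) => //.
  move=> z oz; rewrite -deriveE; last exact: Ck_on_differentiable (sT 1%N) oz.
  rewrite derive_sum_basis; last exact: Ck_on_differentiable (sT 1%N) oz.
  by rewrite summxE; apply: eq_bigr => a _; rewrite [RHS]mxE.
apply: Ck_on_sum => // a; apply: Ck_onM => //.
  by under eq_fun do rewrite mxE; exact: Ck_on_coord.
by have /Ck_on_mxP := comp _ (Ck_on_derive (delta_mx 0 a) (sT k.+1)); exact.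
Qed.

Variable (p0 : M).
Hypothesis cM : complete_manifold M.

Definition gam (u : 'rV[R]_n) : R -> M := geodesic_of (TangentVector p0 u).

Lemma gam_geodesic u : geodesic (gam u).
Proof. by case: (geodesic_of_spec cM (TangentVector p0 u)). Qed.

Lemma gam_velocity0 u : velocity (gam u) 0 = TangentVector p0 u.
Proof. by case: (geodesic_of_spec cM (TangentVector p0 u)). Qed.

Lemma gam0 u : gam u 0 = p0.
Proof. by case: (gam_velocity0 u). Qed.

Definition flow i t (u : 'rV[R]_n) : 'rV[R]_(n + n) := tstate i (velocity (gam u) t).

(** The first clause keeps [flow i t] meaningful near [u0], as a state in the chart [i] makes sense
    only over the domain of [i]. *)
Definition flow_diff u0 i t := (\forall u \near u0, chart_dom i (gam u t)) /\
  exists L : 'M[R]_(n, n + n), strict_diff (flow i t) u0 L.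

Lemma flow0 i u : chart_dom i p0 ->
  flow i 0 u = row_mx (chart i p0) (coord i (TangentVector p0 u)).
Proof. by move=> ip; rewrite /flow gam_velocity0. Qed.

Lemma flow_diff0 i u0 : chart_dom i p0 -> flow_diff u0 i 0.
Proof.
move=> ip; split; first by near=> u; rewrite gam0.
pose A : 'M[R]_n := lin1_mx ('d (trans (chart_at p0) i) (chart (chart_at p0) p0)).
exists (row_mx 0 A).
have -> : flow i 0 = fun u => row_mx (chart i p0) 0 + u *m row_mx 0 A.
  apply/funext => u; rewrite flow0// mul_mx_row mulmx0 add_row_mx addr0 add0r.
  by rewrite mul_rV_lin1.
exact: strict_diff_affine.
Unshelve. all: by end_near.
Qed.

Lemma flow_diff_chart u0 i j t : flow_diff u0 i t -> chart_dom j (gam u0 t) ->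
  flow_diff u0 j t.
Proof.
move=> [ni [L sL]] ju; have iu : chart_dom i (gam u0 t) := nbhs_singleton ni.
have [dL _] := strict_diff_is_diff sL.
have nj : \forall u \near u0, chart_dom j (gam u t).
  have cx : {for u0, continuous (fun u => chart_inv i (lsubmx (flow i t u)))}.
    apply: (@continuous_comp _ _ _ (fun u => lsubmx (flow i t u))).
      apply: (@continuous_comp _ _ _ (flow i t) (fun z => lsubmx z)).
        exact: differentiable_continuous.
      exact: (@lsubmx_Ck _ _ 0 setT openT).
    by rewrite row_mxKl; apply: chart_inv_continuous_at; exact: chart_imgP.
  have E u : chart_dom i (gam u t) -> chart_inv i (lsubmx (flow i t u)) = gam u t.
    by move=> iu'; rewrite row_mxKl chartK.
  have hj : nbhs (chart_inv i (lsubmx (flow i t u0))) (chart_dom j).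
    by rewrite row_mxKl chartK//; exact: near_chart_dom ju.
  have nj : \forall u \near u0, chart_dom j (chart_inv i (lsubmx (flow i t u))).
    exact: cx hj.
  by near=> u; rewrite -E; near: u.
split=> //; have iz : tau_dom i j (flow i t u0).
  by rewrite /tau_dom/= row_mxKl; exact: trans_domain.
have st := Ck2_strict_diff (@tau_dom_open i j) iz (@tau_Ck 2 i j).
exists (L *m jacobian (tau i j) (flow i t u0)).
apply: strict_diff_eq (strict_diff_comp sL st).
by near=> u; rewrite /= tau_tstate//; near: u.
Unshelve. all: by end_near.
Qed.

Lemma spray_bound i (z0 : 'rV[R]_(n + n)) : state_dom i z0 -> exists2 d : R, 0 < d &
  [/\ forall y, ball z0 d y -> state_dom i y,
   forall r y z, ball z0 d r -> ball z0 d y -> ball z0 d z ->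
    `|spray i y - spray i z - 'D_(y - z) (spray i) r| <= d^-1 * (`|y - r| + `|z - r|) * `|y - z|,
   forall y w, ball z0 d y -> `|'D_w (spray i) y| <= d^-1 * `|w| &
   forall y, ball z0 d y -> `|spray i y| <= `|spray i z0| + 1 + d].
Proof.
move=> iz; have H := Ck2_estimate_row (@state_dom_open _ _ _ i) iz (@spray_Ck _ _ _ i 2).
have [d [d0 [H0 H1 H2]]] := filter_ex (filterI (nbhs_right_gt (0 : R)) H).
exists d => //; split=> // y By.
have Bz : ball z0 d z0 by exact: ballxx.
have hy : `|y - z0| <= d by move: By; rewrite -ball_normE/= distrC => /ltW.
have := H1 _ _ _ Bz By Bz; have := H2 z0 (y - z0) Bz.
rewrite subrr normr0 addr0 => h2 h1.
have {}h2 : `|'D_(y - z0) (spray i) z0| <= 1.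
  by apply: le_trans h2 _; rewrite ler_pdivrMl// mulr1.
have {}h1 : `|spray i y - spray i z0 - 'D_(y - z0) (spray i) z0| <= d.
  apply: le_trans h1 _; rewrite -mulrA ler_pdivrMl//.
  exact: ler_pM.
rewrite -[spray i y](subrK (spray i z0)) -[_ - spray i z0](subrK ('D_(y - z0) (spray i) z0)).
have -> : `|spray i z0| + 1 + d = d + 1 + `|spray i z0| by ring.
exact: ler_norm_add3.
Qed.

(** The radius [r] is chosen before the time [s1] at which differentiability is assumed, and [s1]
    may lie on either side of [t]. In this form differentiability propagates along the whole
    geodesic, forwards and backwards. *)
Lemma flow_local u0 t i : chart_dom i (gam u0 t) -> exists2 r : R, 0 < r &
  forall s1, `|s1 - t| < r -> flow_diff u0 i s1 -> exists L : R -> 'M[R]_(n, n + n),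
    (forall s, `|s - t| <= r -> (\forall u \near u0, chart_dom i (gam u s)) /\
       strict_diff (flow i s) u0 (L s)) /\
    (forall s h, `|s - t| < r -> is_derive s (1 : R) (fun s => h *m L s)
       ('D_(h *m L s) (spray i) (flow i s u0))).
Proof.
have quarter (x y : R) : 2 * x <= 2^-1 * y -> x <= y / 4 by move=> hx; lra.
move=> iu; set z0 := flow i t u0.
have iz : state_dom i z0 by exact: tstate_dom.
have [d d0 [Hd GE GB Gb]] := spray_bound iz.
pose B := `|spray i z0| + 1 + d; pose K := d^-1.
have B0 : 0 < B by rewrite /B addr_gt0// ltr_wpDl.
have K0 : 0 <= K by rewrite invr_ge0 ltW.
have nz : \forall s \near t, ball z0 (d / 2) (flow i s u0).
  have /is_derive1_continuous zc := geodesic_ode (gam_geodesic u0) iu.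
  by apply: zc; apply: nbhsx_ballx; rewrite divr_gt0.
have [e e0 He] := near_dist nz.
have C1 : 0 <= K * (1 + 2 * d) by rewrite mulr_ge0// addr_ge0// mulr_ge0// ltW.
have C2 : 0 <= 2 * B / d by rewrite divr_ge0 ?mulr_ge0 ?(ltW B0) ?(ltW d0).
(* Adding the two constants makes one [r] small enough both for the short-time Gronwall condition
   and for the confinement of nearby geodesics to the ball of radius [d]. *)
have [r [r0 re rK]] := short_time e0 (addr_ge0 C1 C2).
have r20 : 0 <= 2 * r by rewrite mulr_ge0// ltW.
move: rK; rewrite mulrDl => rK.
have rK1 : K * (1 + 2 * d) * (2 * r) <= 2^-1.
  by apply: le_trans rK; rewrite lerDl mulr_ge0.
have rK2 : B * (2 * r) <= d / 4.
  have : 2 * B / d * (2 * r) <= 2^-1 by apply: le_trans rK; rewrite lerDr mulr_ge0.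
  rewrite mulrAC ler_pdivrMr// -mulrA => hx.
  by apply: quarter.
exists r => // s1 s1t [n1 [L1 sL1]].
have [dL1 _] := strict_diff_is_diff sL1.
have nb : \forall u \near u0, ball z0 (d / 2) (flow i s1 u).
  apply: (differentiable_continuous dL1).
  by apply: open_nbhs_nbhs; split; [exact: ball_open|apply: He; exact: lt_trans re].
have nn : \forall u \near u0, chart_dom i (gam u s1) /\ ball z0 (d / 2) (flow i s1 u).
  exact: filterI n1 nb.
have /nbhs_ballP[eta /= eta0 Heta] := nn.
have conf u s : ball u0 eta u -> t - r <= s <= t + r ->
    chart_dom i (gam u s) /\ ball z0 d (flow i s u).
  move=> /Heta[iu1 bu1]; rewrite -ler_distl => st.
  apply: (geodesic_confined (gam_geodesic u) d0 B0 Hd Gb iu1 bu1 rK2).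
  rewrite -[s](subrK t) -addrA mulrDl mul1r (le_trans (ler_normD _ _))// lerD//.
  by rewrite distrC ltW.
have Ea : t + r - (t - r) = 2 * r by ring.
have s1ab : t - r <= s1 <= t + r by rewrite -ler_distl ltW.
have GD y : ball z0 d y -> differentiable (spray i) y.
  by move=> /Hd; exact: Ck_on_differentiable (@spray_Ck _ _ _ i 1).
have GC y w : ball z0 d y -> {for y, continuous ('D_w (spray i))}.
  by move=> /Hd; exact: (Ck_on_derive w (@spray_Ck _ _ _ i 1)).
have Sb u s : ball u0 eta u -> t - r <= s <= t + r -> ball z0 d (flow i s u).
  by move=> bu /(conf _ _ bu)[].
have SD u s : ball u0 eta u -> t - r <= s <= t + r ->
    is_derive s (1 : R) (flow i ^~ u) (spray i (flow i s u)).
  by move=> bu /(conf _ _ bu)[iu' _]; exact: geodesic_ode (gam_geodesic u) iu'.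
have Kab : K * (1 + 2 * d) * (t + r - (t - r)) <= 2^-1 by rewrite Ea.
have [L [H1 H2]] := variational_equation d0 K0 eta0 GE GB GD GC Sb SD Kab s1ab sL1.
exists L; split=> [s|s h]; last by rewrite ltr_distl => ?; exact: H2.
rewrite ler_distl => st; split; last exact: H1.
apply/nbhs_ballP; exists eta => // u bu.
by case: (conf _ _ bu st).
Qed.

(** At time 0 the flow is affine in [u]; [flow_local] carries differentiability to time [t], and
    [flow_diff_chart] changes charts on the way. *)
Lemma flow_diff_all u0 i t : chart_dom i (gam u0 t) -> flow_diff u0 i t.
Proof.
pose P t := forall i, chart_dom i (gam u0 t) -> flow_diff u0 i t.
suff : P t by exact.
pose a := Num.min 0 t; pose b := Num.max 0 t.
have ha : a <= 0 <= b by rewrite ge_min le_max lexx.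
have hb : a <= t <= b by rewrite ge_min le_max lexx !orbT.
have P0 : P 0 by move=> j; rewrite gam0; exact: flow_diff0.
apply: (interval_locally_constant (P := P) _ ha hb P0) => s _.
set j := chart_at (gam u0 s); have js : chart_dom j (gam u0 s) by exact: chart_atP.
have cg := (gam_geodesic u0).1 0%N.
have [r r0 H] := flow_local js.
have [e e0 He] := near_dist (near_curve_chart (cg.1 s) js).
exists (Num.min r e) => [|s1 s2 _ _]; first by rewrite lt_min r0.
rewrite !lt_min => /andP[s1r s1e] /andP[s2r s2e] /(_ j (He _ s1e)) Fs1 k ks2.
have [L [HL _]] := H _ s1r Fs1; have [n2 sL2] := HL _ (ltW s2r).
by apply: flow_diff_chart ks2; split; [exact: n2|exists (L s2)].
Qed.

Lemma near_eq_is_derive_at (V W : normedModType R) (f g : V -> W) (Phi : W -> W) x v :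
  {near x, f =1 g} -> is_derive x v g (Phi (g x)) -> is_derive x v f (Phi (f x)).
Proof.
move=> E D; rewrite (nbhs_singleton E); apply: near_eq_is_derive D.
by apply: filterS E => y.
Qed.

Lemma flow_variation u0 i t : chart_dom i (gam u0 t) ->
  [/\ \forall u \near u0, chart_dom i (gam u t),
      exists L : 'M[R]_(n, n + n), strict_diff (flow i t) u0 L &
      forall h, is_derive t (1 : R) (fun s => 'd (flow i s) u0 h)
        ('D_('d (flow i t) u0 h) (spray i) (flow i t u0))].
Proof.
move=> it; have F := flow_diff_all it; have [n0 HL] := F; split=> // h.
have [r r0 H] := flow_local it.
have [|L [H1 H2]] := H t _ F; first by rewrite subrr normr0.
have E s : `|s - t| <= r -> 'd (flow i s) u0 h = h *m L s.
  by move=> /H1[_ /strict_diff_is_diff[_ ->]].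
have ht : `|t - t| < r by rewrite subrr normr0.
apply: (near_eq_is_derive_at (Phi := fun w => 'D_w (spray i) (flow i t u0))) (H2 _ h ht).
apply/nbhs_ballP; exists r; first exact: r0.
by move=> s; rewrite -ball_normE/= distrC => /ltW; exact: E.
Qed.

End geodesic_flow_derivative.

(** * The curvature tensor through Christoffel forms *)

Section curvature.
Context {R : realType} {n : nat} {M : riemannian_manifold R n}.
Implicit Types (i j : chart_index M) (p : M) (c : R -> M) (x u v w : 'rV[R]_n).

Lemma christoffel_differentiable i x k a b : chart_img i x ->
  differentiable (fun y => christoffel i y k a b) x.
Proof. by move=> ix; exact: Ck_on_differentiable (@christoffel_Ck _ _ _ i 1 k a b) ix. Qed.

Definition dchristoffel i x v u w : 'rV[R]_n :=
  'D_v (fun y => christoffel_form i y u w) x.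

Lemma is_derive_christoffel_form (V : normedModType R) i (x u w : V -> 'rV[R]_n)
    (t h : V) dx du dw : chart_img i (x t) ->
  differentiable x t -> is_derive t h x dx -> is_derive t h u du -> is_derive t h w dw ->
  is_derive t h (fun s => christoffel_form i (x s) (u s) (w s))
    ((\row_k \sum_a \sum_b 'D_dx (fun y => christoffel i y k a b) (x t) * u t 0 a * w t 0 b)
     + christoffel_form i (x t) du (w t) + christoffel_form i (x t) (u t) dw).
Proof.
move=> ix diffx [Dx Ex] Du Dw; apply/is_derive_mxP => r k; rewrite ord1.
under eq_fun do rewrite mxE.
apply: is_derive_eq.
  apply: is_derive_sum_fun => a; apply: is_derive_sum_fun => b.
  apply: is_derive_mul; last exact: (is_derive_entry 0 b Dw).
  apply: is_derive_mul; last exact: (is_derive_entry 0 a Du).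
  have dc := christoffel_differentiable k a b ix.
  apply: (@DeriveDef _ _ _ t h (fun s => christoffel i (x s) k a b)
     ('D_dx (fun y => christoffel i y k a b) (x t))).
    by apply: diff_derivable; exact: (differentiable_comp diffx dc).
  by rewrite -Ex; exact: (derive_comp h diffx dc).
rewrite !mxE -!big_split; apply: eq_bigr => a _; rewrite -!big_split; apply: eq_bigr => b _ /=.
by ring.
Qed.

Lemma dchristoffelE i x v u w : chart_img i x -> dchristoffel i x v u w =
  \row_k \sum_a \sum_b 'D_v (fun y => christoffel i y k a b) x * u 0 a * w 0 b.
Proof.
move=> ix; have Di : is_derive x v id v.
  by apply: DeriveDef; [exact: derivable_id|exact: derive_id].
have di : differentiable id x by [].
have := is_derive_christoffel_form (i := i) ix di Di
  (is_derive_cst u x v) (is_derive_cst w x v).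
move=> [_]; rewrite /dchristoffel => -> /=.
have z1 : christoffel_form i x 0 w = 0.
  by apply/rowP => k; rewrite !mxE big1// => a _; rewrite big1// => b _; rewrite mxE mulr0 mul0r.
have z2 : christoffel_form i x u 0 = 0.
  by apply/rowP => k; rewrite !mxE big1// => a _; rewrite big1// => b _; rewrite mxE mulr0.
by rewrite z1 z2 !addr0.
Qed.

Lemma is_derive_christoffel_curve i (x u w : R -> 'rV[R]_n) t dx du dw :
  chart_img i (x t) ->
  is_derive t (1 : R) x dx -> is_derive t (1 : R) u du -> is_derive t (1 : R) w dw ->
  is_derive t (1 : R) (fun s => christoffel_form i (x s) (u s) (w s))
    (dchristoffel i (x t) dx (u t) (w t)
     + christoffel_form i (x t) du (w t) + christoffel_form i (x t) (u t) dw).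
Proof.
move=> ix Dx Du Dw; rewrite dchristoffelE//.
by apply: is_derive_christoffel_form => //; apply/derivable1_diffP; case: Dx.
Qed.

Lemma dchristoffelC i x v u w : chart_img i x ->
  dchristoffel i x v u w = dchristoffel i x v w u.
Proof.
move=> ix; apply: near_eq_derive; near=> y; apply: christoffel_formC.
by near: y; apply: near_open ix; exact: chart_img_open.
Unshelve. all: by end_near.
Qed.

(** Brings the component sums to the shape in which the terms appear when the geodesic equation is
    differentiated along a variation. *)
Lemma curvatureE i x u w z : chart_img i x -> curvature i x u w z =
  dchristoffel i x u w z - dchristoffel i x w u z
  + christoffel_form i x u (christoffel_form i x w z)
  - christoffel_form i x w (christoffel_form i x u z).
Proof.
move=> ix; rewrite !dchristoffelE//; apply/rowP => l; rewrite !mxE.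
have [D DE] : exists D : 'I_n -> 'I_n -> 'I_n -> 'I_n -> R,
    forall (c k a b : 'I_n), 'D_(delta_mx 0 c) (fun y => christoffel i y k a b) x = D c k a b.
  by exists (fun e k a b => 'D_(delta_mx 0 e) (fun y => christoffel i y k a b) x).
have [G GE] : exists G : 'I_n -> 'I_n -> 'I_n -> R, forall k a b, christoffel i x k a b = G k a b.
  by exists (christoffel i x).
have dE v k a b : 'D_v (fun y => christoffel i y k a b) x = \sum_c v 0 c * D c k a b.
  rewrite derive_sum_basis; last exact: christoffel_differentiable.
  by apply: eq_bigr => c _; rewrite DE.
have rE a b d : riemann i x l a b d =
    D a l b d - D b l a d + \sum_m G l a m * G m b d - \sum_m G l b m * G m a d.
  rewrite /riemann !DE sumrB addrA.
  by congr (_ + _ - _); apply: eq_bigr => m _; rewrite !GE.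
under eq_bigr do under eq_bigr do under eq_bigr do rewrite rE.
under [X in X - _ + _ - _]eq_bigr do under eq_bigr do rewrite dE.
under [X in _ - X + _ - _]eq_bigr do under eq_bigr do rewrite dE.
have gE k u' v' : christoffel_form i x u' v' 0 k = \sum_a \sum_b G k a b * u' 0 a * v' 0 b.
  by rewrite mxE; apply: eq_bigr => a _; apply: eq_bigr => b _; rewrite GE.
under [X in _ + X - _]eq_bigr do under eq_bigr do rewrite GE gE.
under [X in _ - X]eq_bigr do under eq_bigr do rewrite GE gE.
clear rE gE dE GE DE ix.
have E1 : \sum_a \sum_b (\sum_c u 0 c * D c l a b) * w 0 a * z 0 b =
  \sum_a \sum_b \sum_d D a l b d * u 0 a * w 0 b * z 0 d.
  rewrite [RHS]sum3_rot; apply: eq_bigr => a _; apply: eq_bigr => b _.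
  by rewrite !mulr_suml; apply: eq_bigr => c _; ring.
have E2 : \sum_a \sum_b (\sum_c w 0 c * D c l a b) * u 0 a * z 0 b =
  \sum_a \sum_b \sum_d D b l a d * u 0 a * w 0 b * z 0 d.
  apply: eq_bigr => a _; rewrite exchange_big; apply: eq_bigr => b _.
  by rewrite !mulr_suml; apply: eq_bigr => c _; ring.
have E3 (u' w' : 'rV[R]_n) : \sum_a \sum_b G l a b * u' 0 a * (\sum_c \sum_d G b c d * w' 0 c * z 0 d) =
  \sum_a \sum_b \sum_d (\sum_m G l a m * G m b d) * u' 0 a * w' 0 b * z 0 d.
  apply: eq_bigr => a _; under eq_bigr do rewrite mulr_sumr.
  rewrite exchange_big; apply: eq_bigr => b _.
  under eq_bigr do rewrite mulr_sumr.
  rewrite exchange_big; apply: eq_bigr => d _.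
  by rewrite !mulr_suml; apply: eq_bigr => m _; ring.
rewrite E1 E2 !E3 [X in _ = _ - X]exchange_big -!sumrB -big_split -sumrB; apply: eq_bigr => a _.
rewrite -!sumrB -big_split -sumrB; apply: eq_bigr => b _.
rewrite -!sumrB -big_split -sumrB; apply: eq_bigr => d _ /=.
ring.
Qed.

Lemma christoffel_formDr i x u v w :
  christoffel_form i x u (v + w) = christoffel_form i x u v + christoffel_form i x u w.
Proof.
apply/rowP => k; rewrite !mxE -big_split; apply: eq_bigr => a _.
by rewrite -big_split; apply: eq_bigr => b _ /=; rewrite !mxE; ring.
Qed.

Lemma christoffel_formNl i x u w :
  christoffel_form i x (- u) w = - christoffel_form i x u w.
Proof.
apply/rowP => k; rewrite !mxE -sumrN; apply: eq_bigr => a _.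
by rewrite -sumrN; apply: eq_bigr => b _ /=; rewrite !mxE; ring.
Qed.

End curvature.

(** * Variation fields of geodesics and the Gauss lemma *)

Section jacobi.
Context {R : realType} {n : nat} {M : riemannian_manifold R n}.
Implicit Types (i j : chart_index M) (p : M) (c : R -> M) (u v w h : 'rV[R]_n).

Lemma derive_lsubmx (V : normedModType R) m q (f : V -> 'rV[R]_(m + q)) (x v : V) :
  differentiable f x -> 'D_v (fun y => lsubmx (f y)) x = lsubmx ('D_v f x).
Proof.
move=> df; apply: derive_val; apply/is_derive_mxP => a b.
under eq_fun do rewrite mxE.
rewrite [lsubmx _ _ _]mxE; apply: is_derive_entry.
by apply/derivableP; exact: diff_derivable.
Qed.

Lemma differentiable_lsubmx (V : normedModType R) m q (f : V -> 'rV[R]_(m + q)) x :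
  differentiable f x -> differentiable (fun y => lsubmx (f y)) x.
Proof.
move=> /differentiable_mx df; apply/differentiable_mx => a b.
by under eq_fun do rewrite mxE; exact: df.
Qed.

Lemma derive_spray i (z w : 'rV[R]_(n + n)) : state_dom i z ->
  'D_w (spray i) z = row_mx (rsubmx w)
    (- (dchristoffel i (lsubmx z) (lsubmx w) (rsubmx z) (rsubmx z)
        + christoffel_form i (lsubmx z) (rsubmx w) (rsubmx z)
        + christoffel_form i (lsubmx z) (rsubmx z) (rsubmx w))).
Proof.
move=> iz; have ds : differentiable (spray i) z by exact: Ck_on_differentiable (@spray_Ck _ _ _ i 1) iz.
have dl : is_derive (0 : R) (1 : R) (fun s : R => s *: w + z) w.
  apply: is_derive_eq (@is_derive_line _ _ _ id z w 0 _) _ => //.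
  exact: derive_id.
have L0 : 0 *: w + z = z by rewrite scale0r add0r.
have ds0 : differentiable (spray i) (0 *: w + z) by rewrite L0.
have [_] := is_derive_comp_curve dl ds0; rewrite L0 => <-.
apply: derive_val; apply: is_derive_row_mx.
  exact: is_derive_rsubmx dl.
apply: is_deriveN; have := is_derive_christoffel_curve (i := i) _
  (is_derive_lsubmx dl) (is_derive_rsubmx dl) (is_derive_rsubmx dl).
by rewrite L0; exact.
Qed.

Lemma geodesic_state_Ck k c i : geodesic c ->
  Ck_on k (c @^-1` chart_dom i) (fun t => tstate i (velocity c t)).
Proof.
move=> gc; have oU : open (c @^-1` chart_dom i).
  by apply: curve_dom_open; exact: (gc.1 0%N).1.
apply: (@Ck_on_eq _ _ _ _ _ (fun t => row_mx (chart i (c t)) (derive1 (chart i \o c) t))) => //.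
  by move=> t it; rewrite tstate_velocity//; exact: (gc.1 1%N).
apply/Ck_on_mxP => // a b; rewrite ord1 -(splitK b); case: (fintype.split b) => q /=.
  under eq_fun do rewrite row_mxEl; have := (gc.1 k).2 i.
  by move=> /Ck_on_mxP; exact.
under eq_fun do rewrite row_mxEr; have [_] := chart_curve_Ck i (gc.1 k.+1).
by move=> /Ck_on_mxP; exact.
Qed.

Lemma christoffel_geodesic c i t : geodesic c -> chart_dom i (c t) ->
  derive1 (derive1 (chart i \o c)) t =
  - christoffel_form i (chart i (c t)) (derive1 (chart i \o c) t) (derive1 (chart i \o c) t).
Proof. by move=> [_ eqn] it; apply/eqP; rewrite -addr_eq0; apply/eqP; exact: eqn. Qed.

Variable (p0 : M).
Hypothesis cM : complete_manifold M.

Local Notation gam := (gam p0).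
Local Notation flow := (flow p0).

(** The variation field of the geodesics from [p0] when the initial velocity moves from [u] in the
    direction [h]. It is read at each time in the chart that [jacobi_field] prescribes, and at time
    1 it is the differential of the exponential map. *)
Definition jac u h t : 'rV[R]_n :=
  'd (fun u' => chart (chart_at (gam u t)) (gam u' t)) u h.

Lemma flow_differentiable u i t : chart_dom i (gam u t) -> differentiable (flow i t) u.
Proof. by move=> /(flow_variation cM)[_ [L /strict_diff_is_diff[]]]. Qed.

Lemma lsubmx_flow i t u : lsubmx (flow i t u) = chart i (gam u t).
Proof. by rewrite row_mxKl. Qed.

Lemma chart_gam_differentiable u i t : chart_dom i (gam u t) ->
  differentiable (fun u => chart i (gam u t)) u.
Proof.
move=> it; have := differentiable_lsubmx (flow_differentiable it).
by under eq_fun do rewrite lsubmx_flow.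
Qed.

Lemma lsubmx_dflow u h i t : chart_dom i (gam u t) ->
  lsubmx ('d (flow i t) u h) = 'd (fun u => chart i (gam u t)) u h.
Proof.
move=> it; have df := flow_differentiable it.
rewrite -!deriveE//; last exact: chart_gam_differentiable.
by rewrite -derive_lsubmx//; under eq_fun do rewrite lsubmx_flow.
Qed.

Lemma coord_jac u h i t : chart_dom i (gam u t) ->
  coord i (TangentVector (gam u t) (jac u h t)) = lsubmx ('d (flow i t) u h).
Proof.
move=> it; rewrite lsubmx_dflow// coordE.
have jt := chart_atP (gam u t); set j := chart_at _ in jt *.
apply: (diff_comp_near (f := fun u => chart j (gam u t))) => //.
- exact: chart_gam_differentiable.
- exact: trans_differentiable.
near=> u'; rewrite /= trans_chart//; near: u'.
by have [] := flow_variation cM jt.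
Unshelve. all: by end_near.
Qed.

Lemma flow_state i u t : chart_dom i (gam u t) ->
  flow i t u = row_mx (chart i (gam u t)) (derive1 (chart i \o gam u) t).
Proof. by move=> it; rewrite -[flow i t u]/(tstate i (velocity (gam u) t)) tstate_velocity//; exact: ((gam_geodesic p0 cM u).1 1%N). Qed.

Lemma near_gam_dom i u t : chart_dom i (gam u t) -> \forall s \near t, chart_dom i (gam u s).
Proof. by move=> it; apply: near_curve_chart it; exact: ((gam_geodesic p0 cM u).1 0%N).1. Qed.

(** Bootstrap: the time derivative of the field is linear in the field itself, with smooth
    coefficients, so each step gains one order. *)
Lemma jac_Ck k u h i :
  Ck_on k (gam u @^-1` chart_dom i) (fun t => 'd (flow i t) u h).
Proof.
have gc := gam_geodesic p0 cM u.
have oU : open (gam u @^-1` chart_dom i).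
  by apply: curve_dom_open; exact: (gc.1 0%N).1.
elim: k => [|k IH].
  move=> t it; have [_ _ /(_ h)] := flow_variation cM it.
  exact: is_derive1_continuous.
apply/Ck_on_curveS => //; split=> [t it|].
  by have [_ _ /(_ h)[]] := flow_variation cM it.
apply: (@Ck_on_eq _ _ _ _ _ (fun t => \sum_j 'd (flow i t) u h 0 j *:
    'D_(delta_mx 0 j) (spray i) (flow i t u))) => //.
  move=> t it; have [_ _ /(_ h)[_]] := flow_variation cM it.
  rewrite derive1E => ->; rewrite derive_sum_basis//.
  exact: Ck_on_differentiable (@spray_Ck _ _ _ i 1) (tstate_dom (v := velocity (gam u) t) it).
apply/Ck_on_mxP => // a b; under eq_fun do rewrite summxE.
apply: Ck_on_sum => // j; under eq_fun do rewrite mxE.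
apply: Ck_onM => //; first by move: IH => /Ck_on_mxP; exact.
move: (Ck_on_derive (delta_mx 0 j) (@spray_Ck _ _ _ i k.+1)) => Cd.
have Cf : Ck_on k (gam u @^-1` chart_dom i) (fun t => flow i t u) by exact: geodesic_state_Ck.
have oS : open (state_dom i) by exact: state_dom_open.
have := Ck_on_comp_mx oU oS _ Cf Cd.
have dom t : (gam u @^-1` chart_dom i) t -> state_dom i (flow i t u).
  by move=> it; exact: (tstate_dom (v := velocity (gam u) t) it).
by move=> /(_ dom)/Ck_on_mxP; exact.
Qed.

Lemma jac_derive u h i t : chart_dom i (gam u t) ->
  let c := gam u in let x := chart i \o c in
  let y s := lsubmx ('d (flow i s) u h) in let y' s := rsubmx ('d (flow i s) u h) in
  is_derive t (1 : R) y (y' t) /\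
  is_derive t (1 : R) y' (- (dchristoffel i (x t) (y t) (derive1 x t) (derive1 x t)
      + 2 *: christoffel_form i (x t) (derive1 x t) (y' t))).
Proof.
move=> it c x y y'; have [_ _ /(_ h) D] := flow_variation cM it.
have iz : state_dom i (flow i t u) by exact: (tstate_dom (v := velocity (gam u) t) it).
have ix : chart_img i (x t) by exact: chart_imgP.
rewrite derive_spray// in D; rewrite flow_state// row_mxKl row_mxKr in D.
split.
  by have := is_derive_lsubmx D; rewrite row_mxKl.
have := is_derive_rsubmx D; rewrite row_mxKr.
by rewrite (christoffel_formC (rsubmx _) _ ix) -addrA -mulr2n -scaler_nat; exact.
Qed.

(** The linearized spray gives a second order equation involving derivatives of the Christoffel
    symbols. Regrouped into covariant derivatives, with the geodesic equation replacing the second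
    derivative of the curve, it becomes the Jacobi equation. *)
Lemma jac_jacobi_field u h : jacobi_field (gam u) (jac u h).
Proof.
move=> i Ji dx; have gc := gam_geodesic p0 cM u.
have oU : open (gam u @^-1` chart_dom i).
  by apply: curve_dom_open; exact: (gc.1 0%N).1.
pose y s := lsubmx ('d (flow i s) u h); pose y' s := rsubmx ('d (flow i s) u h).
have EJ s : chart_dom i (gam u s) -> Ji s = y s by exact: coord_jac.
split=> [k|t it].
  apply: (Ck_on_eq (f := y)) => // [t it|]; first by rewrite EJ.
  apply/Ck_on_mxP => // a b; under eq_fun do rewrite mxE.
  by have /Ck_on_mxP := jac_Ck k u h i; exact.
have ix : chart_img i (chart i (gam u t)) by exact: chart_imgP.
have DJ s : chart_dom i (gam u s) -> derive1 Ji s = y' s.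
  move=> is'; rewrite derive1E; apply: derive_val.
  apply: near_eq_is_derive (jac_derive h is').1.
  by near=> r; rewrite EJ//; near: r; exact: near_gam_dom.
have Ecov : {near t, (fun s => y' s + christoffel_form i (chart i (gam u s)) (dx s) (y s)) =1
    cov_deriv i (gam u) Ji}.
  near=> s; have is' : chart_dom i (gam u s) by near: s; exact: near_gam_dom.
  by rewrite /cov_deriv DJ// EJ.
have [Dy Dy'] := jac_derive h it.
have Dx := curve_is_derive (gc.1 1%N) it.
have Ddx := smooth_curve_derivable2 (gc.1 2) it.
have Dch := is_derive_christoffel_curve ix Dx Ddx Dy.
rewrite {1}/cov_deriv -(nbhs_singleton Ecov) derive1E.
have [_ ->] := near_eq_is_derive Ecov (is_deriveD Dy' Dch).
rewrite (EJ _ it) -/(y t) -/(y' t) curvatureE// -/dx (christoffel_geodesic gc it) -/dx.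
rewrite christoffel_formNl christoffel_formDr.
rewrite (dchristoffelC _ _ (dx t) ix) (christoffel_formC (christoffel_form _ _ _ _) _ ix).
rewrite (christoffel_formC (y t) (dx t) ix).
have arith (a b c d e : 'rV[R]_n) :
    - (a + 2 *: c) + (b - d + c) + (c + e) + (a - b + d - e) = 0.
  by apply/rowP => k; rewrite !mxE; ring.
exact: arith.
Unshelve. all: by end_near.
Qed.

Lemma gam_inner u t : inner (gam u t) (vec (velocity (gam u) t)) (vec (velocity (gam u) t)) =
  inner p0 u u.
Proof.
have := geodesic_speed_cst t 0 (gam_geodesic p0 cM u).
rewrite /speed !tnormE gam_velocity0// => E.
have := congr1 (fun x => x ^+ 2) E.
by rewrite !bnorm_sqr ?gam0//; exact: metric_at_posdef.
Qed.

Lemma jac0 u h : jac u h 0 = 0.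
Proof.
rewrite /jac (_ : (fun _ => _) = cst (chart (chart_at (gam u 0)) p0)) ?diff_cst//.
by apply/funext => u'; rewrite !gam0.
Qed.

(** A geodesic from [p0] keeps the speed of its initial vector. The identity between the squared
    speeds at times [t] and 0 is differentiated in the initial vector, in the direction [h], and
    halved. *)
Lemma energy_variation u h i t : chart_dom i (gam u t) ->
  let x := chart i \o gam u in let W := 'd (flow i t) u h in
  2^-1 * dmet i (x t) (lsubmx W) (derive1 x t) (derive1 x t)
    + met i (x t) (derive1 x t) (rsubmx W) = inner p0 u h.
Proof.
move=> it x W; have df := flow_differentiable it.
have ix : chart_img i (x t) by exact: chart_imgP.
have L0 : 0 *: h + u = u by rewrite scale0r add0r.
have df0 : differentiable (flow i t) (0 *: h + u) by rewrite L0.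
have D := is_derive_line df0; rewrite L0 deriveE// -/W in D.
have D2 := derive_metric_curve (i := i) _ (is_derive_lsubmx D) (is_derive_rsubmx D) (is_derive_rsubmx D).
rewrite L0 (flow_state it) row_mxKl row_mxKr -/x in D2.
have [_ E2] := D2 ix.
have Dl : is_derive (0 : R) (1 : R) (fun s : R => s *: h + u) h.
  apply: is_derive_eq (@is_derive_line _ _ _ id u h 0 _) _ => //.
  exact: derive_id.
pose g0 := metric (chart_at p0) (chart (chart_at p0) p0).
have [_ E3] := is_derive_bil (is_derive_cst g0 (0 : R) 1) Dl Dl.
have gT : g0^T = g0 by case: (metric_at_posdef p0).
have E4 : 'D_1 (fun s : R => bil g0 (s *: h + u) (s *: h + u)) 0 = 2 * inner p0 u h.
  by rewrite E3 L0 {1}/bil mulmx0 mul0mx mxE add0r (bil_sym h u gT) -mulr2n mulr_natl.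
have E5 : 'D_1 (fun s : R => bil g0 (s *: h + u) (s *: h + u)) 0 =
    'D_1 (fun s : R => met i (lsubmx (flow i t (s *: h + u))) (rsubmx (flow i t (s *: h + u)))
      (rsubmx (flow i t (s *: h + u)))) 0.
  apply: near_eq_derive.
  have nu : \forall s \near (0 : R), chart_dom i (gam (s *: h + u) t).
    have [nu _ _] := flow_variation cM it.
    have lc : {for (0 : R), continuous (fun s : R => s *: h + u)} by exact: is_derive1_continuous Dl.
    have nu' : nbhs (0 *: h + u) (fun u => chart_dom i (gam u t)) by rewrite L0.
    exact: lc nu'.
  near=> s; have is' : chart_dom i (gam (s *: h + u) t) by near: s; exact: nu.
  have -> : bil g0 (s *: h + u) (s *: h + u) = inner p0 (s *: h + u) (s *: h + u) by [].
  rewrite -(gam_inner _ t) -(inner_coord _ _ is').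
  by rewrite row_mxKl row_mxKr.
move: E5; rewrite E4 E2; change (chart i (gam u t)) with (x t).
rewrite (met_sym (rsubmx W) _ ix) => E5.
have -> : inner p0 u h = 2^-1 * (2 * inner p0 u h) by field.
by rewrite E5; field.
Unshelve. all: by end_near.
Qed.

(** By the geodesic equation and Koszul's formula the time derivative of the left side is the
    expression of [energy_variation], hence the constant [inner p0 u h]; the field vanishes at time
    0. *)
Lemma gauss_lemma u h t :
  inner (gam u t) (vec (velocity (gam u) t)) (jac u h t) = t * inner p0 u h.
Proof.
pose f t := inner (gam u t) (vec (velocity (gam u) t)) (jac u h t) - t * inner p0 u h.
suff : f t = f 0.
  rewrite /f jac0 mul0r subr0 => /eqP; rewrite subr_eq => /eqP ->.
  by rewrite /inner trmx0 mulmx0 mxE add0r.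
apply: is_derive0_cst => {}t; set i := chart_at (gam u t).
have it : chart_dom i (gam u t) by exact: chart_atP.
have gc := gam_geodesic p0 cM u.
pose x := chart i \o gam u; have ix : chart_img i (x t) by exact: chart_imgP.
pose W s := 'd (flow i s) u h.
have Ef : {near t, (fun s => met i (x s) (derive1 x s) (lsubmx (W s)) - s * inner p0 u h) =1 f}.
  near=> s; have is' : chart_dom i (gam u s) by near: s; exact: near_gam_dom.
  rewrite /f -(inner_coord _ _ is') coord_jac// -/(velocity (gam u) s).
  by have [_ ->] := eq_row_mx (flow_state is').
apply: near_eq_is_derive Ef _.
have [Dy _] := jac_derive h it.
have D := derive_metric_curve ix (curve_is_derive (gc.1 1%N) it)
  (smooth_curve_derivable2 (gc.1 2) it) Dy.
have Di : is_derive t (1 : R) (fun s : R => s * inner p0 u h) (inner p0 u h).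
  have Did : is_derive t (1 : R) id 1 by exact: is_derive_id.
  apply: is_derive_eq (is_derive_mul Did (is_derive_cst (inner p0 u h) t 1)) _.
  by rewrite mul1r mulr0 addr0.
apply: is_derive_eq (is_deriveB D Di) _.
have := energy_variation h it; rewrite /= -/(x t) -/x => <-.
rewrite (christoffel_geodesic gc it) /met bilNl -/(met i (x t) _ _) -/x koszul//.
change (chart i (gam u t)) with (x t).
by field.
Unshelve. all: by end_near.
Qed.

End jacobi.

(** * Local invertibility of the exponential map *)

Section exponential.
Context {R : realType} {n : nat} {M : riemannian_manifold R n}.
Implicit Types (i j : chart_index M) (p : M) (c : R -> M) (u v w h : 'rV[R]_n).
Variable (p0 : M).
Hypothesis cM : complete_manifold M.

Local Notation gam := (@gam R n M p0).
Local Notation flow := (@flow R n M p0).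
Local Notation jac := (@jac R n M p0).

Lemma continuous_near (S T : topologicalType) (f : S -> T) (V : set T) x :
  {for x, continuous f} -> open V -> V (f x) -> \forall y \near x, V (f y).
Proof. by move=> cf oV Vx; apply: cf; exact: near_open. Qed.

Lemma diff_line_eq (V W : normedModType R) (f : V -> W) (a b : V) (d : W) :
  differentiable f a -> is_derive (0 : R) (1 : R) (fun s : R => f (s *: b + a)) d ->
  'd f a b = d.
Proof.
move=> df [_ <-]; have L0 : 0 *: b + a = a by rewrite scale0r add0r.
have df0 : differentiable f (0 *: b + a) by rewrite L0.
by have [_ ->] := is_derive_line df0; rewrite L0 deriveE.
Qed.

Lemma diff_comp_scale (V W : normedModType R) (f : V -> W) (a b : V) (T : R) :
  differentiable f (T *: a) -> 'd (fun x => f (T *: x)) a b = 'd f (T *: a) (T *: b).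
Proof.
move=> df; have Ds := is_diff_scaler T a.
have ds : differentiable ( *:%R T : V -> V) a by exact: ex_diff.
have E := congr1 (fun l => l b) (diff_comp ds df); apply: etrans E _.
by have [_ E'] := Ds; rewrite /= E'.
Qed.

Lemma coord0 i p : coord i (TangentVector p 0) = 0.
Proof. by rewrite coordE linear0. Qed.

Lemma coord_lin i p (k : R) u w : coord i (TangentVector p (k *: u + w)) =
  k *: coord i (TangentVector p u) + coord i (TangentVector p w).
Proof. by rewrite !coordE linearP. Qed.

Lemma dflow0 i u h : chart_dom i p0 ->
  'd (flow i 0) u h = row_mx 0 (coord i (TangentVector p0 h)).
Proof.
move=> ip; have iu : chart_dom i (gam u 0) by rewrite gam0.
have df := flow_differentiable cM iu.
apply: diff_line_eq => //.
have -> : (fun s : R => flow i 0 (s *: h + u)) =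
    fun s => row_mx (chart i p0) (s *: coord i (TangentVector p0 h) + coord i (TangentVector p0 u)).
  by apply/funext => s; rewrite flow0// coord_lin.
apply: is_derive_row_mx.
apply: is_derive_eq (@is_derive_line _ _ _ id (coord i (TangentVector p0 u)) (coord i (TangentVector p0 h)) 0 _) _ => //.
exact: derive_id.
Qed.

Lemma gam_scale u (k t : R) : gam (k *: u) t = gam u (k * t).
Proof. exact: geodesic_of_scale. Qed.

(** Conjugate points are defined along unit speed geodesics, so an initial vector must be
    normalized, at the cost of rescaling time. *)
Lemma jac_scale u h (T t : R) : T != 0 -> jac (T *: u) h t = jac u (T^-1 *: h) (T * t).
Proof.
move=> T0; rewrite /jac gam_scale; set j := chart_at _.
have jt : chart_dom j (gam (T *: u) t) by rewrite gam_scale; exact: chart_atP.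
have df := chart_gam_differentiable cM jt.
have -> : (fun u' => chart j (gam u' (T * t))) = (fun u' => chart j (gam (T *: u') t)).
  by apply/funext => u' /=; rewrite gam_scale.
have E : 'd (fun u' => chart j (gam (T *: u') t)) u (T^-1 *: h) =
    'd (fun u' => chart j (gam u' t)) (T *: u) (T *: (T^-1 *: h)) := diff_comp_scale _ df.
have TT : T *: (T^-1 *: h) = h by rewrite scalerA (divff T0) scale1r.
exact: esym (etrans E (congr1 ('d (fun u' => chart j (gam u' t)) (T *: u)) TT)).
Qed.

Lemma jac_eq0 u h i t : chart_dom i (gam u t) ->
  (jac u h t == 0) = ('d (fun u' => chart i (gam u' t)) u h == 0).
Proof.
move=> it; rewrite -lsubmx_dflow// -coord_jac//; apply/eqP/eqP => [->|E].
  by rewrite coord0.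
by apply: (coord_inj it); rewrite E coord0.
Qed.

Hypothesis ncp : no_conjugate_points M.

(** For [u = 0] the geodesic is constant and has no unit speed reparametrization; there the
    differential of the exponential map is the identity. Otherwise the normalized field vanishes at
    times 0 and [T], hence identically, and its derivative at 0 is [k], a nonzero multiple of
    [h]. *)
Lemma jac_nondegenerate u h : jac u h 1 = 0 -> h = 0.
Proof.
have [->|u0] := eqVneq u 0 => J0.
  have i0 : chart_dom (chart_at (gam 0 1)) (gam 0 1) by exact: chart_atP.
  move: i0; set i := chart_at _ => i0.
  have /eqP := J0; rewrite (jac_eq0 _ i0) => /eqP E.
  have df := chart_gam_differentiable cM i0.
  have G0 s : gam (s *: h + 0) 1 = gam h s by rewrite addr0 gam_scale mulr1.
  have ip : chart_dom i (gam h 0) by rewrite -(G0 0) scale0r addr0.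
  have gc := gam_geodesic p0 cM h.
  have Dh := curve_is_derive (gc.1 1%N) ip; have [D _] := Dh.
  have D0 : derive1 (chart i \o gam h) 0 = 0.
    have DL : is_derive (0 : R) (1 : R) (fun s : R => chart i (gam (s *: h + 0) 1))
        (derive1 (chart i \o gam h) 0) by under eq_fun do rewrite G0.
    by rewrite -E; exact: esym (diff_line_eq df DL).
  have := coord_velocity ((gc.1 0%N).1 0) ip D.
  rewrite D0 gam_velocity0// => E0; apply: (@coord_inj _ _ _ i p0).
    by move: ip; rewrite gam0.
  by rewrite E0 coord0.
have gp := metric_at_posdef p0.
have T0 : 0 < tnorm p0 u.
  rewrite lt_neqAle eq_sym; apply/andP; split; last exact: sqrtr_ge0.
  by apply: contra_neq u0; rewrite tnormE; exact: bnorm_eq0.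
have {T0}[T T0 ET] : exists2 T : R, 0 < T & tnorm p0 u = T by exists (tnorm p0 u).
have T1 : T != 0 by rewrite gt_eqF.
pose v := T^-1 *: u; pose k := T^-1 *: h.
have uv : u = T *: v by rewrite scalerA divff// scale1r.
have ug : unit_geodesic (gam v).
  split; first exact: gam_geodesic.
  move=> t; rewrite (geodesic_speed_cst t 0 (gam_geodesic p0 cM v)) /speed gam_velocity0//.
  by rewrite gam0// tnormZ ET ger0_norm ?invr_ge0 ?(ltW T0)// mulVf.
have JT : jac v k T = 0.
  by have E := jac_scale v h 1 T1; rewrite -uv J0 mulr1 in E; exact: esym E.
have J0' : jac v k 0 = 0 by exact: jac0.
have Jz r : jac v k r = 0.
  have T2 : 0 != T by rewrite eq_sym.
  exact: (ncp ug (jac_jacobi_field p0 cM v k) T2 J0' JT).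
have k0 : k = 0.
  set i := chart_at p0; have ip : chart_dom i p0 by exact: chart_atP.
  have iv : chart_dom i (gam v 0) by rewrite gam0.
  have [Dy _] := jac_derive cM k iv.
  have [_] : is_derive (0 : R) (1 : R) (fun s => lsubmx ('d (flow i s) v k)) 0.
    have Dz : is_derive (0 : R) (1 : R) (cst (0 : 'rV[R]_n)) 0 by exact: is_derive_cst.
    apply: near_eq_is_derive Dz; near=> s; rewrite -(coord_jac cM k (_ : chart_dom i (gam v s))) ?Jz ?coord0//.
    by near: s; exact: near_gam_dom.
  have [_ ->] := Dy; rewrite dflow0// row_mxKr => E0.
  by apply: (coord_inj ip); rewrite E0 coord0.
have := congr1 ( *:%R T) k0; rewrite scalerA divff// scale1r => ->.
by rewrite scaler0.
Unshelve. all: by end_near.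
Qed.

Definition gexp u : M := gam u 1.

Lemma gexp_scale u t : gexp (t *: u) = gam u t.
Proof. by rewrite /gexp gam_scale mulr1. Qed.

Lemma gexp0 : gexp 0 = p0.
Proof. by rewrite -(scale0r 0) gexp_scale gam0. Qed.

Lemma gexp_continuous : continuous gexp.
Proof.
move=> u; have iu := chart_atP (gam u 1); set i := chart_at _ in iu.
have [ni _ _] := flow_variation cM iu.
have dc := differentiable_continuous (chart_gam_differentiable cM iu).
have cc : {for u, continuous (fun u => chart_inv i (chart i (gam u 1)))}.
  apply: (@continuous_comp _ _ _ (fun u => chart i (gam u 1)) (chart_inv i)); first exact: dc.
  by apply: chart_inv_continuous_at; exact: chart_imgP.
move=> V nV.
have nV' : nbhs (chart_inv i (chart i (gam u 1))) V by rewrite chartK.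
have nn : \forall u' \near u, V (chart_inv i (chart i (gam u' 1))) by exact: cc nV'.
have : \forall u' \near u, V (gexp u').
  near=> u'; rewrite /gexp -(chartK (i := i) (p := gam u' 1)); first by near: u'.
  by near: u'.
by [].
Unshelve. all: by end_near.
Qed.

(* The coordinate expression of the exponential map has an invertible
   differential, because its kernel consists of Jacobi fields vanishing twice. *)
Lemma gexp_chart_invertible u i : chart_dom i (gexp u) -> exists W U g,
  [/\ open W /\ W u, open U,
     forall y, U y -> [/\ W (g y), chart i (gexp (g y)) = y & {for y, continuous g}],
     forall x', W x' -> U (chart i (gexp x')) /\ g (chart i (gexp x')) = x' &
     differentiable g (chart i (gexp u))].
Proof.
move=> iu; have [_ [L sL] _] := flow_variation cM iu.
have sL' : strict_diff (fun u => chart i (gexp u)) u (lsubmx L).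
  move=> e e0; have := sL e e0; apply: filterS => d H y z yb zb.
  apply: le_trans (H y z yb zb); rewrite mulmx_lsub.
  have -> : chart i (gexp y) - chart i (gexp z) - lsubmx ((y - z) *m L) =
      lsubmx (flow i 1 y - flow i 1 z - (y - z) *m L).
    by rewrite !linearB /= -!lsubmx_flow.
  by apply: mx_norm_le => // a b; rewrite mxE; exact: mx_entry_le_norm.
have [dF E] := strict_diff_is_diff sL'.
have uL : lsubmx L \in unitmx.
  rewrite -row_free_unit -kermx_eq0; apply/rowV0P => w /sub_kermxP Lw.
  apply: (@jac_nondegenerate u w); apply/eqP; rewrite (jac_eq0 _ iu); apply/eqP.
  have := congr1 (fun f => f w) E; rewrite /= Lw => <-.
  by [].
have [W [U [g [h1 h2 h3 h4 [h5 _]]]]] := strict_diff_invertible uL sL'.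
by exists W, U, g; split.
Qed.

Lemma gexp_locally_invertible u : locally_invertible gexp u.
Proof.
have iu : chart_dom (chart_at (gexp u)) (gexp u) by exact: chart_atP.
set i := chart_at _ in iu.
have [W [U [g [[oW Wu] oU h3 h4 _]]]] := gexp_chart_invertible iu.
pose V := gexp @^-1` chart_dom i.
have oV : open V by apply: open_comp => [x _|]; [exact: gexp_continuous|exact: chart_dom_open].
pose U' : set M := [set y | [/\ chart_dom i y, U (chart i y) & V (g (chart i y))]].
have gc y : U' y -> {for y, continuous (g \o chart i)}.
  move=> [iy Uy _]; apply: continuous_comp; first exact: chart_continuous_at.
  by have [] := h3 _ Uy.
exists (W `&` V), U', (g \o chart i); split.
- by split; [exact: openI|split].
- rewrite openE => y U'y; have [iy Uy Vy] := U'y.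
  have n1 := near_chart_dom iy.
  have n2 : \forall z \near y, U (chart i z).
    by apply: continuous_near (chart_continuous_at iy) _ _.
  have n3 : \forall z \near y, V ((g \o chart i) z).
    by apply: continuous_near (gc _ U'y) _ _.
  by rewrite /interior; near=> z; split; near: z.
- move=> y U'y; have [iy Uy Vy] := U'y; have [Wg Eg _] := h3 _ Uy; split.
  + by split.
  + by rewrite /= -[LHS](chartK (i := i))// Eg chartK.
  + exact: gc.
- move=> x' [Wx Vx]; have [Ux gx] := h4 _ Wx.
  by split; [split => //; rewrite gx|].
Unshelve. all: by end_near.
Qed.

(** By continuity, near [t] the lift is a local inverse of the exponential map, differentiable at
    the point concerned, applied to the coordinates of [c]. *)
Lemma gexp_lift_derivable (c : R -> M) (g : R -> 'rV[R]_n) t i :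
  {for t, continuous g} -> (\forall s \near t, gexp (g s) = c s) ->
  chart_dom i (c t) -> derivable (chart i \o c) t 1 ->
  exists2 dg, is_derive t (1 : R) g dg &
    'd (fun u => chart i (gexp u)) (g t) dg = derive1 (chart i \o c) t.
Proof.
move=> gc E it D; have Et := nbhs_singleton E.
have iu : chart_dom i (gexp (g t)) by rewrite Et.
have [W [U [h [[oW Wu] oU h3 h4 dh]]]] := gexp_chart_invertible iu.
have nW : \forall s \near t, W (g s) by exact: continuous_near gc oW Wu.
have Eg : {near t, h \o (chart i \o c) =1 g}.
  near=> s; have Es : gexp (g s) = c s by near: s.
  by rewrite /= -Es; have [] := h4 (g s); first near: s.
have Dc : is_derive t (1 : R) (chart i \o c) (derive1 (chart i \o c) t).
  by rewrite derive1E; exact/derivableP.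
rewrite Et in dh.
have Dg := near_eq_is_derive Eg (is_derive_comp_curve Dc dh).
eexists; first exact: Dg.
have df : differentiable (fun u => chart i (gexp u)) (g t) := chart_gam_differentiable cM iu.
have [_ E2] := is_derive_comp_curve Dg df.
rewrite -(deriveE _ df) -E2 derive1E; apply: near_eq_derive.
by near=> s; rewrite /=; congr (chart i _); near: s.
Unshelve. all: by end_near.
Qed.

Lemma tnorm_sqr p u : tnorm p u ^+ 2 = inner p u u.
Proof. by rewrite tnormE bnorm_sqr//; exact: metric_at_posdef. Qed.

Lemma inner_cauchy_schwarz p u w : `|inner p u w| <= tnorm p u * tnorm p w.
Proof. by rewrite !tnormE; apply: cauchy_schwarz_bil; exact: metric_at_posdef. Qed.

(** By the Gauss lemma the left side is the inner product of the velocity of [c] with that of the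
    radial geodesic at time 1, whose norm is [tnorm p0 (g t)]; Cauchy-Schwarz then bounds the growth
    of the norm of a lift by the speed of [c]. *)
Lemma gexp_lift_radial (c : R -> M) (g : R -> 'rV[R]_n) t :
  {for t, continuous g} -> (\forall s \near t, gexp (g s) = c s) ->
  derivable (chart (chart_at (c t)) \o c) t 1 ->
  exists2 dg, is_derive t (1 : R) g dg &
    inner p0 (g t) dg <= tnorm p0 (g t) * speed c t.
Proof.
move=> gc E D; have it := chart_atP (c t).
have [dg Dg Ed] := gexp_lift_derivable gc E it D; exists dg => //.
have Et := nbhs_singleton E.
have := gauss_lemma p0 cM (g t) dg 1; rewrite mul1r => <-.
have Ej : jac (g t) dg 1 = vec (velocity c t).
  by rewrite /jac -/(gexp (g t)) Et; exact: Ed.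
rewrite Ej; apply: le_trans (ler_norm _) _.
apply: le_trans (inner_cauchy_schwarz _ _ _) _.
rewrite -[gam (g t) 1]/(gexp (g t)) Et /speed.
apply: ler_pM => //; try exact: sqrtr_ge0.
have := gam_inner p0 cM (g t) 1; rewrite -!tnorm_sqr -[gam (g t) 1]/(gexp (g t)) Et.
by move=> /eqP; rewrite eqrXn2 ?sqrtr_ge0// => /eqP ->.
Qed.

End exponential.

(** * Lifting curves through the exponential map *)

Section lifts_with_compact_range.
Context {R : realType} {X Y : topologicalType} (f : X -> Y).
Hypotheses (hY : hausdorff_space Y) (cf : continuous f).
Hypothesis lf : forall x, locally_invertible f x.

Definition partial_lift (c : R -> Y) (a t : R) (x : X) (g : R -> X) :=
  [/\ continuous g, g a = x & forall s, a <= s <= t -> f (g s) = c s].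

Lemma partial_lift_extend (c : R -> Y) (a s1 s2 : R) (x : X) (g : R -> X)
    (U : set Y) (h : Y -> X) :
  continuous c -> a <= s1 -> s1 <= s2 -> partial_lift c a s1 x g ->
  (forall y, U y -> f (h y) = y /\ {for y, continuous h}) -> h (c s1) = g s1 ->
  (forall s, s1 <= s <= s2 -> U (c s)) -> exists g', partial_lift c a s2 x g'.
Proof.
move=> cc as1 s12 [cg ga fg] Hh hs Uc0.
have Uc u : U (c (clamp s1 s2 u)) by apply: Uc0; exact: clamp_itv.
exists (fun u => if u <= s1 then g u else h (c (clamp s1 s2 u))); split.
- apply: glue_continuous => //.
    move=> u; apply: (@continuous_comp _ _ _ (c \o clamp s1 s2) h).
      by apply: continuous_comp; [exact: clamp_continuous|exact: cc].
    exact: (Hh _ (Uc u)).2.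
  by rewrite clamp_id ?lexx// -hs.
- by rewrite as1.
- move=> u /andP[au us2]; case: leP => us1; first by apply: fg; rewrite au.
  by rewrite (Hh _ (Uc u)).1 clamp_id// us2 ltW.
Qed.

(** At a limit time [t] the ends of lifts over [[a, s]], with [s < t], have a cluster point [x'] in
    [K], which lies over [c t] because [Y] is Hausdorff. A local inverse at [x'] continues up to [t]
    one lift whose end is close enough to [x']; the lifts chosen for different [s] may disagree. *)
Lemma lift_of_compact (c : R -> Y) (a b : R) (x : X) (K : set X) :
  continuous c -> f x = c a -> a <= b -> compact K ->
  (forall t g, a <= t <= b -> partial_lift c a t x g -> K (g t)) ->
  exists g, partial_lift c a b x g.
Proof.
move=> cc fx ab cK HK.
suff : forall t, a <= t <= b -> exists g, partial_lift c a t x g by apply; rewrite ab lexx.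
apply: interval_induction.
- exists (cst x); split => //; first exact: cst_continuous.
  by move=> s; rewrite -eq_le => /eqP <-.
- move=> t /andP[at' tb] HP; have [|g pg] := HP t; first by rewrite at' lexx.
  have [cg ga fg] := pg; have ft : f (g t) = c t by apply: fg; rewrite at' lexx.
  have [W [U [h [[oW Wg] oU H1 H2]]]] := lf (g t).
  have [Ut ht] := H2 _ Wg; rewrite ft in Ut ht.
  have [d d0 Hd] := near_dist (continuous_near (cc t) oU Ut).
  exists d => // s /andP[ts sd] sb.
  apply: (partial_lift_extend cc at' ts pg (U := U) (h := h)) => //.
    by move=> y /H1[].
  move=> r /andP[tr rs]; apply: Hd; rewrite ger0_norm ?subr_ge0//.
  by rewrite ltrBlDl (le_lt_trans rs).
move=> t /andP[at' tb] HP.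
have /choice[G GP] : forall s, exists g, a <= s < t -> partial_lift c a s x g.
  move=> s; have [/HP[g pg]|ns] := pselect (a <= s < t); first by exists g.
  by exists (cst x).
pose u s := G s s.
have fu s : a <= s < t -> f (u s) = c s.
  by move=> st; have [_ _ H] := GP _ st; apply: H; rewrite lexx; case/andP: st => ->.
have nt : \forall s \near t^'-, a <= s < t.
  near=> s; apply/andP; split; first by apply: ltW; near: s; exact: nbhs_left_gt.
  by near: s; exact: nbhs_left_lt.
have FK : (u @ t^'-) K.
  have : \forall s \near t^'-, K (u s); last by [].
  apply: filterS nt => s st; apply: HK (GP _ st).
  by case/andP: st => -> /ltW st; rewrite (le_trans st).
have [x' [_ clx]] := cK _ _ FK.
have fx' : f x' = c t.
  apply: contrapT => /eqP ne; have := hY; rewrite open_hausdorff => /(_ _ _ ne).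
  case=> -[A B]/= [+ +] [oA oB AB]; rewrite !inE => Ax Bt.
  have nB : \forall s \near t^'-, B (c s).
    by apply: (@cvg_within _ (nbhs t)); exact: continuous_near (cc t) oB Bt.
  have FV : (u @ t^'-) [set y | exists2 s, a <= s < t /\ B (c s) & y = u s].
    have : \forall s \near t^'-, exists2 s', a <= s' < t /\ B (c s') & u s = u s'; last by [].
    by apply: filterS2 nt nB => s h1 h2; exists s.
  have [y [[s [st Bs] ys] Ay]] := clx _ _ FV (continuous_near (cf (x := x')) oA Ax).
  have : (A `&` B) (c s) by split; [rewrite -fu// -ys|].
  by rewrite (eqP AB).
have [W [U [h [[oW Wg] oU H1 H2]]]] := lf x'.
have [Ut _] := H2 _ Wg; rewrite fx' in Ut.
have [d d0 Hd] := near_dist (continuous_near (cc t) oU Ut).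
have FV : (u @ t^'-) [set y | exists2 s, a <= s < t /\ t - d < s & y = u s].
  have : \forall s \near t^'-, exists2 s', a <= s' < t /\ t - d < s' & u s = u s'; last by [].
  have nd : \forall s \near t^'-, t - d < s by apply: nbhs_left_gt; rewrite ltrBlDr ltrDl.
  by apply: filterS2 nt nd => s h1 h2; exists s.
have [y [[s [st sd] ys] Wy]] := clx _ _ FV (near_open oW Wg).
rewrite ys in Wy; have /andP[as' st'] := st.
apply: (partial_lift_extend cc as' (ltW st') (GP _ st) (U := U) (h := h)).
- by move=> z /H1[].
- by rewrite -(fu _ st); have [] := H2 _ Wy.
- move=> r /andP[sr rt]; apply: Hd; rewrite distrC ger0_norm ?subr_ge0//.
  by rewrite ltrBlDr -ltrBlDl (lt_le_trans sd).
Unshelve. all: by end_near.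
Qed.

End lifts_with_compact_range.

Section exponential_lifts.
Context {R : realType} {n : nat} {M : riemannian_manifold R n}.
Implicit Types (i j : chart_index M) (p : M) (c : R -> M) (u v w h : 'rV[R]_n).
Variable (p0 : M).
Hypothesis cM : complete_manifold M.
Hypothesis ncp : no_conjugate_points M.

Local Notation gexp := (@gexp R n M p0).
Local Notation tn := (@tnorm R n M p0).

Lemma tnorm_ge0 p u : 0 <= tnorm p u. Proof. exact: sqrtr_ge0. Qed.

Lemma inner_continuous p : continuous (fun u => inner p u u).
Proof. by move=> u; exact: bil_continuous. Qed.

Lemma tnorm_continuous p : continuous (fun u => tnorm p u).
Proof.
move=> u; apply: (@continuous_comp _ _ _ (fun u => inner p u u) Num.sqrt).
  exact: inner_continuous.
exact: sqrt_continuous.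
Qed.

Lemma tnorm_ball_compact p (r : R) : compact [set u | tnorm p u <= r].
Proof.
have [k k0 Hk] := bnorm_lower (metric_at_posdef p).
apply: bounded_closed_compact.
  exists (r / k); split=> [|m rm u /= ur]; first exact: num_real.
  apply: le_trans (ltW rm); rewrite ler_pdivlMr// mulrC.
  by apply: le_trans (Hk u) _; rewrite -tnormE.
have -> : [set u | tnorm p u <= r] = (fun u => tnorm p u) @^-1` [set t | t <= r] by [].
by apply: closed_comp => [u _|]; [exact: tnorm_continuous|exact: closed_le].
Qed.

(* [sqrt (|g|^2 + e^2)] is used in place of [|g|], which need not be
   differentiable where [g] vanishes. *)
Lemma lift_norm_bound (c : R -> M) (g : R -> 'rV[R]_n) (I : R -> R) (a b : R) :
  a <= b -> continuous g -> {within `[a, b], continuous I} ->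
  (forall t, a < t < b -> [/\ \forall s \near t, gexp (g s) = c s,
     derivable (chart (chart_at (c t)) \o c) t 1 &
     exists2 d, is_derive t (1 : R) I d & speed c t <= d]) ->
  tn (g b) - tn (g a) <= I b - I a.
Proof.
move=> ab cg cI H; apply/ler_addgt0Pr => e e0.
pose q t := inner p0 (g t) (g t) + e ^+ 2.
have q0 t : 0 < q t by rewrite ltr_wpDl ?exprn_gt0// -tnorm_sqr sqr_ge0.
pose phi t := Num.sqrt (q t).
have phi0 t : 0 < phi t by rewrite sqrtr_gt0.
have tphi t : tn (g t) <= phi t.
  by rewrite ler_wsqrtr// lerDl sqr_ge0.
have phit t : phi t <= tn (g t) + e.
  rewrite -(@ler_pXn2r _ 2) ?nnegrE ?(ltW (phi0 _)) ?addr_ge0 ?tnorm_ge0 ?(ltW e0)//.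
  rewrite sqr_sqrtr ?(ltW (q0 _))// sqrrD tnorm_sqr /q lerD2r lerDl.
  by rewrite mulrn_wge0// mulr_ge0 ?tnorm_ge0// ltW.
suff : phi b - phi a <= I b - I a.
  by move=> h; have := tphi b; have := phit a; lra.
have cphi : continuous phi.
  move=> t; apply: (@continuous_comp _ _ _ q Num.sqrt); last exact: sqrt_continuous.
  apply: continuousD; last exact: cvg_cst.
  by apply: (@continuous_comp _ _ _ g (fun u => inner p0 u u)); [exact: cg|exact: inner_continuous].
(* [I - phi] is nondecreasing: the derivative of [phi] is [inner p0 (g t) dg / phi t], at most the
   speed because [tn (g t) <= phi t]. *)
have D t : a < t < b -> exists2 d : R, 0 <= d & is_derive t (1 : R) (fun t => I t - phi t) d.
  move=> /H[Ht Dc [d DI dc]].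
  have [dg Dg radial] := gexp_lift_radial cM ncp (cg t) Ht Dc.
  set g0 := metric (chart_at p0) (chart (chart_at p0) p0).
  have gT : g0^T = g0 by case: (metric_at_posdef p0).
  have Dq : is_derive t (1 : R) q (2 * inner p0 (g t) dg).
    apply: is_derive_eq (is_deriveD (is_derive_bil (is_derive_cst g0 t 1) Dg Dg)
      (is_derive_cst (e ^+ 2) t 1)) _.
    by rewrite addr0 {1}/bil mulmx0 mul0mx mxE add0r (bil_sym _ _ gT) -mulr2n mulr_natl.
  have Dphi : is_derive t (1 : R) phi (inner p0 (g t) dg / phi t).
    have [ds Es] := is_derive1_sqrt (q0 t).
    have dsq : differentiable Num.sqrt (q t) by exact/derivable1_diffP.
    apply: is_derive_eq (is_derive_comp_curve Dq dsq) _.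
    rewrite deriveE//.
    have -> : 2 * inner p0 (g t) dg = (2 * inner p0 (g t) dg) *: (1 : R) by rewrite [RHS]mulr1.
    rewrite linearZ -deriveE// Es /= -/(phi t).
    have := phi0 t; move: (phi t) (inner _ _ _) => x y x0.
    rewrite [LHS](_ : _ = 2 * y * (2 * x)^-1) //.
    by field; rewrite gt_eqF.
  exists (d - inner p0 (g t) dg / phi t); last exact: is_deriveB.
  rewrite subr_ge0 ler_pdivrMr//; apply: le_trans radial _; rewrite mulrC.
  by apply: ler_pM => //; [exact: sqrtr_ge0|exact: tnorm_ge0].
have := @ger0_derive1_le_cc _ (fun t => I t - phi t) a b.
move=> /(_ _ _ _ a b); rewrite !in_itv/= !lexx ab => HH.
have : I a - phi a <= I b - phi b.
  apply: HH => //.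
  - by move=> x; rewrite in_itv/= => /D[d _ []].
  - by move=> x; rewrite in_itv/= derive1E => /D[d d0 [_ ->]].
  - move=> x; apply: continuousB; first exact: cI.
    by apply: continuous_subspaceT; exact: cphi.
by move: (I a) (I b) (phi a) (phi b) => *; lra.
Qed.

Lemma metric_bound i x : chart_img i x -> exists2 C : R, 0 <= C &
  \forall y \near x, forall w, bnorm (metric i y) w <= C * `|w|.
Proof.
move=> ix; set C := n%:R * n%:R * (`|metric i x| + 1).
have C0 : 0 <= C by rewrite /C mulr_ge0 ?mulr_ge0 ?addr_ge0.
exists (Num.sqrt C); first exact: sqrtr_ge0.
have cm : {for x, continuous (metric i)} by exact: (@metric_smooth _ _ M i 0%N).
have n1 : \forall y \near x, `|metric i y| < `|metric i x| + 1.
  have cn : {for x, continuous (fun y => `|metric i y|)}.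
    by apply: (@continuous_comp _ _ _ (metric i) (fun m => `|m|)); [exact: cm|exact: norm_continuous].
  apply: (continuous_near cn (@open_lt _ _)); rewrite /= ltrDl; exact: ltr01.
have n2 : \forall y \near x, chart_img i y by apply: near_open ix; exact: chart_img_open.
near=> y => w; have iy : chart_img i y by near: y.
have gp : posdef (metric i y) by case: iy => p ip <-; exact: metric_posdef.
have [H|//] := bnorm_upper (metric i y) w.
have b0 := bnorm_ge0 (metric i y) w.
rewrite -(@ler_pXn2r _ 2) ?nnegrE ?mulr_ge0 ?sqrtr_ge0//.
apply: le_trans H _; rewrite exprMn sqr_sqrtr// ler_wpM2r ?sqr_ge0//.
rewrite /C ler_wpM2l ?mulr_ge0// ltW//; near: y; exact: n1.
Unshelve. all: by end_near.
Qed.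

(** Straight in coordinates rather than geodesic: its coordinate velocity is constant, so its speed
    is bounded where the metric is. *)
Definition segment i (a b : 'rV[R]_n) (t : R) : M := chart_inv i (t *: (b - a) + a).

Lemma coordinate_ball i y : chart_dom i y -> exists2 r : R, 0 < r & exists2 C : R, 0 <= C &
  forall x, ball (chart i y) r x -> chart_img i x /\ forall w, bnorm (metric i x) w <= C * `|w|.
Proof.
move=> iy; have [C C0 nC] := metric_bound (chart_imgP iy).
have ni : \forall x \near chart i y, chart_img i x.
  by apply: near_open; [exact: chart_img_open|exact: chart_imgP].
have nn : \forall x \near chart i y, chart_img i x /\ forall w, bnorm (metric i x) w <= C * `|w|.
  exact: filterI ni nC.
by have /nbhs_ballP[r /= r0 Hr] := nn; exists r => //; exists C.
Qed.

Lemma is_derive_segment i a b t : chart_img i (t *: (b - a) + a) ->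
  is_derive t (1 : R) (chart i \o segment i a b) (b - a).
Proof.
move=> it; have Dl : is_derive t (1 : R) (fun s : R => s *: (b - a) + a) (b - a).
  apply: is_derive_eq (@is_derive_line _ _ _ id a (b - a) t _) _ => //.
  exact: derive_id.
have cl := is_derive1_continuous Dl.
apply: near_eq_is_derive Dl.
have : \forall s \near t, chart_img i (s *: (b - a) + a).
  by apply: (continuous_near cl) it; exact: chart_img_open.
by apply: filterS => s is'; rewrite /= chart_invK.
Qed.

Lemma segment_continuous i a b t : chart_img i (t *: (b - a) + a) ->
  {for t, continuous (segment i a b)}.
Proof.
move=> it; have Dl : is_derive t (1 : R) (fun s : R => s *: (b - a) + a) (b - a).
  apply: is_derive_eq (@is_derive_line _ _ _ id a (b - a) t _) _ => //.
  exact: derive_id.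
apply: (@continuous_comp _ _ _ (fun s : R => s *: (b - a) + a) (chart_inv i)).
  exact: is_derive1_continuous Dl.
exact: chart_inv_continuous_at.
Qed.

(** The section through [x] sends [z] to the end of the lift of the coordinate segment from [gexp x]
    to [z]. The length of the segment is bounded, so its lift stays in a compact ball and exists up
    to time 1; continuity in [z] is that of families of lifts. *)
Lemma gexp_evenly_sectioned : @evenly_sectioned _ M gexp.
Proof.
move=> y; have iy := chart_atP y; set i := chart_at y in iy.
have [r r0 [C C0 Hr]] := coordinate_ball iy.
pose U : set M := [set z | chart_dom i z /\ ball (chart i y) r (chart i z)].
have oU : open U.
  rewrite openE => z [iz bz]; rewrite /interior.
  apply: filterI; first exact: near_chart_dom.
  by apply: (continuous_near (chart_continuous_at iz)) bz; exact: ball_open.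
exists U; split => //; first by split => //; exact: ballxx.
move=> x [ix bx]; set a := chart i (gexp x).
have inb z t : U z -> 0 <= t <= 1 -> ball (chart i y) r (t *: (chart i z - a) + a).
  by move=> [_ bz] t01; exact: ball_convex.
pose cz z t := segment i a (chart i z) (clamp 0 1 t).
have cl01 t : 0 <= clamp (0 : R) 1 t <= 1 by apply: clamp_itv.
have ccz z : U z -> continuous (cz z).
  move=> Uz t; apply: (@continuous_comp _ _ _ (clamp 0 1) (segment i a (chart i z))).
    exact: clamp_continuous.
  by apply: segment_continuous; have [] := Hr _ (inb _ _ Uz (cl01 t)).
have cz0 z : gexp x = cz z 0.
  by rewrite /cz clamp_id ?lexx ?ler01// /segment scale0r add0r chartK.
have cz1 z : U z -> cz z 1 = z.
  move=> [iz _]; rewrite /cz clamp_id ?lexx ?ler01// /segment scale1r subrK chartK//.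
have lift z : U z -> exists g, partial_lift gexp (cz z) 0 1 x g.
  (* The initial norm plus a bound on the length of the segment. *)
  move=> Uz; pose B := tn x + C * `|chart i z - a|.
  apply: (@lift_of_compact _ _ M gexp _ _ _ (cz z) 0 1 x [set u | tn u <= B]).
  - exact: manifold_hausdorff.
  - exact: gexp_continuous.
  - exact: gexp_locally_invertible.
  - exact: ccz.
  - exact: cz0.
  - exact: ler01.
  - exact: tnorm_ball_compact.
  move=> t g /andP[t0 t1] [cg g0 fg] /=.
  have cI : {within `[0, t], continuous (fun s : R => C * `|chart i z - a| * s)}.
    by apply: continuous_subspaceT => s; apply: cvgMr; exact: cvg_id.
  have := lift_norm_bound t0 cg cI; rewrite mulr0 subr0 g0 => H.
  suff : tn (g t) - tn x <= C * `|chart i z - a| * t.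
    move=> {}H; rewrite /B -lerBlDl; apply: le_trans H _.
    by rewrite ler_piMr// mulr_ge0.
  apply: H => s /andP[s0 st].
  have s01 : 0 <= s <= 1 by rewrite !ltW// (lt_le_trans st).
  have [is' bs] := Hr _ (inb z s Uz s01).
  have Ds := is_derive_segment is'.
  have near01 : \forall r \near s, 0 < r < t.
    have := near_in_itvoo (_ : s \in `]0, t[); rewrite in_itv/= s0 st => /(_ isT).
    by apply: filterS => q; rewrite in_itv.
  have Ecz : {near s, segment i a (chart i z) =1 cz z}.
    apply: filterS near01 => q /andP[q0 qt]; rewrite /cz clamp_id// !ltW//.
    exact: lt_le_trans t1.
  have ic : chart_dom i (cz z s) by rewrite -(nbhs_singleton Ecz); exact: chart_inv_dom.
  have Dc : is_derive s (1 : R) (chart i \o cz z) (chart i z - a).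
    apply: near_eq_is_derive Ds; apply: filterS Ecz => q /= E.
    by rewrite /= E.
  have cs : {for s, continuous (cz z)} by exact: ccz.
  split.
  - by apply: filterS near01 => q /andP[q0 qt]; apply: fg; rewrite !ltW.
  - by have [] := curve_trans cs ic (chart_atP (cz z s)) Dc.
  - exists (C * `|chart i z - a|).
      have Did : is_derive s (1 : R) id 1 by exact: is_derive_id.
      apply: is_derive_eq (is_derive_mul (is_derive_cst (C * `|chart i z - a|) s 1) Did) _.
      by rewrite mul0r add0r mulr1.
    rewrite (speed_chart cs ic Dc) -(nbhs_singleton Ecz) chart_invK//.
have /choice[K KP] : forall z, exists g, U z -> partial_lift gexp (cz z) 0 1 x g.
  move=> z; have [/lift[g Hg]|nU] := pselect (U z); first by exists g.
  by exists (cst x).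
exists (fun z => K z 1); split.
  have Ux : U (gexp x) by split.
  have [cg g0 fg] := KP _ Ux; rewrite -[RHS]g0.
  (* The segment from [gexp x] to itself is constant, and so is its lift from [x]. *)
  have E := @lift_unique_itv _ _ _ gexp (@norm_hausdorff _ _) (gexp_locally_invertible p0 cM ncp)
    (K (gexp x)) (cst x) 0 1 0.
  rewrite g0; apply: E.
  - by move=> t _; exact: cg.
  - by move=> t _; exact: cst_continuous.
  - move=> t t01; rewrite fg// /cz clamp_id// /segment subrr scaler0 add0r chartK//.
  - by rewrite lexx ler01.
  - exact: g0.
  - by rewrite ler01 lexx.
move=> z Uz; have [cg g0 fg] := KP _ Uz; split; first by rewrite fg ?cz1// lexx ler01.
apply: (@lift_family _ _ _ gexp (@norm_hausdorff _ _) (@gexp_continuous _ _ M p0 cM) (gexp_locally_invertible p0 cM ncp)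
  M (fun z t => cz z t) K z 0 1 _ _ 0 1); rewrite ?lexx ?ler01//.
- move=> t t01.
  have [ib _] := Hr _ (inb _ _ Uz (cl01 t)).
  apply: (@continuous_comp _ _ _ (fun q : M * R => clamp 0 1 q.2 *: (chart i q.1 - a) + a) (chart_inv i)).
    have cA : {for (z, t), continuous (fun q : M * R => chart i q.1)}.
      apply: (@continuous_comp _ _ _ fst (chart i)); first exact: cvg_fst.
      by apply: chart_continuous_at; case: Uz.
    have cB : {for (z, t), continuous (fun q : M * R => clamp 0 1 q.2)}.
      by apply: (@continuous_comp _ _ _ snd (clamp 0 1)); [exact: cvg_snd|exact: clamp_continuous].
    exact: (cvgD (cvgZ cB (cvgB cA (cvg_cst a))) (cvg_cst a)).
  exact: chart_inv_continuous_at.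
- have nU : \forall z' \near z, U z' by exact: near_open.
  apply: filterS nU => z' Uz' t t01; have [cg' g0' fg'] := KP _ Uz'.
  by split; [exact: cg'|exact: fg'].
- have nU : \forall z' \near z, U z' by exact: near_open.
  have E0 : {near z, cst x =1 K ^~ 0}.
    by apply: filterS nU => z' Uz'; have [_ ->] := KP _ Uz'.
  by apply: cvg_trans (near_eq_cvg E0) _; rewrite -(nbhs_singleton E0); exact: cvg_cst.
Qed.

Lemma gexp_path_lifting : @path_lifting R _ M gexp.
Proof.
apply: evenly_sectioned_path_lifting; [exact: norm_hausdorff|exact: gexp_locally_invertible|].
exact: gexp_evenly_sectioned.
Qed.

End exponential_lifts.

(** * Riemannian coverings *)

Section isometric_coordinates.
Context {R : realType} {n : nat} {E M : riemannian_manifold R n}.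
Variables (i : chart_index E) (j : chart_index M) (U : set 'rV[R]_n) (phi : 'rV[R]_n -> 'rV[R]_n).
Hypotheses (oU : open U) (Ui : U `<=` chart_img i) (Uj : forall x, U x -> chart_img j (phi x)).
Hypothesis smooth_phi : smooth_on U phi.
Hypothesis isometric_phi : forall x u w, U x ->
  met j (phi x) ('D_u phi x) ('D_w phi x) = met i x u w.
Implicit Types (x u v w : 'rV[R]_n).

Lemma isometric_differentiable x : U x -> differentiable phi x.
Proof. by move=> Ux; exact: Ck_on_differentiable (smooth_phi 1%N) Ux. Qed.

Lemma isometric_jacobian x u : U x -> u *m jacobian phi x = 'D_u phi x.
Proof.
by move=> Ux; rewrite deriveE ?mul_rV_lin1//; exact: isometric_differentiable.
Qed.

Lemma isometric_jacobian_unit x : U x -> jacobian phi x \in unitmx.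
Proof.
move=> Ux; rewrite -row_free_unit -kermx_eq0; apply/rowV0P => w /sub_kermxP Lw.
have [p ip xp] := Ui Ux; have := isometric_phi w w Ux.
rewrite -isometric_jacobian// Lw /met bil0l -xp => /esym H.
exact: posdef_eq0 (metric_posdef ip) H.
Qed.

Lemma isometric_nondegenerate x z : U x ->
  (forall w, met j (phi x) z ('D_w phi x) = 0) -> z = 0.
Proof.
move=> Ux H; have [p jp xp] := Uj Ux.
apply: (bil_nondegenerate (metric_posdef jp)) => w.
rewrite xp -(H (w *m invmx (jacobian phi x))) -isometric_jacobian//.
by rewrite mulmxKV//; exact: isometric_jacobian_unit.
Qed.

Lemma second_derivative_sym x u v : U x ->
  'D_v (fun y => 'D_u phi y) x = 'D_u (fun y => 'D_v phi y) x.
Proof.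
move=> Ux; apply/rowP => k.
have df w y : U y -> derivable phi y w.
  by move=> Uy; apply: diff_derivable; exact: isometric_differentiable.
have ddf w w' : derivable (fun y => 'D_w phi y) x w'.
  by apply: diff_derivable; exact: Ck_on_differentiable (Ck_on_derive w (smooth_phi 2)) Ux.
have E2 w w' : 'D_w' (fun y => 'D_w phi y) x 0 k = 'D_w' ('D_w (fun y => phi y 0 k)) x.
  rewrite derive_mx// mxE; apply: near_eq_derive; near=> y.
  rewrite derive_mx ?mxE//; apply: df; near: y; exact: near_open oU Ux.
have C2 : Ck_on 2 U (fun y => phi y 0 k) by have /Ck_on_mxP := smooth_phi 2; exact.
exact: etrans (E2 u v) (etrans (derive_symmetric v u oU Ux C2) (esym (E2 v u))).
Unshelve. all: by end_near.
Qed.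

Lemma second_derivative_sum x v w : U x ->
  'D_v (fun y => 'D_w phi y) x =
  \sum_a w 0 a *: 'D_v (fun y => 'D_(delta_mx 0 a) phi y) x.
Proof.
move=> Ux; transitivity ('D_v (fun y => \sum_a w 0 a *: 'D_(delta_mx 0 a) phi y) x).
  apply: near_eq_derive; near=> y; apply: derive_sum_basis.
  by apply: isometric_differentiable; near: y; exact: near_open oU Ux.
apply: derive_val; apply: is_derive_sum_fun => a; apply: is_deriveZ.
apply/derivableP; apply: diff_derivable.
exact: Ck_on_differentiable (Ck_on_derive _ (smooth_phi 2)) Ux.
Unshelve. all: by end_near.
Qed.

(** The isometry condition differentiated in the direction [v]: the base point of the metric and
    both vectors vary. *)
Lemma isometric_derive x u w v : U x ->
  dmet j (phi x) ('D_v phi x) ('D_u phi x) ('D_w phi x)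
  + met j (phi x) ('D_v (fun y => 'D_u phi y) x) ('D_w phi x)
  + met j (phi x) ('D_u phi x) ('D_v (fun y => 'D_w phi y) x) = dmet i x v u w.
Proof.
move=> Ux; pose l (s : R) := s *: v + x.
have Dl : is_derive (0 : R) (1 : R) l v.
  apply: is_derive_eq (@is_derive_line _ _ _ id x v 0 _) _ => //.
  exact: derive_id.
have l0 : l 0 = x by rewrite /l scale0r add0r.
have Dphi : is_derive (0 : R) (1 : R) (phi \o l) ('D_v phi x).
  by rewrite -{1}l0; apply: is_derive_comp_curve Dl _; rewrite l0; exact: isometric_differentiable.
have DDphi z : is_derive (0 : R) (1 : R) ((fun y => 'D_z phi y) \o l) ('D_v (fun y => 'D_z phi y) x).
  rewrite -{1}l0; apply: is_derive_comp_curve Dl _; rewrite l0.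
  exact: Ck_on_differentiable (Ck_on_derive z (smooth_phi 2)) Ux.
have j0 : chart_img j ((phi \o l) 0) by rewrite /= l0; exact: Uj.
have [_ E1] := derive_metric_curve j0 Dphi (DDphi u) (DDphi w).
have i0 : chart_img i (l 0) by rewrite l0; exact: Ui.
have [_ E2] := derive_metric_curve i0 Dl (is_derive_cst u (0 : R) 1) (is_derive_cst w (0 : R) 1).
move: E1 E2; rewrite /= l0 /met bil0l bil0r !addr0 => <- <-.
apply: near_eq_derive.
have nU : \forall s \near (0 : R), U (l s).
  by apply: (continuous_near (is_derive1_continuous Dl)) => //; rewrite l0.
by apply: filterS nU => s Us; exact: isometric_phi.
Qed.

(** Transformation law of the Christoffel symbols. Both sides are paired with every ['D_w phi x];
    Koszul's formula and the isometry condition differentiated in the directions [u] and [w] reduce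
    the difference of the pairings to 0. *)
Lemma christoffel_transfer x u : U x ->
  christoffel_form j (phi x) ('D_u phi x) ('D_u phi x) + 'D_u (fun y => 'D_u phi y) x
  = 'D_(christoffel_form i x u u) phi x.
Proof.
have arith (a b c d : R) : 2^-1 * (a + a - b) + c - 2^-1 * (a + c + d + (a + c + d)
    - (b + d + d)) = 0 by field.
move=> Ux; apply/eqP; rewrite -subr_eq0; apply/eqP; apply: (isometric_nondegenerate Ux) => w.
have jx := Uj Ux; have ix := Ui Ux.
rewrite {1}/met bilBl bilDl -!/(met _ _ _ _) isometric_phi// !koszul//.
have H1 := isometric_derive u w u Ux; have H2 := isometric_derive u u w Ux.
rewrite (second_derivative_sym u w Ux) in H2; move: H1 H2 => <- <-.
rewrite [met j (phi x) ('D_u phi x) ('D_u (fun y => 'D_w phi y) x)]met_sym//; exact: arith.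
Qed.

End isometric_coordinates.

Section riemannian_covering.
Context {R : realType} {n : nat} {E M : riemannian_manifold R n}.
Variable (proj : E -> M).

Lemma covering_evenly_sectioned : covering_map proj -> evenly_sectioned proj.
Proof.
move=> [_ _ H] y; have [U [oU Uy [J [F [oF _ EF Fs]]]]] := H y.
exists U; split => // x Ux.
have : (\bigcup_j F j) x by rewrite EF.
move=> [j _ Fx]; have [s [cs Hs Ks]] := Fs j.
exists s; split; first exact: Ks.
by move=> z Uz; split; [case: (Hs _ Uz)|exact: within_open_continuous cs _ Uz].
Qed.

Lemma covering_locally_invertible : covering_map proj -> forall x, locally_invertible proj x.
Proof.
move=> [_ _ H] x; have [U [oU Uy [J [F [oF _ EF Fs]]]]] := H (proj x).
have : (\bigcup_j F j) x by rewrite EF.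
move=> [j _ Fx]; have [s [cs Hs Ks]] := Fs j.
exists (F j), U, s; split => //.
  by move=> z Uz; have [h1 h2] := Hs _ Uz; split => //; exact: within_open_continuous cs _ Uz.
move=> x' Fx'; split; last exact: Ks.
have : (\bigcup_j F j) x' by exists j.
by rewrite EF.
Qed.

(** In a small coordinate ball every point is joined to the centre by a coordinate segment. *)
Lemma manifold_locally_path_connected (e : E) (V : set E) : nbhs e V ->
  exists2 V' : set E, nbhs e V' & forall e', V' e' -> exists c : R -> E,
    [/\ continuous c, c 0 = e, c 1 = e' & forall t, V (c t)].
Proof.
move=> nV; have ie := chart_atP e; set i := chart_at e in ie.
have n1 : \forall x \near chart i e, chart_img i x.
  by apply: near_open; [exact: chart_img_open|exact: chart_imgP].
have n2 : \forall x \near chart i e, V (chart_inv i x).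
  by apply: (chart_inv_continuous_at (chart_imgP ie)); rewrite chartK.
have nn : \forall x \near chart i e, chart_img i x /\ V (chart_inv i x) by exact: filterI n1 n2.
have /nbhs_ballP[r /= r0 Hr] := nn.
exists [set z | chart_dom i z /\ ball (chart i e) r (chart i z)].
  apply: filterI; first exact: near_chart_dom.
  by apply: (chart_continuous_at ie); exact: nbhsx_ballx.
move=> z [iz bz].
have Hb t : chart_img i (clamp 0 1 t *: (chart i z - chart i e) + chart i e) /\
    V (segment i (chart i e) (chart i z) (clamp 0 1 t)).
  by apply: Hr; apply: ball_convex => //; [exact: ballxx|exact: clamp_itv].
exists (segment i (chart i e) (chart i z) \o clamp 0 1); split.
- move=> t; apply: continuous_comp; first exact: clamp_continuous.
  by apply: segment_continuous; case: (Hb t).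
- by rewrite /= clamp_id ?lexx ?ler01// /segment scale0r add0r chartK.
- by rewrite /= clamp_id ?lexx ?ler01// /segment scale1r subrK chartK.
- by move=> t; case: (Hb t).
Qed.

Hypothesis iso : local_isometry proj.

Let proj_continuous : continuous proj. Proof. by case: iso. Qed.

Definition rep i j : 'rV[R]_n -> 'rV[R]_n := chart j \o proj \o chart_inv i.

Definition rep_dom (i : chart_index E) (j : chart_index M) :=
  chart i @` (chart_dom i `&` proj @^-1` chart_dom j).

Lemma rep_dom_open i j : open (rep_dom i j).
Proof.
apply: chart_image_open; apply: open_comp => [x _|]; first exact: proj_continuous.
exact: chart_dom_open.
Qed.

Lemma rep_smooth i j : smooth_on (rep_dom i j) (rep i j).
Proof. by case: iso => _ H _; exact: H. Qed.

Lemma rep_domP i j p : chart_dom i p -> chart_dom j (proj p) -> rep_dom i j (chart i p).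
Proof. by move=> ip jp; exists p. Qed.

Lemma rep_chart i j p : chart_dom i p -> rep i j (chart i p) = chart j (proj p).
Proof. by move=> ip; rewrite /rep /= chartK. Qed.

Lemma rep_differentiable i j p : chart_dom i p -> chart_dom j (proj p) ->
  differentiable (rep i j) (chart i p).
Proof. by move=> ip jp; exact: Ck_on_differentiable (@rep_smooth i j 1%N) (rep_domP ip jp). Qed.

Lemma rep_coord i j (v : tangent_vector E) : chart_dom i (base v) -> chart_dom j (proj (base v)) ->
  'd (rep i j) (chart i (base v)) (coord i v) = coord j (tangent_map proj v).
Proof.
case: v => p u /= ip jp; rewrite coordE /tangent_map coordE /=.
have kp := chart_atP p; set k := chart_at p in kp *.
have lp := chart_atP (proj p); set l := chart_at (proj p) in lp *.
rewrite -/(rep k l).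
have nk : \forall x \near chart k p, chart_img k x.
  by apply: near_open; [exact: chart_img_open|exact: chart_imgP].
have cki := chart_inv_continuous_at (chart_imgP kp).
have nki : \forall x \near chart k p, chart_dom i (chart_inv k x).
  by apply: (continuous_near cki); [exact: chart_dom_open|rewrite chartK].
have nkl : \forall x \near chart k p, chart_dom l (proj (chart_inv k x)).
  apply: (continuous_near (f := proj \o chart_inv k)); last by rewrite /= chartK.
    by apply: continuous_comp => //; exact: proj_continuous.
  exact: chart_dom_open.
transitivity ('d (rep k j) (chart k p) u).
  apply: (diff_comp_near (f := trans k i)).
  - exact: trans_differentiable.
  - exact: rep_differentiable.
  - exact: trans_chart.
  near=> x; rewrite /rep /trans /= chartK//; near: x; exact: nki.
apply/esym; apply: (diff_comp_near (f := rep k l)).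
- exact: rep_differentiable.
- exact: trans_differentiable.
- exact: rep_chart.
near=> x; rewrite /rep /trans /= chartK//; near: x; exact: nkl.
Unshelve. all: by end_near.
Qed.

Lemma rep_isometric i j x u w : rep_dom i j x ->
  met j (rep i j x) ('D_u (rep i j) x) ('D_w (rep i j) x) = met i x u w.
Proof.
case=> p [ip jp] <-; have df := rep_differentiable ip jp.
rewrite !(deriveE _ df) -(of_coordK u ip) -(of_coordK w ip) rep_chart//.
rewrite (rep_coord (v := of_coord i p u))// (rep_coord (v := of_coord i p w))//.
by rewrite (inner_coord _ _ jp) (inner_coord _ _ ip); case: iso => _ _; exact.
Qed.

Lemma tangent_map_velocity (c : R -> E) (t : R) : {for t, continuous c} ->
  derivable (chart (chart_at (c t)) \o c) t 1 ->
  velocity (proj \o c) t = tangent_map proj (velocity c t).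
Proof.
move=> cc D; have ic := chart_atP (c t); set i := chart_at (c t) in ic D.
have jc := chart_atP (proj (c t)); set j := chart_at (proj (c t)) in jc.
rewrite /velocity /tangent_map /= -/j -/i; congr TangentVector.
rewrite -/(rep i j) !derive1E.
have Dc : is_derive t (1 : R) (chart i \o c) ('D_1 (chart i \o c) t) by exact/derivableP.
have dr : differentiable (rep i j) ((chart i \o c) t) by exact: rep_differentiable.
have [_] := is_derive_comp_curve Dc dr; rewrite (deriveE _ dr) => <-.
apply: near_eq_derive; near=> s; rewrite /= rep_chart//; near: s.
exact: near_curve_chart.
Unshelve. all: by end_near.
Qed.

Lemma tangent_map_tnorm (v : tangent_vector E) :
  tnorm (base (tangent_map proj v)) (vec (tangent_map proj v)) = tnorm (base v) (vec v).
Proof. by case: v => p u; rewrite /tnorm; congr Num.sqrt; case: iso => _ _; exact. Qed.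

Lemma rep_jacobian i j x z : rep_dom i j x -> z *m jacobian (rep i j) x = 'D_z (rep i j) x.
Proof. by move=> ix; apply: (@isometric_jacobian _ _ (rep_dom i j)) => //; exact: rep_smooth. Qed.

Lemma rep_jacobian_unit i j x : rep_dom i j x -> jacobian (rep i j) x \in unitmx.
Proof.
apply: (@isometric_jacobian_unit _ _ E M i j (rep_dom i j)).
- by move=> _ [q [iq _] <-]; exact: chart_imgP.
- exact: rep_smooth.
- exact: rep_isometric.
Qed.

Lemma rep_jacobian_coord i j (v : tangent_vector E) :
  chart_dom i (base v) -> chart_dom j (proj (base v)) ->
  coord i v *m jacobian (rep i j) (chart i (base v)) = coord j (tangent_map proj v).
Proof.
move=> ip jp; rewrite rep_jacobian; last exact: rep_domP.
by rewrite (deriveE _ (rep_differentiable ip jp)) (rep_coord ip jp).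
Qed.

Lemma tangent_map_inj p u w :
  tangent_map proj (TangentVector p u) = tangent_map proj (TangentVector p w) -> u = w.
Proof.
move=> Euw; have ip := chart_atP p; set i := chart_at p in ip.
have jp := chart_atP (proj p); set j := chart_at (proj p) in jp.
apply: (coord_inj ip); apply: (can_inj (mulmxK (rep_jacobian_unit (rep_domP ip jp)))).
rewrite (rep_jacobian_coord (v := TangentVector p u) ip jp).
by rewrite (rep_jacobian_coord (v := TangentVector p w) ip jp) Euw.
Qed.

Lemma tangent_map_surj p (v : tangent_vector M) : proj p = base v ->
  exists u, tangent_map proj (TangentVector p u) = v.
Proof.
case: v => q w /= E0; subst q.
have ip := chart_atP p; set i := chart_at p in ip.
have jp := chart_atP (proj p); set j := chart_at (proj p) in jp.
have xp := rep_domP ip jp.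
pose u := w *m invmx (jacobian (rep i j) (chart i p)).
exists u; have := rep_jacobian_coord (v := TangentVector p u) ip jp.
rewrite /= coord_chart_at mulmxKV ?rep_jacobian_unit// => ->.
by rewrite /tangent_map/= coord_chart_at.
Qed.

End riemannian_covering.

(** * Continuous lifts of geodesics are geodesics *)

Section lifted_geodesics.
Context {R : realType} {n : nat} {E M : riemannian_manifold R n}.
Variable (proj : E -> M).
Hypotheses (scE : simply_connected R E) (cov : covering_map proj) (iso : local_isometry proj).
Hypothesis cM : complete_manifold M.

Local Notation rep := (rep proj).
Local Notation rep_dom := (rep_dom proj).

Let proj_continuous : continuous proj. Proof. by case: iso. Qed.

Lemma covering_path_lifting : @path_lifting R _ _ proj.
Proof.
apply: evenly_sectioned_path_lifting; first exact: manifold_hausdorff.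
  exact: covering_locally_invertible.
exact: covering_evenly_sectioned.
Qed.

Section one_lift.
Variables (c : R -> M) (g : R -> E).
Hypotheses (gc : geodesic c) (cg : continuous g) (pg : proj \o g = c).

Let pgE t : proj (g t) = c t. Proof. by rewrite -pg. Qed.

Let D i j := g @^-1` chart_dom i `&` c @^-1` chart_dom j.

Let oD i j : open (D i j).
Proof.
apply: openI; first exact: curve_dom_open.
by apply: curve_dom_open; exact: (gc.1 0%N).1.
Qed.

Let near_D i j t : D i j t -> \forall s \near t, D i j s.
Proof. by move=> Dt; apply: open_nbhs_nbhs; split. Qed.

Let D_rep i j t : D i j t -> rep_dom i j (chart i (g t)).
Proof. by move=> [it jt]; apply: rep_domP => //; rewrite pgE. Qed.

(** By continuity [chart i \o g] stays where [rep i j] has a local inverse, and is that inverse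
    applied to the coordinates of [c]. *)
Lemma lift_derive i j t : D i j t -> is_derive t (1 : R) (chart i \o g)
  (derive1 (chart j \o c) t *m invmx (jacobian (rep i j) (chart i (g t)))).
Proof.
move=> Dt; have [it jt] := Dt; have xr := D_rep Dt.
have uJ := rep_jacobian_unit iso xr.
have oR : open (rep_dom i j) by exact: rep_dom_open.
have sd := Ck2_strict_diff oR xr (rep_smooth iso i j 2).
have [W [U [h [[oW Wx] oU H1 H2 Dh]]]] := strict_diff_invertible uJ sd.
have cx : {for t, continuous (chart i \o g)}.
  by apply: continuous_comp; [exact: cg|exact: chart_continuous_at].
have nW : \forall s \near t, W (chart i (g s)) by exact: continuous_near cx oW Wx.
have nD : \forall s \near t, D i j s by exact: near_D Dt.
have Eh : {near t, h \o (chart j \o c) =1 chart i \o g}.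
  near=> s; have [is' js] : D i j s by near: s; exact: nD.
  rewrite /= -pgE -(rep_chart proj j is').
  by have [] := H2 (chart i (g s)); first by near: s; exact: nW.
have Dc := curve_is_derive (gc.1 1%N) jt.
rewrite rep_chart// pgE in Dh; have [dh Eh'] := Dh.
have := is_derive_comp_curve Dc dh; rewrite (deriveE _ dh) Eh' /= => D'.
exact: near_eq_is_derive Eh D'.
Unshelve. all: by end_near.
Qed.

(** Bootstrap: [lift_derive] expresses the derivative of the lift by [c] and by the lift itself. *)
Let lift_Ck_dom k i j : Ck_on k (D i j) (chart i \o g).
Proof.
elim: k => [|k IH].
  by move=> t /lift_derive; exact: is_derive1_continuous.
apply/Ck_on_curveS => //; split=> [t /lift_derive[]//|].
apply: (@Ck_on_eq _ _ _ _ _ (fun t => derive1 (chart j \o c) t *m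
    invmx (jacobian (rep i j) (chart i (g t))))) => //.
  by move=> t /lift_derive[_ <-]; rewrite derive1E.
apply/Ck_on_mxP => // a b; under eq_fun do rewrite mxE.
apply: Ck_on_sum => // l; apply: Ck_onM => //.
  have [_] := chart_curve_Ck j (gc.1 k.+1).
  move=> /(Ck_on_sub (U' := D i j)) H.
  by have /Ck_on_mxP := H (fun t => @proj2 _ _); exact.
apply: (Ck_on_invmx (A := fun t => jacobian (rep i j) (chart i (g t)))) => //.
  by move=> t /D_rep; exact: rep_jacobian_unit.
move=> q r.
apply: (@Ck_on_eq _ _ _ _ _ ((fun x => 'D_(delta_mx 0 q) (rep i j) x 0 r) \o (chart i \o g))) => //.
  move=> t /D_rep xr; rewrite /= -(rep_jacobian iso)//.
  by rewrite -rowE mxE.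
apply: (Ck_on_comp (U' := rep_dom i j)) => //.
- by move=> t /D_rep.
- by move=> l'; have /Ck_on_mxP := IH; exact.
- have oR : open (rep_dom i j) by exact: rep_dom_open.
  have := Ck_on_derive (delta_mx 0 q) (rep_smooth iso i j k.+1).
  by move=> /Ck_on_mxP; exact.
Qed.

(** Differentiating [rep i j \o x = y] twice and applying [christoffel_transfer] turns the geodesic
    equation of [c] into the image of that of [g] under an invertible Jacobian matrix. *)
Lemma lift_geodesic : geodesic g.
Proof.
have smooth_g k : Ck_curve k g.
  split=> // i; apply: Ck_on_local => t it; exists (D i (chart_at (c t))).
    by split=> //; exact: chart_atP.
  exact: lift_Ck_dom.
split=> // i t it; have jt := chart_atP (c t); set j := chart_at (c t) in jt.
have Dt : D i j t by [].
have xr := D_rep Dt; have oR : open (rep_dom i j) by exact: rep_dom_open.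
pose x := chart i \o g; pose y := chart j \o c.
have Ey : {near t, rep i j \o x =1 y}.
  have nD : \forall s \near t, D i j s by exact: near_D Dt.
  by near=> s; have [is' js] : D i j s by [near: s; exact: nD];
     rewrite /= rep_chart// pgE.
have dr z : rep_dom i j z -> differentiable (rep i j) z.
  by move=> zr; exact: Ck_on_differentiable (rep_smooth iso i j 1) zr.
have Dx s : chart_dom i (g s) -> is_derive s (1 : R) x (derive1 x s).
  by move=> is'; exact: curve_is_derive (smooth_g 1%N) is'.
have D2x := smooth_curve_derivable2 (smooth_g 2) it; rewrite -/x in D2x.
have Ey1 s : D i j s -> derive1 y s = 'D_(derive1 x s) (rep i j) (x s).
  move=> Ds; have [is' js] := Ds.
  have [_ <-] := is_derive_comp_curve (Dx _ is') (dr _ (D_rep Ds)).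
  rewrite derive1E; apply: near_eq_derive.
  have nD : \forall r \near s, D i j r by exact: near_D Ds.
  near=> r; have [ir jr] : D i j r by near: r; exact: nD.
  by rewrite /= rep_chart// pgE.
have E2 : derive1 (derive1 y) t = 'D_(derive1 (derive1 x) t) (rep i j) (x t)
    + 'D_(derive1 x t) (fun z => 'D_(derive1 x t) (rep i j) z) (x t).
  have nD : \forall s \near t, D i j s by exact: near_D Dt.
  rewrite derive1E; apply: derive_val.
  have Db a : is_derive t (1 : R) ((fun z => 'D_(delta_mx 0 a) (rep i j) z) \o x)
      ('D_(derive1 x t) (fun z => 'D_(delta_mx 0 a) (rep i j) z) (x t)).
    apply: is_derive_comp_curve; first exact: Dx.
    exact: Ck_on_differentiable (Ck_on_derive _ (rep_smooth iso i j 2)) xr.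
  apply: (@near_eq_is_derive _ _ _ (fun s => \sum_a derive1 x s 0 a *: 'D_(delta_mx 0 a) (rep i j) (x s))).
    near=> s; have Ds : D i j s by near: s; exact: nD.
    by rewrite Ey1// -derive_sum_basis//; exact: dr (D_rep Ds).
  have Dsum : is_derive t (1 : R) (fun s => \sum_a derive1 x s 0 a *: 'D_(delta_mx 0 a) (rep i j) (x s))
      (\sum_a (derive1 x t 0 a *: 'D_(derive1 x t) (fun z => 'D_(delta_mx 0 a) (rep i j) z) (x t)
       + derive1 (derive1 x) t 0 a *: 'D_(delta_mx 0 a) (rep i j) (x t))).
    apply: is_derive_sum_fun => a; apply/is_derive_mxP => r l.
    under eq_fun do rewrite mxE.
    apply: is_derive_eq (is_derive_mul (is_derive_entry 0 a D2x) (is_derive_entry r l (Db a))) _.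
    by rewrite [LHS]addrC !mxE.
  apply: is_derive_eq Dsum _.
  rewrite big_split addrC /= -derive_sum_basis; last exact: dr.
  congr (_ + _); apply/esym.
  exact: (second_derivative_sum oR (rep_smooth iso i j) _ _ xr).
have := gc.2 j t jt; rewrite /cov_deriv -/y E2.
have -> : chart j (c t) = rep i j (x t) by rewrite rep_chart// pgE.
have Et : derive1 (chart j \o c) t = 'D_(derive1 x t) (rep i j) (x t) by exact: Ey1.
have tr := christoffel_transfer oR _ _ (rep_smooth iso i j)
  (fun x u w => @rep_isometric _ _ _ _ _ iso i j x u w) (derive1 x t) xr.
rewrite Et -addrA [X in _ + X]addrC tr; last 2 first.
- by move=> _ [q [iq _] <-]; exact: chart_imgP.
- by move=> _ [q [iq jq] <-]; rewrite rep_chart//; exact: chart_imgP.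
rewrite -!(rep_jacobian iso _ xr) -mulmxDl => H.
apply: (can_inj (mulmxK (rep_jacobian_unit iso xr))).
by rewrite mul0mx.
Unshelve. all: by end_near.
Qed.

End one_lift.
End lifted_geodesics.

(** * Arc length and piecewise paths *)

Section curve_length.
Context {R : realType} {n : nat} {M : riemannian_manifold R n}.
Implicit Types (c : R -> M) (p q : M) (s : seq (R -> M)).

Lemma speed_continuous c : Ck_curve 1 c -> continuous (speed c).
Proof.
move=> C1 t; have it := chart_atP (c t); set i := chart_at (c t) in it.
have oD : open (c @^-1` chart_dom i) by apply: curve_dom_open; exact: C1.1.
pose f (r : R) := met i (chart i (c r)) (derive1 (chart i \o c) r) (derive1 (chart i \o c) r).
have Cf k : Ck_on k (c @^-1` chart_dom i) (chart i \o c) ->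
    Ck_on k (c @^-1` chart_dom i) (derive1 (chart i \o c)) -> Ck_on k (c @^-1` chart_dom i) f.
  move=> /(Ck_on_mxP _ _ oD) Cx /(Ck_on_mxP _ _ oD) C0.
  rewrite /f /met; under eq_fun do rewrite bilE.
  apply: Ck_on_sum => // a; apply: Ck_on_sum => // b.
  apply: Ck_onM => //; apply: Ck_onM => //.
  apply: (Ck_on_comp (f := chart i \o c) (U' := chart_img i) (g := fun x => metric i x a b)) => //.
    by move=> r ir; exact: chart_imgP.
  exact: metric_entry_Ck.
have {}Cf := Cf 0%N (Ck_on_pred (C1.2 i)) (chart_curve_Ck i C1).2.
have nD : \forall s \near t, chart_dom i (c s) by exact: near_open oD it.
have E : {near t, (fun r => Num.sqrt (f r)) =1 speed c}.
  near=> r; have is' : chart_dom i (c r) by near: r; exact: nD.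
  by rewrite (speed_chart (C1.1 r) is' (curve_is_derive C1 is')).
have cs : {for t, continuous (fun r => Num.sqrt (f r))}.
  apply: (@continuous_comp _ _ _ f Num.sqrt); first exact: Cf.
  exact: sqrt_continuous.
rewrite /continuous_at -(nbhs_singleton E).
by apply: cvg_trans cs; apply: near_eq_cvg; apply: filterS E => r ->.
Unshelve. all: by end_near.
Qed.

Lemma tnorm0 p : tnorm p 0 = 0.
Proof. by rewrite tnormE /bnorm bil0l sqrtr0. Qed.

Lemma speed_ge0 c t : 0 <= speed c t. Proof. exact: sqrtr_ge0. Qed.

Definition arc_length c (t : R) : R := \int[lebesgue_measure]_(s in `[0, t]) speed c s.

Lemma speed_integrable c : Ck_curve 1 c ->
  lebesgue_measure.-integrable `[0, 1] (EFin \o speed c).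
Proof.
move=> C1; apply: continuous_compact_integrable; first exact: segment_compact.
by apply: continuous_subspaceT => t; exact: speed_continuous.
Qed.

Lemma arc_length_continuous c : Ck_curve 1 c ->
  {within `[0, 1], continuous (arc_length c)}.
Proof.
by move=> C1; apply: parameterized_integral_continuous; [exact: ler01|exact: speed_integrable].
Qed.

Lemma is_derive_arc_length c (t : R) : Ck_curve 1 c -> 0 < t < 1 ->
  is_derive t (1 : R) (arc_length c) (speed c t).
Proof.
move=> C1 /andP[t0 t1].
have [D E] := continuous_FTC1_closed t1 (speed_integrable C1) t0 (speed_continuous C1 (x := t)).
by rewrite -E derive1E; exact/derivableP.
Qed.

Lemma arc_length0 c : arc_length c 0 = 0.
Proof. by rewrite /arc_length set_itv1 Rintegral_set1. Qed.

Lemma arc_length_cst c (k : R) : (forall t, speed c t = k) -> arc_length c 1 = k.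
Proof.
move=> H; rewrite /arc_length; under eq_Rintegral do rewrite H.
rewrite Rintegral_cst//= lebesgue_measure_itv/= lte_fin ltr01 oppr0 adde0 /=.
by rewrite mulr1.
Qed.

Lemma path_length_cons c s : path_length (c :: s) = arc_length c 1 + path_length s.
Proof. by rewrite /path_length big_cons. Qed.

Lemma path_length_nil : path_length ([::] : seq (R -> M)) = 0.
Proof. by rewrite /path_length big_nil. Qed.

Lemma path_length_cat s s' : path_length (s ++ s') = path_length s + path_length s'.
Proof. by rewrite /path_length big_cat. Qed.

Lemma piecewise_path_cat p q r s s' : piecewise_path p s q -> piecewise_path q s' r ->
  piecewise_path p (s ++ s') r.
Proof.
elim: s p => [|c s IH] p /=; first by move=> ->.
by move=> [C1 c0 ps] ps'; split => //; exact: IH.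
Qed.

Lemma gexp_path (cM : complete_manifold M) (x : M) u :
  piecewise_path x [:: gam x u] (gexp x u) /\ path_length [:: gam x u] = tnorm x u.
Proof.
have gc := gam_geodesic x cM u; split.
  by split=> //; [exact: (gc.1 1%N)|rewrite gam0].
rewrite path_length_cons path_length_nil addr0; apply: arc_length_cst => t.
by rewrite (geodesic_speed_cst t 0 gc) /speed gam_velocity0// gam0.
Qed.

End curve_length.

Section complete_cover.
Context {R : realType} {n : nat} {E M : riemannian_manifold R n}.
Variable (proj : E -> M).
Hypotheses (scE : simply_connected R E) (cov : covering_map proj) (iso : local_isometry proj).
Hypothesis cM : complete_manifold M.

Let proj_continuous : continuous proj. Proof. by case: iso. Qed.

Lemma tangent_map_eq (v w : tangent_vector E) : base v = base w ->
  tangent_map proj v = tangent_map proj w -> v = w.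
Proof.
by case: v w => p u [q w] /= E1; subst q => /(tangent_map_inj iso) ->.
Qed.

(** The geodesic of [M] with the projected initial vector is lifted; the lift has initial velocity
    [v] because the differential of [proj] is injective. Completeness of [E] follows. *)
Lemma geodesic_lift (v : tangent_vector E) : exists g, [/\ geodesic g, velocity g 0 = v &
  proj \o g = geodesic_of (tangent_map proj v)].
Proof.
have [gc vc] := geodesic_of_spec cM (tangent_map proj v).
have c0 : proj (base v) = geodesic_of (tangent_map proj v) 0 by case: vc => ->.
have [g [cg g0 pg]] := covering_path_lifting cov (gc.1 0%N).1 c0.
have gg := lift_geodesic iso gc cg pg.
exists g; split=> //; apply: tangent_map_eq => //.
rewrite -(tangent_map_velocity iso); first by rewrite pg vc.
  exact: cg.
by have [] := curve_is_derive (gg.1 1%N) (chart_atP (g 0)).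
Qed.

Lemma cover_complete : complete_manifold E.
Proof. by move=> v; have [g [gg vg _]] := geodesic_lift v; exists g. Qed.

Lemma proj_geodesic_of (v : tangent_vector E) :
  proj \o geodesic_of v = geodesic_of (tangent_map proj v).
Proof. by have [g [gg vg <-]] := geodesic_lift v; rewrite (geodesic_ofE gg vg). Qed.

Lemma proj_geodesic (c : R -> E) : geodesic c -> geodesic (proj \o c).
Proof.
move=> gc; rewrite -(geodesic_ofE gc (erefl _)) proj_geodesic_of.
by have [] := geodesic_of_spec cM (tangent_map proj (velocity c 0)).
Qed.

Lemma proj_velocity (c : R -> E) t : Ck_curve 1 c ->
  velocity (proj \o c) t = tangent_map proj (velocity c t).
Proof.
move=> C1; apply: (tangent_map_velocity iso); first exact: C1.1.
by have [] := curve_is_derive C1 (chart_atP (c t)).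
Qed.

Lemma proj_speed (c : R -> E) t : Ck_curve 1 c -> speed (proj \o c) t = speed c t.
Proof.
by move=> C1; rewrite /speed proj_velocity// -[RHS](tangent_map_tnorm iso).
Qed.

Lemma proj_derivable (c : R -> E) t j : Ck_curve 1 c -> chart_dom j (proj (c t)) ->
  derivable (chart j \o (proj \o c)) t 1.
Proof.
move=> C1 jt; have it := chart_atP (c t); set i := chart_at (c t) in it.
have D := curve_is_derive C1 it.
have dr : differentiable (rep proj i j) ((chart i \o c) t) by exact: rep_differentiable.
have Dr := is_derive_comp_curve D dr.
have E' : {near t, rep proj i j \o (chart i \o c) =1 chart j \o (proj \o c)}.
  near=> s; rewrite /= rep_chart//; near: s; apply: near_curve_chart it; exact: C1.1.
by have [] := near_eq_is_derive E' Dr.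
Unshelve. all: by end_near.
Qed.

Lemma unit_proj (c : R -> E) : unit_geodesic c -> unit_geodesic (proj \o c).
Proof.
move=> [gc sc]; split; first exact: proj_geodesic.
by move=> t; rewrite proj_speed//; exact: (gc.1 1%N).
Qed.

End complete_cover.

(** * Geodesics and angles in the universal cover *)

Section logarithm.
Context {R : realType} {n : nat} {E M : riemannian_manifold R n}.
Variable (proj : E -> M).
Hypotheses (scE : simply_connected R E) (cov : covering_map proj) (iso : local_isometry proj).
Hypotheses (cM : complete_manifold M) (ncp : no_conjugate_points M).

Let cE : complete_manifold E. Proof. exact: cover_complete cov iso cM. Qed.
Let proj_continuous : continuous proj. Proof. by case: iso. Qed.

Lemma proj_gexp (x : E) u : proj (gexp x u) =
  gexp (proj x) (vec (tangent_map proj (TangentVector x u))).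
Proof. by have /(congr1 (fun f => f 1)) := proj_geodesic_of cov iso cM (TangentVector x u). Qed.

(** The exponential map of [M] at [proj x] lifts paths and [E] is simply connected, so [proj] itself
    lifts through it. *)
Lemma log_lift (x : E) : exists G : E -> 'rV[R]_n,
  [/\ continuous G, gexp (proj x) \o G = proj & G x = 0].
Proof.
apply: (lifting_theorem (f := gexp (proj x)) (R := R)).
- exact: norm_hausdorff.
- exact: gexp_continuous.
- exact: proj_continuous.
- exact: gexp_locally_invertible.
- exact: gexp_path_lifting.
- exact: scE.
- exact: manifold_locally_path_connected.
- exact: gexp0.
Qed.

(** On each arc [G \o c] is a lift of [proj \o c], so [lift_norm_bound] bounds the growth of its
    norm by the arc length, which [proj] preserves. *)
Lemma log_lift_length (x : E) (G : E -> 'rV[R]_n) : continuous G ->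
  gexp (proj x) \o G = proj -> forall s p q, piecewise_path p s q ->
  tnorm (proj x) (G q) - tnorm (proj x) (G p) <= path_length s.
Proof.
move=> cG EG; elim=> [|c s IH] p q /=.
  by move=> ->; rewrite subrr path_length_nil.
move=> [C1 c0 /IH ps]; rewrite path_length_cons.
have cGc : continuous (G \o c) by move=> t; apply: continuous_comp; [exact: C1.1|exact: cG].
have := lift_norm_bound cM ncp (p0 := proj x) (c := proj \o c) ler01 cGc (arc_length_continuous C1).
rewrite arc_length0 subr0 /= c0 => H.
rewrite -[tnorm _ _](subrK (tnorm (proj x) (G (c 1)))) -addrA addrC lerD//.
apply: H => t t01; split.
- near=> r; exact: (congr1 (fun f => f (c r)) EG).
- by apply: (proj_derivable iso C1); exact: chart_atP.
- exists (speed c t); first exact: is_derive_arc_length.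
  by rewrite (proj_speed iso _ C1).
Unshelve. all: by end_near.
Qed.

(** A global inverse of the exponential map at [x] whose norm is the distance to [x]. The minimizing
    properties of geodesics are deduced from the existence of such maps. *)
Definition is_log (x : E) (L : E -> 'rV[R]_n) :=
  [/\ continuous L, forall y, gexp x (L y) = y, forall u, L (gexp x u) = u &
      forall y, dist x y = tnorm x (L y)].

(** [h] and the identity are lifts of [proj] that agree at [x]; they are compared along a path from
    [x] to [y]. *)
Lemma deck_fixed (h : E -> E) (x : E) : continuous h -> (forall y, proj (h y) = proj y) ->
  h x = x -> forall y, h y = y.
Proof.
move=> ch ph hx y; have [a [ca a0 a1]] := scE.1 x y.
pose a' := a \o clamp 0 1.
have ca' : continuous a'.
  apply: within_continuous_comp ca _ _; first exact: clamp_continuous.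
  by move=> t; rewrite /= in_itv/=; exact: clamp_itv.
have cha : continuous (h \o a') by move=> t; apply: continuous_comp; [exact: ca'|exact: ch].
have e0 : a' 0 = x by rewrite /a' /= clamp_id ?lexx ?ler01.
have e1 : a' 1 = y by rewrite /a' /= clamp_id ?lexx ?ler01.
have pa : proj \o (h \o a') = proj \o a' by apply/funext => t /=; exact: ph.
have h0 : (h \o a') 0 = a' 0 by rewrite /= e0.
have := @lift_unique R _ _ proj (@manifold_hausdorff _ _ E)
  (covering_locally_invertible cov) _ _ 0 cha ca' pa h0.
by move=> /(congr1 (fun f => f 1)); rewrite /= e1.
Qed.

(** [L] is [G] followed by the inverse [A] of the differential [T] of [proj] at [x]. On one side,
    [gexp x \o L] lifts [proj] and fixes [x], hence is the identity; on the other, lifts are unique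
    along rays. Every path from [x] to [y] has length at least the norm of [L y], which the radial
    geodesic attains. *)
Lemma log_exists (x : E) : exists L, is_log x L.
Proof.
have [G [cG EG G0]] := log_lift x.
have EGy y : gexp (proj x) (G y) = proj y by exact: (congr1 (fun f => f y) EG).
pose T u := vec (tangent_map proj (TangentVector x u)).
have Tn u : tnorm (proj x) (T u) = tnorm x u.
  exact: (tangent_map_tnorm iso (TangentVector x u)).
have /choice[A TA] : forall w, exists u, T u = w.
  move=> w; have [u Eu] := tangent_map_surj iso (p := x) (v := TangentVector (proj x) w) erefl.
  by exists u; rewrite /T Eu.
have ip := chart_atP x; set i := chart_at x in ip.
have jp := chart_atP (proj x); set j := chart_at (proj x) in jp.
pose J := jacobian (rep proj i j) (chart i x).
have uJ : J \in unitmx by apply: rep_jacobian_unit => //; exact: rep_domP.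
have TJ u : T u = u *m J.
  have := rep_jacobian_coord iso (v := TangentVector x u) ip jp.
  by rewrite /= coord_chart_at /= -/J => ->; rewrite /tangent_map/= coord_chart_at.
have AJ w : A w = w *m invmx J.
  by rewrite -[w in RHS]TA TJ mulmxK.
have cA : continuous A.
  have -> : A = mulmxr (invmx J) by apply/funext => w; rewrite AJ.
  exact: mulmxr_continuous.
have cT : continuous T.
  have -> : T = mulmxr J by apply/funext => w; rewrite TJ.
  exact: mulmxr_continuous.
have A0 : A 0 = 0 by rewrite AJ mul0mx.
have AT u : A (T u) = u by rewrite AJ TJ mulmxK.
pose L := A \o G.
have cL : continuous L by move=> y; apply: continuous_comp; [exact: cG|exact: cA].
have projL y : proj (gexp x (L y)) = proj y by rewrite proj_gexp -/(T _) TA EGy.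
have expL y : gexp x (L y) = y.
  apply: (@deck_fixed (fun y => gexp x (L y)) x).
  - move=> z; apply: (@continuous_comp _ _ _ L (gexp x)); first exact: cL.
    exact: gexp_continuous.
  - exact: projL.
  - by rewrite /L /= G0 A0 gexp0.
(* Both [G] along the radial geodesic and the straight ray with direction [T u] are lifts, starting
   at 0, of the projected geodesic through the exponential map of [M]. *)
have Lexp u : L (gexp x u) = u.
  have cl1 : continuous (fun t : R => G (gexp x (t *: u))).
    move=> t; apply: (@continuous_comp _ _ _ (fun t : R => gexp x (t *: u)) G); last exact: cG.
    apply: (@continuous_comp _ _ _ (fun t : R => t *: u) (gexp x)); last exact: gexp_continuous.
    exact: scalel_continuous.
  have cl2 : continuous (fun t : R => T (t *: u)).
    move=> t; apply: (@continuous_comp _ _ _ (fun t : R => t *: u) T); last exact: cT.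
    exact: scalel_continuous.
  have := @lift_unique R _ _ (gexp (proj x)) (@norm_hausdorff _ _)
    (gexp_locally_invertible _ cM ncp) _ _ 0 cl1 cl2.
  have -> : gexp (proj x) \o (fun t : R => G (gexp x (t *: u))) =
      gexp (proj x) \o (fun t : R => T (t *: u)).
    by apply/funext => t /=; rewrite EGy proj_gexp.
  rewrite !scale0r gexp0// G0 TJ mul0mx => /(_ erefl erefl)/(congr1 (fun f => f 1)).
  by rewrite /L /= !scale1r => ->.
exists L; split=> // y.
have [pp pl] := gexp_path cE x (L y); rewrite expL in pp.
have lb : lbound [set path_length s | s in piecewise_path x ^~ y] (tnorm x (L y)).
  move=> _ [s ps <-]; have := log_lift_length cG EG ps.
  by rewrite G0 tnorm0 subr0 -(TA (G y)) Tn.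
apply/eqP; rewrite eq_le; apply/andP; split.
  rewrite -pl; apply: ge_inf; first by exists (tnorm x (L y)).
  by exists [:: gam x (L y)].
by apply: lb_le_inf => //; exists (path_length [:: gam x (L y)]); exists [:: gam x (L y)].
Qed.

End logarithm.

Section angles.
Context {R : realType} {n : nat} {M : riemannian_manifold R n}.
Implicit Types (p : M) (u v w : 'rV[R]_n).

Lemma inner_metric p : (metric (chart_at p) (chart (chart_at p) p))^T =
  metric (chart_at p) (chart (chart_at p) p).
Proof. by case: (metric_at_posdef p). Qed.

Lemma innerC p u w : inner p u w = inner p w u.
Proof. exact: bil_sym _ _ (inner_metric p). Qed.

Lemma cos_bound p u w : -1 <= inner p u w / (tnorm p u * tnorm p w) <= 1.
Proof.
rewrite -ler_norml normrM normfV; set d := tnorm p u * tnorm p w.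
have d0 : 0 <= d by rewrite mulr_ge0// tnorm_ge0.
rewrite (ger0_norm d0); have [->|dn] := eqVneq d 0; first by rewrite invr0 mulr0.
by rewrite ler_pdivrMr ?lt0r ?dn// mul1r; exact: inner_cauchy_schwarz.
Qed.

Lemma vector_angleC p u w : vector_angle p u w = vector_angle p w u.
Proof. by rewrite /vector_angle innerC [tnorm p u * _]mulrC. Qed.

Lemma vector_angle_unit p u w : tnorm p u = 1 -> tnorm p w = 1 ->
  vector_angle p u w = acos (inner p u w).
Proof. by move=> u1 w1; rewrite /vector_angle u1 w1 mulr1 divr1. Qed.

Lemma inner_unit_bound p u w : tnorm p u = 1 -> tnorm p w = 1 -> -1 <= inner p u w <= 1.
Proof. by move=> u1 w1; have := cos_bound p u w; rewrite u1 w1 mulr1 divr1. Qed.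

Lemma vector_angle_self p u : tnorm p u = 1 -> vector_angle p u u = 0.
Proof. by move=> u1; rewrite vector_angle_unit// -tnorm_sqr u1 expr1n acos1. Qed.

Lemma tnormN p u : tnorm p (- u) = tnorm p u.
Proof. by rewrite -scaleN1r tnormZ normrN1 mul1r. Qed.

Lemma innerN p u w : inner p u (- w) = - inner p u w.
Proof. exact: bilNr. Qed.

Lemma vector_angleN p u : tnorm p u = 1 -> vector_angle p u (- u) = pi.
Proof.
move=> u1; rewrite vector_angle_unit ?tnormN//.
by rewrite innerN -tnorm_sqr u1 expr1n acosN1.
Qed.

Lemma vector_angle0 p w : vector_angle p 0 w = pi / 2.
Proof. by rewrite /vector_angle {1}/inner !mul0mx mxE mul0r acos0. Qed.

(* The triangle inequality for angles is Cauchy-Schwarz for the components of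
   [u] and [w] orthogonal to [v]. *)
Lemma vector_angle_triangle p u v w : tnorm p u = 1 -> tnorm p v = 1 -> tnorm p w = 1 ->
  vector_angle p u w <= vector_angle p u v + vector_angle p v w.
Proof.
move=> u1 v1 w1; rewrite !vector_angle_unit//.
have bx := inner_unit_bound u1 v1; have by' := inner_unit_bound v1 w1.
have bz := inner_unit_bound u1 w1.
set x := inner p u v in bx *; set y := inner p v w in by' *; set z := inner p u w in bz *.
have a0 := acos_ge0 bx; have b0 := acos_ge0 by'.
(* When the sum exceeds [pi] the bound is trivial; otherwise both angles lie where the cosine is
   decreasing, and the claim becomes a lower bound on [z]. *)
have [abpi|] := leP (acos x + acos y) pi; last first.
  by move=> /ltW; apply: le_trans; exact: acos_lepi.
have E1 : inner p (u - x *: v) (u - x *: v) = 1 - x ^+ 2.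
  have := tnorm_sqr p u; have := tnorm_sqr p v; rewrite u1 v1 expr1n.
  rewrite {3}/inner -/(bil _ _ _) !(bilBl, bilBr, bilZl, bilZr) /bil -!/(inner p _ _).
  by rewrite (innerC p v u) -/x => <- <-; ring.
have E2 : inner p (w - y *: v) (w - y *: v) = 1 - y ^+ 2.
  have := tnorm_sqr p w; have := tnorm_sqr p v; rewrite w1 v1 expr1n.
  rewrite {3}/inner -/(bil _ _ _) !(bilBl, bilBr, bilZl, bilZr) /bil -!/(inner p _ _).
  by rewrite (innerC p w v) -/y => <- <-; ring.
have E3 : inner p (u - x *: v) (w - y *: v) = z - x * y.
  have := tnorm_sqr p v; rewrite v1 expr1n.
  rewrite {2}/inner -/(bil _ _ _) !(bilBl, bilBr, bilZl, bilZr) /bil -!/(inner p _ _).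
  by rewrite -/x -/y -/z => <-; ring.
have CS := inner_cauchy_schwarz p (u - x *: v) (w - y *: v).
rewrite E3 /tnorm E1 E2 ler_norml in CS; have {CS}/andP[CS _] := CS.
rewrite leNgt; apply/negP => lt.
have : cos (acos z) < cos (acos x + acos y).
  by rewrite ltr_cos// in_itv/= ?addr_ge0//= acos_ge0// acos_lepi.
rewrite cosD !sin_acos// !acosK ?in_itv//= ltNge => /negP; apply.
by rewrite lerBlDr -lerBlDl addrC -lerBrDr opprK in CS *; move: CS; lra.
Qed.

End angles.

(** * The distance function and minimizing geodesics *)

Section minimizing_geodesics.
Context {R : realType} {n : nat} {E : riemannian_manifold R n}.
Implicit Types (p x y z : E) (c : R -> E) (u v w : 'rV[R]_n).
Hypothesis cE : complete_manifold E.
Hypothesis HL : forall x : E, exists L, is_log x L.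

Lemma dist_gexp x u : dist x (gexp x u) = tnorm x u.
Proof. by have [L [_ _ Le Ld]] := HL x; rewrite Ld Le. Qed.

Lemma gexp_inj x u w : gexp x u = gexp x w -> u = w.
Proof. by have [L [_ _ Le Ld]] := HL x => /(congr1 L); rewrite !Le. Qed.

Lemma gexp_surj x y : exists2 u, gexp x u = y & tnorm x u = dist x y.
Proof. by have [L [_ eL Le Ld]] := HL x; exists (L y); rewrite ?eL ?Ld. Qed.

Lemma dist_continuous_right x : continuous (dist x).
Proof.
have [L [cL _ _ Ld]] := HL x => y.
have -> : dist x = (fun u => tnorm x u) \o L by apply/funext => z; exact: Ld.
by apply: continuous_comp; [exact: cL|exact: tnorm_continuous].
Qed.

Lemma dist_ge0 x y : 0 <= dist x y.
Proof. by have [u _ <-] := gexp_surj x y; exact: tnorm_ge0. Qed.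

Lemma dist_self x : dist x x = 0.
Proof. by rewrite -[X in dist _ X](gexp0 x cE) dist_gexp tnorm0. Qed.

Lemma tnorm_eq0 p u : tnorm p u = 0 -> u = 0.
Proof. by rewrite tnormE; apply: bnorm_eq0; exact: metric_at_posdef. Qed.

Lemma dist_eq0 x y : dist x y = 0 -> x = y.
Proof.
have [u <- <-] := gexp_surj x y; move=> /tnorm_eq0 ->.
by rewrite gexp0.
Qed.

Lemma geodesic_gexp c s t : geodesic c ->
  c t = gexp (c s) ((t - s) *: vec (velocity c s)).
Proof.
move=> gc; rewrite gexp_scale//.
have -> : gam (c s) (vec (velocity c s)) = fun r => c (1 * r + s).
  apply: geodesic_ofE; first exact: geodesic_affine.
  rewrite velocity_affine; last exact: (gc.1 1%N).
  by rewrite mulr0 add0r scale1r.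
by rewrite mul1r subrK.
Qed.

Lemma dist_geodesic c s t : geodesic c -> dist (c s) (c t) = `|t - s| * speed c s.
Proof. by move=> gc; rewrite (geodesic_gexp s t gc) dist_gexp tnormZ. Qed.

Lemma dist_unit_geodesic c s t : unit_geodesic c -> dist (c s) (c t) = `|t - s|.
Proof. by move=> [gc c1]; rewrite dist_geodesic// c1 mulr1. Qed.

Lemma dist_sym x y : dist x y = dist y x.
Proof.
have [u <- _] := gexp_surj x y; have gc := gam_geodesic x cE u.
have e0 : gam x u 0 = x by exact: gam0.
have -> : dist x (gexp x u) = dist (gam x u 0) (gam x u 1) by rewrite e0.
have -> : dist (gexp x u) x = dist (gam x u 1) (gam x u 0) by rewrite e0.
by rewrite (dist_geodesic 0 1 gc) (dist_geodesic 1 0 gc) (geodesic_speed_cst 0 1 gc) distrC.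
Qed.

Lemma path_length_ge x y s : piecewise_path x s y -> 0 <= path_length s.
Proof.
move=> _; rewrite /path_length; apply: sumr_ge0 => c _.
by apply: Rintegral_ge0 => t _; exact: speed_ge0.
Qed.

(** The two minimizing geodesics, put end to end, form a piecewise path that competes in the
    infimum. *)
Lemma dist_triangle x y z : dist x z <= dist x y + dist y z.
Proof.
have [u Eu <-] := gexp_surj x y; have [w Ew <-] := gexp_surj y z.
have [p1 l1] := gexp_path cE x u; have [p2 l2] := gexp_path cE y w.
rewrite Eu in p1; rewrite Ew in p2.
rewrite -l1 -l2 -path_length_cat; apply: ge_inf.
  by exists 0 => _ [s ps <-]; exact: path_length_ge ps.
by eexists; last reflexivity; exact: piecewise_path_cat p1 p2.
Qed.

Lemma dist_triangleB x y z : dist x y - dist y z <= dist x z.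
Proof. by rewrite lerBlDr (dist_sym y z); exact: dist_triangle. Qed.

Lemma dist_to_le p (A : set E) q : A q -> dist_to p A <= dist p q.
Proof.
move=> Aq; apply: ge_inf; last by exists q.
by exists 0 => _ [r _ <-]; exact: dist_ge0.
Qed.

Lemma dist_to_ge p (A : set E) (r : R) : A !=set0 -> (forall q, A q -> r <= dist p q) ->
  r <= dist_to p A.
Proof.
move=> [q Aq] H; apply: lb_le_inf; first by exists (dist p q); exists q.
by move=> _ [q' Aq' <-]; exact: H.
Qed.

Lemma dist_to_lt p (A : set E) (r : R) : A !=set0 -> dist_to p A < r ->
  exists2 q, A q & dist p q < r.
Proof.
move=> [q Aq] /inf_lt[|_ [q' Aq' <-] lt]; first by exists (dist p q); exists q.
by exists q'.
Qed.

Lemma unit_gam p u : tnorm p u = 1 -> unit_geodesic (gam p u).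
Proof.
move=> u1; split; first exact: gam_geodesic.
move=> t; rewrite (geodesic_speed_cst t 0 (gam_geodesic p cE u)) /speed gam_velocity0//.
by rewrite gam0.
Qed.

Lemma unit_geodesic_gam c : unit_geodesic c -> c = gam (c 0) (vec (velocity c 0)).
Proof. by move=> [gc _]; apply/esym; exact: geodesic_ofE. Qed.

Lemma unit_geodesic_reverse c s : unit_geodesic c -> unit_geodesic (fun t => c (s - t)).
Proof.
move=> [gc c1]; have -> : (fun t => c (s - t)) = fun t => c (-1 * t + s).
  by apply/funext => t; rewrite mulN1r addrC.
split; first exact: geodesic_affine.
by move=> t; rewrite speed_affine ?normrN1 ?mul1r//; exact: (gc.1 1%N).
Qed.

Lemma unit_geodesic_between x y : x <> y -> exists2 c, unit_geodesic c &
  c 0 = x /\ c (dist x y) = y.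
Proof.
move=> xy; have [u Eu nu] := gexp_surj x y.
have d0 : dist x y != 0 by apply/eqP => /dist_eq0.
exists (gam x ((dist x y)^-1 *: u)).
  by apply: unit_gam; rewrite tnormZ nu ger0_norm ?invr_ge0 ?dist_ge0// mulVf.
split; first by rewrite gam0.
by rewrite -gexp_scale// scalerA divff// scale1r.
Qed.

(** [geodesic_to] is a choice. Any candidate reaches [c t] at the time given by the distance, hence
    at time [t], and has the initial vector of [c] because the exponential map is injective. *)
Lemma unit_geodesic_through c t : unit_geodesic c -> 0 < t ->
  geodesic_to (c 0) (Finite (c t)) = c.
Proof.
move=> uc t0; rewrite /geodesic_to.
set S := [set _ | _]; have Sc : S c by split=> //; exists t.
have [uc' c0' [t' t'0 ct']] := xgetPex (cst (c 0)) (ex_intro S c Sc).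
move: uc' c0' ct'; move: (xget _ _) => c' uc' c0' ct'.
have tt' : t' = t.
  have := dist_unit_geodesic 0 t uc; rewrite -ct' -c0' dist_unit_geodesic//.
  by rewrite !subr0 !gtr0_norm.
rewrite (unit_geodesic_gam uc) (unit_geodesic_gam uc') c0'; congr (gam _ _).
apply: (scalerI (lt0r_neq0 t0)); apply: (@gexp_inj (c 0)).
have := geodesic_gexp 0 t uc.1; have := geodesic_gexp 0 t' uc'.1.
rewrite !subr0 c0' ct' tt' => e1 e2; exact: etrans (esym e1) e2.
Qed.

Lemma geodesic_to_finite p q : p <> q ->
  [/\ unit_geodesic (geodesic_to p (Finite q)), geodesic_to p (Finite q) 0 = p &
      geodesic_to p (Finite q) (dist p q) = q].
Proof.
move=> pq; have [c uc [c0 cd]] := unit_geodesic_between pq.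
have d0 : 0 < dist p q.
  by rewrite lt_neqAle dist_ge0 andbT eq_sym; apply/eqP => /dist_eq0.
by have := unit_geodesic_through uc d0; rewrite c0 cd => ->.
Qed.

Lemma unit_velocity c p : unit_geodesic c -> c 0 = p -> tnorm p (vec (velocity c 0)) = 1.
Proof. by move=> [_ c1] <-; exact: c1. Qed.

Lemma direction_unit p (x : cone_space E) : unit_geodesic (geodesic_to p x) ->
  geodesic_to p x 0 = p -> tnorm p (direction_to p x) = 1.
Proof. exact: unit_velocity. Qed.

Lemma direction_finite_unit p q : p <> q -> tnorm p (direction_to p (Finite q)) = 1.
Proof. by move=> /geodesic_to_finite[u0 u1 _]; exact: direction_unit. Qed.

Lemma velocity_cst (p : E) (t : R) : vec (velocity (cst p) t) = 0.
Proof.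
rewrite /velocity /= derive1E (_ : _ \o cst p = cst (chart (chart_at p) p)) //.
exact: derive_cst.
Qed.

End minimizing_geodesics.

(** * The topology of the tangent bundle and of the cone compactification *)

Section subbases.
Context {R : realType} {n : nat} {M : riemannian_manifold R n}.

(** An open set is a union of finite intersections of subbasic sets, so convergence may be tested on
    the subbase. *)
Lemma cone_cvg (T : Type) (F : set_system T) (FF : Filter F) (f : T -> cone_space M)
    (x : cone_space M) :
  (forall S, cone_subbase S -> S x -> F (f @^-1` S)) -> f @ F --> x.
Proof.
move=> H A; rewrite nbhsE => -[B [oB Bx] BA].
have : F (f @^-1` B); last by apply: filterS => t; exact: BA.
case: oB => D' sD' EB; move: Bx; rewrite -EB => -[C DC Cx].
have [D sD EC] := sD' _ DC.
suff : F (f @^-1` C) by apply: filterS => t Ct; exists C.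
rewrite -EC.
apply: (@filter_bigI _ _ D id (f @ F)) => S SD; apply: H.
  exact: set_mem (sD _ SD).
by move: Cx; rewrite -EC; exact.
Qed.

Lemma cone_nbhs (x : cone_space M) S : cone_subbase S -> S x -> nbhs x S.
Proof.
move=> bS Sx; rewrite nbhsE; exists S => //; split => //.
exists [set S]; last by rewrite bigcup_set1.
by move=> _ ->; exact: finI_from1.
Qed.

Lemma tangent_cvg (T : Type) (F : set_system T) (FF : Filter F) (f : T -> tangent_vector M)
    (x : tangent_vector M) :
  (forall S, tangent_subbase S -> S x -> F (f @^-1` S)) -> f @ F --> x.
Proof.
move=> H A; rewrite nbhsE => -[B [oB Bx] BA].
have : F (f @^-1` B); last by apply: filterS => t; exact: BA.
case: oB => D' sD' EB; move: Bx; rewrite -EB => -[C DC Cx].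
have [D sD EC] := sD' _ DC.
suff : F (f @^-1` C) by apply: filterS => t Ct; exists C.
rewrite -EC.
apply: (@filter_bigI _ _ D id (f @ F)) => S SD; apply: H.
  exact: set_mem (sD _ SD).
by move: Cx; rewrite -EC; exact.
Qed.

Lemma tangent_nbhs (x : tangent_vector M) S : tangent_subbase S -> S x -> nbhs x S.
Proof.
move=> bS Sx; rewrite nbhsE; exists S => //; split => //.
exists [set S]; last by rewrite bigcup_set1.
by move=> _ ->; exact: finI_from1.
Qed.

Lemma base_continuous : continuous (@base R n M).
Proof.
move=> v; have iv := chart_atP (base v); set i := chart_at (base v) in iv.
move=> V; rewrite nbhsE => -[B [oB Bv] BV].
pose W : set ('rV[R]_n * 'rV[R]_n) := [set z | (chart i @` (chart_dom i `&` B)) z.1].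
have oW : open W.
  apply: (@open_comp _ _ fst); last exact: chart_image_open.
  by move=> z _; exact: cvg_fst.
have nS : nbhs v [set w : tangent_vector M | chart_dom i (base w) /\ W (chart i (base w), coord i w)].
  apply: tangent_nbhs; first by exists i, W.
  by split=> //; exists (base v).
apply: filterS nS => w [iw [q [iq Bq] Eq]]; apply: BV.
by rewrite /= in Eq; rewrite -(chartK iw) -Eq chartK.
Qed.

(** The subbase involves every chart [j] of the tangent bundle; continuity in one chart [i] suffices
    because [tau i j] is continuous. *)
Lemma tangent_continuous (T : topologicalType) (f : T -> tangent_vector M) (z : T)
    (i : chart_index M) : chart_dom i (base (f z)) ->
  {for z, continuous (fun y => base (f y))} -> {for z, continuous (fun y => tstate i (f y))} ->
  {for z, continuous f}.
Proof.
move=> iz cb ct; apply: tangent_cvg => S [j [W [oW ->]]] /= [jz Wz].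
have ni : \forall y \near z, chart_dom i (base (f y)).
  by apply: (continuous_near cb) => //; exact: chart_dom_open.
have nj : \forall y \near z, chart_dom j (base (f y)).
  by apply: (continuous_near cb) => //; exact: chart_dom_open.
have ctau : {for z, continuous (fun y => tau i j (tstate i (f y)))}.
  apply: (@continuous_comp _ _ _ (fun y => tstate i (f y)) (tau i j)); first exact: ct.
  apply: (@tau_Ck _ _ _ 0); rewrite /tau_dom/= row_mxKl.
  exact: trans_domain.
pose g (q : 'rV[R]_(n + n)) : 'rV[R]_n * 'rV[R]_n := (lsubmx q, rsubmx q).
have cg q : {for q, continuous g}.
  by apply: pair_continuous; [exact: (@lsubmx_Ck _ _ 0 setT openT)|exact: (@rsubmx_Ck _ _ 0 setT openT)].
have nW : \forall y \near z, W (g (tau i j (tstate i (f y)))).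
  have cgt : {for z, continuous (g \o (fun y => tau i j (tstate i (f y))))}.
    by apply: continuous_comp ctau _; exact: cg.
  apply: (continuous_near cgt oW).
  by rewrite /= tau_tstate// /g row_mxKl row_mxKr.
near=> y; have iy : chart_dom i (base (f y)) by near: y.
have jy : chart_dom j (base (f y)) by near: y.
split=> //; have : W (g (tau i j (tstate i (f y)))) by near: y.
by rewrite tau_tstate// /g row_mxKl row_mxKr.
Unshelve. all: by end_near.
Qed.

Lemma near_eq_continuous (T X : topologicalType) (f g : T -> X) (z : T) :
  {near z, f =1 g} -> {for z, continuous f} -> {for z, continuous g}.
Proof.
move=> E cf; rewrite /prop_for /continuous_at -(nbhs_singleton E).
by apply: cvg_trans cf; apply: near_eq_cvg; apply: filterS E => y ->.
Qed.

Lemma row_mx_continuous (T : topologicalType) m q (f : T -> 'rV[R]_m) (g : T -> 'rV[R]_q) (z : T) :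
  {for z, continuous f} -> {for z, continuous g} ->
  {for z, continuous (fun y => row_mx (f y) (g y))}.
Proof.
move=> cf cg.
pose A : 'M[R]_(m, m + q) := row_mx 1%:M 0; pose B : 'M[R]_(q, m + q) := row_mx 0 1%:M.
have E : (fun y => row_mx (f y) (g y)) = (fun y => f y *m A + g y *m B).
  by apply/funext => y; rewrite !mul_mx_row !mulmx1 !mulmx0 add_row_mx addr0 add0r.
have cA := @mulmxr_continuous R 1 m (m + q) A (f z).
have cB := @mulmxr_continuous R 1 q (m + q) B (g z).
have c1 : {for z, continuous (fun y => f y *m A)} := continuous_comp cf cA.
have c2 : {for z, continuous (fun y => g y *m B)} := continuous_comp cg cB.
by rewrite E; exact: (cvgD c1 c2).
Qed.

(** A cluster point in recurrence form: each of its neighbourhoods contains terms of arbitrarily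
    large index, among which terms with large parameters can be selected. *)
Lemma cluster_seq (T : topologicalType) (A : set T) (u : nat -> T) :
  compact A -> (forall k, A (u k)) -> exists2 x, A x &
    forall N, nbhs x N -> forall m, exists2 k, (m <= k)%N & N (u k).
Proof.
move=> cA Au; have FA : (u @ \oo) A by exists 0%N => // k _; exact: Au.
have [x [Ax clx]] := cA _ _ FA; exists x => // N nN m.
have Fm : (u @ \oo) [set y | exists2 k, (m <= k)%N & y = u k].
  have : \forall k \near \oo, exists2 k', (m <= k')%N & u k = u k'; last by [].
  by exists m => // k mk; exists k.
by have [y [[k mk ->] Ny]] := clx _ _ Fm nN; exists k.
Qed.

(* Unit vectors with base point in a small coordinate ball form a compact set:
   it is parametrized by the ball and the unit sphere of [R^n]. *)
Lemma unit_tangent_locally_compact (x : M) : exists (A : set (tangent_vector M)) (N : set M),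
  [/\ compact A, A `<=` unit_tangent (M := M), nbhs x N &
      forall v : tangent_vector M, N (base v) -> unit_tangent v -> A v].
Proof.
have ix := chart_atP x; set i := chart_at x in ix.
have [r r0 [C C0 Hr]] := coordinate_ball ix.
pose Z := [set z : 'rV[R]_(n + n) | `|lsubmx z - chart i x| <= r / 2 /\ `|rsubmx z : 'rV_n| = 1].
have Zi z : Z z -> chart_img i (lsubmx z).
  move=> [zr _]; apply: (Hr _ _).1; rewrite -ball_normE/= distrC (le_lt_trans zr)//.
  by rewrite ltr_pdivrMr// ltr_pMr// ltr1n.
pose len (z : 'rV[R]_(n + n)) := bnorm (metric i (lsubmx z)) (rsubmx z).
have len0 z : Z z -> len z != 0.
  move=> Zz; have [p ip pz] := Zi _ Zz; apply/eqP; rewrite /len -pz => /(bnorm_eq0 (metric_posdef ip)) E.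
  by have [_] := Zz; rewrite E normr0 => /eqP; rewrite eq_sym oner_eq0.
(* The Euclidean data are renormalized by the Riemannian length, so that [Psi] takes its values in
   the unit tangent vectors. *)
pose Psi (z : 'rV[R]_(n + n)) := of_coord i (chart_inv i (lsubmx z)) ((len z)^-1 *: rsubmx z).
have cl z : {for z, continuous (fun z : 'rV[R]_(n + n) => lsubmx z)}.
  exact: (@lsubmx_Ck _ _ 0 setT openT).
have cr z : {for z, continuous (fun z : 'rV[R]_(n + n) => rsubmx z)}.
  exact: (@rsubmx_Ck _ _ 0 setT openT).
have clen z : Z z -> {for z, continuous len}.
  move=> Zz; apply: (@continuous_comp _ _ _ (fun z => met i (lsubmx z) (rsubmx z) (rsubmx z)) Num.sqrt); last first.
    exact: sqrt_continuous.
  have oS : open (@state_dom _ _ M i) by exact: state_dom_open.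
  have Cm k : Ck_on k (state_dom i) (fun z => met i (lsubmx z) (rsubmx z) (rsubmx z)).
    rewrite /met; under eq_fun do rewrite bilE.
    apply: Ck_on_sum => // a; apply: Ck_on_sum => // b.
    apply: Ck_onM => //; last by under eq_fun do rewrite mxE; exact: Ck_on_coord.
    apply: Ck_onM => //; first by under eq_fun do rewrite mxE; exact: Ck_on_coord.
    apply: (Ck_on_comp (f := fun z => lsubmx z : 'rV_n) (U' := chart_img i)
      (g := fun x => metric i x a b)) => //.
      by move=> c; under eq_fun do rewrite mxE; exact: Ck_on_coord.
    exact: metric_entry_Ck.
  by apply: (Cm 0%N); exact: Zi.
have base_Psi z : Z z -> chart_dom i (base (Psi z)) by move=> Zz; exact: chart_inv_dom (Zi _ Zz).
exists (Psi @` Z), [set p | chart_dom i p /\ `|chart i p - chart i x| <= r / 2]; split.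
- apply: continuous_compact.
    apply: continuous_in_subspaceT => z /set_mem Zz.
    have iz := Zi _ Zz.
    apply: (tangent_continuous (base_Psi _ Zz)).
      apply: (@continuous_comp _ _ _ (fun z : 'rV[R]_(n + n) => lsubmx z) (chart_inv i)); first exact: cl.
      exact: chart_inv_continuous_at.
    have nz : \forall y \near z, chart_img i (lsubmx y).
      by apply: (continuous_near (cl z)) => //; exact: chart_img_open.
    have E : {near z, (fun y => row_mx (lsubmx y) ((len y)^-1 *: rsubmx y)) =1 (fun y => tstate i (Psi y))}.
      near=> y; have iy : chart_img i (lsubmx y) by near: y; exact: nz.
      by rewrite /tstate /= chart_invK// of_coordK//; exact: chart_inv_dom.
    have crow : {for z, continuous (fun y => row_mx (lsubmx y) ((len y)^-1 *: rsubmx y))}.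
      have c1 : {for z, continuous (fun y => (len y)^-1 *: rsubmx y)}.
        have c2 : {for z, continuous (fun y => (len y)^-1)} by exact: (cvgV (len0 _ Zz) (clen _ Zz)).
        exact: (cvgZ c2 (cr z)).
      exact: row_mx_continuous (cl z) c1.
    exact: near_eq_continuous E crow.
  apply: bounded_closed_compact.
    exists (`|chart i x| + r + 1); split=> [|m Hm z [z1 z2]]; first exact: num_real.
    apply: le_trans (ltW Hm); apply: mx_norm_le => [|a b].
      by rewrite !addr_ge0// ltW.
    rewrite ord1 -[z]hsubmxK -(splitK b); case: (fintype.split b) => l /=.
      rewrite row_mxEl (le_trans (mx_entry_le_norm _ _ _))//.
      rewrite -[lsubmx z](subrK (chart i x)) (le_trans (ler_normD _ _))//.
      have : r / 2 <= r by rewrite ler_pdivrMr// ler_pMr// ler1n.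
      by move: z1; move: (`|lsubmx z - _|) (`|chart i x|) => a1 a2; lra.
    rewrite row_mxEr (le_trans (mx_entry_le_norm _ _ _))// z2.
    by rewrite lerDr addr_ge0// ltW.
  have -> : Z = (fun z => `|lsubmx z - chart i x|) @^-1` [set t | t <= r / 2] `&`
      (fun z : 'rV[R]_(n + n) => `|rsubmx z : 'rV_n|) @^-1` [set t | t = 1] by [].
  apply: closedI.
    apply: closed_comp => [z _|]; last exact: closed_le.
    apply: (@continuous_comp _ _ _ (fun z : 'rV[R]_(n + n) => lsubmx z) (fun y => `|y - chart i x|)).
      exact: cl.
    exact: dist_continuous.
  apply: closed_comp => [z _|]; last exact: closed_eq.
  apply: (@continuous_comp _ _ _ (fun z : 'rV[R]_(n + n) => rsubmx z) (fun y => `|y|)).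
    exact: cr.
  exact: norm_continuous.
- move=> _ [z Zz <-]; have iz := chart_inv_dom (Zi _ Zz).
  rewrite /unit_tangent /= (tnorm_coord _ iz) of_coordK// chart_invK; last exact: Zi.
  rewrite bnormZ -/(len z) ger0_norm ?invr_ge0 ?bnorm_ge0// mulVf//; exact: len0.
- apply: filterI; first exact: near_chart_dom.
  have cd : {for x, continuous (fun p => `|chart i p - chart i x|)}.
    apply: (@continuous_comp _ _ _ (chart i) (fun y => `|y - chart i x|)).
      exact: chart_continuous_at.
    exact: dist_continuous.
  have : \forall p \near x, `|chart i p - chart i x| < r / 2.
    apply: (continuous_near cd (@open_lt _ (r / 2))).
    by rewrite /= subrr normr0 divr_gt0.
  by apply: filterS => p /ltW.
- move=> v [iv vr] uv.
  have uv' : bnorm (metric i (chart i (base v))) (coord i v) = 1.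
    by rewrite -[RHS]uv (tnorm_coord _ iv); case: (v).
  have k0 : coord i v != 0.
    apply/eqP => E; move: uv'; rewrite E /bnorm bil0l sqrtr0 => /eqP.
    by rewrite eq_sym oner_eq0.
  have N0 : `|coord i v| != 0 by rewrite normr_eq0.
  exists (row_mx (chart i (base v)) (`|coord i v|^-1 *: coord i v)).
    rewrite /Z /= row_mxKl row_mxKr; split=> //.
    by rewrite normrZ normfV normr_id mulVf.
  rewrite /Psi /len row_mxKl row_mxKr bnormZ uv' mulr1 normfV normr_id invrK scalerA divff// scale1r.
  by rewrite chartK// coordK.
Unshelve. all: by end_near.
Qed.

End subbases.

(** * Visibility and conical limit points *)

Section deck_transformations.
Context {R : realType} {n : nat} {E M : riemannian_manifold R n}.
Variable (proj : E -> M).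
Hypotheses (scE : simply_connected R E) (cov : covering_map proj) (iso : local_isometry proj).
Hypothesis cM : complete_manifold M.
Hypothesis HL : forall x : E, exists L, is_log x L.

Let cE : complete_manifold E. Proof. exact: cover_complete cov iso cM. Qed.
Let proj_continuous : continuous proj. Proof. by case: iso. Qed.

(** The lifting theorem for [proj] through itself gives maps [a] and [b] in both directions; their
    compositions lift [proj] and fix a point, hence are the identity. *)
Lemma deck_transitive e e' : proj e = proj e' ->
  exists2 a, deck_group proj a & a e = e'.
Proof.
have lift x y : proj x = proj y -> exists G : E -> E,
    [/\ continuous G, proj \o G = proj & G x = y].
  move=> xy; apply: (lifting_theorem (f := proj) (R := R)) => //.
  - exact: manifold_hausdorff.
  - exact: covering_locally_invertible.
  - exact: covering_path_lifting.
  - exact: manifold_locally_path_connected.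
move=> ee'; have [a [ca pa ae]] := lift _ _ ee'; have [b [cb pb be]] := lift _ _ (esym ee').
exists a => //; split=> //; split=> //; exists b; split=> // y.
- apply: (deck_fixed scE cov (h := b \o a) (x := e)).
  + by move=> z; apply: continuous_comp; [exact: ca|exact: cb].
  + move=> z; transitivity ((proj \o b) (a z)) => //.
    by rewrite pb; exact: (congr1 (fun f => f z) pa).
  + by rewrite /= ae.
- apply: (deck_fixed scE cov (h := a \o b) (x := e')).
  + by move=> z; apply: continuous_comp; [exact: cb|exact: ca].
  + move=> z; transitivity ((proj \o a) (b z)) => //.
    by rewrite pa; exact: (congr1 (fun f => f z) pb).
  + by rewrite /= be.
Qed.

(** [a] carries the geodesic from [x] to [y] to another lift of the same projected geodesic. This
    lift is a geodesic of the same speed, and the speed is the distance between its points at times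
    0 and 1. *)
Lemma deck_dist a x y : deck_group proj a -> dist (a x) (a y) = dist x y.
Proof.
move=> [[ca _] pa]; have [u Eu nu] := gexp_surj HL x y.
have gc := gam_geodesic x cE u.
have cag : continuous (a \o gam x u).
  by move=> t; apply: continuous_comp; [exact: (gc.1 0%N).1|exact: ca].
have pag : proj \o (a \o gam x u) = proj \o gam x u.
  by apply/funext => t; exact: (congr1 (fun f => f (gam x u t)) pa).
have ga := lift_geodesic iso (proj_geodesic cov iso cM gc) cag pag.
have := dist_geodesic cE HL 0 1 ga; rewrite /= gam0// -[gam x u 1]/(gexp x u) Eu => ->.
rewrite -(proj_speed iso _ (ga.1 1%N)) pag (proj_speed iso _ (gc.1 1%N)).
by rewrite /speed gam_velocity0// gam0// nu subr0 normr1 mul1r.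
Qed.

End deck_transformations.

(** * Angles at infinity and convergence in the cone topology *)

Section visibility.
Context {R : realType} {n : nat} {E : riemannian_manifold R n}.
Implicit Types (p q x y : E) (c : R -> E).
Hypothesis cE : complete_manifold E.
Hypothesis HL : forall x : E, exists L, is_log x L.
Hypothesis vis : uniform_visibility E.

(** The points of the segment from [x] to [y] are within [d] of [x], hence at distance at least [r]
    from [q]. The case [x = y] is separate because visibility is stated for nondegenerate
    segments. *)
Lemma segment_angle (e : R) : 0 < e -> exists2 r : R, 0 < r &
  forall q x y (d : R), dist x y <= d -> r + d <= dist q x ->
    visual_angle q (Finite x) (Finite y) <= e.
Proof.
move=> e0; have [r r0 H] := vis e0; exists r => // q x y d xyd rd.
have d0 : 0 <= d by apply: le_trans xyd; exact: dist_ge0.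
have qx : q <> x.
  by move=> qx; move: rd; rewrite qx dist_self// leNgt ltr_wpDr.
have [<-|xy] := pselect (x = y).
  by rewrite /visual_angle vector_angle_self ?ltW//; exact: direction_finite_unit.
have [c uc [c0 cd]] := unit_geodesic_between cE HL xy.
have D0 : 0 < dist x y.
  by rewrite lt_neqAle dist_ge0// andbT eq_sym; apply/eqP => /(dist_eq0 cE HL).
apply: (H q c 0%:E%E (dist x y)%:E%E) => //.
apply: dist_to_ge.
  by exists (c 0); exists 0 => //=; rewrite !lee_fin lexx ltW.
move=> _ [t [t0 td] <-]; rewrite !lee_fin in t0 td.
have := dist_triangleB cE HL q x (c t).
rewrite -[X in dist X (c t)]c0 (dist_unit_geodesic cE HL) // subr0 ger0_norm//.
by move: rd xyd td; move: (dist q x) (dist x y) (dist q (c t)) => *; lra.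
Qed.

(** By the triangle inequality the part of the ray from time [t] on stays at distance at least [r]
    from [q]. *)
Lemma ray_angle (e : R) : 0 < e -> exists2 r : R, 0 < r &
  forall q c (xi : ideal_boundary E) t, unit_geodesic c -> val xi c ->
    r + dist q (c 0) <= t -> visual_angle q (Finite (c t)) (Ideal xi) <= e.
Proof.
move=> e0; have [r r0 H] := vis e0; exists r => // q c xi t uc xc rt.
apply: (H q c t%:E%E +oo%E) => //; first by rewrite ltry.
apply: dist_to_ge; first by exists (c t); exists t => //=; rewrite lexx leey.
move=> _ [s [ts _] <-]; rewrite lee_fin in ts.
have s0 : 0 <= s by apply: le_trans ts; apply: le_trans rt; rewrite addr_ge0 ?(ltW r0)// dist_ge0.
have := dist_triangle cE HL (c 0) q (c s).
rewrite (dist_unit_geodesic cE HL)// subr0 ger0_norm// (dist_sym cE HL (c 0)).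
by move: rt ts; move: (dist q (c 0)) (dist q (c s)) => *; lra.
Qed.

Lemma asymptoticP (xi : ideal_boundary E) c c' : val xi c -> val xi c' -> asymptotic c c'.
Proof.
have [c0 u0 E0] := set_valP xi; rewrite -E0 => -[uc [B HB]] [uc' [B' HB']].
exists (B + B') => t t0; apply: le_trans (dist_triangle cE HL _ (c0 t) _) _.
by apply: lerD; [rewrite (dist_sym cE HL); exact: HB|exact: HB'].
Qed.

Lemma val_unit (xi : ideal_boundary E) c : val xi c -> unit_geodesic c.
Proof. by have [c0 u0 E0] := set_valP xi; rewrite -E0 => -[]. Qed.

Lemma ideal_representative (xi : ideal_boundary E) : exists c, val xi c.
Proof.
have [c0 u0 E0] := set_valP xi; exists c0; rewrite -E0; split=> //.
by exists 0 => t _; rewrite (dist_self cE HL).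
Qed.

(* A point at infinity that could not be joined to [q] would have the zero
   direction at [q], at angle [pi / 2] from everything, against visibility. *)
Lemma geodesic_to_ideal q (xi : ideal_boundary E) :
  [/\ unit_geodesic (geodesic_to q (Ideal xi)), geodesic_to q (Ideal xi) 0 = q &
      val xi (geodesic_to q (Ideal xi))].
Proof.
set S := [set c | [/\ unit_geodesic c, c 0 = q & val xi c]].
have [[c Sc]|nS] := pselect (exists c, S c).
  exact: (xgetPex (cst q) (ex_intro S c Sc)).
exfalso; have [c xc] := ideal_representative xi; have uc := val_unit xc.
have [|r r0 H] := ray_angle (e := 2^-1); first by rewrite invr_gt0.
have := H q c xi _ uc xc (lexx _).
have g0 : geodesic_to q (Ideal xi) = cst q.
  by apply: xgetPN => c' Sc'; apply: nS; exists c'.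
rewrite /visual_angle vector_angleC {1}/direction_to g0 velocity_cst vector_angle0.
by have := @pi_ge2 R; lra.
Qed.

Lemma direction_ideal_unit q (xi : ideal_boundary E) : tnorm q (direction_to q (Ideal xi)) = 1.
Proof. by have [u0 u1 _] := geodesic_to_ideal q xi; exact: direction_unit. Qed.

Lemma class_ideal c : unit_geodesic c -> exists xi : ideal_boundary E, val xi = asymptote_class c.
Proof.
move=> uc; have Pc : [set asymptote_class c | c in @unit_geodesic R n E] (asymptote_class c).
  by exists c.
by exists (SigSub (mem_set Pc)).
Qed.

(** The comparison goes through [c t]: the directions to [x] and [c t] are close by [segment_angle],
    those to [c t] and [xi] by [ray_angle]. *)
Lemma angle_to_far_points q c (xi : ideal_boundary E) (m e : R) :
  val xi c -> 0 < e -> exists T : R, forall x t, T <= t -> dist x (c t) <= m ->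
    vector_angle q (direction_to q (Finite x)) (direction_to q (Ideal xi)) <= e /\
    q <> x.
Proof.
have absurd_bounds (a b d l t : R) : a + b + d + 2 * l + 1 <= t -> 0 < a -> 0 < b ->
  0 <= d -> 0 <= l -> t - d <= 0 -> False by move=> *; lra.
move=> xc e0; have uc := val_unit xc.
have e2 : 0 < e / 2 by rewrite divr_gt0.
have [r1 r10 H1] := segment_angle e2; have [r2 r20 H2] := ray_angle e2.
(* [dist q (c t)] is at least [t - dist q (c 0)], and [x] is within [m] of [c t]. The terms meet the
   requirements of both angle lemmas and keep [q] distinct from [x] and [c t]; the absolute value is
   there because [m] has no prescribed sign. *)
exists (r1 + r2 + dist q (c 0) + 2 * `|m| + 1) => x t Tt xm.
have D0 := dist_ge0 HL q (c 0); have m0 := normr_ge0 m; have mm := ler_norm m.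
have ct : t - dist q (c 0) <= dist q (c t).
  have := dist_triangle cE HL (c 0) q (c t).
  rewrite (dist_unit_geodesic cE HL)// subr0 (dist_sym cE HL (c 0) q).
  have t0 : 0 <= t by move: Tt r10 r20 D0 m0; move: (dist q (c 0)) `|m| => *; lra.
  by rewrite ger0_norm// -lerBlDl.
have qx1 : dist q (c t) - m <= dist q x.
  have := dist_triangleB cE HL q (c t) x; rewrite (dist_sym cE HL (c t) x).
  by move: xm; move: (dist q (c t)) (dist q x) (dist x (c t)) => *; lra.
have qx2 : r1 + `|m| <= dist q x.
  move: Tt r10 r20 D0 m0 mm qx1 ct.
  by move: (dist q (c 0)) (dist q x) (dist q (c t)) `|m| => *; lra.
have A1 := H1 q x (c t) `|m| (le_trans xm mm) qx2.
have A2 : visual_angle q (Finite (c t)) (Ideal xi) <= e / 2.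
  apply: H2 => //; move: Tt r10 r20 D0 m0.
  by move: (dist q (c 0)) `|m| => *; lra.
have qx : q <> x.
  move=> qx; move: qx2; rewrite qx (dist_self cE HL) leNgt.
  by rewrite ltr_wpDr.
have qc : q <> c t.
  move=> qc; move: ct; rewrite -qc (dist_self cE HL).
  exact: absurd_bounds Tt r10 r20 D0 m0.
split=> //; apply: le_trans (vector_angle_triangle (v := direction_to q (Finite (c t))) _ _ _) _.
- exact: direction_finite_unit.
- exact: direction_finite_unit.
- exact: direction_ideal_unit.
by have := lerD A1 A2; rewrite -splitr.
Qed.

(** An open set of [E] contains no ideal point, so only truncated cones matter. The direction to
    [x k] differs from that to [xi] by at most [dl], half of the room left in the cone, and the
    distance to the apex is large because [t k] is. *)
Lemma cvg_to_ideal c (xi : ideal_boundary E) (m : R) (x : nat -> E) (t : nat -> R) :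
  val xi c -> (forall k, dist (x k) (c (t k)) <= m) -> t @ \oo --> +oo ->
  (fun k => Finite (x k)) @ \oo --> (Ideal xi : cone_space E).
Proof.
move=> xc xm tk; have uc := val_unit xc.
have tge (T : R) : \forall k \near \oo, T <= t k by have /cvgryPge := tk; exact.
apply: cone_cvg => S [[U _ ->] [y _ //]|[q [v [e [r [v1 e0 r0 ->]]]]]].
move=> /= [Sx _].
pose dl := (e - vector_angle q (direction_to q (Ideal xi)) v) / 2.
have dl0 : 0 < dl by rewrite divr_gt0// subr_gt0.
have [T HT] := angle_to_far_points q m xc dl0.
have nT := tge T; have nr := tge (r + 1 + dist q (c 0) + `|m|).
near=> k; have Tk : T <= t k by near: k.
have rk : r + 1 + dist q (c 0) + `|m| <= t k by near: k; exact: nr.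
have [A qx] := HT _ _ Tk (xm k).
have D0 := dist_ge0 HL q (c 0); have m0 := normr_ge0 m; have mm := ler_norm m.
split.
  apply: le_lt_trans (vector_angle_triangle (v := direction_to q (Ideal xi)) _ _ v1) _.
  - exact: direction_finite_unit.
  - exact: direction_ideal_unit.
  move: A; rewrite /dl; move: (vector_angle _ _ _) (vector_angle _ _ v) dl0 Sx => a1 a2 d1 d2 A.
  by rewrite /dl in d1; lra.
have h1 := dist_triangle cE HL (c 0) q (c (t k)).
have h2 := dist_triangle cE HL q (x k) (c (t k)).
have t0 : 0 <= t k.
  by move: rk r0 D0 m0; move: (dist q (c 0)) `|m| (t k) => *; lra.
rewrite (dist_unit_geodesic cE HL)// subr0 ger0_norm// (dist_sym cE HL (c 0) q) in h1.
have h3 := xm k.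
move: h1 h2 h3 rk r0 D0 m0 mm.
by move: (dist q (c 0)) `|m| (t k) (dist q (x k)) (dist q (c (t k))) (dist (x k) (c (t k))) => *; lra.
Unshelve. all: by end_near.
Qed.

(** Distances force [|s k|] to be large. If [s k] were negative, the direction from [p] to [c (s k)]
    would be [- v], while [x k] is close to [c (s k)] and lies in a narrow cone about [v]; then [pi]
    would be at most the sum of two angles bounded by [2^-1]. *)
Lemma cvg_to_ideal_parameters c (xi : ideal_boundary E) (m : R) (x : nat -> E) (s : nat -> R) :
  c = geodesic_to (c 0) (Ideal xi) ->
  (fun k => Finite (x k)) @ \oo --> (Ideal xi : cone_space E) ->
  (forall k, dist (x k) (c (s k)) <= m) -> s @ \oo --> +oo.
Proof.
have absurd_angles (a b q : R) : 2 <= q -> q <= a + b -> b <= 2^-1 -> a < 2^-1 -> False.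
  by move=> *; lra.
move=> cdef cx xm; set p := c 0 in cdef.
have [uc c0 xc] := geodesic_to_ideal p xi; rewrite -cdef in uc c0 xc.
apply/cvgryPge => T.
have h2 : 0 < (2^-1 : R) by rewrite invr_gt0.
have [r1 r10 H1] := segment_angle h2.
have d1 := direction_ideal_unit p xi; set v := direction_to p (Ideal xi) in d1.
(* [r1 + |m|] is what [segment_angle] requires of [dist p (x k)]; the remaining terms push [|s k|]
   beyond [|T|]. *)
pose r := r1 + `|T| + 3 * `|m| + 1.
have r0 : 0 < r by rewrite /r ltr_wpDl// !addr_ge0 ?(ltW r10)// mulr_ge0.
have nS : nbhs (Ideal xi : cone_space E) (truncated_cone p v 2^-1 r).
  apply: cone_nbhs; first by right; exists p, v, 2^-1, r.
  by split=> //; rewrite -/v vector_angle_self.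
have nk : \forall k \near \oo, truncated_cone p v 2^-1 r (Finite (x k)) by exact: cx nS.
apply: filterS nk => k [Ak rk].
have h := dist_triangle cE HL p (c (s k)) (x k).
rewrite (dist_sym cE HL (c (s k)) (x k)) {1}/p (dist_unit_geodesic cE HL)// subr0 in h.
have h3 := xm k; have m0 := normr_ge0 m; have mm := ler_norm m; have T0 := ler_norm T.
have T00 := normr_ge0 T.
have sk : r1 + `|T| + 2 * `|m| + 1 <= `|s k|.
  move: h h3 rk m0 mm; rewrite /r.
  by move: `|m| `|T| `|s k| (dist p (x k)) (dist (x k) (c (s k))) => *; lra.
have [s0|s0] := ltP (s k) 0; last first.
  by move: sk; rewrite (ger0_norm s0); move: `|m| `|T| T0 m0 r10 => *; lra.
exfalso; have psk : p <> c (s k).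
  move=> E0; have := dist_unit_geodesic cE HL 0 (s k) uc; rewrite -/p -E0 (dist_self cE HL) subr0.
  by move=> /esym/eqP; rewrite normr_eq0 => /eqP E1; rewrite E1 ltxx in s0.
pose c' t := c (0 - t); have uc' := unit_geodesic_reverse 0 uc.
have Ec' : geodesic_to p (Finite (c (s k))) = c'.
  have := unit_geodesic_through cE HL uc' (t := - s k); rewrite oppr_gt0 => /(_ s0).
  by rewrite opprK sub0r oppr0 add0r.
have Ed : direction_to p (Finite (c (s k))) = - v.
  rewrite /direction_to Ec' /v /direction_to -cdef.
  have -> : c' = fun t => c (-1 * t + 0) by apply/funext => t; rewrite /c' mulN1r addr0 sub0r.
  rewrite velocity_affine; last exact: (uc.1.1 1%N).
  by rewrite mulr0 addr0 /= scaleN1r.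
have A1 : visual_angle p (Finite (x k)) (Finite (c (s k))) <= 2^-1.
  apply: (H1 p (x k) (c (s k)) `|m|); first exact: le_trans mm.
  move: rk; rewrite /r; move: `|m| `|T| (dist p (x k)) m0 T00 => *; lra.
have px : p <> x k.
  by move=> px; move: rk; rewrite -px (dist_self cE HL) ltNge (ltW r0).
have := vector_angle_triangle (p := p) (u := v) (v := direction_to p (Finite (x k))) (w := - v) d1.
rewrite vector_angleN// tnormN => /(_ (direction_finite_unit cE HL px) d1).
rewrite vector_angleC -Ed => h4; exact: absurd_angles (@pi_ge2 R) h4 A1 Ak.
Qed.

End visibility.

(** * Conservative points and conical limit points *)

Section conical_limit_points.
Context {R : realType} {n : nat} {E M : riemannian_manifold R n}.
Variable (proj : E -> M).
Hypotheses (scE : simply_connected R E) (cov : covering_map proj) (iso : local_isometry proj).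
Hypotheses (cM : complete_manifold M) (ncp : no_conjugate_points M).
Hypothesis vis : uniform_visibility E.

Let cE : complete_manifold E. Proof. exact: cover_complete cov iso cM. Qed.
Let HL : forall x : E, exists L, is_log x L. Proof. exact: log_exists scE cov iso cM ncp. Qed.
Let proj_continuous : continuous proj. Proof. by case: iso. Qed.

Lemma unit_lift_exists (v : tangent_vector M) : unit_tangent v ->
  exists2 w : tangent_vector E, unit_tangent w & tangent_map proj w = v.
Proof.
move=> v1; have [p pv] : exists p, proj p = base v by case: cov => _ + _; exact.
have [u Eu] := tangent_map_surj iso pv; exists (TangentVector p u) => //.
by rewrite /unit_tangent /= -(tangent_map_tnorm iso (TangentVector p u)) Eu.
Qed.

Lemma unit_geodesic_of (w : tangent_vector E) : unit_tangent w -> unit_geodesic (geodesic_of w).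
Proof. by case: w => p u; exact: unit_gam. Qed.

(** A cluster vector [v0] of the orbit has a neighbourhood over whose base points a section [s] of
    [proj] exists and stays within [m] of [p]. At a return time a deck transformation carries the
    value of [s] to the point of [c], hence carries [p] to within [m] of that point. *)
Lemma conservative_conical (v : tangent_vector M) (w : tangent_vector E) :
  unit_tangent w -> tangent_map proj w = v -> conservative_point v ->
  exists2 xi : ideal_boundary E, endpoint (geodesic_of w) +oo%E (Ideal xi) &
    conical_limit_set (deck_group proj) xi.
Proof.
move=> w1 wv [A [cA _ [t tk At]]].
set c := geodesic_of w; have uc : unit_geodesic c by exact: unit_geodesic_of.
have pc : proj \o c = geodesic_of v by rewrite -wv; exact: proj_geodesic_of cov iso cM w.
have [xi Exi] := class_ideal uc.
have xc : val xi c.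
  by rewrite Exi; split=> //; exists 0 => r _; rewrite (dist_self cE HL).
exists xi => // p.
have [v0 Av0 clv] := cluster_seq cA At.
have [e0 pe0] : exists e, proj e = base v0 by case: cov => _ + _; exact.
have [U [oU Uv0 HU]] := covering_evenly_sectioned cov (base v0).
have Ue0 : U (proj e0) by rewrite pe0.
have [s [se0 Hs]] := HU _ Ue0; rewrite pe0 in se0.
pose m := dist p e0 + 1.
have cb : {for v0, continuous (@base R n M)} by exact: base_continuous.
have nU : \forall v' \near v0, U (base v') by exact: continuous_near cb oU Uv0.
have nm : \forall v' \near v0, dist p (s (base v')) < m.
  have cs : {for v0, continuous (fun v' : tangent_vector M => s (base v'))}.
    by apply: continuous_comp cb _; exact: (Hs _ Uv0).2.
  have cd : {for v0, continuous (fun v' : tangent_vector M => dist p (s (base v')))}.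
    by apply: continuous_comp cs _; exact: dist_continuous_right.
  by apply: (continuous_near cd (@open_lt _ m)); rewrite /= se0 /m ltrDl.
have nn : nbhs v0 (fun v' : tangent_vector M => U (base v') /\ dist p (s (base v')) < m).
  exact: filterI nU nm.
(* A return beyond every integer [j] is selected, so that the selected times still tend to
   infinity. *)
have /choice[kappa Hk] : forall j : nat, exists k, j%:R <= t k /\
    exists a, [/\ deck_group proj a & dist (a p) (c (t k)) <= m].
  move=> j; have : \forall k \near \oo, j%:R <= t k by have /cvgryPge := tk; exact.
  move=> [N _ HN]; have [k Nk [Uk mk]] := clv _ nn N; exists k; split; first exact: HN.
  have E1 : base (geodesic_flow (t k) v) = proj (c (t k)).
    by rewrite /= -pc.
  rewrite E1 in Uk mk.
  have Eps : proj (s (proj (c (t k)))) = proj (c (t k)) by case: (Hs _ Uk).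
  have [a da ae] := deck_transitive scE cov iso Eps.
  exists a; split=> //; rewrite -ae (deck_dist cov iso cM HL p _ da).
  exact: ltW.
have /choice[alpha Ha] : forall j, exists a, deck_group proj a /\ dist (a p) (c (t (kappa j))) <= m.
  by move=> j; have [_ [a [? ?]]] := Hk j; exists a.
have tinf : (fun j => t (kappa j)) @ \oo --> +oo.
  apply/cvgryPge => T; near=> j; apply: le_trans (Hk j).1.
  by near: j; exact: nbhs_infty_ger.
have [ug g0 xg] := geodesic_to_ideal cE HL vis p xi.
have [B HB] := asymptoticP cE HL xc xg.
have m0 : 0 < m by rewrite /m ltr_wpDl// dist_ge0.
(* The orbit of [p] is close to [c], whereas conical limit points refer to the geodesic from [p] to
   [xi]; [B] bounds the distance between these asymptotic geodesics at equal nonnegative times. *)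
exists (m + `|B|); first by rewrite ltr_wpDr.
exists alpha; split=> [k||k]; first by case: (Ha k).
  by apply: (cvg_to_ideal cE HL vis (t := fun j => t (kappa j)) (m := m) xc) => // k; case: (Ha k).
have tk0 : 0 <= t (kappa k) by apply: le_trans (Hk k).1.
apply: le_trans (dist_to_le HL _ (q := geodesic_to p (Ideal xi) (t (kappa k))) _) _.
  by exists (t (kappa k)).
apply: le_trans (dist_triangle cE HL _ (c (t (kappa k))) _) _.
apply: lerD; first by case: (Ha k).
by apply: le_trans (ler_norm B); exact: HB.
Unshelve. all: by end_near.
Qed.

(** The inverse of [alpha k] brings [c (s k)] within [m] of [p], so the projected geodesic returns
    to the compact set [K]. Near a cluster point in [K] its unit velocities belong to one compact
    set. *)
Lemma conical_conservative (v : tangent_vector M) (w : tangent_vector E)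
    (xi : ideal_boundary E) : unit_tangent w -> tangent_map proj w = v ->
  endpoint (geodesic_of w) +oo%E (Ideal xi) -> conical_limit_set (deck_group proj) xi ->
  conservative_point v.
Proof.
move=> w1 wv; set c := geodesic_of w => /= xc con.
have uc : unit_geodesic c by exact: unit_geodesic_of.
have pc : proj \o c = geodesic_of v by rewrite -wv; exact: proj_geodesic_of cov iso cM w.
set p := base w; have [D D0 [alpha [Ga cva Da]]] := con p.
set g := geodesic_to p (Ideal xi) in Da.
have [ug g0 xg] := geodesic_to_ideal cE HL vis p xi; rewrite -/g in ug g0 xg.
have [B HB] := asymptoticP cE HL xc xg.
have /choice[s Hs] : forall k, exists s, dist (alpha k p) (g s) <= D + 1.
  move=> k; have ne : range g !=set0 by exists (g 0); exists 0.
  have lt : dist_to (alpha k p) (range g) < D + 1 by apply: le_lt_trans (Da k) _; rewrite ltrDl.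
  by have [_ [r _ <-] /ltW h] := dist_to_lt ne lt; exists r.
have sinf : s @ \oo --> +oo.
  apply: (cvg_to_ideal_parameters cE HL vis (c := g) (xi := xi) (m := D + 1) _ cva Hs).
  by rewrite g0.
pose m := D + 1 + `|B|.
pose K : set M := proj @` (gexp p @` [set u | tnorm p u <= m]).
have cK : compact K.
  apply: continuous_compact.
    by apply: continuous_subspaceT => x; exact: proj_continuous.
  apply: continuous_compact; last exact: tnorm_ball_compact.
  by apply: continuous_subspaceT => x; exact: gexp_continuous.
(* Asymptotic geodesics are compared at nonnegative times only, hence the shift of indices by
   [N]. *)
have [N _ HN] : \forall k \near \oo, 0 <= s k by have /cvgryPge := sinf; exact.
have Kc k : K (geodesic_of v (s (N + k)%N)).
  set r := s _; have r0 : 0 <= r by apply: HN; rewrite /= leq_addr.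
  have [[ca [b [cb ab ba]]] pa] := Ga (N + k)%N.
  have [u Eu nu] := gexp_surj HL p (b (c r)).
  exists (b (c r)); last first.
    rewrite -pc /= -[in RHS](ba (c r)).
    exact: esym (congr1 (fun f => f (b (c r))) pa).
  exists u => //=; rewrite nu -(deck_dist cov iso cM HL p (b (c r)) (Ga (N + k)%N)) ba.
  apply: le_trans (dist_triangle cE HL _ (g r) _) _; apply: lerD; first exact: Hs.
  by rewrite (dist_sym cE HL) (le_trans (HB _ r0))// ler_norm.
have [x0 _ clx] := cluster_seq cK Kc.
have [A [N' [cA uA nN' HA]]] := unit_tangent_locally_compact x0.
exists A; split=> //.
have /choice[kappa Hk] : forall j : nat, exists k, j%:R <= s (N + k)%N /\ N' (geodesic_of v (s (N + k)%N)).
  move=> j; have [N2 _ HN2] : \forall k \near \oo, j%:R <= s k by have /cvgryPge := sinf; exact.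
  have [k N2k Nk] := clx _ nN' N2; exists k; split=> //.
  by apply: HN2; rewrite /= (leq_trans N2k)// leq_addl.
exists (fun j => s (N + kappa j)%N).
  apply/cvgryPge => T; near=> j; apply: le_trans (Hk j).1.
  by near: j; exact: nbhs_infty_ger.
move=> j; apply: HA; first exact: (Hk j).2.
have := (unit_proj cov iso cM uc).2 (s (N + kappa j)%N).
by rewrite pc.
Unshelve. all: by end_near.
Qed.

End conical_limit_points.

Theorem proposition6p2 (R : realType) (n : nat)
    (M Mtilde : riemannian_manifold R n) (proj : Mtilde -> M)
    (proj_cover : universal_riemannian_covering proj)
    (M_complete : complete_manifold M)
    (M_no_conj : no_conjugate_points M)
    (M_visibility : uniform_visibility Mtilde)
    (v : tangent_vector M) (v_unit : unit_tangent v) :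
  (conservative_point v <->
    exists2 w : tangent_vector Mtilde,
      unit_tangent w /\ tangent_map proj w = v &
      exists2 xi : ideal_boundary Mtilde,
        endpoint (geodesic_of w) +oo%E (Ideal xi) &
        conical_limit_set (deck_group proj) xi) /\
  (conservative_point v <->
    forall w : tangent_vector Mtilde,
      unit_tangent w -> tangent_map proj w = v ->
      exists2 xi : ideal_boundary Mtilde,
        endpoint (geodesic_of w) +oo%E (Ideal xi) &
        conical_limit_set (deck_group proj) xi).
Proof.
have [scE cov iso] := proj_cover.
(* Without a unit lift the condition on all lifts could hold vacuously; [w0] also serves as the
   witness for the existential form. *)
have [w0 w01 w0v] := unit_lift_exists cov iso v_unit.
have direct := conservative_conical scE cov iso M_complete M_no_conj M_visibility (v := v).
have converse := conical_conservative scE cov iso M_complete M_no_conj M_visibility (v := v).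
split; split=> [cons|].
- by exists w0 => //; exact: (direct w0 w01 w0v cons).
- by move=> [w [w1 wv] [xi ex cxi]]; exact: (converse w xi w1 wv ex cxi).
- by move=> w w1 wv; exact: (direct w w1 wv cons).
- by move=> /(_ w0 w01 w0v)[xi ex cxi]; exact: (converse w0 xi w01 w0v ex cxi).
Qed.
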